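(* Let $k$ be a differential field of characteristic zero with an algebraically closed field of constants $C$, and let $f\in k[Y,Z]$ be an irreducible polynomial involving the variable $Z$. Suppose that the differential equation $f(y,y')=0$ has a nonalgebraic solution (i.e. a solution not algebraic over $k$) in an iterated strongly normal extension $E$ of $k$, or equivalently, that the differential field $k(f)$ can be embedded (over $k$, as a differential field) in an iterated strongly normal extension $E$ of $k$. Then the following statements hold. (i) The differential equation $f(y,y')=0$ is of either Riccati type or Weierstrass type. (ii) If $k=C$ and $f(y,y')=0$ is of Riccati type, then there is a nonzero element $t\in C(f)$ such that either $t'=1$, or $t'=ct$ for some nonzero $c\in C$. (iii) If $E$ is a strongly normal extension of $k$ and $f(y,y')=0$ is of Riccati type (respectively, Weierstrass type), then the finite algebraic extension $\tilde{k}$ and the element $t\in\tilde{k}(f)$, as in the definition of Riccati type (respectively, Weierstrass type), can be chosen so that $\tilde{k}(f)=\tilde{k}(t)$ (respectively, $\tilde{k}(f)=\tilde{k}(t,t')$).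
   Context: Derivations are denoted by $'$; algebraic extensions of differential fields of characteristic zero carry the unique extended derivation. For $f$ as in the claim, $k(f)$ denotes the field of fractions of $k[Y,Z]/\langle f\rangle$, with the derivation induced by $f$: it extends that of $k$ and maps $y$ to $z$, where $y,z$ are the images of $Y,Z$. For a finite algebraic extension $\tilde k$ of $k$, $\tilde k(f)$ denotes the compositum of $\tilde k$ and $k(f)$ (inside an algebraic closure of $k(f)$). A solution of $f(y,y')=0$ is an element $u$ of a differential field extension of $k$ having $C$ as its field of constants such that $f(u,u')=0$; it is nonalgebraic if it is not algebraic over $k$. Riccati type: there are a nonalgebraic solution of $f(y,y')=0$, a finite algebraic extension $\tilde k$ of $k$ and an element $t\in\tilde k(f)$ such that $\tilde k(f)$ is a finite algebraic extension of $\tilde k(t)$ and $t'=a_2t^2+a_1t+a_0$ with $a_0,a_1,a_2\in\tilde k$ not all zero. Weierstrass type: there are a nonalgebraic solution of $f(y,y')=0$, a finite algebraic extension $\tilde k$ of $k$ and an element $t\in\tilde k(f)$ such that $\tilde k(f)$ is a finite algebraic extension of $\tilde k(t,t')$ and $(t')^2=\alpha^2(4t^3-g_2t-g_3)$ with $g_2,g_3\in C$, $\alpha\in\tilde k$ and $27g_3^2-g_2^3\neq0$. Strongly normal extension: a differential field extension $E$ of $k$ that is finitely differentially generated over $k$ and such that every differential $k$-isomorphism $\sigma$ of $E$ (into a differential field extension of $E$) satisfies $E\,\sigma E=E\,C(\sigma)=\sigma E\,C(\sigma)$, where $C(\sigma)$ is the field of constants of the compositum $E\,\sigma E$, and $\sigma(c)=c$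 for all constants $c$ of $E$. (Such an $E$ has $C$ as its field of constants.) Iterated strongly normal extension: a differential field extension $E$ of $k$ for which there is a tower of differential fields $k=E_0\subseteq E_1\subseteq\cdots\subseteq E_n=E$ with $E_i$ a strongly normal extension of $E_{i-1}$ for each $i=1,\dots,n$. *)

(* Defs.v *)
From HB Require Import structures.
From mathcomp Require Import all_boot all_order all_algebra.
From mathcomp Require Import classical_sets.

Set Implicit Arguments.
Unset Strict Implicit.
Unset Printing Implicit Defensive.

Import GRing.Theory.
Local Open Scope ring_scope.
Local Open Scope classical_set_scope.

HB.mixin Record Field_hasDerivation F of GRing.Field F := {
  der : F -> F;
  derD : {morph der : x y / x + y};
  derM : forall x y : F, der (x * y) = der x * y + x * der y
}.

#[short(type="diffFieldType")]
HB.structure Definition DiffField := {F of GRing.Field F & Field_hasDerivation F}.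

(* Differential field extensions are given by their embeddings: a ring morphism
   between fields is injective. *)
HB.mixin Record isDiffMorphism (K L : diffFieldType) (i : K -> L) := {
  dmorph_der : {morph i : x / der x}
}.

HB.structure Definition DiffMorphism (K L : diffFieldType) :=
  {i of @GRing.RMorphism K L i & @isDiffMorphism K L i}.

Notation "{ 'dmorphism' K -> L }" := (DiffMorphism.type K L)
  (at level 0, K at level 98, L at level 99) : type_scope.

Definition constants (K : diffFieldType) : set K := [set x | der x = 0].

Definition constants_alg_closed (K : diffFieldType) : Prop :=
  forall p : {poly K}, (forall i, constants p`_i) -> (1 < size p)%N ->
    exists2 c, constants c & root p c.

Definition no_new_constants (k E : diffFieldType) (i : {dmorphism k -> E}) : Prop :=
  constants (K := E) = i @` constants (K := k).

Definition subfield (L : fieldType) (S : set L) : Prop :=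
  [/\ S 1, forall x y, S x -> S y -> S (x - y)
    & forall x y, S x -> S y -> S (x / y)].

Definition diff_subfield (L : diffFieldType) (S : set L) : Prop :=
  subfield S /\ forall x, S x -> S (der x).

(* S(A); for two subfields S and A, this is their compositum in L. *)
Definition adjoin (L : fieldType) (S A : set L) : set L :=
  smallest (@subfield L) (S `|` A).

Definition diff_adjoin (L : diffFieldType) (S A : set L) : set L :=
  smallest (@diff_subfield L) (S `|` A).

(* L is a finite-dimensional vector space over its subfield S. *)
Definition finite_over (L : fieldType) (S : set L) : Prop :=
  exists s : seq L, forall x, exists2 c : 'I_(size s) -> L,
    (forall i, S (c i)) & x = \sum_(i < size s) c i * s`_i.

(* In M, the field k is embedded by j \o i, and sigma is a k-isomorphism of
   j(E) = E onto its image. *)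
Definition strongly_normal (k E : diffFieldType) (i : {dmorphism k -> E}) : Prop :=
  (exists s : seq E, diff_adjoin (range i) [set` s] = setT) /\
  forall (M : diffFieldType) (j sigma : {dmorphism E -> M}),
    (forall x, sigma (i x) = j (i x)) ->
    let EsE := adjoin (range j) (range sigma) in
    let Csigma := EsE `&` constants (K := M) in
    [/\ EsE = adjoin (range j) Csigma,
        EsE = adjoin (range sigma) Csigma
      & forall c, constants c -> sigma c = j c].

Inductive iterated_strongly_normal (k : diffFieldType) :
    forall E : diffFieldType, {dmorphism k -> E} -> Prop :=
| ISN_base (E : diffFieldType) (i : {dmorphism k -> E}) :
    range i = setT -> iterated_strongly_normal i
| ISN_step (F E : diffFieldType) (i : {dmorphism k -> F})
    (j : {dmorphism F -> E}) (ji : {dmorphism k -> E}) :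
    iterated_strongly_normal i -> strongly_normal j ->
    (forall x, ji x = j (i x)) -> iterated_strongly_normal ji.

(* {poly k} is k[Y] and {poly {poly k}} is k[Y][Z]. MathComp's irreducible_poly
   is not used: it ignores factors that are constant in Z. *)
Definition irreducible_elt (R : unitRingType) (f : R) : Prop :=
  [/\ f != 0, f \isn't a GRing.unit
    & forall g h, f = g * h -> (g \is a GRing.unit) || (h \is a GRing.unit)].

(* f(u, v), where Y := u is the inner and Z := v the outer variable. *)
Definition eval2 (k L : fieldType) (i : {rmorphism k -> L})
    (f : {poly {poly k}}) (u v : L) : L :=
  (map_poly (map_poly i) f).[v%:P].[u].

(* K is the field of fractions of k[Y,Z]/<f>: the morphism k[Y,Z] -> K sending
   Y to y and Z to y' has kernel <f>, and every element of K is a quotient of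
   two elements of its image. As iK is differential and the image of Z is y',
   the derivation of K is the one induced by f. *)
Definition is_k_of_f (k K : diffFieldType) (f : {poly {poly k}})
    (iK : {dmorphism k -> K}) (y : K) : Prop :=
  (forall g, eval2 iK g y (der y) = 0 <-> exists h, g = h * f) /\
  (forall x, exists g h, eval2 iK h y (der y) != 0 /\
     x = eval2 iK g y (der y) / eval2 iK h y (der y)).

Definition has_nonalgebraic_solution_in (k : diffFieldType) (f : {poly {poly k}})
    (E : diffFieldType) (iE : {dmorphism k -> E}) : Prop :=
  no_new_constants iE /\
  exists u : E, eval2 iE f u (der u) = 0 /\ ~ algebraicOver iE u.

Definition has_nonalgebraic_solution (k : diffFieldType) (f : {poly {poly k}}) : Prop :=
  exists (E : diffFieldType) (iE : {dmorphism k -> E}),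
    has_nonalgebraic_solution_in f iE.

Definition embeds_over (k K E : diffFieldType) (iK : {dmorphism k -> K})
    (iE : {dmorphism k -> E}) : Prop :=
  exists e : {dmorphism K -> E}, forall x, e (iK x) = iE x.

(* kt is a finite algebraic extension of k, and L is a compositum of kt and K
   over k. Such an L is finite over K, so it embeds in an algebraic closure
   of K. *)
Definition finite_compositum (k K kt L : diffFieldType)
    (iK : {dmorphism k -> K}) (ikt : {dmorphism k -> kt})
    (jK : {dmorphism K -> L}) (jkt : {dmorphism kt -> L}) : Prop :=
  [/\ finite_over (range ikt), forall x, jkt (ikt x) = jK (iK x)
    & adjoin (range jkt) (range jK) = setT].

Definition riccati_data (k K kt L : diffFieldType)
    (iK : {dmorphism k -> K}) (ikt : {dmorphism k -> kt})
    (jK : {dmorphism K -> L}) (jkt : {dmorphism kt -> L}) (t : L) : Prop :=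
  [/\ finite_compositum iK ikt jK jkt,
      finite_over (adjoin (range jkt) [set t])
    & exists a0 a1 a2 : kt, ~ [/\ a0 = 0, a1 = 0 & a2 = 0] /\
        der t = jkt a2 * t ^+ 2 + jkt a1 * t + jkt a0].

Definition weierstrass_data (k K kt L : diffFieldType)
    (iK : {dmorphism k -> K}) (ikt : {dmorphism k -> kt})
    (jK : {dmorphism K -> L}) (jkt : {dmorphism kt -> L}) (t : L) : Prop :=
  [/\ finite_compositum iK ikt jK jkt,
      finite_over (adjoin (range jkt) [set t; der t])
    & exists (g2 g3 : k) (alpha : kt),
        [/\ constants g2, constants g3, 27%:R * g3 ^+ 2 - g2 ^+ 3 != 0
          & der t ^+ 2 = jkt alpha ^+ 2 *
              (4%:R * t ^+ 3 - jkt (ikt g2) * t - jkt (ikt g3))]].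

(* In the next four definitions, (K, iK) is meant to be k(f). *)
Definition riccati_type (k K : diffFieldType) (f : {poly {poly k}})
    (iK : {dmorphism k -> K}) : Prop :=
  has_nonalgebraic_solution f /\
  exists (kt L : diffFieldType) (ikt : {dmorphism k -> kt})
    (jK : {dmorphism K -> L}) (jkt : {dmorphism kt -> L}) (t : L),
    riccati_data iK ikt jK jkt t.

Definition weierstrass_type (k K : diffFieldType) (f : {poly {poly k}})
    (iK : {dmorphism k -> K}) : Prop :=
  has_nonalgebraic_solution f /\
  exists (kt L : diffFieldType) (ikt : {dmorphism k -> kt})
    (jK : {dmorphism K -> L}) (jkt : {dmorphism kt -> L}) (t : L),
    weierstrass_data iK ikt jK jkt t.

Definition riccati_type_generating (k K : diffFieldType) (f : {poly {poly k}})
    (iK : {dmorphism k -> K}) : Prop :=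
  has_nonalgebraic_solution f /\
  exists (kt L : diffFieldType) (ikt : {dmorphism k -> kt})
    (jK : {dmorphism K -> L}) (jkt : {dmorphism kt -> L}) (t : L),
    riccati_data iK ikt jK jkt t /\ adjoin (range jkt) [set t] = setT.

Definition weierstrass_type_generating (k K : diffFieldType) (f : {poly {poly k}})
    (iK : {dmorphism k -> K}) : Prop :=
  has_nonalgebraic_solution f /\
  exists (kt L : diffFieldType) (ikt : {dmorphism k -> kt})
    (jK : {dmorphism K -> L}) (jkt : {dmorphism kt -> L}) (t : L),
    weierstrass_data iK ikt jK jkt t /\ adjoin (range jkt) [set t; der t] = setT.

(* Main.v *)
Require Import Defs.
From HB Require Import structures.
From mathcomp Require Import all_boot all_order all_algebra.
From mathcomp Require Import all_field generic_quotient ring_quotient.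
From mathcomp Require Import classical_sets boolp.
From mathcomp Require Import ring zify.

Set Implicit Arguments.
Unset Strict Implicit.
Unset Printing Implicit Defensive.

Import GRing.Theory.
Local Open Scope ring_scope.

Local Notation sfield := divringClosed.
Local Notation sring := subringClosed.
Local Notation char_0 R := ([pchar R] =i pred0).
Local Notation "p \over F" := (p \is a polyOver F) (at level 70).
Local Notation "A \sub B" := {subset A <= B} (at level 70).
Local Notation "A \nsub B" := (exists2 x, x \in A & x \notin B) (at level 70).
Local Notation stab D F := (forall y, y \in F -> D y \in F).
Local Notation stab_in D F O := (forall y, y \in F -> y \in O -> D y \in O).
Local Notation is_frac R y := (exists a b, [/\ a \in R, b \in R, b != 0 & y = a / b]).
Local Notation kills D F := (forall y, y \in F -> D y = 0).
Local Notation "K ~> L" := {dmorphism K -> L} (at level 99, L at level 200) : type_scope.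

(** Let u be a nonalgebraic solution. Somewhere in the tower there is a strongly normal step from F
    to E such that u is algebraic over E but not over F. Strong normality is used through a generic
    isomorphism: two exponentials of derivations, in power series in two variables, give an
    algebraically closed differential field M with embeddings J and sigma that agree on F, such that
    w = sigma u is transcendental over the image of J ([generic_embeddings]). Inside M let k' be the
    algebraic closure of k, U that of the image of J, K = k'(w, w') and UK = U(w, w'). The constants
    of U and of K lie in k'. As sigma E lies in the field generated by U and constants, and w is
    algebraic over sigma E, the field UK must contain a constant x outside U
    ([not_alg_over_constants], [strongly_normal_step]).

    Geometrically K is the function field of a curve over k', and UK that of the same curve over U.
    The derivations of U, extended by zero to K, act as a Galois group for the descent from U to k'.
    Let ep be one of them with ep x nonzero, and let ex agree with ep on U and kill x. Then ep - ex
    is a nonzero U-linear vector field. It has no pole because x is a constant: where x takes a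
    value be in U, either be is constant too, or x - be is a uniformizer, since its derivative is a
    unit there ([regular_uniformizer], [vector_field]). Expanding its coefficient over elements of U
    independent over k', and testing regularity at Gauss extensions of places, one obtains a regular
    vector field on a subfield K0 of K ([descended_field]). For a single strongly normal extension
    containing u, UK is generated by U and constants, and K0 = K.

    A function field with a nonzero regular vector field v has genus 0 or 1 ([classify]). The
    argument avoids the Riemann-Roch theorem: a Birkhoff basis over F[x] describes the pole spaces
    of a function x of least degree; if there are two independent regular differentials,
    eigenvectors of the Lie derivative along v have a quotient t with v t = mu t + c, and then the
    field is rational ([lin1], [lin2]); the remaining case is a double cover s^2 = Q(x) with Q of
    degree 3 or 4. The given derivation is also regular at all places ([der_place_stable],
    [der_stable_subring]). On a rational field this bounds D x by a quadratic polynomial in x, a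
    Riccati equation. In genus one all branch points solve one Riccati equation, so their cross
    ratio is constant, and the Legendre form turns into the Weierstrass form ([legendre_of_quad],
    [weierstrass_of_legendre]).

    This settles (i) over k'; [descent] keeps only finitely many elements of k' to reach a finite
    extension of k. For (ii), a Riccati equation with constant coefficients is linearized by moving
    its roots. For (iii), K itself carries the vector field. A Riccati element excludes genus one,
    since t / v t would be a function without poles that vanishes at the zeros of t
    ([riccati_of_vector_field]); a Weierstrass element excludes genus zero, since dt / t' would be a
    regular differential on the line ([rational_no_weierstrass]). So the normal form of K is of the
    type in question and generates. The two forms of the hypothesis agree because a nonalgebraic
    solution is the same as an embedding of k(f) ([function_field_embedding]) and the tower adds no
    constants ([isn_no_new]). *)

Definition rmorph_of (A B : pzRingType) (f : A -> B) (fB : zmod_morphism f) (fM : monoid_morphism f) : {rmorphism A -> B} :=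
 HB.pack_for {rmorphism A -> B} f (GRing.isZmodMorphism.Build A B f fB) (GRing.isMonoidMorphism.Build A B f fM).

(** * Subfields of an ambient field and algebraic elements *)

Section Subfields.
Variable M : fieldType.
Implicit Types (F G U L : sfield M) (x y z u w : M).

(** Fields are handled as bundled predicates on one ambient field, so that adjunctions, closures and
    intersections keep the same type; they are bundled here. *)
Lemma mkF (P : set M) : subfield P ->
 exists F : sfield M, forall x, x \in F <-> P x.
Proof.
case=> P1 PB PD.
pose S : {pred M} := fun x => `[< P x >].
have SP x : x \in S <-> P x by split => [/asboolP|?]; last exact/asboolP.
have Sdiv : GRing.divring_closed S.
 split; first exact/SP.
  by move=> x y /SP Sx /SP Sy; apply/SP/PB.
 by move=> x y /SP Sx /SP Sy; apply/SP/PD.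
pose SM := GRing.isDivringClosed.Build M S Sdiv.
pose F : sfield M := HB.pack S SM.
by exists F => x; apply: SP.
Qed.

Section SubType.
Variable F : sfield M.
(** The subfield as a field type of its own, which gives access to matrix rank, polynomial division
    and the closure properties of algebraic elements. *)
Record subF := SubF { subval : M; subvalP : subval \in F }.
HB.instance Definition _ := [isSub for subval].
HB.instance Definition _ := [Choice of subF by <:].
HB.instance Definition _ := [SubChoice_isSubIntegralDomain of subF by <:].
HB.instance Definition _ := [SubIntegralDomain_isSubField of subF by <:].
End SubType.

Definition alg (F : {pred M}) x :=
 exists p : {poly M}, [/\ p \over F, p != 0 & root p x].

Lemma polyOver_lift F (p : {poly M}) : p \over F ->
 exists q : {poly subF F}, p = map_poly val q.
Proof.
move=> /polyOverP pF.
exists (\poly_(i < size p) insubd (0 : subF F) p`_i).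
apply/polyP => i; rewrite coef_map coef_poly /=.
case: ltnP => [_|le]; last by rewrite nth_default.
by rewrite val_insubd pF.
Qed.

Lemma polyOver_map F (q : {poly subF F}) : map_poly val q \over F.
Proof. by apply/polyOverP => i; rewrite coef_map /=; apply: subvalP. Qed.

Lemma algP F x : alg F x <-> algebraicOver (val : subF F -> M) x.
Proof.
split.
 move=> [p [pF p0 px]]; have [q pq] := polyOver_lift pF.
 exists q; rewrite -?pq //; apply: contra_neq p0 => q0.
 by rewrite pq q0 map_poly0.
move=> [q q0 qx]; exists (map_poly val q); split=> //.
 exact: polyOver_map.
by rewrite map_poly_eq0.
Qed.

Lemma alg_id F x : x \in F -> alg F x.
Proof.
move=> xF; exists ('X - x%:P); split; rewrite ?root_XsubC //.
 by rewrite polyOverXsubC.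
by rewrite polyXsubC_eq0.
Qed.

Lemma alg_sub F x y : alg F x -> alg F y -> alg F (x - y).
Proof. by move=> /algP hx /algP hy; apply/algP; apply: algebraic_sub. Qed.
Lemma alg_div F x y : alg F x -> alg F y -> alg F (x / y).
Proof. by move=> /algP hx /algP hy; apply/algP; apply: algebraic_div. Qed.
Lemma alg_inv F x : alg F x -> alg F x^-1.
Proof. by move=> /algP hx; apply/algP; apply: algebraic_inv. Qed.

Lemma alg_closure F : exists G : sfield M, forall x, x \in G <-> alg F x.
Proof.
apply: mkF; split; first exact/alg_id/rpred1.
 by move=> x y; apply: alg_sub.
by move=> x y; apply: alg_div.
Qed.

Lemma polyOver_sub (S T : addrClosed M) (p : {poly M}) :
 S \sub T -> p \over S -> p \over T.
Proof. by move=> ST /polyOverP pS; apply/polyOverP => i; apply/ST/pS. Qed.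

Lemma alg_subset F G x : F \sub G -> alg F x -> alg G x.
Proof.
by move=> FG [p [pF p0 px]]; exists p; split=> //; apply: polyOver_sub pF.
Qed.

Lemma alg_trans F G x :
 (forall y, y \in G -> alg F y) -> alg G x -> alg F x.
Proof.
move=> GF [p [/polyOverP pG p0 px]]; apply/algP/integral_algebraic.
apply: (integral_root p0 px) => _ /(nthP 0)[i _ <-].
by apply/integral_algebraic/algP/GF/pG.
Qed.

Definition indep (F : {pred M}) n (e : 'I_n -> M) :=
 forall c : 'I_n -> M, (forall i, c i \in F) ->
  \sum_i c i * e i = 0 -> forall i, c i = 0.

(** The bound [L : F] <= n through dependence only, so that it passes at once to a smaller L and a
    larger F. *)
Definition rk (F L : {pred M}) n :=
 forall e : 'I_n.+1 -> M, (forall i, e i \in L) -> ~ indep F e.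

Lemma not_indep (F : {pred M}) n (e : 'I_n -> M) : ~ indep F e ->
 exists c : 'I_n -> M, [/\ forall i, c i \in F, \sum_i c i * e i = 0
  & exists i, c i != 0].
Proof.
move=> /existsNP[c /not_implyP[cF /not_implyP[ce /existsNP[i /eqP ci]]]].
by exists c; split=> //; exists i.
Qed.

Lemma rk_span F (L : {pred M}) m (s : 'I_m -> M) :
 (forall y, y \in L -> exists2 c : 'I_m -> M, (forall i, c i \in F) &
   y = \sum_i c i * s i) -> rk F L m.
Proof.
move=> span e eL ind.
have /choice[A AP] : forall i, exists c : 'I_m -> M, (forall j, c j \in F) /\
   e i = \sum_j c j * s j by move=> i; have [c cF ec] := span _ (eL i); exists c.
pose B : 'M[subF F]_(m.+1, m) := \matrix_(i, j) SubF ((AP i).1 j).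
have : kermx B != 0.
 rewrite kermx_eq0 /row_free; apply: contraTneq isT => rB.
 by have := rank_leq_col B; rewrite rB ltnn.
move=> /rowV0Pn[v /sub_kermxP vB v0].
have [j vj] : exists j, v 0 j != 0 by apply/rV0Pn.
have := ind (fun i => val (v 0 i)) (fun i => subvalP _) _ j.
rewrite -(rmorph0 (val : subF F -> M)) => /(_ _)/val_inj vj0.
apply/negP: vj; rewrite vj0 ?negbK //.
rewrite rmorph0.
under eq_bigr do rewrite (AP _).2 mulr_sumr.
rewrite exchange_big /= big1 // => k _.
under eq_bigr do rewrite mulrA.
rewrite -mulr_suml.
have /matrixP/(_ 0 k) := vB; rewrite !mxE => /(congr1 (val : subF F -> M)).
rewrite (rmorph_sum (val : subF F -> M)) => vBk.
suff -> : \sum_i val (v 0 i) * A i k = 0 by rewrite mul0r.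
by rewrite -[RHS]vBk; apply: eq_bigr => i _; rewrite !mxE.
Qed.

Lemma rk_sub (F F' L L' : {pred M}) n : F \sub F' -> L' \sub L ->
 rk F L n -> rk F' L' n.
Proof.
move=> FF LL r e eL ind; apply: (r e) => [i|c cF]; first exact/LL.
by apply: ind => i; apply/FF.
Qed.

Lemma rk_alg F (L : {pred M}) n y : rk F L n -> (forall i, y ^+ i \in L) ->
 exists p : {poly M}, [/\ p \over F, p != 0, root p y & (size p <= n.+1)%N].
Proof.
move=> r yL; have [c [cF c0 [i ci]]] := not_indep (r (fun i => y ^+ i) (fun i => yL i)).
exists (\poly_(j < n.+1) c (inord j)); split.
- by apply/polyOverP => j; rewrite coef_poly; case: ifP => // _; rewrite rpred0.
- apply: contraNneq ci => /polyP/(_ i); rewrite coef_poly ltn_ord coef0.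
 by rewrite inord_val => ->.
- rewrite rootE horner_poly -[X in _ == X]c0; apply/eqP.
 by apply: eq_bigr => j _; rewrite inord_val.
- exact: size_poly.
Qed.

Definition adj (F : {pred M}) u y := exists p q : {poly M},
 [/\ p \over F, q \over F, q.[u] != 0 & y = p.[u] / q.[u]].

Lemma adjF F u : exists G : sfield M, forall y, y \in G <-> adj F u y.
Proof.
apply: mkF; split.
- by exists 1, 1; rewrite rpred1 hornerC oner_eq0 divr1.
- move=> _ _ [p [q [pF qF q0 ->]]] [p' [q' [pF' qF' q0' ->]]].
 exists (p * q' - p' * q), (q * q'); split.
 + by rewrite rpredB ?rpredM.
 + by rewrite rpredM.
 + by rewrite hornerM mulf_neq0.
 + rewrite !hornerE; field; by rewrite q0 q0'.
- move=> _ _ [p [q [pF qF q0 ->]]] [p' [q' [pF' qF' q0' ->]]].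
 have [p0|p0] := eqVneq p'.[u] 0.
  by exists 0, 1; rewrite rpred0 rpred1 hornerC oner_eq0 p0 mul0r invr0 mulr0 horner0 mul0r.
 exists (p * q'), (q * p'); split.
 + by rewrite ?rpredM.
 + by rewrite rpredM.
 + by rewrite hornerM mulf_neq0.
 + rewrite !hornerE; field; by rewrite q0 q0' p0.
Qed.

Lemma adj_id F u x : x \in F -> adj F u x.
Proof.
by move=> xF; exists x%:P, 1; rewrite rpred1 polyOverC !hornerC oner_eq0 divr1.
Qed.
Lemma adj_gen F u : adj F u u.
Proof. by exists 'X, 1; rewrite rpred1 polyOverX hornerX hornerC oner_eq0 divr1. Qed.

Lemma adj_min F u G y : F \sub G -> u \in G -> adj F u y -> y \in G.
Proof.
move=> FG uG [p [q [pF qF _ ->]]].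
by rewrite rpred_div // rpred_horner //; apply: polyOver_sub FG _.
Qed.

Lemma alg_adj F x y : alg F x -> adj F x y -> alg F y.
Proof.
have [G GP] := alg_closure F.
move=> ax /(@adj_min F x G) yG; apply/GP/yG => [z zF|]; first exact/GP/alg_id.
exact/GP.
Qed.

Lemma polyOver_scale_inv F (p : {poly M}) : p \over F ->
 (lead_coef p)^-1 *: p \over F.
Proof.
move=> pF; apply/polyOverP => i; rewrite coefZ rpredM // ?rpredV.
 by apply: (polyOverP pF).
by apply: (polyOverP pF).
Qed.

Lemma alg_monic F u : alg F u -> exists p : {poly M},
 [/\ p \over F, p \is monic & root p u].
Proof.
move=> [p [pF p0 pu]]; exists ((lead_coef p)^-1 *: p); split.
- exact: polyOver_scale_inv.
- by rewrite monicE lead_coefZ mulVf // lead_coef_eq0.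
- by rewrite rootE hornerZ (rootP pu) mulr0.
Qed.

Lemma polyOver_rem F (p m : {poly M}) : p \over F -> m \over F ->
 p %% m \over F.
Proof.
move=> /polyOver_lift[p' ->] /polyOver_lift[m' ->].
by rewrite -map_modp polyOver_map.
Qed.

Lemma polyOver_quo F (p m : {poly M}) : p \over F -> m \over F ->
 p %/ m \over F.
Proof.
move=> /polyOver_lift[p' ->] /polyOver_lift[m' ->].
by rewrite -map_divp polyOver_map.
Qed.

Lemma minpoly F u : alg F u -> exists m : {poly M},
 [/\ m \over F, m \is monic, root m u
  & forall p, p \over F -> root p u -> m %| p].
Proof.
move=> /alg_monic; set P := fun n => exists p : {poly M},
 [/\ p \over F, p \is monic & root p u] /\ size p = n.
move=> [p0 hp0].
have ex : exists n, `[< P n >] by exists (size p0); apply/asboolP; exists p0.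
have := ex_minnP ex; case=> n /asboolP[m [[mF mm mu] <-]] minm.
exists m; split=> // p pF pu.
have m0 : m != 0 by apply: monic_neq0.
have ru : root (p %% m) u.
 by have := pu; rewrite {1}(divp_eq p m) rootE !hornerE (rootP mu) mulr0 add0r.
rewrite /dvdp; apply: contraT => r0.
have := minm (size (p %% m)); rewrite leqNgt ltn_modp m0 => /implyP; rewrite implybF.
move=> /asboolP[]; exists ((lead_coef (p %% m))^-1 *: (p %% m)); split; [split|].
- exact/polyOver_scale_inv/polyOver_rem.
- by rewrite monicE lead_coefZ mulVf // lead_coef_eq0.
- by rewrite rootE hornerZ (rootP ru) mulr0.
- by rewrite size_scale // invr_eq0 lead_coef_eq0.
Qed.

(** The minimal polynomial m of a nonzero z has m(0) nonzero by minimality, so m(z) = 0 can be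
    solved for 1/z. *)
Lemma alg_invX F z : alg F z -> exists g : {poly M},
 g \over F /\ z^-1 = g.[z].
Proof.
move=> az; have [-> |z0] := eqVneq z 0.
 by exists 0; rewrite rpred0 invr0 horner0.
have [m [mF mm mz min]] := minpoly az.
have m0 : m.[0] != 0.
 apply/eqP => m0.
 have Xm : 'X %| m by rewrite -[X in X %| _]subr0 -polyC0 dvdp_XsubCl rootE m0.
 have qz : root (m %/ 'X) z.
  have := mz; rewrite -{1}(divpK Xm) rootM => /orP[//|].
  by rewrite rootE hornerX (negPf z0).
 have q0 : m %/ 'X != 0.
  by apply: contraTneq (monic_neq0 mm) => q0; rewrite -(divpK Xm) q0 mul0r eqxx.
 have := dvdp_leq q0 (min _ (polyOver_quo mF (polyOverX F)) qz).
 by rewrite size_divp ?polyX_eq0 // size_polyX /= leqNgt ltn_subrL /= size_poly_gt0 monic_neq0.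
pose q := (m - m.[0]%:P) %/ 'X.
have qE : m = q * 'X + m.[0]%:P.
 rewrite divpK ?subrK // -[X in X %| _]subr0 -polyC0 dvdp_XsubCl rootE.
 by rewrite !hornerE subrr.
have m0F : m.[0] \in F by rewrite rpred_horner ?rpred0.
exists ((- m.[0]^-1) *: q); split.
 apply/polyOverP => i; rewrite coefZ rpredM ?rpredN ?rpredV //.
 apply: (polyOverP (polyOver_quo _ _)); rewrite ?polyOverX //.
 by rewrite rpredB ?polyOverC.
apply: (mulIf z0); rewrite mulVf //.
have /rootP := mz; rewrite qE !hornerE /= => e.
have : q.[z] * z = - m.[0] by apply/eqP; rewrite -addr_eq0 e.
by rewrite -mulrA => ->; rewrite mulrNN mulVf.
Qed.

Lemma alg_adj_poly F u : alg F u -> exists d, forall y, adj F u y ->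
 exists p : {poly M}, [/\ p \over F, (size p <= d)%N & y = p.[u]].
Proof.
move=> au; have [m [mF mm mu _]] := minpoly au.
exists (size m) => y [p [q [pF qF q0 ->]]].
have aq : alg F q.[u].
 apply: (alg_adj au); exists q, 1; rewrite qF rpred1 hornerC oner_eq0 divr1.
 by split.
have [g [gF ->]] := alg_invX aq.
exists ((p * (g \Po q)) %% m); split.
- by rewrite polyOver_rem ?rpredM ?polyOver_comp.
- by rewrite ltnW // ltn_modp monic_neq0.
- rewrite -horner_comp -hornerM [in LHS](divp_eq (p * _) m) hornerD hornerM.
 by rewrite (rootP mu) mulr0 add0r.
Qed.

Lemma rk_adj2 F u w F1 F2 : (forall y, y \in F1 <-> adj F u y) ->
 (forall y, y \in F2 <-> adj F1 w y) ->
 alg F u -> alg F w -> exists n, rk F F2 n.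
Proof.
move=> h1 h2 au aw.
have FF1 : F \sub F1 by move=> x xF; apply/h1/adj_id.
have [d hd] := alg_adj_poly au.
have [e he] := alg_adj_poly (alg_subset FF1 aw).
exists (#|{: 'I_e * 'I_d}|).
pose s (k : 'I_(#|{: 'I_e * 'I_d}|)) := u ^+ (enum_val k).2 * w ^+ (enum_val k).1.
apply: (@rk_span F F2 _ s) => y /h2/he[p [/polyOverP pF1 sp ->]].
have /choice[q hq] : forall i, exists q : {poly M},
  [/\ q \over F, (size q <= d)%N & p`_i = q.[u]].
 by move=> i; apply/hd/h1/pF1.
exists (fun k : 'I_(#|{: 'I_e * 'I_d}|) => (q (enum_val k).1)`_(enum_val k).2).
 by move=> k; have [/polyOverP] := hq (enum_val k).1.
rewrite (horner_coef_wide _ sp).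
under eq_bigr => i _.
 have [_ sq ->] := hq i.
 rewrite (horner_coef_wide _ sq) mulr_suml.
 over.
rewrite pair_big /= (reindex (@enum_val _ (mem {: 'I_e * 'I_d}))) /=; last first.
 by apply: onW_bij; apply: enum_val_bij.
by apply: eq_bigr => k _; rewrite mulrA.
Qed.

(** Clearing denominators in an equation of z over F(u) gives a plane relation P(u, z) = 0 that is
    not trivial at u. *)
Lemma alg_bivar F u F1 z : (forall y, y \in F1 <-> adj F u y) -> alg F1 z ->
 exists P : {poly {poly M}}, [/\ forall i, P`_i \over F,
   (exists i, (P`_i).[u] != 0) & (P.[z%:P]).[u] = 0].
Proof.
move=> h1 [p [/polyOverP pF p0 pz]].
have /choice[f hf] : forall i, exists ab : {poly M} * {poly M},
 [/\ ab.1 \over F, ab.2 \over F, ab.2.[u] != 0 & p`_i = ab.1.[u] / ab.2.[u]].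
 by move=> i; have /h1[a [b h]] := pF i; exists (a, b).
pose n := size p.
pose B i : {poly M} := \prod_(j < n | j != i :> nat) (f j).2.
pose P : {poly {poly M}} := \poly_(i < n) ((f i).1 * B i).
have BF i : B i \over F.
 by apply: rpred_prod => j _; have [] := hf j.
pose Q := \prod_(j < n) (f j).2.[u].
have Q0 : Q != 0 by apply/prodf_neq0 => j _; have [] := hf j.
have PE i : (P`_i).[u] = Q * p`_i.
 rewrite coef_poly; case: ltnP => le; last by rewrite nth_default // mulr0 horner0.
 have [_ _ b0 ->] := hf i.
 rewrite hornerM /B horner_prod /Q [in RHS](bigD1 (Ordinal le)) //=.
 have gen (a b X : M) : b != 0 -> a * X = b * X * (a / b) by move=> nb; field.
 exact: gen.
exists P; split.
- move=> i; rewrite coef_poly; case: ifP => _; last exact: rpred0.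
 by have [aF _ _ _] := hf i; rewrite rpredM.
- exists n.-1; rewrite PE mulf_neq0 // -lead_coefE lead_coef_eq0 //.
- rewrite (horner_coef P) horner_sum.
 have sP : (size P <= n)%N by apply: size_poly.
 rewrite (big_ord_widen n (fun i => (P`_i * z%:P ^+ i).[u]) sP) big_mkcond /=.
 transitivity (\sum_(i < n) Q * (p`_i * z ^+ i)).
  apply: eq_bigr => i _; case: ltnP => le.
   by rewrite hornerM PE horner_exp hornerC mulrA.
  have := PE i; rewrite nth_default // horner0 => e.
  by rewrite mulrA -e mul0r.
 by rewrite -mulr_sumr -horner_coef (rootP pz) mulr0.
Qed.

(** Steinitz exchange: P(u, z) = 0 is reread as a polynomial in u over F(z); if all its coefficients
    vanished, z would be algebraic over F. *)
Lemma alg_exchange F u z F1 (Fz : sfield M) : (forall y, y \in F1 <-> adj F u y) ->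
 (forall y, y \in Fz <-> adj F z y) ->
 alg F1 z -> ~ alg F z -> alg Fz u.
Proof.
move=> h1 hz az nz; have [P [PF [i Pi] P0]] := alg_bivar h1 az.
pose R : {poly M} := \poly_(j < sizeY P) (\sum_(i < size P) P`_i`_j * z ^+ i).
exists R; split.
- apply/polyOverP => j; rewrite coef_poly; case: ifP => _; last exact: rpred0.
 apply/hz; exists (\poly_(i < size P) P`_i`_j), 1; split.
 + apply/polyOverP => l; rewrite coef_poly; case: ifP => _; last exact: rpred0.
  exact: (polyOverP (PF l)).
 + exact: rpred1.
 + by rewrite hornerC oner_eq0.
 + by rewrite hornerC divr1 horner_poly.
- have Pi0 : P`_i != 0 by apply: contraNneq Pi => ->; rewrite horner0.
 pose j := (size P`_i).-1.
 have Pij : P`_i`_j != 0 by rewrite -lead_coefE lead_coef_eq0.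
 have lti : (i < size P)%N by rewrite ltnNge; apply: contra Pi0 => le; rewrite nth_default.
 have ltj : (j < sizeY P)%N.
  apply: leq_trans (max_size_coefXY P i) => /=.
  by rewrite /j prednK // size_poly_gt0.
 apply: contra_notN nz => /eqP R0.
 exists (\poly_(i < size P) P`_i`_j); split.
 + apply/polyOverP => l; rewrite coef_poly; case: ifP => _; last exact: rpred0.
  exact: (polyOverP (PF l)).
 + by apply: contraNneq Pij => /polyP/(_ i); rewrite coef_poly lti coef0 => ->.
 + rewrite rootE horner_poly; have /polyP/(_ j) := R0.
  by rewrite coef_poly ltj coef0 => ->.
- rewrite rootE horner_poly -[X in _ == X]P0 (horner_coef P) horner_sum; apply/eqP.
 under eq_bigr do rewrite mulr_suml.
 rewrite exchange_big /=; apply: eq_bigr => l _.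
 rewrite hornerM horner_exp hornerC.
 rewrite (horner_coef_wide _ (max_size_coefXY P l)) mulr_suml.
 by apply: eq_bigr => j _; rewrite mulrAC.
Qed.

End Subfields.

Local Notation adj_is F x G := (forall y, y \in G <-> adj F x y).

(** * Derivations and their extensions *)

Section Derivations.
Variable M : fieldType.
Implicit Types (F G U L S : sfield M) (x y z u w : M) (D : M -> M).

(** D is a total function of M of which only the restriction to S matters; its values on S may leave
    S. *)
Definition derOn (S : {pred M}) D :=
 (forall x y, x \in S -> y \in S -> D (x + y) = D x + D y) /\
 (forall x y, x \in S -> y \in S -> D (x * y) = D x * y + x * D y).

Definition isder D :=
 (forall x y, D (x + y) = D x + D y) /\
 (forall x y, D (x * y) = D x * y + x * D y).

Lemma isder_on S D : isder D -> derOn S D.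
Proof. by case=> DA DM; split=> x y _ _. Qed.

Lemma fullF : exists T : sfield M, forall x, x \in T.
Proof.
have [T TP] : exists T : sfield M, forall x, x \in T <-> setT x.
 by apply: mkF; split.
by exists T => x; apply/TP.
Qed.

Lemma derOn_full T D : (forall x, x \in T) -> derOn T D -> isder D.
Proof. by move=> TT [DA DM]; split=> x y; [apply: DA|apply: DM]. Qed.

Lemma derOn_sub (S T : {pred M}) D : S \sub T -> derOn T D -> derOn S D.
Proof.
by move=> ST [DA DM]; split=> x y /ST xT /ST yT; [apply: DA|apply: DM].
Qed.

Section On.
Variables (S : sfield M) (D : M -> M).
Hypothesis DS : derOn S D.

Lemma der0 : D 0 = 0.
Proof. by have := DS.1 0 0 (rpred0 S) (rpred0 S); rewrite addr0 -[X in X = _]addr0 => /addrI. Qed.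
Lemma der1 : D 1 = 0.
Proof.
have := DS.2 1 1 (rpred1 S) (rpred1 S).
by rewrite !mulr1 mul1r -[X in X = _]addr0 => /addrI.
Qed.
Lemma derN x : x \in S -> D (- x) = - D x.
Proof.
move=> xS; apply/eqP; rewrite -addr_eq0 -DS.1 ?rpredN // addNr.
by rewrite der0.
Qed.
Lemma derB x y : x \in S -> y \in S -> D (x - y) = D x - D y.
Proof. by move=> xS yS; rewrite DS.1 ?rpredN // derN. Qed.
Lemma derMn x n : x \in S -> D (x *+ n) = D x *+ n.
Proof.
move=> xS; elim: n => [|n IH]; first by rewrite !mulr0n der0.
by rewrite !mulrS DS.1 ?IH // rpredMn.
Qed.
Lemma dern n : D n%:R = 0.
Proof. by rewrite derMn ?rpred1 // der1 mul0rn. Qed.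
Lemma derX x n : x \in S -> D (x ^+ n) = n%:R * x ^+ n.-1 * D x.
Proof.
move=> xS; elim: n => [|n IH]; first by rewrite expr0 der1 !mul0r.
rewrite exprS DS.2 ?rpredX // IH -[n.+1%:R]natr1.
case: n {IH} => [|n]; first by rewrite !expr0 /=; ring.
by rewrite /= !exprS; ring.
Qed.
Lemma derV x : x \in S -> D x^-1 = - D x / x ^+ 2.
Proof.
move=> xS; have [->|x0] := eqVneq x 0; first by rewrite invr0 der0 oppr0 mul0r.
have := der1; rewrite -(divff x0) DS.2 ?rpredV // => e.
apply: (mulfI x0); apply/eqP; rewrite -subr_eq0; apply/eqP.
by rewrite -[RHS]e; field.
Qed.
Lemma derQ x y : x \in S -> y \in S -> y != 0 -> D (x / y) = (D x * y - x * D y) / y ^+ 2.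
Proof. by move=> xS yS y0; rewrite DS.2 ?rpredV // derV //; field. Qed.
Lemma der_sum I (r : seq I) (P : pred I) (f : I -> M) : (forall i, P i -> f i \in S) ->
 D (\sum_(i <- r | P i) f i) = \sum_(i <- r | P i) D (f i).
Proof.
move=> fS; pose K x y := x \in S /\ D x = y.
suff [] : K (\sum_(i <- r | P i) f i) (\sum_(i <- r | P i) D (f i)) by [].
apply: big_ind2; first by split; [exact: rpred0|exact: der0].
 by move=> x1 y1 x2 y2 [h1 <-] [h2 <-]; split; [rewrite rpredD|rewrite DS.1].
by move=> i Pi; split; first exact: fS.
Qed.

Definition dpoly (p : {poly M}) := map_poly D p.

Lemma coef_dpoly p i : (dpoly p)`_i = D p`_i.
Proof. by rewrite coef_map_id0 // der0. Qed.

Lemma dpolyC c : dpoly c%:P = (D c)%:P.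
Proof.
by apply/polyP => i; rewrite coef_dpoly !coefC; case: (i == 0)%N; rewrite ?der0.
Qed.

Lemma dpolyD p q : p \over S -> q \over S ->
 dpoly (p + q) = dpoly p + dpoly q.
Proof.
move=> /polyOverP pS /polyOverP qS; apply/polyP => i.
by rewrite coefD !coef_dpoly coefD DS.1.
Qed.

Lemma dpolyM p q : p \over S -> q \over S ->
 dpoly (p * q) = dpoly p * q + p * dpoly q.
Proof.
move=> /polyOverP pS /polyOverP qS; apply/polyP => i.
rewrite coefD !coefM coef_dpoly coefM der_sum; last by move=> j _; rewrite rpredM.
rewrite -big_split; apply: eq_bigr => j _ /=.
by rewrite DS.2 // !coef_dpoly.
Qed.

Lemma der_horner p x : p \over S -> x \in S ->
 D p.[x] = (dpoly p).[x] + p^`().[x] * D x.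
Proof.
move=> pS xS; elim/poly_ind: p pS => [|p c IH] pS.
 by rewrite horner0 der0 /dpoly map_poly0 deriv0 !horner0 mul0r addr0.
have cS : c \in S.
 by have /polyOverP/(_ 0%N) := pS; rewrite coefD coefMX coefC eqxx add0r.
have {}pS : p \over S.
 apply/polyOverP => i; have /polyOverP/(_ i.+1) := pS.
 by rewrite coefD coefMX coefC addr0.
have -> : dpoly (p * 'X + c%:P) = dpoly p * 'X + (D c)%:P.
 apply/polyP => -[|i]; rewrite coef_dpoly !coefD !coefMX !coefC /= ?add0r ?addr0 //.
 by rewrite coef_dpoly.
rewrite !(hornerE, derivE) DS.1 ?rpredM ?rpred_horner // DS.2 ?rpred_horner // IH //.
ring.
Qed.
End On.

Lemma dpoly0 D p S : derOn S D -> (kills D S) -> p \over S ->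
 dpoly D p = 0.
Proof.
move=> DS D0 /polyOverP pS; apply/polyP => i.
by rewrite (coef_dpoly DS) coef0 D0.
Qed.

Hypothesis char0 : char_0 M.

Lemma natr_eq0 n : (n%:R == 0 :> M) = (n == 0)%N.
Proof. by move/pcharf0P: char0. Qed.

Lemma minpoly_sep F y : alg F y -> exists m : {poly M},
 [/\ m \over F, m \is monic, root m y,
   m^`().[y] != 0 & forall p, p \over F -> root p y -> m %| p].
Proof.
move=> /minpoly[m [mF mm my min]]; exists m; split=> //.
apply/negP => m'y.
have m'F : m^`() \over F by exact: polyOver_deriv.
have sm : (1 < size m)%N.
 rewrite ltnNge; apply: contraL my => s1.
 rewrite (size1_polyC s1) rootC; apply: contraTneq (monic_neq0 mm) => m0.
 by rewrite (size1_polyC s1) m0 eqxx.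
have m'0 : m^`() != 0.
 apply: contraTneq sm => m'0; rewrite -leqNgt.
 apply/leq_sizeP => -[//|i] _.
 have /polyP/(_ i) := m'0; rewrite coef_deriv coef0 => /eqP.
 by rewrite -mulr_natr mulf_eq0 natr_eq0 orbF => /eqP.
have := dvdp_leq m'0 (min _ m'F m'y).
by rewrite leqNgt lt_size_deriv // monic_neq0.
Qed.

(** Differentiating m(y) = 0 determines D y, as m'(y) is nonzero in characteristic 0. One polynomial
    m serves all D, which gives both uniqueness and stability. *)
Lemma der_alg F y : alg F y -> exists m : {poly M},
 [/\ m \over F, m^`().[y] != 0 & forall L D, derOn L D -> F \sub L ->
   y \in L -> D y = - (dpoly D m).[y] / m^`().[y]].
Proof.
move=> /minpoly_sep[m [mF mm my m'y _]]; exists m; split=> // L D DL FL yL.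
have := der_horner DL (polyOver_sub FL mF) yL.
rewrite (rootP my) (der0 DL) => e; apply: (mulIf m'y); rewrite divfK //.
by apply/eqP; rewrite -addr_eq0 addrC mulrC -e.
Qed.

Lemma der_unique F L D1 D2 y : alg F y -> derOn L D1 -> derOn L D2 ->
 F \sub L -> y \in L -> (forall x, x \in F -> D1 x = D2 x) -> D1 y = D2 y.
Proof.
move=> /der_alg[m [mF _ h]] D1L D2L FL yL e.
rewrite (h _ _ D1L FL yL) (h _ _ D2L FL yL); congr (- _.[_] / _).
apply/polyP => i; rewrite (coef_dpoly D1L) (coef_dpoly D2L) e //.
exact: (polyOverP mF).
Qed.

Lemma der_stable F G L D y : alg F y -> derOn L D -> F \sub L -> y \in L ->
 F \sub G -> y \in G -> (forall x, x \in F -> D x \in G) -> D y \in G.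
Proof.
move=> /der_alg[m [mF _ h]] DL FL yL FG yG DG; rewrite (h _ _ DL FL yL).
rewrite rpred_div ?rpredN ?rpred_horner //.
 by apply/polyOverP => i; rewrite (coef_dpoly DL) DG // (polyOverP mF).
by rewrite polyOver_deriv //; apply: polyOver_sub mF.
Qed.

(** The value at p(b) / q(b) is forced by the quotient rule; the last hypothesis, that the value
    forced on p(b) is 0 whenever p(b) = 0, makes it well defined. *)
Lemma der_ext1 S U D b c : derOn S D -> S \sub U ->
 (forall x, x \in S -> D x \in U) -> b \in U -> c \in U ->
 (forall p, p \over S -> p.[b] = 0 -> (dpoly D p).[b] + p^`().[b] * c = 0) ->
 exists (S' : sfield M) D', [/\ derOn S' D',
  S \sub S', b \in S', S' \sub U &
  [/\ forall x, x \in S' -> D' x \in U, forall x, x \in S -> D' x = D x & D' b = c]].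
Proof.
move=> DS SU DU bU cU cons.
have [S' S'P] := adjF S b.
pose d p := (dpoly D p).[b] + p^`().[b] * c.
have dD p q : p \over S -> q \over S -> d (p + q) = d p + d q.
 by move=> pS qS; rewrite /d (dpolyD DS) // derivD !hornerD mulrDl addrACA.
have dM p q : p \over S -> q \over S -> d (p * q) = d p * q.[b] + p.[b] * d q.
 by move=> pS qS; rewrite /d (dpolyM DS) // derivM !hornerD !hornerM; ring.
have d0 p : p \over S -> p.[b] = 0 -> d p = 0 by exact: cons.
have dU p : p \over S -> d p \in U.
 move=> pS; have pU := polyOver_sub SU pS.
 rewrite rpredD ?rpredM ?rpred_horner //; last exact: polyOver_deriv.
 by apply/polyOverP => i; rewrite (coef_dpoly DS) DU // (polyOverP pS).
pose val p q := (d p * q.[b] - p.[b] * d q) / q.[b] ^+ 2.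
have wd p q p' q' : p \over S -> q \over S -> q.[b] != 0 ->
  p' \over S -> q' \over S -> q'.[b] != 0 ->
  p.[b] / q.[b] = p'.[b] / q'.[b] -> val p q = val p' q'.
 move=> pS qS q0 pS' qS' q0' e.
 have {e} e : p.[b] = p'.[b] / q'.[b] * q.[b] by rewrite -e divfK.
 have NS : (-1)%:P \over S by rewrite polyOverC rpredN rpred1.
 have dN r : r \over S -> d ((-1)%:P * r) = - d r.
  move=> rS; rewrite dM // {1}/d derivC (dpolyC DS).
  by rewrite (derN DS) ?rpred1 // (der1 DS) oppr0 !hornerE; ring.
 have z : (p * q' + (-1)%:P * (p' * q)).[b] = 0.
  by rewrite hornerD !hornerM hornerC e; field.
 have := d0 _ _ z; rewrite rpredD ?rpredM // => /(_ isT).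
 rewrite dD ?rpredM // dN ?rpredM // !dM // e => E.
 have {}E : d p = (p'.[b] * d q + d p' * q.[b] - p'.[b] / q'.[b] * q.[b] * d q') / q'.[b].
  apply: (mulIf q0'); rewrite divfK //; apply/eqP; rewrite -subr_eq0; apply/eqP.
  by rewrite -[RHS]E; ring.
 by rewrite /val E e; field; rewrite q0 q0'.
have /choice[D' D'P] : forall y, exists z, y \in S' -> exists p q,
  [/\ p \over S, q \over S, q.[b] != 0, y = p.[b] / q.[b] & z = val p q].
 move=> y; have [yS|yS] := boolP (y \in S'); last by exists 0.
 by have /S'P[p [q [pS qS q0 e]]] := yS; exists (val p q) => _; exists p, q.
have D'E p q : p \over S -> q \over S -> q.[b] != 0 ->
  D' (p.[b] / q.[b]) = val p q.
 move=> pS qS q0.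
 have : p.[b] / q.[b] \in S' by apply/S'P; exists p, q.
 by move=> /D'P[p' [q' [pS' qS' q0' e ->]]]; apply: wd.
have S'U : S' \sub U.
 by move=> y /S'P[p [q [pS qS q0 ->]]]; rewrite rpred_div ?rpred_horner // (polyOver_sub SU).
exists S', D'; split=> //.
- split=> x y /S'P[p [q [pS qS q0 ->]]] /S'P[p' [q' [pS' qS' q0' ->]]].
  have qq0 : (q * q').[b] != 0 by rewrite hornerM mulf_neq0.
  have -> : p.[b] / q.[b] + p'.[b] / q'.[b] = (p * q' + p' * q).[b] / (q * q').[b].
   by rewrite hornerD !hornerM; field; rewrite q0 q0'.
  rewrite !D'E ?rpredD ?rpredM // /val dD ?rpredM // !dM // hornerD !hornerM.
  by field; rewrite q0 q0'.
 have qq0 : (q * q').[b] != 0 by rewrite hornerM mulf_neq0.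
 have -> : p.[b] / q.[b] * (p'.[b] / q'.[b]) = (p * p').[b] / (q * q').[b].
  by rewrite !hornerM; field; rewrite q0 q0'.
 rewrite !D'E ?rpredD ?rpredM // /val !dM // !hornerM.
 by field; rewrite q0 q0'.
- by move=> x xS; apply/S'P/adj_id.
- exact/S'P/adj_gen.
- have d1 : d 1%:P = 0.
  by rewrite /d (dpolyC DS) (der1 DS) derivC !hornerC mul0r addr0.
 have one0 : (1%:P : {poly M}).[b] != 0 by rewrite hornerC oner_eq0.
 have oneS : (1%:P : {poly M}) \over S by rewrite polyOverC rpred1.
 split.
 + move=> x /S'P[p [q [pS qS q0 ->]]]; rewrite D'E // /val.
  by rewrite rpred_div ?rpredB ?rpredM ?rpredX ?dU ?rpred_horner // (polyOver_sub SU).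
 + move=> x xS; have xSp : x%:P \over S by rewrite polyOverC.
  have := D'E _ _ xSp oneS one0; rewrite !hornerC divr1 => ->.
  rewrite /val d1 !hornerC expr1n divr1 mulr1 mulr0 subr0.
  by rewrite /d (dpolyC DS) derivC !hornerC mul0r addr0.
 + have := D'E _ _ (polyOverX S) oneS one0; rewrite hornerX !hornerC divr1 => ->.
  rewrite /val d1 !hornerC /d derivX.
  have -> : dpoly D 'X = 0.
   apply/polyP => i; rewrite (coef_dpoly DS) coefX coef0.
   by case: (i == 1)%N; rewrite ?(der1 DS) ?(der0 DS).
  by rewrite -polyC1 horner0 !hornerC add0r mul1r mulr1 mulr0 subr0 expr1n divr1.
Qed.

(** For b algebraic over S the value D b is forced by its separable minimal polynomial; for b
    transcendental the value 0 is as good as any. *)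
Lemma der_ext1' S U D b : derOn S D -> S \sub U ->
 (forall x, x \in S -> D x \in U) -> b \in U ->
 exists (S' : sfield M) D', [/\ derOn S' D',
  S \sub S', b \in S', S' \sub U &
  (forall x, x \in S' -> D' x \in U) /\ forall x, x \in S -> D' x = D x].
Proof.
move=> DS SU DU bU.
suff [c [cU cons]] : exists c, c \in U /\ forall p, p \over S -> p.[b] = 0 ->
  (dpoly D p).[b] + p^`().[b] * c = 0.
 have [S' [D' [h1 h2 h3 h4 [h5 h6 h7]]]] := der_ext1 DS SU DU bU cU cons.
 by exists S', D'.
have [/minpoly_sep[m [mS mm mb m'b min]]|nalg] := pselect (alg S b); last first.
 exists 0; split=> [|p pS pb]; first exact: rpred0.
 have [->|p0] := eqVneq p 0; first by rewrite /dpoly map_poly0 deriv0 !horner0 mul0r addr0.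
 by case: nalg; exists p; split=> //; apply/rootP.
have mU := polyOver_sub SU mS.
exists (- (dpoly D m).[b] / m^`().[b]); split.
 rewrite rpred_div ?rpredN ?rpred_horner ?polyOver_deriv //.
 by apply/polyOverP => i; rewrite (coef_dpoly DS) DU // (polyOverP mS).
move=> p pS /rootP pb; have mp := min p pS pb.
have qS := polyOver_quo pS mS.
rewrite -(divpK mp) (dpolyM DS) // derivM !hornerD !hornerM (rootP mb).
by field.
Qed.

(** Zorn on the graphs of partial extensions between F and U: by [der_ext1'] a maximal one is
    defined on all of U. *)
Theorem der_ext F U D0 : derOn F D0 -> F \sub U ->
 (forall x, x \in F -> D0 x \in U) ->
 exists D, [/\ derOn U D, stab D U & forall x, x \in F -> D x = D0 x].
Proof.
move=> DF FU D0U.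
pose good S D := [/\ derOn S D, F \sub S, S \sub U,
 forall x, x \in S -> D x \in U & forall x, x \in F -> D x = D0 x].
pose graph S D : set (M * M) := [set xy | xy.1 \in S /\ xy.2 = D xy.1]%classic.
pose P (A : set (M * M)) := A = set0%classic \/ exists S D, good S D /\ A = graph S D.
have [C CP Ctot|A [[A0|[S [D [gSD AE]]]] Amax]] := @Zorn_bigcup _ P.
- have [[A0 [CA0 [S0 [D0' [g0 A0E]]]]]|none] :=
   pselect (exists A, C A /\ exists S D, good S D /\ A = graph S D); last first.
  left; apply/seteqP; split=> // xy [A CA Axy].
  by have [A0|[S [D h]]] := CP _ CA; [rewrite A0 in Axy|case: none; exists A; split=> //; exists S, D].
 right.
 pose T : set M := [set x | exists y, (\bigcup_(X in C) X)%classic (x, y)]%classic.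
 have mem x : T x -> exists S D, [/\ good S D, C (graph S D) & x \in S].
  move=> [y [A CA Axy]]; have [A0'|[S [D [g AE]]]] := CP _ CA; first by rewrite A0' in Axy.
  by exists S, D; rewrite -AE; split=> //; rewrite AE in Axy; case: Axy.
 have two x y : T x -> T y -> exists S D, [/\ good S D, C (graph S D), x \in S & y \in S].
  move=> /mem[S [D [g CS xS]]] /mem[S1 [D1 [g1 CS1 yS]]].
  have [le|le] := Ctot _ _ CS CS1.
   exists S1, D1; split=> //; suff : graph S1 D1 (x, D x) by case.
   by apply: le.
  exists S, D; split=> //; suff : graph S D (y, D1 y) by case.
  by apply: le.
 have inT S D x : C (graph S D) -> x \in S -> T x.
  by move=> CS xS; exists (D x); exists (graph S D).
 have [S SP] : exists S : sfield M, forall x, x \in S <-> T x.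
  apply: mkF; split.
  - by apply: (inT S0 D0'); [rewrite -A0E|exact: rpred1].
  - move=> x y Tx Ty; have [S [D [g CS xS yS]]] := two x y Tx Ty.
   by apply: inT CS _; rewrite rpredB.
  - move=> x y Tx Ty; have [S [D [g CS xS yS]]] := two x y Tx Ty.
   by apply: inT CS _; rewrite rpred_div.
 have /choice[D DP] : forall x, exists y, T x -> (\bigcup_(X in C) X)%classic (x, y).
  move=> x; have [[y h]|n] := pselect (T x); first by exists y.
  by exists 0.
 have DE S1 D1 x : C (graph S1 D1) -> x \in S1 -> D x = D1 x.
  move=> CS1 xS1; have [A CA Axy] := DP _ (inT _ _ _ CS1 xS1).
  have [le|le] := Ctot _ _ CA CS1; first by have [] := le _ Axy.
  have [A0'|[S2 [D2 [g2 AE]]]] := CP _ CA; first by rewrite A0' in Axy.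
  have : A (x, D1 x) by apply: le.
  by move: Axy; rewrite AE => -[_ /= ->] [_ /= ->].
 exists S, D; split.
  split.
  - split=> x y /SP Tx /SP Ty; have [S1 [D1 [[dS1 _ _ _ _] CS1 xS yS]]] := two _ _ Tx Ty.
    by rewrite !(DE _ _ _ CS1) ?rpredD // dS1.1.
   by rewrite !(DE _ _ _ CS1) ?rpredM // dS1.2.
  - move=> x xF; apply/SP; apply: (inT S0 D0'); first by rewrite -A0E.
   by have [_ h _ _ _] := g0; apply: h.
  - by move=> x /SP/mem[S1 [D1 [[_ _ h _ _] _ xS]]]; apply: h.
  - by move=> x /SP/mem[S1 [D1 [[_ _ _ h _] CS xS]]]; rewrite (DE _ _ _ CS) // h.
  - move=> x xF; have [_ h _ _ h'] := g0.
   by rewrite (DE S0 D0') ?h' //; [rewrite -A0E|exact: h].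
 apply/seteqP; split=> -[x y] /=.
  move=> [A CA Axy]; have [A0'|[S1 [D1 [g1 AE]]]] := CP _ CA; first by rewrite A0' in Axy.
  move: (Axy); rewrite AE => -[/= xS1 /= ->]; rewrite AE in CA.
  split; first by apply/SP; apply: inT CA xS1.
  by rewrite (DE _ _ _ CA).
 by move=> [/SP Tx /= ->]; apply: DP.
- have g0 : good F D0 by split.
 case: (Amax (graph F D0)); last by right; exists F, D0.
 rewrite A0; split=> // /(_ (1, D0 1)).
 by apply; split=> //=; exact: rpred1.
- have [DS FS SU DU DE] := gSD.
 have {}US : U \sub S.
  move=> b bU; apply: contrapT => bS.
  have [S' [D' [h1 h2 h3 h4 [h5 h6]]]] := der_ext1' DS SU DU bU.
  case: (Amax (graph S' D')); last first.
   right; exists S', D'; split=> //; split=> //.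
    by move=> x /FS/h2.
   by move=> x xF; rewrite h6 ?FS // DE.
  rewrite AE; split.
   by move=> [x y] [/= xS ->]; split; [exact: h2|rewrite /= h6].
  by move=> /(_ (b, D' b)) [].
 exists D; split=> //.
  exact: derOn_sub DS.
 by move=> x xU; apply: DU; apply: US.
Qed.

Lemma der_ext_transc F U D0 a c : derOn F D0 -> F \sub U ->
 (forall x, x \in F -> D0 x \in U) -> a \in U -> c \in U -> ~ alg F a ->
 exists D, [/\ derOn U D, stab D U,
  forall x, x \in F -> D x = D0 x & D a = c].
Proof.
move=> DF FU D0U aU cU na.
have [|S' [D' [h1 h2 h3 h4 [h5 h6 h7]]]] := der_ext1 DF FU D0U aU cU.
 move=> p pF pa; have [->|p0] := eqVneq p 0.
  by rewrite /dpoly map_poly0 deriv0 !horner0 mul0r addr0.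
 by case: na; exists p; split=> //; apply/rootP.
have [D [d1 d2 d3]] := der_ext h1 h4 h5.
exists D; split=> //; first by move=> x xF; rewrite d3 ?h2 // h6.
by rewrite d3 // h7.
Qed.

End Derivations.

Lemma Zorn_nonempty T (P : set (set T)) A0 : P A0 ->
 (forall C : set (set T), (C `<=` P)%classic -> total_on C subset ->
   (exists A, C A) -> P (\bigcup_(X in C) X)%classic) ->
 exists A, P A /\ forall B, (A `<=` B)%classic -> P B -> (B `<=` A)%classic.
Proof.
move=> PA0 chain; pose Q A := A = set0 \/ P A.
have [C CQ Ctot|A [QA Amax]] := @Zorn_bigcup _ Q.
 have [[A [CA /eqP A0n]]|none] := pselect (exists A, C A /\ A <> set0); last first.
  left; apply/seteqP; split=> // x [A CA Ax].
  have [A0e|/eqP A0n] := eqVneq A set0; first by rewrite A0e in Ax.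
  by case: none; exists A.
 right; have -> : (\bigcup_(X in C) X = \bigcup_(X in [set X | C X /\ P X]) X)%classic.
  apply/seteqP; split=> x [B CB Bx]; exists B => //; last by case: CB.
  split=> //; have [B0|//] := CQ _ CB.
  by rewrite B0 in Bx.
 apply: chain.
 - by move=> B [].
 - by move=> B B' [CB _] [CB' _]; apply: Ctot.
 - exists A; split=> //; have [A0e|//] := CQ _ CA.
  by rewrite A0e eqxx in A0n.
case: QA => [A0e|PA]; last first.
 by exists A; split=> // B AB PB; apply: contrapT => nBA; apply: (Amax B) => //; right.
exists A0; split=> // B AB PB; apply: contrapT => nBA.
apply: (Amax B); last by right.
by rewrite A0e; split=> // B0; apply: nBA => x /B0.
Qed.

(** * Valuation rings *)

Section Valuations.
Variable M : fieldType.
Implicit Types (F G U L S : sfield M) (x y z u w : M) (O R : sring M).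

Lemma mkR (P : set M) : P 1 -> (forall x y, P x -> P y -> P (x - y)) ->
 (forall x y, P x -> P y -> P (x * y)) ->
 exists R : sring M, forall x, x \in R <-> P x.
Proof.
move=> P1 PB PM.
pose S : {pred M} := fun x => `[< P x >].
have SP x : x \in S <-> P x by split => [/asboolP|?]; last exact/asboolP.
have Sring : GRing.subring_closed S.
 split; first exact/SP.
  by move=> x y /SP Sx /SP Sy; apply/SP/PB.
 by move=> x y /SP Sx /SP Sy; apply/SP/PM.
pose SM := GRing.isSubringClosed.Build M S Sring.
pose R : sring M := HB.pack S SM.
by exists R => x; apply: SP.
Qed.

Definition valring O := forall x, (x \in O) || (x^-1 \in O).
Definition mx O : {pred M} := [pred x | (x \in O) && ((x == 0) || (x^-1 \notin O))].

Section Val.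
Variable O : sring M.
Hypothesis vO : valring O.

Lemma mx_sub x : x \in mx O -> x \in O. Proof. by case/andP. Qed.
Lemma mx0 : 0 \in mx O. Proof. by rewrite inE rpred0 eqxx. Qed.
Lemma mx1 : 1 \notin mx O.
Proof. by rewrite inE rpred1 oner_eq0 invr1 rpred1. Qed.
Lemma unitO x : x \in O -> x \notin mx O -> x != 0 /\ x^-1 \in O.
Proof. by move=> xO; rewrite inE xO /= negb_or negbK => /andP. Qed.
Lemma notO_mx x : x \notin O -> x^-1 \in mx O.
Proof.
move=> xO; have := vO x; rewrite (negPf xO) /= => xi.
by rewrite inE xi invrK xO orbT.
Qed.
Lemma mx_mulr x y : x \in O -> y \in mx O -> x * y \in mx O.
Proof.
move=> xO /andP[yO yi]; rewrite inE rpredM //=.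
have [//|xy0] := eqVneq (x * y) 0; move: xy0; rewrite mulf_eq0 negb_or => /andP[x0 y0] /=.
move: yi; rewrite (negPf y0) /=; apply: contra => h.
by rewrite -[y^-1]mul1r -(divff x0) -mulrA -invfM rpredM.
Qed.
Lemma mx_mull x y : x \in mx O -> y \in O -> x * y \in mx O.
Proof. by move=> xm yO; rewrite mulrC mx_mulr. Qed.
Lemma mx_add x y : x \in mx O -> y \in mx O -> x + y \in mx O.
Proof.
move=> xm ym.
have [->|x0] := eqVneq x 0; first by rewrite add0r.
have [->|y0] := eqVneq y 0; first by rewrite addr0.
have /orP[h|] := vO (x / y).
 have -> : x + y = (x / y + 1) * y by field.
 by rewrite mx_mulr // rpredD ?rpred1.
rewrite invf_div => h.
have -> : x + y = (y / x + 1) * x by field.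
by rewrite mx_mulr // rpredD ?rpred1.
Qed.
Lemma mx_opp x : x \in mx O -> - x \in mx O.
Proof. by move=> xm; rewrite -mulN1r mx_mulr // rpredN rpred1. Qed.
Lemma mx_oppE x : (- x \in mx O) = (x \in mx O).
Proof. by apply/idP/idP => /mx_opp; rewrite ?opprK. Qed.
Lemma mx_subr x y : x \in mx O -> y \in mx O -> x - y \in mx O.
Proof. by move=> xm ym; rewrite mx_add // mx_opp. Qed.
Lemma mx_sum I (r : seq I) (P : pred I) (f : I -> M) :
 (forall i, P i -> f i \in mx O) -> \sum_(i <- r | P i) f i \in mx O.
Proof. by move=> h; apply: (big_ind (fun x => x \in mx O)); [exact: mx0|exact: mx_add|]. Qed.
Lemma mx_prime x y : x \in O -> y \in O -> x * y \in mx O -> x \in mx O \/ y \in mx O.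
Proof.
move=> xO yO xy; have [|xn] := boolP (x \in mx O); first by left.
right; have [x0 xi] := unitO xO xn.
by have := mx_mulr xi xy; rewrite mulKf.
Qed.
Lemma mx_unitM x y : x \in O -> y \in O -> x \notin mx O -> y \notin mx O -> x * y \notin mx O.
Proof. by move=> xO yO xn yn; apply/negP => /(mx_prime xO yO)[]; apply/negP. Qed.
Lemma mx_exp x n : x \in O -> x ^+ n \in mx O -> x \in mx O.
Proof.
move=> xO; elim: n => [|n IH]; first by rewrite expr0 (negPf mx1).
by rewrite exprS => /(mx_prime xO (rpredX _ xO))[].
Qed.
Lemma O_exp x n : (0 < n)%N -> x ^+ n \in O -> x \in O.
Proof.
move=> n0 xn; have [->|x0] := eqVneq x 0; first exact: rpred0.
apply: contraT => /notO_mx xm.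
have : x^-1 ^+ n * x ^+ n \in mx O.
 rewrite mulrC mx_mulr //; case: n n0 {xn} => // n _.
 by rewrite exprS mx_mull // rpredX // mx_sub.
by rewrite -exprMn mulVf // expr1n (negPf mx1).
Qed.
Lemma O_add_unit x y : x \in O -> y \in mx O -> x \notin mx O -> x + y \notin mx O.
Proof. by move=> xO ym; apply: contra => xy; rewrite -(addrK y x) mx_subr. Qed.

(** Valuation rings are integrally closed: if z is outside O, dividing the equation by the top power
    of z writes -1 as a sum of elements of the maximal ideal. *)
Lemma O_root p z : p \is monic -> p \over O -> root p z -> z \in O.
Proof.
move=> pm pO pz; apply: contraT => zO; have zm := notO_mx zO.
have z0 : z != 0 by apply: contraNneq zO => ->; rewrite rpred0.
have sp : (0 < size p)%N by rewrite size_poly_gt0 monic_neq0.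
pose n := (size p).-1.
have : \sum_(i < n) p`_i * z^-1 ^+ (n - i) \in mx O.
 apply: mx_sum => i _; rewrite mx_mulr ?(polyOverP pO) //.
 rewrite -(prednK (_ : 0 < n - i)%N) ?subn_gt0 // exprS mx_mull // rpredX //.
 exact: mx_sub.
suff -> : \sum_(i < n) p`_i * z^-1 ^+ (n - i) = - 1 by rewrite mx_oppE (negPf mx1).
have /rootP := pz; rewrite horner_coef -(prednK sp) big_ord_recr /= -/n.
have -> : p`_n = 1 by apply/eqP; rewrite -lead_coefE -monicE.
rewrite mul1r => /eqP; rewrite addr_eq0 => /eqP e.
apply: (mulIf (expf_neq0 n z0)); rewrite mulN1r -e mulr_suml.
apply: eq_bigr => i _; rewrite -mulrA exprVn; congr (_ * _).
rewrite -[in z ^+ n](subnK (ltnW (ltn_ord i))) exprD mulrA mulVf ?mul1r //.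
exact: expf_neq0.
Qed.
End Val.

Section Existence.
Variables (R : sring M) (J0 : set M).
Hypotheses (JR : forall x, J0 x -> x \in R) (J00 : J0 0)
 (JB : forall x y, J0 x -> J0 y -> J0 (x - y))
 (JM : forall x y, x \in R -> J0 y -> J0 (x * y)) (J1 : ~ J0 1).

(** A ring A above R with a proper ideal J above J0; Zorn is applied to such pairs. *)
Let good (A J : set M) := [/\ (forall x, x \in R -> A x) /\ (forall x, J0 x -> J x),
 (forall x y, A x -> A y -> A (x - y)) /\ (forall x y, A x -> A y -> A (x * y)),
 (forall x, J x -> A x) /\ ~ J 1,
 forall x y, J x -> J y -> J (x - y) & forall x y, A x -> J y -> J (x * y)].

Lemma good_ext A J x : good A J ->
 (forall p : {poly M}, (forall i, J p`_i) -> p.[x] <> 1) ->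
 good [set y | exists p : {poly M}, (forall i, A p`_i) /\ y = p.[x]]%classic
    [set y | exists p : {poly M}, (forall i, J p`_i) /\ y = p.[x]]%classic.
Proof.
move=> [[g1 g2] [g3 g4] [g5 g6] g7 g8] n1.
have A0 : A 0 by apply/g1/rpred0.
have J0' : J 0 by apply: g2.
have JN a : J a -> J (- a) by move=> /(g7 _ _ J0'); rewrite sub0r.
have AN a : A a -> A (- a) by move=> /(g3 _ _ A0); rewrite sub0r.
have JD a b : J a -> J b -> J (a + b) by move=> Ja /JN Jb; have := g7 _ _ Ja Jb; rewrite opprK.
have AD a b : A a -> A b -> A (a + b) by move=> Ja /AN Jb; have := g3 _ _ Ja Jb; rewrite opprK.
split; [split|split|split| |].
- move=> y yR; exists y%:P; split; last by rewrite hornerC.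
 by move=> i; rewrite coefC; case: ifP => _ //; apply: g1.
- move=> y yR; exists y%:P; split; last by rewrite hornerC.
 by move=> i; rewrite coefC; case: ifP => _ //; apply: g2.
- move=> _ _ [p [pA ->]] [q [qA ->]]; exists (p - q); split; last by rewrite !hornerE.
 by move=> i; rewrite coefB; apply: g3.
- move=> _ _ [p [pA ->]] [q [qA ->]]; exists (p * q); split; last by rewrite !hornerE.
 by move=> i; rewrite coefM; apply: big_ind => // j _; apply: g4.
- by move=> _ [p [pJ ->]]; exists p; split=> // i; apply: g5.
- by move=> [p [pJ /esym]]; apply: n1.
- move=> _ _ [p [pA ->]] [q [qA ->]]; exists (p - q); split; last by rewrite !hornerE.
 by move=> i; rewrite coefB; apply: g7.
- move=> _ _ [p [pA ->]] [q [qA ->]]; exists (p * q); split; last by rewrite !hornerE.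
 by move=> i; rewrite coefM; apply: big_ind => // j _; apply: g8.
Qed.

(** Infinite descent: two expressions of 1, as a polynomial in x and one in 1/x with coefficients in
    J, can always be shortened. *)
Lemma good_nopair A J : good A J -> forall N x (p q : {poly M}),
 x != 0 -> (size p + size q <= N)%N ->
 (forall i, J p`_i) -> (forall i, J q`_i) -> p.[x] = 1 -> q.[x^-1] = 1 -> False.
Proof.
move=> [[g1 g2] [g3 g4] [g5 g6] g7 g8]; elim=> [|N IH] x p q x0.
 rewrite leqn0 addn_eq0 size_poly_eq0 => /andP[/eqP -> _] _ _.
 by rewrite horner0 => /esym/eqP; rewrite oner_eq0.
have A0 : A 0 by apply/g1/rpred0.
have J0' : J 0 by apply: g2.
have A1 : A 1 by apply/g1/rpred1.
have JN a : J a -> J (- a) by move=> /(g7 _ _ J0'); rewrite sub0r.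
have JD a b : J a -> J b -> J (a + b) by move=> Ja /JN Jb; have := g7 _ _ Ja Jb; rewrite opprK.
wlog le : x p q x0 / (size q <= size p)%N => [wl|].
 have [le|/ltnW le] := leqP (size q) (size p); first exact: wl le.
 move=> s pJ qJ px qx; apply: (wl x^-1 q p) => //; rewrite ?invr_eq0 ?invrK //.
 by rewrite addnC.
move=> sN pJ qJ px qx.
have sp1 : (1 < size p)%N.
 rewrite ltnNge; apply/negP => /size1_polyC e; apply: g6.
 by rewrite -px e hornerC.
pose n := (size p).-1.
have n0 : (0 < n)%N by rewrite /n; lia.
have spn : size p = n.+1 by rewrite /n; lia.
(* Multiply p(x) = 1 by 1 - q_0 and rewrite the product of 1 - q_0 and x^n with the relation q(1/x)
   = 1: the value at x is still 1 and the degree has dropped below n. *)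
pose r := (q`_0)%:P + (1 - q`_0) *: (\poly_(i < n) p`_i)
  + p`_n *: (\sum_(j < n) q`_(j.+1) *: 'X^(n - j.+1)).
have ex : q`_0 + \sum_(j < n) q`_j.+1 * x^-1 ^+ j.+1 = 1.
 have sq : (size q <= n.+1)%N by rewrite -spn.
 rewrite -[RHS]qx (horner_coef_wide _ sq).
 by rewrite big_ord_recl expr0 mulr1.
have rx : r.[x] = 1.
 rewrite !hornerD hornerC !hornerZ horner_poly horner_sum.
 have -> : \sum_(i < n) (q`_i.+1 *: 'X^(n - i.+1)).[x] = x ^+ n * (1 - q`_0).
  rewrite -ex addrC addKr mulr_sumr; apply: eq_bigr => j _.
  rewrite hornerZ hornerXn mulrCA exprVn; congr (_ * _).
  have -> : x ^+ n = x ^+ (n - j.+1) * x ^+ j.+1 by rewrite -exprD subnK.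
  by rewrite mulfK // expf_neq0.
 have -> : \sum_(i < n) p`_i * x ^+ i = 1 - p`_n * x ^+ n.
  by rewrite -[in RHS]px horner_coef spn big_ord_recr /= addrK.
 ring.
apply: (IH x r q) => //.
 have : (size r <= n)%N; last by lia.
 apply/leq_sizeP => i ni; rewrite !coefD coefC !coefZ coef_poly.
 rewrite ltnNge ni /= coef_sum big1 ?mulr0 ?addr0; last first.
  move=> j _; rewrite coefZ coefXn.
  by case: eqP => [e|]; rewrite ?mulr0 //; move: (ltn_ord j); lia.
 by have -> : (i == 0)%N = false by lia.
move=> i; rewrite !coefD coefC !coefZ coef_poly coef_sum.
apply: (JD); first apply: JD.
- by case: ifP => _ //; apply: qJ.
- by apply: (g8) => //; [apply/(g3)/g5/qJ | case: ifP].
- rewrite mulrC; apply: (g8); last exact: pJ.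
 apply: g5; apply: big_ind => // j _; rewrite coefZ mulrC; apply: (g8) => //.
 by apply: g1; rewrite coefXn rpred_nat.
Qed.

(** Chevalley's extension theorem. In a maximal pair, A contains every x such that J[x] omits 1, and
    by [good_nopair] one of x and 1/x always qualifies. *)
Theorem valring_ext : exists O, [/\ valring O, R \sub O & forall x, J0 x -> x \in mx O].
Proof.
(* A pair (ring, ideal) is coded as one subset of [M * bool], so that inclusion is the right
   order. *)
pose T := (M * bool)%type.
pose Q (X : set T) := good [set a | X (a, true)]%classic [set a | X (a, false)]%classic.
pose X0 : set T := [set ab | if ab.2 then is_true (ab.1 \in R) else J0 ab.1]%classic.
have [||X [QX Xmax]] := @Zorn_nonempty _ Q X0.
- split; rewrite /X0 /=; [by split|split|by split| |].
 + by move=> x y; apply: rpredB.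
 + by move=> x y; apply: rpredM.
 + exact: JB.
 + exact: JM.
- move=> C CQ Ctot [X CX].
 have two a b : (\bigcup_(X in C) X)%classic a -> (\bigcup_(X in C) X)%classic b ->
   exists X, [/\ C X, X a & X b].
  move=> [Y CY Ya] [Z CZ Zb]; have [le|le] := Ctot _ _ CY CZ.
   by exists Z; split=> //; apply: le.
  by exists Y; split=> //; apply: le.
 split; [split|split|split| |] => /=.
 + by move=> x xR; exists X => //; have [[h _] _ _ _ _] := CQ _ CX; apply: h.
 + by move=> x xR; exists X => //; have [[_ h] _ _ _ _] := CQ _ CX; apply: h.
 + move=> x y hx hy; have [Y [CY Yx Yy]] := two _ _ hx hy; exists Y => //.
  by have [_ [h _] _ _ _] := CQ _ CY; apply: h.
 + move=> x y hx hy; have [Y [CY Yx Yy]] := two _ _ hx hy; exists Y => //.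
  by have [_ [_ h] _ _ _] := CQ _ CY; apply: h.
 + move=> x [Y CY Yx]; exists Y => //.
  by have [_ _ [h _] _ _] := CQ _ CY; apply: h.
 + by move=> [Y CY Yx]; have [_ _ [_ h] _ _] := CQ _ CY; apply: h.
 + move=> x y hx hy; have [Y [CY Yx Yy]] := two _ _ hx hy; exists Y => //.
  by have [_ _ _ h _] := CQ _ CY; apply: h.
 + move=> x y hx hy; have [Y [CY Yx Yy]] := two _ _ hx hy; exists Y => //.
  by have [_ _ _ _ h] := CQ _ CY; apply: h.
pose A : set M := [set a | X (a, true)]%classic.
pose J : set M := [set a | X (a, false)]%classic.
have g : good A J := QX.
have inA x : (forall p : {poly M}, (forall i, J p`_i) -> p.[x] <> 1) -> A x.
 move=> nx; have g' := good_ext g nx.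
 have [[g1 g2] [g3 g4] [g5 g6] g7 g8] := g.
 pose Y : set T := [set ab | if ab.2 then exists p : {poly M}, (forall i, A p`_i) /\ ab.1 = p.[x]
   else exists p : {poly M}, (forall i, J p`_i) /\ ab.1 = p.[x]]%classic.
 have XY : (X `<=` Y)%classic.
  have A0 : A 0 by apply/g1/rpred0.
  have J0' : J 0 by apply: g2.
  move=> [a []] Xa; exists a%:P; split; rewrite /= ?hornerC // => i; rewrite coefC; by case: ifP.
 apply: (Xmax Y XY g' (x, true)); exists 'X; rewrite hornerX; split=> // i.
 by rewrite coefX; apply: g1; rewrite rpred_nat.
have [[g1 g2] [g3 g4] [g5 g6] g7 g8] := g.
have [O OP] : exists O, forall x, x \in O <-> A x.
 by apply: mkR => //; apply/g1/rpred1.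
have vO : valring O.
 move=> x; have [->|x0] := eqVneq x 0; first by rewrite rpred0.
 apply/orP; have [h|/existsNP[p /not_implyP[pJ /contrapT px]]] :=
   pselect (forall p : {poly M}, (forall i, J p`_i) -> p.[x] <> 1).
  by left; apply/OP/inA.
 right; apply/OP/inA => q qJ qx.
 exact: (good_nopair g x0 (leqnn _) pJ qJ px qx).
exists O; split=> //; first by move=> x xR; apply/OP/g1.
move=> x /g2 Jx; rewrite inE; apply/andP; split; first exact/OP/g5.
have [//|x0] := eqVneq x 0; apply/negP => /OP Ax; apply: g6.
by rewrite -(mulVf x0); apply: g8.
Qed.
End Existence.

(* The point at infinity of F(y). *)
Lemma valring_transc F y : ~ alg F y -> exists O, [/\ valring O, F \sub O & y \notin O].
Proof.
move=> ny; have y0 : y != 0 by apply: contra_notN ny => /eqP ->; apply/alg_id/rpred0.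
have [R RP] : exists R, forall x, x \in R <-> exists2 p : {poly M}, p \over F & x = p.[y^-1].
 apply: mkR.
 - by exists 1; rewrite ?rpred1 // -polyC1 hornerC.
 - by move=> _ _ [p pF ->] [q qF ->]; exists (p - q); rewrite ?rpredB // hornerD hornerN.
 - by move=> _ _ [p pF ->] [q qF ->]; exists (p * q); rewrite ?rpredM // hornerM.
pose J : set M := [set x | exists2 p : {poly M}, p \over F & x = p.[y^-1] / y]%classic.
have [||||| O [vO RO JO]] := @valring_ext R J.
- move=> _ [p pF ->]; apply/RP; exists (p * 'X); rewrite ?rpredM ?polyOverX //.
 by rewrite hornerM hornerX.
- by exists 0; rewrite ?rpred0 // horner0 mul0r.
- by move=> _ _ [p pF ->] [q qF ->]; exists (p - q); rewrite ?rpredB // hornerD hornerN mulrBl.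
- by move=> _ _ /RP[p pF ->] [q qF ->]; exists (p * q); rewrite ?rpredM // hornerM mulrA.
- move=> [p pF e]; apply: ny; rewrite -[y]invrK; apply: alg_inv.
 exists (p * 'X - 1); split.
 + by rewrite rpredB ?rpredM ?polyOverX ?rpred1.
 + apply/eqP => /(congr1 (fun q : {poly M} => q.[0])).
  rewrite hornerD hornerN hornerM hornerX mulr0 horner0 -polyC1 hornerC add0r.
  by move/eqP; rewrite oppr_eq0 oner_eq0.
 + by rewrite rootE hornerD hornerN hornerM hornerX -polyC1 hornerC -e subrr.
exists O; split=> //.
 by move=> x xF; apply/RO/RP; exists x%:P; rewrite ?polyOverC ?hornerC.
have : y^-1 \in mx O by apply: JO; exists 1; rewrite ?rpred1 // -polyC1 hornerC mul1r.
by rewrite inE invr_eq0 (negPf y0) invrK => /andP[].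
Qed.

End Valuations.

Definition acl (M : fieldType) := forall p : {poly M}, (1 < size p)%N -> exists x, root p x.
Definition relacl (M : fieldType) (F : sfield M) := forall y, alg F y -> y \in F.

Section Splitting.
Variables (M : fieldType) (aclM : acl M).
Implicit Types (F : sfield M).

Lemma poly_split F (p : {poly M}) : relacl F -> p \over F -> p != 0 ->
 exists rs : seq M, rs \sub F /\ p = lead_coef p *: \prod_(r <- rs) ('X - r%:P).
Proof.
move=> hF; move sp : (size p) => n; elim: n p sp => [|n IH] p sp pF p0.
 by move/eqP: sp; rewrite size_poly_eq0 (negPf p0).
case: n IH sp => [|n] IH sp.
 exists [::]; split=> //; rewrite big_nil.
 by rewrite [in LHS](size1_polyC (eq_leq sp)) lead_coefE sp alg_polyC.
have [|x px] := aclM (p := p); first by rewrite sp.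
have xF : x \in F by apply: hF; exists p.
have Xp : 'X - x%:P %| p by rewrite dvdp_XsubCl.
have XF : 'X - x%:P \over F by rewrite polyOverXsubC.
have q0 : p %/ ('X - x%:P) != 0.
 by apply: contraNneq p0 => q0; rewrite -(divpK Xp) q0 mul0r.
have [|rs [rsF e]] := IH (p %/ ('X - x%:P)) _ (polyOver_quo pF XF) q0.
 by rewrite size_divp ?polyXsubC_eq0 // size_XsubC sp subn1.
exists (x :: rs); split.
 by move=> y; rewrite inE => /orP[/eqP ->|/rsF].
have -> : lead_coef p = lead_coef (p %/ ('X - x%:P)).
 by rewrite -[in LHS](divpK Xp) lead_coef_Mmonic ?monicXsubC.
by rewrite big_cons scalerAr -e mulrC divpK.
Qed.
End Splitting.

(** * Orders and residues at a place *)

Section Local.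
Variable M : fieldType.
Hypotheses (aclM : acl M).
Variables (O : sring M).
Hypothesis vO : valring O.
Implicit Types (F L : sfield M).

Definition un x := (x \in O) && (x \notin mx O).

Lemma unE x : un x = [&& x != 0, x \in O & x^-1 \in O].
Proof.
apply/idP/idP => [/andP[xO xm]|/and3P[x0 xO xi]].
 by have [-> ->] := unitO xO xm; rewrite xO.
by rewrite /un inE xO (negPf x0) xi.
Qed.
Lemma un_neq0 x : un x -> x != 0. Proof. by rewrite unE => /and3P[]. Qed.
Lemma un_O x : un x -> x \in O. Proof. by case/andP. Qed.
Lemma un_nm x : un x -> x \notin mx O. Proof. by case/andP. Qed.
Lemma unM x y : un x -> un y -> un (x * y).
Proof.
rewrite !unE => /and3P[x0 xO xi] /and3P[y0 yO yi].
by rewrite mulf_neq0 // invfM !rpredM.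
Qed.
Lemma unV x : un x -> un x^-1.
Proof. by rewrite !unE => /and3P[x0 xO xi]; rewrite invr_eq0 x0 invrK xO xi. Qed.
Lemma un1 : un 1. Proof. by rewrite unE oner_eq0 invr1 rpred1. Qed.
Lemma unX x n : un x -> un (x ^+ n).
Proof. by move=> ux; elim: n => [|n IH]; rewrite ?expr0 ?un1 // exprS unM. Qed.
Lemma un_add x y : un x -> y \in mx O -> un (x + y).
Proof.
move=> /andP[xO xm] ym; apply/andP; split; first by rewrite rpredD // (mx_sub ym).
exact: O_add_unit.
Qed.
Lemma un_F F x : F \sub O -> x \in F -> x != 0 -> un x.
Proof. by move=> FO xF x0; rewrite unE x0 !FO ?rpredV. Qed.
Lemma mx_F F x : F \sub O -> x \in F -> x \in mx O -> x = 0.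
Proof.
by move=> FO xF xm; apply/eqP; apply: contraT => /(un_F FO xF)/un_nm; rewrite xm.
Qed.

(** Divisibility in a valuation ring is total, so a finite family has a member of least order, which
    divides all others. *)
Lemma comb n (t : 'I_n -> M) i0 : t i0 != 0 ->
 exists j, t j != 0 /\ forall i, t i / t j \in O.
Proof.
move=> t0.
suff : forall s : seq 'I_n, exists j, t j != 0 /\ forall i, i \in s -> t i / t j \in O.
 by move=> /(_ (enum 'I_n))[j [tj h]]; exists j; split=> // i; apply: h; rewrite mem_enum.
elim=> [|i s [j [tj h]]]; first by exists i0.
have /orP[tij|tji] := vO (t i / t j).
 by exists j; split=> // l; rewrite inE => /orP[/eqP ->|/h].
have [ti|ti] := eqVneq (t i) 0.
 exists j; split=> // l; rewrite inE => /orP[/eqP ->|/h //].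
 by rewrite ti mul0r rpred0.
exists i; split=> // l; rewrite inE => /orP[/eqP ->|/h hl].
 by rewrite divff // rpred1.
have -> : t l / t i = (t l / t j) * (t i / t j)^-1 by field; rewrite ti tj.
by rewrite rpredM.
Qed.

(** In a vanishing sum the least order occurs at least twice; otherwise the sum divided by its
    leading term would be a unit. *)
Lemma comb2 n (t : 'I_n -> M) i0 : t i0 != 0 -> \sum_i t i = 0 ->
 exists i j, [/\ i != j, t i != 0, t j != 0 & un (t i / t j)].
Proof.
move=> /comb[j [tj h]] s0.
have : \sum_(i | i != j) t i / t j = - 1.
 have := congr1 (fun z => z / t j) s0; rewrite mul0r mulr_suml (bigD1 j) //= divff //.
 by move=> /eqP; rewrite addrC addr_eq0 => /eqP.
have [[i [ij ui]] _|none e] := pselect (exists i, i != j /\ un (t i / t j)).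
 exists i, j; split=> //; apply: contraTneq ui => ->; rewrite mul0r unE eqxx //.
have : \sum_(i | i != j) t i / t j \in mx O.
 apply: mx_sum => // i ij; apply: contraT => ti; case: none; exists i; split=> //.
 by rewrite /un h.
by rewrite e mx_oppE // (negPf (mx1 O)).
Qed.

Lemma poly_res F (q : {poly M}) y b : F \sub O -> q \over F -> b \in F ->
 y - b \in mx O -> q.[y] - q.[b] \in mx O.
Proof.
move=> FO qF bF ym.
have : root (q - q.[b]%:P) b by rewrite rootE !hornerE subrr.
rewrite -dvdp_XsubCl => /divpK e.
have -> : q.[y] - q.[b] = (q - q.[b]%:P).[y] by rewrite !hornerE.
have qO : q - q.[b]%:P \over F by rewrite rpredB ?polyOverC ?rpred_horner.
rewrite -e hornerM hornerXsubC mx_mulr // rpred_horner //.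
 by apply: polyOver_sub (polyOver_quo qO _); rewrite ?polyOverXsubC.
by rewrite -(subrK b y) rpredD ?(mx_sub ym) // FO.
Qed.

Section Uniformizer.
Variables (F : sfield M) (p : M).
Hypotheses (FO : F \sub O) (pm : p \in mx O) (p0 : p != 0).

(** On F[p] the place is p-adic: the order is the multiplicity of 0 as a root of q, and the unit
    part has its residue in F. *)
Lemma poly_ord (q : {poly M}) : q \over F -> q != 0 ->
 exists (e : nat) c u, [/\ q.[p] = p ^+ e * u, un u, c \in F & u - c \in mx O].
Proof.
move sq : (size q) => n; elim: n q sq => [|n IH] q sq qF q0.
 by move/eqP: sq; rewrite size_poly_eq0 (negPf q0).
have [q00|q00] := eqVneq q.[0] 0; last first.
 have c0 : q.[0] \in F by rewrite rpred_horner ?rpred0.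
 have h : q.[p] - q.[0] \in mx O by apply: poly_res FO _ _ _; rewrite ?rpred0 // subr0.
 exists 0%N, q.[0], q.[p]; rewrite expr0 mul1r; split=> //.
 by rewrite -(subrK q.[0] q.[p]) addrC un_add // (un_F FO).
have Xq : 'X %| q by rewrite -[X in X %| _]subr0 -polyC0 dvdp_XsubCl rootE q00.
have r0 : q %/ 'X != 0 by apply: contraNneq q0 => r0; rewrite -(divpK Xq) r0 mul0r.
have [|e [c [u [h1 h2 h3 h4]]]] := IH _ _ (polyOver_quo qF (polyOverX F)) r0.
 by rewrite size_divp ?polyX_eq0 // size_polyX sq subn1.
exists e.+1, c, u; split=> //.
by rewrite -(divpK Xq) hornerM hornerX h1 exprS mulrC mulrA.
Qed.

Lemma adj_ord a : adj F p a -> a != 0 ->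
 exists (e : int) c u, [/\ a = p ^ e * u, un u, c \in F & u - c \in mx O].
Proof.
move=> [q [r [qF rF r0 ->]]]; rewrite mulf_eq0 negb_or => /andP[q0 _].
have [|e [c [u [h1 h2 h3 h4]]]] := poly_ord qF.
 by apply: contraNneq q0 => ->; rewrite horner0.
have [|e' [c' [u' [h1' h2' h3' h4']]]] := poly_ord rF.
 by apply: contraNneq r0 => ->; rewrite horner0.
have u0 := un_neq0 h2; have u0' := un_neq0 h2'.
have c0' : c' != 0.
 by apply: contraTneq (un_nm h2') => c0'; rewrite c0' subr0 in h4'; rewrite h4'.
exists (e%:Z - e'%:Z), (c / c'), (u / u'); split.
- rewrite h1 h1' expfzDr // -invr_expz -!exprnP.
 by have := expf_neq0 e' p0; move=> pe; field; rewrite u0' pe.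
- by rewrite unM ?unV.
- by rewrite rpred_div.
- have -> : u / u' - c / c' = ((u - c) * c' - c * (u' - c')) / (u' * c').
  by field; rewrite u0' c0'.
 rewrite mulrC mx_mulr //; first by rewrite invfM rpredM // (un_O (unV _)) // (un_F FO).
 by apply: mx_subr => //; [apply: mx_mull|apply: mx_mulr] => //; apply: FO.
Qed.

Lemma exprz_O (e : int) u : un u -> (p ^ e * u \in O) -> (0 <= e)%R.
Proof.
case: e => // n uu; rewrite NegzE -invr_expz -exprnP => h.
have : p ^+ n.+1 \in mx O by rewrite exprS mx_mull // rpredX // mx_sub.
rewrite inE => /andP[_]; rewrite (negPf (expf_neq0 _ p0)) /=.
suff -> : (p ^+ n.+1)^-1 \in O by [].
by rewrite -[_^-1](mulfK (un_neq0 uu)) rpredM // un_O // unV.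
Qed.

Variables (L : sfield M) (Fp : sfield M) (n0 : nat).
Hypotheses (FpP : adj_is F p Fp) (rkL : rk Fp L n0).

(** In an equation of b of degree at most n0 over F(p) two terms have equal order, so the order of
    some power b^(j-i) is an integer multiple of that of p. As j - i divides n0!, that exponent
    serves all b at once. *)
Lemma ord_exists b : b \in L -> b != 0 ->
 exists (r : int) u, b ^+ n0`! = p ^ r * u /\ un u.
Proof.
move=> bL b0.
have [q [/polyOverP qF q0 /rootP qb sq]] := rk_alg rkL (fun i => rpredX i bL).
pose t (i : 'I_n0.+1) := q`_i * b ^+ i.
have [i ti] : exists i, t i != 0.
 have lt : ((size q).-1 < n0.+1)%N by apply: leq_trans sq; rewrite ltn_predL size_poly_gt0.
 by exists (Ordinal lt); rewrite mulf_neq0 ?expf_neq0 //= -lead_coefE lead_coef_eq0.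
have s0 : \sum_i t i = 0 by rewrite -[RHS]qb (horner_coef_wide _ sq).
have [{ti}i [j [ij ti tj]]] := comb2 ti s0.
wlog ltij : i j ij ti tj / (i < j)%N => [wl|].
 have [|le] := ltnP i j; first exact: wl.
 have := wl j i; rewrite eq_sym => /(_ ij tj ti); rewrite ltn_neqAle le.
 have -> : (j != i :> nat) by rewrite eq_sym.
 by move=> /(_ isT) h /unV; rewrite invf_div; apply: h.
move=> uij.
have [qi qj] : q`_i != 0 /\ q`_j != 0.
 by move: ti tj; rewrite !mulf_eq0 !negb_or => /andP[-> _] /andP[-> _].
have [e [_ [u [hi ui _ _]]]] := adj_ord ((FpP _).1 (qF i)) qi.
have [e' [_ [u' [hj uj _ _]]]] := adj_ord ((FpP _).1 (qF j)) qj.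
have pe (z : int) : p ^ z != 0 by rewrite expfz_eq0 (negPf p0) andbF.
have bs : b ^+ (j - i) = p ^ (e - e') * (u / u' / (t i / t j)).
 have -> : u / u' = (q`_i / q`_j) * p ^ (e' - e).
  rewrite hi hj !expfzDr // -!invr_expz.
  by have := pe e; have := pe e'; move=> pe1 pe2; field; rewrite pe1 pe2 un_neq0 // un_neq0.
 rewrite /t -[in b ^+ j](subnK (ltnW ltij)) exprD.
 have := expf_neq0 i b0; have := expf_neq0 (j - i) b0 => b1 b2.
 rewrite -[e' - e]opprB -invr_expz.
 by have := pe (e - e') => pe1; field; rewrite pe1 b1 b2 qi qj.
have dv : (j - i %| n0`!)%N.
 apply: dvdn_fact; rewrite subn_gt0 ltij /=.
 by apply: leq_trans (leq_subr _ _) _; rewrite -ltnS.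
exists ((e - e') * (n0`! %/ (j - i))%:Z), ((u / u' / (t i / t j)) ^+ (n0`! %/ (j - i))); split.
 by rewrite -[in LHS](divnK dv) mulnC exprM bs exprMn exprnP -exprz_exp.
by rewrite unX // !unM ?unV.
Qed.

Lemma ord_exists_nat b : b \in L -> b != 0 -> b \in O ->
 exists (r : nat) u, b ^+ n0`! = p ^+ r * u /\ un u.
Proof.
move=> bL b0 bO; have [r [u [e uu]]] := ord_exists bL b0.
have := rpredX n0`! bO; rewrite e => /(exprz_O uu).
by case: r e => // r e _; exists r, u.
Qed.

Lemma ord_pos b r u : b \in mx O -> b ^+ n0`! = p ^+ r * u -> un u -> (0 < r)%N.
Proof.
move=> bm e uu; case: r e => // e; move: (un_nm uu); rewrite -[u]mul1r -(expr0 p) -e.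
have : (0 < n0`!)%N by rewrite fact_gt0.
by case: (n0`!) => // n _; rewrite exprS mx_mull // rpredX // mx_sub.
Qed.

Hypothesis hF : relacl F.

(** An equation of y over F(p), scaled to integral coefficients of which one is 1, reduces to a
    nonzero polynomial over F. It splits over F, and one of its linear factors at y falls into the
    maximal ideal. *)
Lemma res_exists y : y \in L -> y \in O -> exists2 b, b \in F & y - b \in mx O.
Proof.
move=> yL yO.
have [q [/polyOverP qF q0 /rootP qy sq]] := rk_alg rkL (fun i => rpredX i yL).
have lt : ((size q).-1 < n0.+1)%N by apply: leq_trans sq; rewrite ltn_predL size_poly_gt0.
have : q`_(Ordinal lt) != 0 by rewrite -lead_coefE lead_coef_eq0.
move=> /(@comb _ (fun i : 'I_n0.+1 => q`_i) (Ordinal lt))[j [qj h]].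
have /choice[g gP] : forall i : 'I_n0.+1, exists g, g \in F /\ q`_i / q`_j - g \in mx O.
 move=> i; have [->|qi] := eqVneq (q`_i) 0.
  by exists 0; rewrite mul0r subr0 mx0 rpred0.
 have Fpq : q`_i / q`_j \in Fp by rewrite rpred_div.
 have [|e [c [u [E uu cF uc]]]] := adj_ord ((FpP _).1 Fpq).
  by rewrite mulf_neq0 ?invr_eq0.
 have := h i; rewrite E => /(exprz_O uu); case: e E => // -[|e] E _.
  by exists c; rewrite expr0z mul1r.
 exists 0; rewrite rpred0 subr0 -exprnP exprS -mulrA mx_mull //.
 by rewrite rpredM ?rpredX ?(mx_sub pm) // un_O.
pose G : {poly M} := \poly_(i < n0.+1) g (inord i).
have GF : G \over F.
 apply/polyOverP => i; rewrite coef_poly; case: ifP => _; last exact: rpred0.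
 by have [] := gP (inord i).
have G0 : G != 0.
 have [gjF] := gP j; rewrite divff // => gj.
 apply: contraTneq (un_nm un1) => /polyP/(_ j); rewrite coef_poly ltn_ord coef0 inord_val => e.
 by rewrite e subr0 in gj; rewrite gj.
have Gy : G.[y] \in mx O.
 rewrite horner_poly.
 have -> : \sum_(i < n0.+1) g (inord i) * y ^+ i =
   \sum_(i < n0.+1) - ((q`_i / q`_j - g i) * y ^+ i) + q.[y] / q`_j.
  rewrite (horner_coef_wide _ sq) mulr_suml -big_split /=; apply: eq_bigr => i _.
  by rewrite inord_val; ring.
 rewrite qy mul0r addr0; apply: mx_sum => // i _; rewrite mx_oppE // mx_mull ?rpredX //.
 by have [] := gP i.
have [rs [rsF e]] := poly_split aclM hF GF G0.
move: Gy; rewrite e hornerZ horner_prod => Gy.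
have lc : un (lead_coef G).
 by apply: (un_F FO); rewrite ?lead_coef_eq0 //; apply: (polyOverP GF).
have {Gy} : \prod_(r <- rs) ('X - r%:P).[y] \in mx O.
 by have := mx_mulr (un_O (unV lc)) Gy; rewrite mulKf ?un_neq0.
elim: rs rsF {e} => [|r rs IH] rsF; first by rewrite big_nil (negPf (mx1 O)).
rewrite big_cons hornerXsubC.
have rF : r \in F by apply: rsF; rewrite inE eqxx.
have rs' : rs \sub F by move=> z zs; apply: rsF; rewrite inE zs orbT.
have prO : \prod_(j <- rs) ('X - j%:P).[y] \in O.
 rewrite big_seq; apply: rpred_prod => z zs; rewrite hornerXsubC rpredB //.
 by apply/FO/rs'.
move=> /(mx_prime _ prO)[|hm|hm]; first by rewrite rpredB // FO.
 by exists r.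
exact: IH rs' hm.
Qed.

End Uniformizer.
End Local.

(** * Function fields of one variable and their places *)

Section FunctionField.
Variable M : fieldType.
Hypotheses (aclM : acl M).
Implicit Types (F L : sfield M) (O : sring M).

(* L is an algebraic function field of one variable over F, which is
  algebraically closed in M. *)
Definition ffield F L := [/\ relacl F, F \sub L &
 forall x (Fx : sfield M), x \in L -> x \notin F ->
  (adj_is F x Fx) -> exists n, rk Fx L n].

Definition place F O := valring O /\ F \sub O.

(** The integral closure of F[x] in L, as an intersection of valuation rings. *)
Definition intcl F x L b :=
 b \in L /\ forall O, place F O -> x \in O -> b \in O.

(** The Riemann-Roch space of m times the polar divisor of x. *)
Definition Lm F x L m b := b \in L /\ forall O, place F O ->
 (x \in O -> b \in O) /\ (x \notin O -> b / x ^+ m \in O).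

Section FL.
Variables (F L : sfield M).
Hypothesis ffL : ffield F L.

Let hF : relacl F. Proof. by case: ffL. Qed.
Let FL : F \sub L. Proof. by case: ffL. Qed.

Lemma transcF x (p : {poly M}) : x \notin F -> p \over F -> p != 0 -> p.[x] != 0.
Proof.
move=> xF pF p0; apply: contraNneq xF => px.
by apply: hF; exists p; split=> //; apply/rootP.
Qed.

Lemma in_all_places y : (forall O, place F O -> y \in O) -> y \in F.
Proof.
move=> h; apply: hF; apply: contrapT => ny.
by have [O [vO FO yO]] := valring_transc ny; rewrite h // in yO.
Qed.

Lemma place_inf y : y \notin F -> exists O, place F O /\ y \notin O.
Proof.
move=> yF; have [|O [vO FO yO]] := @valring_transc _ F y; last by exists O.
by move=> /hF; rewrite (negPf yF).
Qed.

Section AtPlace.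
Variable O : sring M.
Hypotheses (vO : valring O) (FO : F \sub O).

Lemma mx_notF p : p \in mx O -> p != 0 -> p \notin F.
Proof. by move=> pm; apply: contra => pF; rewrite (mx_F FO pF pm). Qed.

(** p need not generate the maximal ideal: orders are multiples of 1/N of the order of p, and the
    factorial N absorbs the ramification. *)
Lemma unif p : p \in L -> p \in mx O -> p != 0 -> exists N, [/\ (0 < N)%N,
 forall b, b \in L -> b != 0 -> b \in O ->
  exists r u, [/\ b ^+ N = p ^+ r * u, un O u, u \in L & b \in mx O -> (0 < r)%N],
 forall b, b \in L -> exists m, p ^+ m * b ^+ N \in O &
 forall y, y \in L -> y \in O -> exists2 b, b \in F & y - b \in mx O].
Proof.
move=> pL pm p0; have [Fp FpP] := adjF F p.
have [_ _ /(_ p Fp pL (mx_notF pm p0) FpP)[n rkn]] := ffL.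
exists n`!; split; first exact: fact_gt0.
- move=> b bL b0 bO.
 have [r [u [e uu]]] := ord_exists_nat vO FO pm p0 FpP rkn bL b0 bO.
 exists r, u; split=> //; last by move=> bm; apply: ord_pos bm e uu.
 suff -> : u = b ^+ n`! / p ^+ r by rewrite rpred_div ?rpredX.
 by rewrite e mulrC mulKf // expf_neq0.
- move=> b bL; have [->|b0] := eqVneq b 0.
  by exists 0%N; rewrite expr0n gtn_eqF ?fact_gt0 // mulr0 rpred0.
 have [r [u [-> uu]]] := ord_exists vO FO pm p0 FpP rkn bL b0.
 case: r => r; first by exists 0%N; rewrite expr0 mul1r -exprnP rpredM ?rpredX ?(mx_sub pm) ?un_O.
 exists r.+1; rewrite NegzE -invr_expz -exprnP mulrA divff ?mul1r ?un_O //.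
 exact: expf_neq0.
- by move=> y yL yO; apply: (res_exists aclM vO FO pm p0 FpP rkn hF yL yO).
Qed.

Hypothesis nLO : L \nsub O.

Lemma unif_exists : exists p, [/\ p \in L, p \in mx O & p != 0].
Proof.
have [z zL zO] := nLO; exists z^-1; rewrite rpredV notO_mx // invr_eq0.
by split=> //; apply: contraNneq zO => ->; rewrite rpred0.
Qed.

Lemma residue y : y \in L -> y \in O -> exists2 b, b \in F & y - b \in mx O.
Proof.
have [p [pL pm p0]] := unif_exists; have [N [_ _ _ h]] := unif pL pm p0.
exact: h.
Qed.

(** The valuation ring on L is a localization of the integral closure of F[x]; numerator and
    denominator are cut out of a polynomial relation between x and y. *)
Lemma localize x y : x \in L -> x \notin F -> x \in O -> y \in L -> y \in O ->
 exists c b, [/\ intcl F x L c, intcl F x L b, b \notin mx O & y = c / b].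
Proof.
move=> xL xF xO yL yO.
have int0 : intcl F x L 0 by split=> [|O' _ _]; rewrite rpred0.
have int1 : intcl F x L 1 by split=> [|O' _ _]; rewrite rpred1.
have [->|y0] := eqVneq y 0.
 by exists 0, 1; rewrite mul0r mx1.
have [a aF xa] := residue xL xO.
have [Fx FxP] := adjF F x.
have [_ _ /(_ x Fx xL xF FxP)[n rkn]] := ffL.
have [q [qF q0 qy _]] := rk_alg rkn (fun i => rpredX i yL).
have [P0 [PF0 [i0 Pi0] Py0]] : exists P : {poly {poly M}}, [/\ forall i, P`_i \over F,
   (exists i, (P`_i).[x] != 0) & (P.[y%:P]).[x] = 0].
 by apply: alg_bivar FxP _; exists q.
(* Common factors X - a of the coefficients are divided out, so that the relation survives reduction
   at the residue a of x. *)
have [P [PF [i1 Pi1] Py]] : exists P : {poly {poly M}}, [/\ forall i, P`_i \over F,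
   (exists i, (P`_i).[a] != 0) & (P.[y%:P]).[x] = 0].
 move s : (size P0`_i0) => m; elim: m P0 s PF0 Pi0 Py0 => [|m IH] P s PF Pi Py.
  by move/eqP: s; rewrite size_poly_eq0 => /eqP e; rewrite e horner0 eqxx in Pi.
 have [h|none] := pselect (exists i, (P`_i).[a] != 0); first by exists P.
 have Pa i : (P`_i).[a] = 0.
  by apply/eqP; apply: contrapT => /negP h; apply: none; exists i.
 pose Q : {poly {poly M}} := \poly_(i < size P) (P`_i %/ ('X - a%:P)).
 have QE i : Q`_i = P`_i %/ ('X - a%:P).
  by rewrite coef_poly; case: ltnP => // le; rewrite nth_default // div0p.
 have PE i : P`_i = Q`_i * ('X - a%:P) by rewrite QE divpK // dvdp_XsubCl; apply/rootP.
 have PQ : P = Q * ('X - a%:P)%:P by apply/polyP => i; rewrite coefMC.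
 have xa0 : x - a != 0 by apply: contraNneq xF => /eqP; rewrite subr_eq0 => /eqP ->.
 apply: (IH Q).
 - rewrite QE size_divp ?polyXsubC_eq0 // size_XsubC s subn1 //.
 - by move=> i; rewrite QE polyOver_quo // polyOverXsubC.
 - by move: Pi; rewrite PE hornerM mulf_eq0 negb_or => /andP[].
 - move: Py; rewrite PQ !hornerM hornerC hornerXsubC => /eqP.
  by rewrite mulf_eq0 (negPf xa0) orbF => /eqP.
have lts i : (P`_i).[a] != 0 -> (i <= size P)%N.
 move=> Pi; apply: contraTT Pi; rewrite -ltnNge => /ltnW le.
 by rewrite nth_default // horner0 eqxx.
have ex : exists i, (P`_i).[a] != 0 by exists i1.
case: (ex_maxnP ex lts) => i Pi imax.
have lti : (i < size P)%N.
 by apply: contraTT Pi; rewrite -leqNgt => le; rewrite nth_default // horner0 eqxx.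
have Px O' j : place F O' -> x \in O' -> (P`_j).[x] \in O'.
 by move=> [_ FO'] xO'; rewrite rpred_horner // (polyOver_sub FO').
have sum0 : \sum_(j < size P) (P`_j).[x] * y ^+ j = 0.
 rewrite -[RHS]Py (horner_coef P) horner_sum; apply: eq_bigr => j _.
 by rewrite hornerM horner_exp hornerC.
(* The relation is cut at the last index i with P_i(a) nonzero, which makes b a unit at O. By the
   relation b is a polynomial in y and also one in 1/y, so b and y b are integral wherever x is. *)
pose b := \sum_(j < size P | (i <= j)%N) (P`_j).[x] * y ^+ (j - i).
have be : b = - \sum_(j < size P | (j < i)%N) (P`_j).[x] * y^-1 ^+ (i - j).
 apply: (mulIf (expf_neq0 i y0)); apply/eqP; rewrite mulNr -addr_eq0 -[X in _ == X]sum0; apply/eqP.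
 rewrite [RHS](bigID (fun j : 'I__ => (i <= j)%N)) /=; congr (_ + _).
  by rewrite mulr_suml; apply: eq_bigr => j le; rewrite -mulrA -exprD subnK.
 rewrite mulr_suml; apply: eq_big => j; first by rewrite ltnNge.
 move=> le; rewrite -mulrA; congr (_ * _); rewrite exprVn.
 by rewrite -[in y ^+ i](subnK (ltnW le)) exprD mulrA mulVf ?mul1r // expf_neq0.
have bL : b \in L.
 apply: rpred_sum => j _; rewrite rpredM ?rpredX // rpred_horner //.
 exact: polyOver_sub (PF j).
have intb : intcl F x L b.
 split=> // O' pO' xO'; have /orP[yO'|yiO'] := pO'.1 y.
  by apply: rpred_sum => j _; rewrite rpredM ?rpredX // Px.
 by rewrite be rpredN; apply: rpred_sum => j _; rewrite rpredM ?rpredX // Px.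
have intc : intcl F x L (y * b).
 split=> [|O' pO' xO']; first by rewrite rpredM.
 have /orP[yO'|yiO'] := pO'.1 y; first by rewrite rpredM // intb.2.
 rewrite be mulrN rpredN mulr_sumr; apply: rpred_sum => j le.
 rewrite mulrCA rpredM ?Px //.
 rewrite -(prednK (_ : 0 < i - j)%N) ?subn_gt0 // exprS mulrA divff // mul1r.
 exact: rpredX.
have bm : b \notin mx O.
 apply: un_nm; rewrite /b (bigD1 (Ordinal lti)) //= subnn mulr1.
 have Pres j := poly_res FO (PF j) aF xa.
 apply: un_add => //; last first.
  apply: mx_sum => // j /andP[le ji]; apply: mx_mull; last exact: rpredX.
  suff e : (P`_j).[a] = 0 by have := Pres j; rewrite e subr0.
  apply/eqP; apply: contraT => /imax le'.
  by move: ji; rewrite -val_eqE /= eqn_leq le le'.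
 rewrite -[_.[x]](subrK (P`_i).[a]) addrC un_add // (un_F FO) ?rpred_horner //.
exists (y * b), b; split=> //; rewrite mulfK //.
by apply: contraNneq bm => ->; rewrite mx0.
Qed.

End AtPlace.

Section Birkhoff.
Variable x : M.
Hypotheses (xL : x \in L) (xF : x \notin F).

Lemma Lm_intcl m b : Lm F x L m b -> intcl F x L b.
Proof. by move=> [bL h]; split=> // O pO xO; apply: (h O pO).1. Qed.

Lemma x_neq0 : x != 0. Proof. by apply: contraNneq xF => ->; rewrite rpred0. Qed.

Lemma Lm_le m m' b : (m <= m')%N -> Lm F x L m b -> Lm F x L m' b.
Proof.
move=> le [bL h]; split=> // O pO; have [h1 h2] := h O pO; split=> // xO.
rewrite -(subnK le) exprD invfM mulrCA rpredM ?h2 //.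
by rewrite -exprVn rpredX // mx_sub // notO_mx //; case: pO.
Qed.

Lemma LmF b : Lm F x L 0 b <-> b \in F.
Proof.
split=> [[bL h]|bF].
 apply: in_all_places => O pO; have [h1 h2] := h O pO.
 have [/h1//|/h2] := boolP (x \in O); by rewrite expr0 divr1.
split=> [|O [vO FO]]; first exact: FL.
by split=> _; rewrite ?expr0 ?divr1 FO.
Qed.

Lemma LmD m b b' : Lm F x L m b -> Lm F x L m b' -> Lm F x L m (b + b').
Proof.
move=> [bL h] [bL' h']; split=> [|O pO]; first exact: rpredD.
have [h1 h2] := h O pO; have [h1' h2'] := h' O pO.
by split=> xO; rewrite ?mulrDl rpredD ?h1 ?h2 ?h1' ?h2'.
Qed.

Lemma LmM m m' b b' : Lm F x L m b -> Lm F x L m' b' -> Lm F x L (m + m') (b * b').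
Proof.
move=> [bL h] [bL' h']; split=> [|O pO]; first exact: rpredM.
have [h1 h2] := h O pO; have [h1' h2'] := h' O pO.
split=> xO; first by rewrite rpredM ?h1 ?h1'.
by rewrite exprD invfM mulrACA rpredM ?h2 ?h2'.
Qed.

Lemma LmX m : Lm F x L m (x ^+ m).
Proof.
split=> [|O pO]; first exact: rpredX.
split=> xO; first exact: rpredX.
by rewrite divff ?rpred1 // expf_neq0 // x_neq0.
Qed.

Lemma Lm_poly (p : {poly M}) m : p \over F -> (size p <= m.+1)%N -> Lm F x L m p.[x].
Proof.
move=> pF sp; rewrite (horner_coef_wide _ sp).
apply: (big_ind (fun z => Lm F x L m z)); [|exact: LmD|].
 by apply: (@Lm_le 0) => //; apply/LmF/rpred0.
move=> i _; have le : (i <= m)%N by rewrite -ltnS.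
rewrite -[X in Lm _ _ _ X _](subnK le); apply: LmM; last exact: LmX.
by apply: (@Lm_le 0) => //; apply/LmF/(polyOverP pF).
Qed.

(** If Q(x) is the leading coefficient of an equation of b over F[x], then Q(x) b is integral over
    F[x]; at the poles of x the same equation, rescaled by powers of x, bounds the pole. *)
Lemma denom b : b \in L -> exists q : {poly M},
 [/\ q \over F, q != 0 & exists m, Lm F x L m (q.[x] * b)].
Proof.
move=> bL; have [Fx FxP] := adjF F x.
have [_ _ /(_ x Fx xL xF FxP)[n rkn]] := ffL.
have [q [qF q0 qy _]] := rk_alg rkn (fun i => rpredX i bL).
have [P [PF [i0 Pi0] Py]] : exists P : {poly {poly M}}, [/\ forall i, P`_i \over F,
   (exists i, (P`_i).[x] != 0) & (P.[b%:P]).[x] = 0].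
 by apply: alg_bivar FxP _; exists q.
have P0 : P != 0 by apply: contraNneq Pi0 => ->; rewrite coef0 horner0.
pose s := (size P).-1.
have sP : size P = s.+1 by rewrite prednK // size_poly_gt0.
have lc0 : P`_s != 0 by rewrite -lead_coefE lead_coef_eq0.
have Q0 : (P`_s).[x] != 0 by apply: transcF.
pose Q := (P`_s).[x].
pose R : {poly M} := \poly_(i < s) ((P`_i).[x] * Q ^+ (s.-1 - i)) + 'X^s.
have Rc : ((R \is monic) * (R`_s = 1) * (size R = s.+1))%type.
 have sz : (size (\poly_(i < s) ((P`_i).[x] * Q ^+ (s.-1 - i)))%R < s.+1)%N.
  by rewrite ltnS size_poly.
 have sR : size R = s.+1 by rewrite /R addrC size_polyDl size_polyXn.
 have Rs : R`_s = 1 by rewrite coefD coef_poly ltnn add0r coefXn eqxx.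
 by rewrite monicE lead_coefE sR /= Rs eqxx.
have rR : root R (Q * b).
 apply/rootP; rewrite /R hornerD hornerXn horner_poly.
 case: s sP lc0 Q0 @Q {R Rc} => [|s'] sP lc0 Q0 Q.
  move: Py; rewrite (horner_coef P) sP big_ord1 expr0 mulr1 => e.
  by move: Q0; rewrite e eqxx.
 have := Py; rewrite (horner_coef P) horner_sum sP big_ord_recr /= => e.
 apply: (@mulfI _ (Q ^- s')); first by rewrite invr_eq0 expf_neq0.
 rewrite mulr0 -[RHS]e mulrDr mulr_sumr; congr (_ + _).
  apply: eq_bigr => i _; rewrite hornerM horner_exp hornerC exprMn.
  have le : (i <= s')%N by rewrite -ltnS.
  rewrite -[in Q ^- s'](subnK le) exprD.
  by have := expf_neq0 i Q0; have := expf_neq0 (s' - i) Q0; rewrite -/Q => h1 h2; field; rewrite h1 h2.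
 rewrite hornerM horner_exp hornerC exprMn [in Q ^+ s'.+1]exprS -/Q.
 by have := expf_neq0 s' Q0; rewrite -/Q => h1; field.
pose m := (\max_(i < s) size (P`_i)%R)%N.
pose t := size P`_s.
have QF : P`_s \over F by exact: PF.
exists P`_s; split=> //; exists (m + t)%N; split.
 by rewrite rpredM // rpred_horner // (polyOver_sub FL).
move=> O [vO FO]; split=> xO.
 apply: O_root rR => //; first by rewrite Rc.
 rewrite rpredD ?polyOverXn //; apply/polyOverP => i; rewrite coef_poly.
 case: ifP => _; last exact: rpred0.
 by rewrite rpredM ?rpredX // rpred_horner // (polyOver_sub FO).
have xi : x^-1 \in mx O by apply: notO_mx.
have x0 := x_neq0.
have polO (q' : {poly M}) l : q' \over F -> (size q' <= l.+1)%N -> q'.[x] / x ^+ l \in O.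
 move=> qF' sq; have [_ /(_ O (conj vO FO))[_ h]] := Lm_poly qF' sq.
 exact: h.
pose R' : {poly M} := \poly_(i < s) ((P`_i).[x] * Q ^+ (s.-1 - i) / x ^+ ((m + t) * (s - i))) + 'X^s.
have Rc' : R' \is monic.
 have sz : (size (\poly_(i < s) ((P`_i).[x] * Q ^+ (s.-1 - i) / x ^+ ((m + t) * (s - i))))%R < s.+1)%N.
  by rewrite ltnS size_poly.
 by rewrite monicE lead_coefE /R' (addrC _ 'X^s) size_polyDl size_polyXn //= coefD coef_poly ltnn addr0 coefXn eqxx.
apply: (@O_root _ _ vO R') => //.
 rewrite rpredD ?polyOverXn //; apply/polyOverP => i; rewrite coef_poly.
 case: ifP => lt; last exact: rpred0.
 have -> : ((m + t) * (s - i) = m + t + (m + t) * (s.-1 - i))%N.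
  by move: lt; case: (s) => // s'; rewrite ltnS => le; rewrite subSn // mulnS.
 rewrite exprD invfM mulrACA rpredM //.
  have le : (size (P`_i)%R <= (m + t).+1)%N.
   apply: leq_trans (leqnSn _); apply: leq_trans (leq_addr _ _).
   exact: (@leq_bigmax _ (fun i : 'I_s => size P`_i) (Ordinal lt)).
  exact: polO.
 rewrite exprM -exprVn -exprMn rpredX // polO //.
 by apply: leq_trans (leqnSn _); apply: leq_addl.
apply/rootP; have /rootP := rR; rewrite /R /R' !hornerD !hornerXn !horner_poly => e.
set w := (m + t)%N.
apply: (@mulfI _ (x ^+ (w * s))); first by rewrite expf_neq0.
rewrite mulr0 -[RHS]e mulrDr mulr_sumr; congr (_ + _).
 apply: eq_bigr => i _; rewrite expr_div_n -exprM.
 have le : (i <= s)%N by exact: ltnW.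
 have -> : (w * s = w * (s - i) + w * i)%N by rewrite -mulnDr subnK.
 rewrite exprD.
 by have := expf_neq0 (w * i) x0; have := expf_neq0 (w * (s - i)) x0 => h1 h2; field; rewrite h1 h2.
by rewrite expr_div_n -exprM mulrC divfK // expf_neq0.
Qed.

End Birkhoff.
End FL.
End FunctionField.

(** * Birkhoff bases by successive minima *)

Section Birkhoff.
Variable M : fieldType.
Hypotheses (aclM : acl M).
Variables (F L : sfield M).
Hypothesis ffL : ffield F L.
Variable x : M.
Hypotheses (xL : x \in L) (xF : x \notin F).

Let hF : relacl F. Proof. by case: ffL. Qed.
Let FL : F \sub L. Proof. by case: ffL. Qed.
Let x0 : x != 0. Proof. exact: x_neq0 xF. Qed.

Definition lcomb (e : nat -> M) r (p : nat -> {poly M}) := \sum_(i < r) (p i).[x] * e i.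

Definition pindep e r := forall p : nat -> {poly M}, (forall i, p i \over F) ->
 lcomb e r p = 0 -> forall i, (i < r)%N -> p i = 0.

Definition pspan e r b := exists (q : {poly M}) (p : nat -> {poly M}),
 [/\ q \over F, q != 0, forall i, p i \over F & q.[x] * b = lcomb e r p].

(** Successive minima: each new e_i lies outside the F(x)-span of its predecessors and has the least
    possible pole order d_i; the sequence starts with the constant 1. *)
Let Inv r (e : nat -> M) (d : nat -> nat) := [/\ (0 < r)%N /\ (e 0%N = 1 /\ d 0%N = 0%N),
 forall i, (i < r)%N -> Lm F x L (d i) (e i), pindep e r &
 forall i, (i < r)%N -> forall m b, Lm F x L m b -> (m < d i)%N -> pspan e i b].

Lemma eq_lcomb e e' r p : (forall i, (i < r)%N -> e i = e' i) -> lcomb e r p = lcomb e' r p.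
Proof. by move=> h; apply: eq_bigr => i _; rewrite h. Qed.

Lemma eq_pspan e e' r b : (forall i, (i < r)%N -> e i = e' i) -> pspan e r b -> pspan e' r b.
Proof.
by move=> h [q [p [h1 h2 h3 h4]]]; exists q, p; split=> //; rewrite h4; apply: eq_lcomb.
Qed.

Lemma lcomb_widen e r r' p : (r <= r')%N ->
 lcomb e r p = lcomb e r' (fun i => if (i < r)%N then p i else 0).
Proof.
move=> le; rewrite /lcomb (big_ord_widen r' (fun i => (p i).[x] * e i) le) big_mkcond /=.
by apply: eq_bigr => i _; case: ifP => // _; rewrite horner0 mul0r.
Qed.

Lemma lcombB e r p p' : lcomb e r (fun i => p i - p' i) = lcomb e r p - lcomb e r p'.
Proof. by rewrite /lcomb -sumrB; apply: eq_bigr => i _; rewrite hornerD hornerN mulrBl. Qed.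

Lemma lcombM e r q p : lcomb e r (fun i => q * p i) = q.[x] * lcomb e r p.
Proof. by rewrite /lcomb mulr_sumr; apply: eq_bigr => i _; rewrite hornerM mulrA. Qed.

Lemma pindep_rk e r (Fx : sfield M) n0 : (adj_is F x Fx) ->
 rk Fx L n0 -> (forall i, (i < r)%N -> e i \in L) -> pindep e r -> (r <= n0)%N.
Proof.
move=> FxP rkn eL ind; rewrite leqNgt; apply/negP => lt.
have [c [cF c0 [j cj]]] : exists c : 'I_n0.+1 -> M, [/\ forall i, c i \in Fx,
  \sum_i c i * e i = 0 & exists i, c i != 0].
 apply: not_indep; apply: rkn => i; apply: eL; exact: leq_trans (ltn_ord i) lt.
have /choice[f hf] : forall i, exists ab : {poly M} * {poly M},
  [/\ ab.1 \over F, ab.2 \over F, ab.2.[x] != 0 & c i = ab.1.[x] / ab.2.[x]].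
 by move=> i; have /FxP[a [b h]] := cF i; exists (a, b).
pose Q (i : 'I_n0.+1) := \prod_(l | l != i) (f l).2.
have QF i : Q i \over F by apply: rpred_prod => l _; have [] := hf l.
have Q0 i : (Q i).[x] != 0.
 by rewrite horner_prod; apply/prodf_neq0 => l _; have [] := hf l.
pose p i : {poly M} := if (i < n0.+1)%N then (f (inord i)).1 * Q (inord i) else 0.
have pF i : p i \over F.
 rewrite /p; case: ifP => _; last exact: rpred0.
 by rewrite rpredM //; have [] := hf (inord i).
have : lcomb e r p = 0.
 transitivity ((\prod_l (f l).2.[x]) * \sum_i c i * e i); last by rewrite c0 mulr0.
 have -> : lcomb e r p = lcomb e n0.+1 p.
  rewrite (lcomb_widen e p lt); apply: eq_bigr => i _ /=; rewrite /p.
  by case: ifP => //.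
 rewrite /lcomb mulr_sumr; apply: eq_bigr => i _.
 rewrite /p ltn_ord inord_val mulrA; congr (_ * _).
 rewrite (bigD1 i) //= hornerM /Q horner_prod; have [_ _ h ->] := hf i.
 have gen (a b X : M) : b != 0 -> a * X = b * X * (a / b) by move=> nb; field.
 exact: gen.
move=> /(ind p pF)/(_ j (leq_trans (ltn_ord j) lt)); rewrite /p ltn_ord inord_val => /eqP.
rewrite mulf_eq0 => /orP[/eqP a0|/eqP q0].
 by move: cj; have [_ _ _ ->] := hf j; rewrite a0 horner0 mul0r eqxx.
by have := Q0 j; rewrite q0 horner0 eqxx.
Qed.

Lemma inv_extend r e d b : Inv r e d -> b \in L -> ~ pspan e r b ->
 exists e' d', Inv r.+1 e' d'.
Proof.
move=> [[r0 [e0 d0]] eLm ind min] bL nb.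
have [q [qF q0 [m1 qb]]] := denom ffL xL xF bL.
have ex : exists m, `[< exists b, Lm F x L m b /\ ~ pspan e r b >].
 exists m1; apply/asboolP; exists (q.[x] * b); split=> //.
 move=> [q' [p [qF' q0' pF h]]]; apply: nb; exists (q' * q), p; split=> //.
 - by rewrite rpredM.
 - by rewrite mulf_neq0.
 - by rewrite hornerM -mulrA.
case: (ex_minnP ex) => m /asboolP[c [cm nc]] mmin.
pose e' i := if i == r then c else e i.
pose d' i := if i == r then m else d i.
have ee i : (i < r)%N -> e i = e' i by move=> lt; rewrite /e' ltn_eqF.
have dd i : (i < r)%N -> d i = d' i by move=> lt; rewrite /d' ltn_eqF.
exists e', d'; split.
- by split=> //; rewrite -ee // -dd.
- move=> i; rewrite ltnS leq_eqVlt => /orP[/eqP ->|lt].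
  by rewrite /e' /d' eqxx.
 by rewrite -ee // -dd //; apply: eLm.
- move=> p pF s0.
 have pr : p r = 0.
  apply/eqP; apply: contrapT => /negP pr; apply: nc.
  exists (p r), (fun i => - p i); split=> // [i|]; first by rewrite rpredN.
  move: s0; rewrite /lcomb big_ord_recr /= /e' eqxx addrC => /eqP.
  rewrite addr_eq0 => /eqP ->; rewrite -sumrN; apply: eq_bigr => i _.
  by rewrite hornerN mulNr ltn_eqF.
 have : lcomb e r p = 0.
  rewrite (eq_lcomb p ee); move: s0; rewrite /lcomb big_ord_recr /= pr horner0.
  by rewrite mul0r addr0.
 move=> /(ind p pF) h i; rewrite ltnS leq_eqVlt => /orP[/eqP -> //|]; exact: h.
- move=> i lt m' b' hb' lm.
 have {}lt : (i <= r)%N by [].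
 apply: (@eq_pspan e) => [l li|]; first by apply: ee; apply: leq_trans li lt.
 move: lt lm; rewrite leq_eqVlt => /orP[/eqP ->|lt].
  rewrite /d' eqxx => lm; apply: contrapT => nsp.
  suff : (m <= m')%N by rewrite leqNgt lm.
  by apply: mmin; apply/asboolP; exists b'.
 by rewrite -dd //; apply: min.
Qed.

Lemma inv_full : exists r e d, Inv r e d /\ forall b, b \in L -> pspan e r b.
Proof.
have [Fx FxP] := adjF F x.
have [_ _ /(_ x Fx xL xF FxP)[n rkn]] := ffL.
have ex : exists r, `[< exists e d, Inv r e d >].
 exists 1%N; apply/asboolP; exists (fun=> 1), (fun=> 0%N); split=> //.
 - by move=> i _; apply/(LmF ffL); exact: rpred1.
 - move=> p pF; rewrite /lcomb big_ord1 mulr1 => h [|//] _.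
  apply/eqP; apply: contra_eqT h => p0; exact: (transcF ffL).
have bd r : `[< exists e d, Inv r e d >] -> (r <= n)%N.
 move=> /asboolP[e [d [_ h ind _]]]; apply: (pindep_rk FxP rkn) ind.
 by move=> i /h[].
case: (ex_maxnP ex bd) => r /asboolP[e [d inv]] rmax.
exists r, e, d; split=> // b bL; apply: contrapT => nb.
have [e' [d' inv']] := inv_extend inv bL nb.
suff : (r.+1 <= r)%N by rewrite ltnn.
by apply: rmax; apply/asboolP; exists e', d'.
Qed.

(** The Birkhoff-Grothendieck splitting: pushed forward to the line of x, the structure sheaf is a
    sum of line bundles of degrees -d_i, and the last clause reads off all spaces [Lm]. *)
Definition birk n (e : nat -> M) (d : nat -> nat) := [/\ [/\ (0 < n)%N, e 0%N = 1 & d 0%N = 0%N],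
 forall i, (i < n)%N -> Lm F x L (d i) (e i) /\ ((0 < i)%N -> (0 < d i)%N),
 pindep e n,
 forall b, b \in L -> pspan e n b &
 forall m b, Lm F x L m b -> exists p : nat -> {poly M}, [/\ forall i, p i \over F,
  b = lcomb e n p & forall i, (i < n)%N -> p i != 0 -> (size (p i) + d i <= m.+1)%N]].

Section WithInv.
Variables (r : nat) (e : nat -> M) (d : nat -> nat).
Hypotheses (inv : Inv r e d) (full : forall b, b \in L -> pspan e r b).

Let eLm i : (i < r)%N -> Lm F x L (d i) (e i). Proof. by case: inv => _ h _ _; apply: h. Qed.
Let ind : pindep e r. Proof. by case: inv. Qed.
Let e0 : e 0%N = 1. Proof. by case: inv => -[_ []]. Qed.
Let d0 : d 0%N = 0%N. Proof. by case: inv => -[_ []]. Qed.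
Let r0 : (0 < r)%N. Proof. by case: inv => -[]. Qed.

(** If m were below d_j, b would lie in the span of the e_i with i < j, and p_j would enter a
    nontrivial relation. *)
Lemma inv_top q p j m b : q \over F -> q != 0 -> (forall i, p i \over F) ->
 q.[x] * b = lcomb e r p -> (j < r)%N -> p j != 0 ->
 Lm F x L m b -> (d j <= m)%N.
Proof.
move=> qF q0 pF E jr pj bm; rewrite leqNgt; apply/negP => lt.
have [_ _ _ min] := inv.
have [q' [p' [qF' q0' pF' E']]] := min j jr m b bm lt.
pose g i := q' * p i - q * (if (i < j)%N then p' i else 0).
have gF i : g i \over F.
 by rewrite rpredB ?rpredM //; case: ifP => _ //; exact: rpred0.
have : lcomb e r g = 0.
 by rewrite lcombB !lcombM -(lcomb_widen _ _ (ltnW jr)) -E -E' mulrCA subrr.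
move=> /(ind gF)/(_ j jr)/eqP; rewrite /g ltnn mulr0 subr0 mulf_eq0.
by rewrite (negPf q0') (negPf pj).
Qed.

Lemma inv_dpos i : (0 < i)%N -> (i < r)%N -> (0 < d i)%N.
Proof.
move=> i0 ir; rewrite lt0n; apply/negP => /eqP di.
have := eLm ir; rewrite di => /(LmF ffL) eF.
pose p l : {poly M} := if l == 0%N then (e i)%:P else if l == i then - 1 else 0.
have pF l : p l \over F.
 by rewrite /p; do 2?case: ifP => _; rewrite ?polyOverC ?rpredN ?rpred1 ?rpred0.
have : lcomb e r p = 0.
 rewrite /lcomb (bigD1 (Ordinal r0)) //= (bigD1 (Ordinal ir)) /=; last first.
  by rewrite -val_eqE /= -lt0n.
 rewrite big1 => [|l /andP[l0 li]].
  rewrite /p eqxx gtn_eqF //= eqxx hornerC hornerN -polyC1 hornerC e0.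
  by rewrite mulr1 mulN1r addr0 subrr.
 by move: l0 li; rewrite -!val_eqE /= /p => /negPf -> /negPf ->; rewrite horner0 mul0r.
move=> /(ind pF)/(_ i ir) /eqP; rewrite /p gtn_eqF //= eqxx oppr_eq0.
by rewrite oner_eq0.
Qed.

Lemma inv_mono i j : (i <= j)%N -> (j < r)%N -> (d i <= d j)%N.
Proof.
rewrite leq_eqVlt => /orP[/eqP -> //|ij] jr; rewrite leqNgt; apply/negP => lt.
have [_ _ _ min] := inv.
have [q [p [qF q0 pF E]]] := min i (ltn_trans ij jr) _ _ (eLm jr) lt.
pose p' l : {poly M} := (if l == j then q else 0) - (if (l < i)%N then p l else 0).
have pF' l : p' l \over F.
 by rewrite /p' rpredB //; case: ifP => _ //; rewrite rpred0.
have : lcomb e r p' = 0.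
 rewrite lcombB -(lcomb_widen _ _ (ltnW (ltn_trans ij jr))) -E.
 rewrite /lcomb (bigD1 (Ordinal jr)) //= eqxx big1 ?addr0 ?subrr // => l.
 by rewrite -val_eqE /= => /negPf ->; rewrite horner0 mul0r.
move=> /(ind pF')/(_ j jr)/eqP; rewrite /p' eqxx ltnNge (ltnW ij) /= subr0.
by rewrite (negPf q0).
Qed.

(* The successive minima property in the form used below: no combination of the
  [e i] with constant leading coefficients gains a place. *)
Lemma inv_gain (al : nat -> M) b q p : (forall i, al i \in F) ->
 q \over F -> q != 0 -> (forall i, p i \over F) ->
 (forall i, (i < r)%N -> al i = 0 -> p i = 0) ->
 (forall i, (i < r)%N -> al i != 0 -> p i != 0) ->
 q.[x] * b = lcomb e r p -> b \in L ->
 (exists i, (i < r)%N && (al i != 0)) ->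
 (forall j, (j < r)%N -> al j != 0 -> (forall i, (i < r)%N -> al i != 0 -> (i <= j)%N) ->
   (forall O, place F O -> x \in O -> b \in O) /\
   ((0 < d j)%N -> forall O, place F O -> x \notin O -> b / x ^+ (d j).-1 \in O)) ->
 al 0%N != 0 /\ (forall i, (0 < i < r)%N -> al i = 0).
Proof.
move=> alF qF q0 pF p0 pn0 E bL ex h.
have bd i : (i < r)%N && (al i != 0) -> (i <= r)%N by move=> /andP[/ltnW].
case: (ex_maxnP ex bd) => j /andP[jr aj] jmax.
have [|h1 h2] := h j jr aj; first by move=> i ir ai; apply: jmax; rewrite ir.
have [dj|dj] := posnP (d j); last first.
 have bm : Lm F x L (d j).-1 b by split=> // O pO; split=> xO; [exact: h1|exact: h2].
 have := inv_top qF q0 pF E jr (pn0 _ jr aj) bm.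
 by rewrite leqNgt prednK // leqnn.
have j0 : j = 0%N.
 by apply/eqP; rewrite -leqn0 leqNgt; apply/negP => j0; have := inv_dpos j0 jr; rewrite dj.
split; first by rewrite -j0.
move=> i /andP[i0 ir]; apply/eqP; apply: contraT => ai.
by have := jmax i; rewrite ir ai j0 leqNgt i0 => /(_ isT).
Qed.

(** The roots of the denominator q are removed one at a time: at a root a, the combination of the
    e_i with coefficients p_i(a) is divisible by x - a, which contradicts the minimality of the e_i
    unless all p_i(a) vanish. *)
Lemma inv_poly m b : Lm F x L m b -> exists p : nat -> {poly M},
 (forall i, p i \over F) /\ b = lcomb e r p.
Proof.
move=> bm; have [bL bO] := bm.
suff [q [p [[qF q0 pF E] sq]]] : exists q p, [/\ q \over F, q != 0,
   forall i, p i \over F & q.[x] * b = lcomb e r p] /\ (size q <= 1)%N.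
 have qC := size1_polyC sq; have c0 : q`_0 != 0 by apply: contraNneq q0 => c0; rewrite qC c0.
 exists (fun i => (q`_0)^-1%:P * p i); split.
  by move=> i; rewrite rpredM // polyOverC rpredV (polyOverP qF).
 have qx : q.[x] = q`_0 by rewrite {1}qC hornerC.
 by rewrite lcombM -E hornerC qx mulKf.
have [q [p]] := full bL; move s : (size q) => n.
elim: n q p s => [|n IH] q p s [qF q0 pF E].
 by move/eqP: s; rewrite size_poly_eq0 (negPf q0).
have [n0|n0] := posnP n; first by exists q, p; split; rewrite // s n0.
have [|a qa] := aclM (p := q); first by rewrite s.
have aF : a \in F by apply: hF; exists q.
have xa0 : x - a != 0 by apply: contraNneq xF => /eqP; rewrite subr_eq0 => /eqP ->.
have Xq : 'X - a%:P %| q by rewrite dvdp_XsubCl.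
have XF : 'X - a%:P \over F by rewrite polyOverXsubC.
have qE := divpK Xq; set q' := q %/ _ in qE.
have qF' : q' \over F by apply: polyOver_quo.
have q0' : q' != 0 by apply: contraNneq q0 => q0'; rewrite -qE q0' mul0r.
pose al i := (p i).[a].
have alF i : al i \in F by rewrite rpred_horner.
pose p' i := (p i - (al i)%:P) %/ ('X - a%:P).
have pF' i : p' i \over F by rewrite polyOver_quo // rpredB // polyOverC.
have pE i : p i = p' i * ('X - a%:P) + (al i)%:P.
 by rewrite divpK ?subrK // dvdp_XsubCl rootE hornerD hornerN hornerC subrr.
pose c := q'.[x] * b - lcomb e r p'.
have cE : (x - a) * c = lcomb e r (fun i => (al i)%:P).
 rewrite /c mulrBr mulrA.
 have -> : (x - a) * q'.[x] = q.[x] by rewrite -qE hornerM hornerXsubC mulrC.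
 rewrite E {1}/lcomb mulr_sumr -sumrB; apply: eq_bigr => i _.
 by rewrite pE hornerD hornerM hornerXsubC !hornerC; ring.
have [all0|ex] := pselect (forall i, (i < r)%N -> al i = 0).
 apply: (IH q' p').
  by rewrite /q' size_divp ?polyXsubC_eq0 // size_XsubC s subn1.
 split=> //; apply/eqP; rewrite -subr_eq0 -/c -(inj_eq (mulfI xa0)) mulr0 cE.
 by rewrite /lcomb big1 // => i _; rewrite all0 // hornerC mul0r.
have {}ex : exists i, (i < r)%N && (al i != 0).
 move/existsNP: ex => [i /not_implyP[ir /eqP ai]]; exists i.
 by rewrite ir.
have eL i : (i < r)%N -> e i \in L by move=> /eLm[].
have cL : c \in L.
 rewrite rpredB ?rpredM ?rpred_horner ?(polyOver_sub FL) //.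
 by apply: rpred_sum => i _; rewrite rpredM ?eL // rpred_horner ?(polyOver_sub FL).
have cint O : place F O -> x \in O -> c \in O.
 move=> pO xO; have [vO FO] := pO.
 rewrite rpredB ?rpredM ?rpred_horner ?(polyOver_sub FO) //; first by have [h _] := bO _ pO; apply: h.
 apply: rpred_sum => i _; rewrite rpredM ?rpred_horner ?(polyOver_sub FO) //.
 by have [_ /(_ O pO)[h _]] := eLm (ltn_ord i); apply: h.
have [||||||||||a00 a0] := @inv_gain al c ('X - a%:P) (fun i => (al i)%:P).
- exact: alF.
- exact: XF.
- by rewrite polyXsubC_eq0.
- by move=> i; rewrite polyOverC.
- by move=> i _ ->.
- by move=> i _; rewrite polyC_eq0.
- by rewrite hornerXsubC.
- exact: cL.
- exact: ex.
- move=> j jr aj jmax; split=> // dj O pO xO; have [vO FO] := pO.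
 have xa : x / (x - a) \in O.
  have -> : x / (x - a) = (1 - a / x)^-1.
   by field; rewrite ?xa0 ?x0.
  apply: un_O; apply: unV; apply: un_add => //; first exact: un1.
  by rewrite mx_oppE mx_mulr ?FO // notO_mx.
 have -> : c / x ^+ (d j).-1 = x / (x - a) * \sum_(i < r) al i * (e i / x ^+ d j).
  have -> : \sum_(i < r) al i * (e i / x ^+ d j) = (x - a) * c / x ^+ d j.
   by rewrite cE /lcomb mulr_suml; apply: eq_bigr => i _; rewrite hornerC mulrA.
  rewrite -[in x ^+ d j](prednK dj) exprS.
  by have := expf_neq0 (d j).-1 x0 => xx; field; rewrite xx x0 xa0.
 rewrite rpredM //; apply: rpred_sum => i _; have [->|ai] := eqVneq (al i) 0.
  by rewrite mul0r rpred0.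
 rewrite rpredM //; first exact: FO.
 have [_ /(_ O pO)[_]] := Lm_le (inv_mono (jmax i (ltn_ord i) ai) jr) (eLm (ltn_ord i)).
 by apply.
(* Only the multiple of e_0 = 1 has survived, so c is a multiple of 1 / (x - a), which has a pole
   where x is finite. *)
have xai : (x - a)^-1 \notin F.
 by rewrite rpredV; apply: contra xF => h; rewrite -(subrK a x) rpredD.
have [O [pO nO]] := place_inf ffL xai; have [vO FO] := pO.
have xO : x \in O.
 have /mx_sub h : x - a \in mx O by rewrite -[x - a]invrK notO_mx.
 by rewrite -(subrK a x) rpredD //; apply: FO.
case/negP: nO.
have -> : (x - a)^-1 = c / al 0%N.
 apply: (mulfI xa0); rewrite divff // mulrA cE /lcomb (bigD1 (Ordinal r0)) //= e0 mulr1.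
 rewrite hornerC big1 ?addr0 ?divff // => i; rewrite -val_eqE /= -lt0n => i0.
 by rewrite a0 ?i0 ?ltn_ord // hornerC mul0r.
by rewrite rpredM ?cint // FO // rpredV.
Qed.

(** Terms of too large a weight mu must cancel at infinity. Their leading coefficients then give a
    combination of the e_i, with powers of x equalizing the pole orders, whose pole is smaller than
    minimality allows. *)
Lemma inv_deg m b p : Lm F x L m b -> (forall i, p i \over F) -> b = lcomb e r p ->
 forall i, (i < r)%N -> p i != 0 -> (size (p i) + d i <= m.+1)%N.
Proof.
move=> bm pF bE i1 ir1 pi1; rewrite leqNgt; apply/negP => bad.
have [bL bO] := bm.
(* The pole order of the i-th term; zero coefficients count as 0, harmless since the maximum exceeds
   m. *)
pose w (i : 'I_r) := if p i == 0 then 0%N else (size (p i) + d i).-1.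
pose mu := (\max_i w i)%N.
have wE i : p i != 0 -> (size (p i) + d i).-1.+1 = (size (p i) + d i)%N.
 by move=> pi; rewrite prednK // addn_gt0 size_poly_gt0 pi.
have wle i : (i < r)%N -> p i != 0 -> (size (p i) + d i <= mu.+1)%N.
 move=> ir pi; have := @leq_bigmax _ w (Ordinal ir).
 by rewrite /w /= (negPf pi) -ltnS wE.
have mmu : (m < mu)%N by have := wle i1 ir1 pi1; move: bad; lia.
pose al i := if (d i <= mu)%N then (p i)`_(mu - d i) else 0.
have alF i : al i \in F by rewrite /al; case: ifP => _; rewrite ?rpred0 ?(polyOverP (pF i)).
have ex : exists i, (i < r)%N && (al i != 0).
 have [j jE] : exists j : 'I_r, mu = w j.
  by rewrite /mu; have := @eq_bigmax _ w; rewrite card_ord => /(_ (leq_ltn_trans (leq0n _) ir1))[j]; exists j.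
 exists j; rewrite ltn_ord /=; move: jE; rewrite /w.
 case: eqP => [_ mu0|/eqP pj jE]; first by move: mmu; rewrite mu0.
 have szj : (0 < size (p j))%N by rewrite size_poly_gt0.
 rewrite /al jE; have -> : (d j <= (size (p j) + d j).-1)%N by lia.
 have -> : ((size (p j) + d j).-1 - d j = (size (p j)).-1)%N by lia.
 by rewrite -lead_coefE lead_coef_eq0.
have key O : place F O -> x \notin O -> x * (\sum_(i < r) al i * (e i / x ^+ d i)) \in O.
 move=> pO xO; have [vO FO] := pO.
 have xi : x^-1 \in O by rewrite mx_sub // notO_mx.
 have eO i : (i < r)%N -> e i / x ^+ d i \in O.
  by move=> ir; have [_ /(_ O pO)[_]] := eLm ir; apply.
 have -> : x * (\sum_(i < r) al i * (e i / x ^+ d i)) =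
   b / x ^+ mu.-1 - \sum_(i < r) x * ((p i).[x] / x ^+ mu * e i - al i * (e i / x ^+ d i)).
  apply/eqP; rewrite eq_sym subr_eq mulr_sumr -big_split /=; apply/eqP.
  rewrite bE /lcomb mulr_suml; apply: eq_bigr => i _.
  rewrite -mulrDr addrC subrK -[in x ^+ mu](prednK (leq_ltn_trans (leq0n _) mmu)) exprS.
  by have := expf_neq0 mu.-1 x0 => xx; field; rewrite xx x0.
 rewrite rpredB //.
  have -> : b / x ^+ mu.-1 = b / x ^+ m * x^-1 ^+ (mu.-1 - m).
   have le : (m <= mu.-1)%N by lia.
   have -> : x ^+ mu.-1 = x ^+ m * x ^+ (mu.-1 - m) by rewrite -exprD subnKC.
   by rewrite exprVn invfM mulrA.
  by rewrite rpredM ?rpredX //; have [_ h] := bO _ pO; apply: h.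
 apply: rpred_sum => i _; have [pi|pi] := eqVneq (p i) 0.
  by rewrite /al pi coef0 if_same horner0 !mul0r subr0 mulr0 rpred0.
 have le := wle i (ltn_ord i) pi.
 have dmu : (d i <= mu)%N by move: le; have := pi; rewrite -size_poly_gt0; lia.
 pose pr := p i - al i *: 'X^(mu - d i).
 have prF : pr \over F by rewrite rpredB // polyOverZ // polyOverXn.
 have prs : (size pr <= mu - d i)%N.
  apply/leq_sizeP => j; rewrite leq_eqVlt => /orP[/eqP <-|lt].
   by rewrite coefB coefZ coefXn eqxx mulr1 /al dmu subrr.
  rewrite coefB coefZ coefXn gtn_eqF // mulr0 subr0 nth_default //.
  have {}le : (size (p i) + d i <= mu.+1)%N := le.
  by move: le lt dmu; move: (size (p i)) (d i) (mu) => a b1 c; lia.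
 have -> : x * ((p i).[x] / x ^+ mu * e i - al i * (e i / x ^+ d i)) =
   x * (pr.[x] / x ^+ (mu - d i)) * (e i / x ^+ d i).
  rewrite /pr hornerD hornerN hornerZ hornerXn.
  have -> : x ^+ mu = x ^+ (mu - d i) * x ^+ d i by rewrite -exprD subnK.
  by have := expf_neq0 (mu - d i) x0; have := expf_neq0 (d i) x0 => h1 h2; field; rewrite h1 h2.
 rewrite rpredM ?eO //; move: prs; case: (mu - d i)%N => [|l] prs.
  by move: prs; rewrite leqn0 size_poly_eq0 => /eqP ->; rewrite horner0 mul0r mulr0 rpred0.
 have [_ /(_ O pO)[_ /(_ xO)]] := Lm_poly ffL xL xF prF prs.
 suff -> : x * (pr.[x] / x ^+ l.+1) = pr.[x] / x ^+ l by [].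
 by rewrite exprS; have := expf_neq0 l x0 => xx; field; rewrite xx x0.
have [j /andP[jr aj] jmax] : exists2 j, (j < r)%N && (al j != 0) &
  forall i, (i < r)%N && (al i != 0) -> (i <= j)%N.
 have bd i : (i < r)%N && (al i != 0) -> (i <= r)%N by move=> /andP[/ltnW].
 by case: (ex_maxnP ex bd) => j h1 h2; exists j.
have dle i : (i < r)%N -> al i != 0 -> (d i <= d j)%N.
 by move=> ir ai; apply: inv_mono => //; apply: jmax; rewrite ir.
pose q i := al i *: 'X^(d j - d i).
have qF i : q i \over F by rewrite polyOverZ // polyOverXn.
pose c := lcomb e r q.
have cL : c \in L.
 by apply: rpred_sum => i _; rewrite rpredM ?rpred_horner ?(polyOver_sub FL) //; have [] := eLm (ltn_ord i).
have cE : c = x ^+ d j * \sum_(i < r) al i * (e i / x ^+ d i).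
 rewrite mulr_sumr; apply: eq_bigr => i _; rewrite hornerZ hornerXn.
 have [->|ai] := eqVneq (al i) 0; first by rewrite !mul0r mulr0.
 have -> : x ^+ d j = x ^+ (d j - d i) * x ^+ d i by rewrite -exprD subnK // dle.
 by have := expf_neq0 (d i) x0 => h1; field.
have [||||||||||a00 a0] := @inv_gain al c 1 q.
- exact: alF.
- exact: rpred1.
- exact: oner_neq0.
- exact: qF.
- by move=> i _; rewrite /q => ->; rewrite scale0r.
- by move=> i _ ai; rewrite /q -size_poly_eq0 size_scale // size_polyXn.
- by rewrite -polyC1 hornerC mul1r.
- exact: cL.
- exact: ex.
- move=> j' jr' aj' jmax'.
 have -> : j' = j by apply/eqP; rewrite eqn_leq jmax ?jr' ?aj' // jmax'.
 split.
  move=> O pO xO; have [vO FO] := pO.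
  apply: rpred_sum => i _; rewrite rpredM ?rpred_horner ?(polyOver_sub FO) //.
  by have [_ /(_ O pO)[h _]] := eLm (ltn_ord i); apply: h.
 move=> dj O pO xO; have := key O pO xO.
 rewrite cE -[in x ^+ d j](prednK dj) exprS -mulrA.
 by have := expf_neq0 (d j).-1 x0 => h1; rewrite [x ^+ _ * _]mulrC mulrA mulfK.
(* Again only the coefficient of e_0 = 1 survives, and x would be integral at one of its poles. *)
have [O [pO xO]] := place_inf ffL xF; have [vO FO] := pO.
have := key O pO xO; rewrite (bigD1 (Ordinal r0)) //= e0 d0 expr0 divr1 mulr1.
rewrite big1 ?addr0 => [h|i]; last first.
 by rewrite -val_eqE /= -lt0n => i0; rewrite a0 ?mul0r // i0 ltn_ord.
by case/negP: xO; rewrite -[x](mulfK a00) rpredM // FO // rpredV.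
Qed.

End WithInv.

Theorem birkhoff : exists n e d, birk n e d.
Proof.
have [r [e [d [inv full]]]] := inv_full; exists r, e, d.
have [[r0 [e0 d0]] eLm ind _] := inv; split=> //.
 move=> i ir; split; first exact: eLm.
 by move=> i0; apply: (inv_dpos inv).
move=> m b bm; have [p [pF bE]] := inv_poly inv full bm.
by exists p; split=> //; apply: (inv_deg inv bm pF bE).
Qed.

End Birkhoff.

(** * Valuation rings stable under a derivation *)

Section Stability.
Variable M : fieldType.
Hypotheses (char0 : char_0 M) (aclM : acl M).
Variables (F L : sfield M).
Hypothesis ffL : ffield F L.
Variables (O : sring M).
Hypotheses (vO : valring O) (FO : F \sub O).

Let FL : F \sub L. Proof. by case: ffL. Qed.

Lemma poly_inv_inf x (q : {poly M}) : x \notin O -> q \over F -> q != 0 ->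
 q.[x]^-1 \in O.
Proof.
move=> xO qF q0; have xm := notO_mx vO xO.
have x0 : x != 0 by apply: contraNneq xO => ->; rewrite rpred0.
pose n := (size q).-1.
have sq : size q = n.+1 by rewrite prednK // size_poly_gt0.
have lc0 : q`_n != 0 by rewrite -lead_coefE lead_coef_eq0.
have : un O (q.[x] / x ^+ n).
 rewrite horner_coef sq big_ord_recr /= mulrDl mulfK ?expf_neq0 // addrC.
 apply: un_add => //; first by apply: (un_F FO) => //; apply: (polyOverP qF).
 rewrite mulr_suml; apply: mx_sum => // i _.
 have -> : q`_i * x ^+ i / x ^+ n = q`_i * (x^-1 ^+ (n - i.+1) * x^-1).
  have -> : x ^+ n = x ^+ (n - i.+1) * x * x ^+ i by rewrite -exprSr -exprD; congr (_ ^+ _); have := ltn_ord i; lia.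
  have := expf_neq0 i x0; have := expf_neq0 (n - i.+1) x0 => h1 h2.
  by rewrite exprVn; field; rewrite h1 h2 x0.
 apply: mx_mulr; first by apply: FO; apply: (polyOverP qF).
 by apply: mx_mulr => //; apply: rpredX; exact: mx_sub.
move=> /unV /un_O h; have -> : q.[x]^-1 = (q.[x] / x ^+ n)^-1 * x^-1 ^+ n.
 by rewrite invfM invrK exprVn mulfK // expf_neq0.
by rewrite rpredM // rpredX // mx_sub.
Qed.

End Stability.

Section Stability2.
Variable M : fieldType.
Hypotheses (char0 : char_0 M) (aclM : acl M).
Variables (F L : sfield M).
Hypothesis ffL : ffield F L.

Let FL : F \sub L. Proof. by case: ffL. Qed.

Lemma intcl_Lm x c : x \in L -> x \notin F -> intcl F x L c -> exists m, Lm F x L m c.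
Proof.
move=> xL xF [cL cint]; have [q [qF q0 [m [qcL qcm]]]] := denom ffL xL xF cL.
exists m; split=> // O pO; split=> xO; first exact: cint.
have [_ /(_ xO) h] := qcm O pO; have [vO FO] := pO.
have -> : c / x ^+ m = q.[x] * c / x ^+ m / q.[x].
 by have := transcF ffL xF qF q0 => qx; rewrite mulrAC [q.[x] * c]mulrC mulfK.
by rewrite rpredM // (poly_inv_inf vO FO).
Qed.

Variables (O : sring M).
Hypotheses (vO : valring O) (FO : F \sub O).

(** The condition bounds the order of z below by a rational multiple of the order of p; it is
    written with powers because orders are only known up to the exponent N. *)
Lemma pw_add p m N z1 z2 : p ^+ m * z1 ^+ N \in O -> p ^+ m * z2 ^+ N \in O ->
 p ^+ m * (z1 + z2) ^+ N \in O.
Proof.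
move=> h1 h2; have [->|n1] := eqVneq z1 0; first by rewrite add0r.
have [->|n2] := eqVneq z2 0; first by rewrite addr0.
have /orP[h|] := vO (z1 / z2).
 have -> : z1 + z2 = (z1 / z2 + 1) * z2 by field.
 by rewrite exprMn mulrCA rpredM // rpredX // rpredD // rpred1.
rewrite invf_div => h.
have -> : z1 + z2 = (z2 / z1 + 1) * z1 by field.
by rewrite exprMn mulrCA rpredM // rpredX // rpredD // rpred1.
Qed.

Lemma pw_O p m N z : p \in O -> z \in O -> p ^+ m * z ^+ N \in O.
Proof. by move=> pO zO; rewrite rpredM ?rpredX. Qed.

Lemma pw_mul p m N a z : a \in O -> p ^+ m * z ^+ N \in O -> p ^+ m * (a * z) ^+ N \in O.
Proof. by move=> aO h; rewrite exprMn mulrCA rpredM // rpredX. Qed.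

Lemma pw_sum p m N I (r : seq I) (P : pred I) (f : I -> M) : (0 < N)%N ->
 (forall i, P i -> p ^+ m * (f i) ^+ N \in O) ->
 p ^+ m * (\sum_(i <- r | P i) f i) ^+ N \in O.
Proof.
move=> N0 h; apply: (big_ind (fun z => p ^+ m * z ^+ N \in O)) => //.
 by rewrite expr0n gtn_eqF // mulr0 rpred0.
by move=> a b; apply: pw_add.
Qed.

Lemma pw_le p m m' N z : p \in O -> (m <= m')%N -> p ^+ m * z ^+ N \in O -> p ^+ m' * z ^+ N \in O.
Proof. by move=> pO le h; rewrite -(subnK le) exprD -mulrA rpredM // rpredX. Qed.

Lemma nat_inv_O n : (0 < n)%N -> (n%:R : M)^-1 \in O.
Proof. by move=> n0; apply: FO; rewrite rpredV rpred_nat. Qed.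

Variable D : M -> M.
Hypotheses (DD : derOn L D) (DL : stab D L)
 (DF : forall y, y \in F -> D y \in O).

Section AtUniformizer.
Variable p : M.
Hypotheses (pL : p \in L) (pm : p \in mx O) (p0 : p != 0) (Dp : D p \in O).

Let pO : p \in O. Proof. exact: mx_sub. Qed.
Let pF : p \notin F. Proof. exact: (mx_notF FO pm p0). Qed.

(** D lowers orders by a bounded amount: the Birkhoff basis generates the integral closure of F[p]
    as a finite module, and [localize] passes from it to O by the quotient rule. *)
Lemma der_bounded N : (0 < N)%N -> (forall b, b \in L -> exists m, p ^+ m * b ^+ N \in O) ->
 exists m, forall y, y \in L -> y \in O -> p ^+ m * D y ^+ N \in O.
Proof.
move=> N0 bnd; have [n [e [d bk]]] := birkhoff aclM ffL pL pF.
have [[n0 e0 _] eLm _ _ rep] := bk.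
have eL i : (i < n)%N -> e i \in L by move=> /eLm[[]].
have eO i : (i < n)%N -> e i \in O by move=> /eLm[[_ /(_ O)h _]]; apply: (h _).1.
have /choice[mf mfP] : forall i : 'I_n, exists m, p ^+ m * D (e i) ^+ N \in O.
 by move=> i; apply/bnd/DL/eL.
pose m := (\max_i mf i)%N; exists m => y yL yO.
have intD c : intcl F p L c -> p ^+ m * D c ^+ N \in O.
 move=> ic; have [l cl] := intcl_Lm pL pF ic.
 have [q [qF -> _]] := rep _ _ cl.
 have qL i : (q i).[p] \in L by rewrite rpred_horner // (polyOver_sub FL).
 rewrite (der_sum DD) => [|i _]; last by rewrite rpredM ?eL.
 apply: pw_sum => // i _; rewrite DD.2 ?eL //; apply: pw_add.
  apply: pw_O => //; rewrite rpredM ?eO //.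
  rewrite (der_horner DD) //; last exact: polyOver_sub (qF i).
  rewrite rpredD ?rpredM ?rpred_horner //.
   apply/polyOverP => j; rewrite (coef_dpoly DD) DF // (polyOverP (qF i)) //.
  by rewrite polyOver_deriv // (polyOver_sub FO).
 apply: pw_mul; first by rewrite rpred_horner // (polyOver_sub FO).
 by apply: pw_le (mfP i) => //; apply: leq_bigmax.
have [LO|nLO] := pselect (forall z, z \in L -> z \in O).
 by apply: pw_O => //; apply/LO/DL.
have {}nLO : L \nsub O.
 by move/existsNP: nLO => [z /not_implyP[zL /negP zO]]; exists z.
have [c [b [ic ib bm ->]]] := localize aclM ffL vO FO nLO pL pF pO yL yO.
have [b0 bi] := unitO (ib.2 _ (conj vO FO) pO) bm.
have [cL cO] := ic; have [bL bO] := ib.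
have -> : D (c / b) = b^-1 * D c + (- c / b ^+ 2) * D b.
 by rewrite (derQ DD) //; field.
have {}cO := cO O (conj vO FO) pO.
apply: pw_add; apply: pw_mul => //; try exact: intD.
by rewrite -exprVn rpredM ?rpredN ?rpredX.
Qed.

(** The bound m of [der_bounded] is lowered step by step to 0. Subtracting a residue, y may be taken
    in the maximal ideal. If p generates that ideal, Leibniz applies to y = p (y / p); if D p / p is
    integral, the logarithmic derivative of y^N = p^r u gains one step because r > 0. *)
Theorem der_place_stable :
 D p / p \in O \/ (forall b, b \in L -> b \in mx O -> b / p \in O) ->
 stab_in D L O.
Proof.
move=> alt; have [N [N0 ord bnd res]] := unif aclM ffL vO FO pL pm p0.
have [m hm] := der_bounded N0 bnd.
suff: forall y, y \in L -> y \in O -> p ^+ 0 * D y ^+ N \in O.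
 by move=> h y yL yO; have := h y yL yO; rewrite expr0 mul1r => /(O_exp vO N0).
elim: m hm => // m IH hm; apply: IH => y yL yO.
have [b bF yb] := res y yL yO.
rewrite -(subrK b y) addrC; set c := y - b in yb *.
have cL : c \in L by rewrite rpredB // FL.
have bL := FL bF; rewrite DD.1 //; apply: pw_add; first by apply: pw_O => //; apply: DF.
have [->|c0] := eqVneq c 0.
 by rewrite (der0 DD) expr0n gtn_eqF // mulr0 rpred0.
case: alt => [alt|alt]; last first.
 have c1 := alt c cL yb; have c1L : c / p \in L by rewrite rpred_div.
 rewrite -[c](divfK p0) DD.2 //; apply: pw_add.
  have -> : p ^+ m * (D (c / p) * p) ^+ N = p ^+ N.-1 * (p ^+ m.+1 * D (c / p) ^+ N).
   by rewrite exprMn -[in p ^+ N](prednK N0) !exprS; ring.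
  by rewrite rpredM ?rpredX // hm.
 by apply: pw_mul => //; apply: pw_O.
have [r [u [e uu uL]]] := ord c cL c0 (mx_sub yb).
move=> /(_ yb) r0; have u0 := un_neq0 uu.
have Nn0 : N%:R != 0 :> M by rewrite (natr_eq0 char0) -lt0n.
(* The logarithmic derivative of c, read off from c^N = p^r u. *)
pose z := (N%:R)^-1 * (r%:R * (D p / p) + u^-1 * D u).
have Dc : D c = c * z.
 have := congr1 D e; rewrite (derX DD) // DD.2 ?rpredX // (derX DD) // => E.
 have cN : c ^+ N = c ^+ N.-1 * c by rewrite -exprSr prednK.
 have pr : p ^+ r = p ^+ r.-1 * p by rewrite -exprSr prednK.
 have cN0 : c ^+ N.-1 != 0 by rewrite expf_neq0.
 apply: (mulfI Nn0); apply: (mulfI cN0).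
 transitivity (c ^+ N * (r%:R * (D p / p) + u^-1 * D u)); last first.
  by rewrite cN /z; field; rewrite Nn0 p0 u0.
 by rewrite mulrCA mulrA E e pr; field; rewrite p0 u0.
have hz : p ^+ m.+1 * z ^+ N \in O.
 apply: pw_mul; first exact: nat_inv_O.
 apply: pw_add.
  by apply: pw_O => //; rewrite rpredM // rpred_nat.
 apply: pw_mul; first exact: un_O (unV uu).
 by apply: hm => //; exact: un_O.
rewrite Dc exprMn e -(prednK r0) exprSr.
have -> : p ^+ m * (p ^+ r.-1 * p * u * z ^+ N) = p ^+ r.-1 * u * (p ^+ m.+1 * z ^+ N).
 by rewrite exprS; ring.
by rewrite rpredM // rpredM ?rpredX // un_O.
Qed.

End AtUniformizer.
End Stability2.

Section LinAlg.
Variables (M : fieldType) (F : sfield M).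

Lemma vec_dep (I J : finType) (A : I -> J -> M) : (forall i j, A i j \in F) ->
 (#|J| < #|I|)%N -> exists c : I -> M, [/\ forall i, c i \in F,
  forall j, \sum_i c i * A i j = 0 & exists i, c i != 0].
Proof.
move=> AF lt.
pose B : 'M[subF F]_(#|I|, #|J|) := \matrix_(i, j) SubF (AF (enum_val i) (enum_val j)).
have : kermx B != 0.
 rewrite kermx_eq0 /row_free; apply: contraTneq lt => rB.
 by rewrite -leqNgt -rB rank_leq_col.
move=> /rowV0Pn[v /sub_kermxP vB v0].
have [j vj] : exists j, v 0 j != 0 by apply/rV0Pn.
exists (fun i => val (v 0 (enum_rank i))); split.
- by move=> i; apply: subvalP.
- move=> l; have /matrixP/(_ 0 (enum_rank l)) := vB; rewrite !mxE.
 move=> /(congr1 (val : subF F -> M)); rewrite (rmorph_sum (val : subF F -> M)) => h.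
 rewrite -[RHS]h (reindex (@enum_val _ (mem I))) /=; last by apply: onW_bij; apply: enum_val_bij.
 by apply: eq_bigr => i _; rewrite !mxE enum_valK /= !enum_rankK.
- exists (enum_val j); rewrite enum_valK; apply: contra vj => /eqP e.
 by apply/eqP/val_inj.
Qed.

Lemma span_dep (I J : finType) (s : J -> M) (f : I -> M) :
 (forall i, exists2 c : J -> M, (forall j, c j \in F) & f i = \sum_j c j * s j) ->
 (#|J| < #|I|)%N -> exists c : I -> M, [/\ forall i, c i \in F,
  \sum_i c i * f i = 0 & exists i, c i != 0].
Proof.
move=> span lt.
have /choice[A hA] : forall i, exists c : J -> M, (forall j, c j \in F) /\
   f i = \sum_j c j * s j by move=> i; have [c cF ec] := span i; exists c.
have [c [cF c0 nz]] := vec_dep (fun i => (hA i).1) lt.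
exists c; split=> //; under eq_bigr do rewrite (hA _).2 mulr_sumr.
rewrite exchange_big /= big1 // => j _.
by under eq_bigr do rewrite mulrA; rewrite -mulr_suml c0 mul0r.
Qed.
End LinAlg.

(** * Degrees over F(x) *)

Section Degree.
Variable M : fieldType.
Hypotheses (char0 : char_0 M) (aclM : acl M).
Variables (F L : sfield M).
Hypothesis ffL : ffield F L.

Let hF : relacl F. Proof. by case: ffL. Qed.
Let FL : F \sub L. Proof. by case: ffL. Qed.

(** n is the degree [L : F(x)], with a Birkhoff basis as witness. *)
Definition hasdeg x n := exists e d, birk F L x n e d.

Lemma hasdeg_ex x : x \in L -> x \notin F -> exists n, hasdeg x n.
Proof. by move=> xL xF; have [n [e [d b]]] := birkhoff aclM ffL xL xF; exists n, e, d. Qed.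

Section AtX.
Variables (x : M) (n : nat) (e : nat -> M) (d : nat -> nat).
Hypotheses (xL : x \in L) (xF : x \notin F) (bk : birk F L x n e d).

Lemma birk_eL i : (i < n)%N -> e i \in L.
Proof. by case: bk => _ h _ _ _ /h[[]]. Qed.

Lemma adj_poly (Fx : sfield M) p : (adj_is F x Fx) ->
 p \over F -> p.[x] \in Fx.
Proof.
move=> FxP pF; apply/FxP; exists p, 1; rewrite pF rpred1 -polyC1 hornerC oner_eq0 divr1.
by split.
Qed.

Lemma birk_coord (Fx : sfield M) y : (adj_is F x Fx) -> y \in L ->
 exists2 c : 'I_n -> M, (forall i, c i \in Fx) & y = \sum_(i < n) c i * e i.
Proof.
move=> FxP yL; have [_ _ _ /(_ y yL)[q [p [qF q0 pF E]]] _] := bk.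
have qx : q.[x] != 0 by exact: (transcF ffL xF qF q0).
exists (fun i => (p i).[x] / q.[x]).
 by move=> i; rewrite rpred_div // adj_poly.
apply: (mulfI qx); rewrite E mulr_sumr; apply: eq_bigr => i _.
by rewrite mulrA [q.[x] * _]mulrC divfK.
Qed.

Lemma birk_rk (Fx : sfield M) : (adj_is F x Fx) -> rk Fx L n.
Proof. by move=> FxP; apply: rk_span => y; apply: birk_coord. Qed.

Lemma deg_max e' r : (forall i, (i < r)%N -> e' i \in L) -> pindep F x e' r -> (r <= n)%N.
Proof.
by move=> eL' ind; have [Fx FxP] := adjF F x; apply: (pindep_rk FxP (birk_rk FxP) eL').
Qed.

Lemma birk_indep (Fx : sfield M) (c : 'I_n -> M) : (adj_is F x Fx) ->
 (forall i, c i \in Fx) -> \sum_(i < n) c i * e i = 0 -> forall i, c i = 0.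
Proof.
move=> FxP cF s0 i0; apply/eqP; apply: contraT => ci0.
have /choice[f hf] : forall i, exists ab : {poly M} * {poly M},
  [/\ ab.1 \over F, ab.2 \over F, ab.2.[x] != 0 & c i = ab.1.[x] / ab.2.[x]].
 by move=> i; have /FxP[a [b h]] := cF i; exists (a, b).
pose Q (i : 'I_n) := \prod_(l | l != i) (f l).2.
have QF i : Q i \over F by apply: rpred_prod => l _; have [] := hf l.
pose p (i : nat) : {poly M} := oapp (fun i : 'I_n => (f i).1 * Q i) 0 (insub i).
have pF i : p i \over F.
 rewrite /p; case: insubP => [j _ _|_] /=; last exact: rpred0.
 by rewrite rpredM //; have [] := hf j.
have pE (i : 'I_n) : p i = (f i).1 * Q i by rewrite /p valK.
pose P := \prod_l (f l).2.[x].
have P0 : P != 0 by apply/prodf_neq0 => l _; have [] := hf l.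
have pxE (i : 'I_n) : (p i).[x] = P * c i.
 rewrite pE hornerM /Q horner_prod /P [in RHS](bigD1 i) //=; have [_ _ h ->] := hf i.
 have gen (a b X : M) : b != 0 -> a * X = b * X * (a / b) by move=> nb; field.
 exact: gen.
have [_ _ ind _ _] := bk.
have : lcomb x e n p = 0.
 by rewrite -[RHS](mulr0 P) -[in RHS]s0 mulr_sumr; apply: eq_bigr => i _; rewrite pxE mulrA.
move=> /(ind p pF)/(_ i0 (ltn_ord i0)) p0.
by have := pxE i0; rewrite p0 horner0 => /esym/eqP; rewrite mulf_eq0 (negPf P0) (negPf ci0).
Qed.

Lemma Lm_span m b : Lm F x L m b -> exists2 c : 'I_n * 'I_m.+1 -> M, (forall j, c j \in F) &
 b = \sum_j c j * (e j.1 * x ^+ j.2).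
Proof.
move=> bm; have [_ _ _ _ /(_ m b bm)[p [pF -> sp]]] := bk.
exists (fun j : 'I_n * 'I_m.+1 => (p j.1)`_j.2); first by move=> j; apply: (polyOverP (pF _)).
rewrite /lcomb -(pair_bigA _ (fun (i : 'I_n) (j : 'I_m.+1) => (p i)`_j * (e i * x ^+ j))) /=.
apply: eq_bigr => i _.
have si : (size (p i) <= m.+1)%N.
 have [->|pi] := eqVneq (p i) 0; first by rewrite size_poly0.
 exact: leq_trans (leq_addr _ _) (sp i (ltn_ord i) pi).
by rewrite (horner_coef_wide _ si) mulr_suml; apply: eq_bigr => j _; rewrite mulrAC mulrA.
Qed.

Lemma Lm_rk m (G : {pred M}) : (forall y, y \in G -> Lm F x L m y) ->
 rk F G #|{: 'I_n * 'I_m.+1}|.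
Proof.
move=> GL f fG ind.
have [||c [cF c0 [i ci]]] := @span_dep _ F _ _ (fun j : 'I_n * 'I_m.+1 => e j.1 * x ^+ j.2) f.
- by move=> i; apply: Lm_span; apply: GL.
- by rewrite card_ord.
by have := ind c cF c0 i; move/eqP: ci.
Qed.

(* If L(x) contains a function h outside <1, x>, then h - a x has fewer poles
  than x for a suitable constant a. *)
Lemma deg_drop i1 : (0 < i1)%N -> (i1 < n)%N -> d i1 = 1%N -> exists h n', [/\ h \in L, h \notin F, hasdeg h n' & (n' < n)%N].
Proof.
move=> i1p n1 d1.
have [[n0 e0 d0] eLm ind _ rep] := bk.
have [e1m _] := eLm i1 n1; rewrite d1 in e1m.
have [e1L _] := e1m.
have [O [pO xO]] := place_inf ffL xF; have [vO FO] := pO.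
have x0 := x_neq0 xF; have xm := notO_mx vO xO.
have nLO : L \nsub O by exists x.
have [||a aF ha] := residue aclM ffL vO FO nLO (y := e i1 / x).
- by rewrite rpred_div.
- by have [_ /(_ O pO)[_]] := e1m; rewrite expr1; apply.
pose h := e i1 - a * x.
have hx : h / x \in mx O by rewrite mulrBl mulfK.
have hL : h \in L by rewrite rpredB // rpredM // FL.
have hF' : h \notin F.
 apply/negP => hF'; pose p i : {poly M} := if i == 0%N then - h%:P - a%:P * 'X else if i == i1 then 1 else 0.
 have pF i : p i \over F.
  rewrite /p; do 2?case: ifP => _; rewrite ?rpred1 ?rpred0 //.
  by rewrite rpredB ?rpredN ?rpredM ?polyOverC ?polyOverX.
 have : lcomb x e n p = 0.
  rewrite /lcomb (bigD1 (Ordinal n0)) //= (bigD1 (Ordinal n1)) -?val_eqE /= -?lt0n //.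
  rewrite big1 => [|i /andP[]].
   rewrite /p /= e0 eqxx -leqn0 leqNgt i1p /= hornerD !hornerN hornerM hornerX !hornerC /h; ring.
  by rewrite -!val_eqE /= /p => /negPf -> /negPf ->; rewrite horner0 mul0r.
 by move=> /(ind p pF)/(_ i1 n1)/eqP; rewrite /p -leqn0 leqNgt i1p eqxx /= oner_eq0.
have [n' [e' [d' bk']]] := hasdeg_ex hL hF'.
exists h, n'; split=> //; first by exists e', d'.
(* Dimension count: if h had degree at least n, products of powers of h with n functions independent
   over F(h), together with high powers of x, would be too many independent elements of one space
   [Lm]. *)
rewrite ltnNge; apply/negP => le.
have h0 : h != 0 by apply: contraNneq hF' => ->; rewrite rpred0.
have [[_ _ _] eLm' ind' _ _] := bk'.
have eL' i : (i < n)%N -> e' i \in L.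
 by move=> lt; have [[]] := eLm' i (leq_trans lt le).
have /choice[q hq] : forall i : 'I_n, exists q : {poly M},
  [/\ q \over F, q != 0 & exists m, Lm F x L m (q.[x] * e' i)].
 by move=> i; exact: (denom ffL xL xF (eL' i (ltn_ord i))).
pose Q := \prod_i q i.
have QF : Q \over F by apply: rpred_prod => i _; have [] := hq i.
have Q0 : Q != 0 by apply/prodf_neq0 => i _; have [] := hq i.
have Qx0 := transcF ffL xF QF Q0.
have /choice[mc hmc] : forall i : 'I_n, exists m, Lm F x L m (Q.[x] * e' i).
 move=> i; have [qF q0 [m qm]] := hq i.
 pose R := \prod_(l | l != i) q l.
 have RF : R \over F by apply: rpred_prod => l _; have [] := hq l.
 exists (size R + m)%N; rewrite /Q (bigD1 i) //= -/R [q i * R]mulrC hornerM -mulrA.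
 by apply: LmM qm; apply: Lm_poly => //; apply: leqnSn.
pose c := (\max_i mc i)%N.
have cLm i : Lm F x L c (Q.[x] * e' (i : 'I_n)).
 by apply: Lm_le (hmc i); apply: leq_bigmax.
have hLm : Lm F x L 1 h.
 have naF : - a \in F by rewrite rpredN.
 have := LmD e1m (LmM (proj2 (LmF ffL x (- a)) naF) (LmX xL xF 1)).
 by rewrite expr1 mulNr.
have pL : x^-1 \in L by rewrite rpredV.
have xi0 : x^-1 != 0 by rewrite invr_eq0.
have [N [N0 ord _ _]] := unif aclM ffL vO FO pL xm xi0.
have hx0 : h / x != 0 by rewrite mulf_neq0.
have [r [u [hxE uu uL /(_ hx) r0]]] := ord _ (rpred_div hL xL) hx0 (mx_sub hx).
(* The n(m+1) products and T powers of x exceed the dimension n(m+c+1) by one. With m = N T the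
   products have smaller poles at O than each of these powers. *)
pose m := (N * (n * c).+1)%N.
pose T := (n * c).+1.
pose I := ('I_n * 'I_m.+1 + 'I_T)%type.
pose f (i : I) := match i with
 | inl ij => h ^+ ij.2 * (Q.[x] * e' ij.1)
 | inr t => x ^+ (m + c - t) end.
have hpow i : Lm F x L i (h ^+ i).
 elim: i => [|i IH]; first by rewrite expr0; apply/(LmF ffL x); rewrite rpred1.
 by rewrite exprS -add1n; apply: LmM.
have [||a' [aF' a0 [i0 ai0]]] := @span_dep _ F I ('I_n * 'I_(m + c).+1)%type
  (fun j : 'I_n * 'I_(m + c).+1 => e j.1 * x ^+ j.2) f.
- move=> i; apply: Lm_span; case: i => [[j i]|t] /=.
  apply: LmM; last exact: cLm.
  by apply: Lm_le (hpow i); rewrite -ltnS.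
 by apply: Lm_le (LmX xL xF _); apply: leq_subr.
- rewrite card_sum !card_prod !card_ord /T /m.
 by move: (N * _)%N => mm; rewrite addnS ltnS !mulnS mulnDr addnA.
move: a0; rewrite big_sumType /=.
set S1 := \sum_(i : 'I_n * 'I_m.+1) _; set S2 := \sum_(i : 'I_T) _ => S12.
(* all terms of S1 vanish to order >= m at O, measured in N-th powers *)
have hS1 : (x ^+ m) ^+ 1 * (S1 / x ^+ (m + c)) ^+ N \in O.
 rewrite mulr_suml; apply: pw_sum => // -[j i] _ /=.
 rewrite -mulrA; apply: pw_mul => //; first exact: FO.
 have im : (i <= m)%N by rewrite -ltnS.
 have -> : h ^+ i * (Q.[x] * e' j) / x ^+ (m + c) =
   (Q.[x] * e' j) / x ^+ c * ((h / x) ^+ i * x^-1 ^+ (m - i)).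
  rewrite -[in x ^+ (m + c)](subnK im) !exprD expr_div_n exprVn.
  have := expf_neq0 i x0; have := expf_neq0 c x0; have := expf_neq0 (m - i) x0 => h1 h2 h3.
  by field; rewrite h1 h2 h3.
 apply: pw_mul => //; first by have [_ /(_ O pO)[_ /(_ xO)]] := cLm j.
 rewrite expr1 exprMn -exprM [(i * N)%N]mulnC exprM hxE exprMn -exprM.
 rewrite -exprM.
 have -> : x ^+ m = x ^+ i * x ^+ (m - i) by rewrite -exprD subnKC.
 have -> : x^-1 ^+ (r * i) = x^-1 ^+ i * x^-1 ^+ (r.-1 * i).
  by rewrite -exprD -mulSn prednK.
 have -> : x^-1 ^+ ((m - i) * N) = x^-1 ^+ (m - i) * x^-1 ^+ ((m - i) * N.-1).
  by rewrite -exprD -mulnS prednK.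
 have -> : x ^+ i * x ^+ (m - i) * (x^-1 ^+ i * x^-1 ^+ (r.-1 * i) * u ^+ i *
   (x^-1 ^+ (m - i) * x^-1 ^+ ((m - i) * N.-1))) =
   x^-1 ^+ (r.-1 * i) * u ^+ i * x^-1 ^+ ((m - i) * N.-1).
  rewrite ![x^-1 ^+ i]exprVn ![x^-1 ^+ (m - i)]exprVn.
  have := expf_neq0 i x0; have := expf_neq0 (m - i) x0 => h1 h2.
  by field; rewrite h1 h2.
 by rewrite !rpredM ?rpredX ?(mx_sub xm) // un_O.
have a2 t : a' (inr t) = 0.
 pose g : {poly M} := \poly_(t < T) a' (inr (inord t)).
 have gF : g \over F.
  by apply/polyOverP => i; rewrite coef_poly; case: ifP => _; rewrite ?rpred0.
 have S2E : S2 / x ^+ (m + c) = g.[x^-1].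
  rewrite horner_poly mulr_suml; apply: eq_bigr => i _; rewrite inord_val -mulrA.
  congr (_ * _).
  have li : (i <= m + c)%N.
   apply: leq_trans (leq_addr _ _); rewrite /m.
   by have := ltn_ord i; rewrite /T => lt; apply: leq_trans (ltnW lt) _; rewrite leq_pmull.
  rewrite -[in X in _ / X](subnK li) exprD exprVn.
  by have := expf_neq0 (m + c - i) x0; have := expf_neq0 i x0 => h1 h2; field; rewrite h1 h2.
 have [g0|g0] := eqVneq g 0.
  have /polyP/(_ t) := g0; rewrite coef_poly ltn_ord coef0.
  by rewrite inord_val.
 exfalso; have [k [c0 [u0 [gE uu0 c0F u0c0]]]] := poly_ord vO FO xm gF g0.
 have kT : (k < T)%N.
  rewrite ltnNge; apply/negP => Tk.
  have sg : (size g <= T)%N by apply: size_poly.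
  have [l [gl ll]] : exists l, g`_l != 0 /\ forall i, (i < l)%N -> g`_i = 0.
   have ex : exists l, g`_l != 0 by exists (size g).-1; rewrite -lead_coefE lead_coef_eq0.
   case: (ex_minnP ex) => l gl lmin; exists l; split=> // i il; apply/eqP.
   by apply: contraTT il => /lmin; rewrite -leqNgt.
  have lT : (l < T)%N.
   by rewrite ltnNge; apply: contra gl => Tl; rewrite nth_default // (leq_trans sg).
  have : un O (g.[x^-1] / x^-1 ^+ l).
   rewrite (horner_coef_wide _ sg) mulr_suml (bigD1 (Ordinal lT)) //= mulfK ?expf_neq0 //.
   apply: un_add => //; first by apply: (un_F FO) => //; apply: (polyOverP gF).
   apply: mx_sum => // i il.
   have [lt|lt] := ltnP i l; first by rewrite ll // !mul0r mx0.
   have {lt}lt : (l < i)%N by rewrite ltn_neqAle lt andbT eq_sym; move: il; rewrite -val_eqE.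
   rewrite -mulrA mx_mulr ?FO ?(polyOverP gF) //.
   have -> : (i : nat) = ((i - l).-1.+1 + l)%N by rewrite prednK ?subn_gt0 // subnK // ltnW.
   by rewrite exprD mulfK ?expf_neq0 // exprS mx_mull // rpredX // mx_sub.
  move=> /un_nm; rewrite gE.
  have lk : (l < k)%N by exact: leq_trans Tk.
  have -> : k = ((k - l).-1.+1 + l)%N by rewrite prednK ?subn_gt0 // subnK // ltnW.
  rewrite exprD mulrAC mulfK ?expf_neq0 // exprS -mulrA mx_mull //.
  by rewrite rpredM ?rpredX ?(mx_sub xm) // un_O.
 have := hS1; have -> : S1 = - S2 by apply/eqP; rewrite -addr_eq0 S12.
 rewrite mulNr S2E exprNn mulrCA gE exprMn => hO.
 have : x ^+ m * (x^-1 ^+ (k * N) * u0 ^+ N) \in O.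
  suff -> : x ^+ m * (x^-1 ^+ (k * N) * u0 ^+ N) = (-1) ^+ N * ((-1) ^+ N * ((x ^+ m) ^+ 1 * ((x^-1 ^+ k) ^+ N * u0 ^+ N))) by apply: rpredM hO; rewrite rpredX ?rpredN1.
  by rewrite mulrA -exprMn mulrNN mulr1 expr1n mul1r expr1 -exprM.
 have lt : (k * N < m)%N by rewrite mulnC /m ltn_pmul2l.
 have -> : x ^+ m * (x^-1 ^+ (k * N) * u0 ^+ N) = x ^+ (m - k * N).-1.+1 * u0 ^+ N.
  have -> : ((m - k * N).-1.+1 = m - k * N)%N by rewrite prednK ?subn_gt0.
  rewrite -[in LHS](subnK (ltnW lt)) exprD exprVn mulrA mulfK //.
  by rewrite expf_neq0.
 set j := (m - k * N).-1 => hj.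
 have hx1 : x ^+ j.+1 \in O.
  by rewrite -[_ ^+ _](mulfK (expf_neq0 N (un_neq0 uu0))) rpredM // un_O // unV // unX.
 have hx2 : x^-1 ^+ j.+1 \in mx O by rewrite exprS mx_mull ?rpredX ?(mx_sub xm).
 have := mx_mulr hx1 hx2.
 by rewrite exprVn mulfV ?expf_neq0 // (negPf (mx1 O)).
have a1 : forall ij, a' (inl ij) = 0.
 move=> [j i]; have S10 : S1 = 0.
  by rewrite -[LHS]addr0 -[RHS]S12; congr (_ + _); rewrite /S2 big1 // => t _; rewrite a2 mul0r.
 pose g (j : nat) : {poly M} := oapp (fun j : 'I_n => \poly_(i < m.+1) a' (inl (j, inord i))) 0 (insub j).
 have gF l : g l \over F.
  rewrite /g; case: insubP => [l' _ _|_] /=; last exact: rpred0.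
  by apply/polyOverP => z; rewrite coef_poly; case: ifP => _; rewrite ?rpred0.
 have : lcomb h e' n' g = 0.
  transitivity (lcomb h e' n g).
   rewrite (lcomb_widen h e' g le); apply: eq_bigr => l _; congr (_.[_] * _).
   by case: ifP => // nl; rewrite /g insubF.
  apply: (mulfI Qx0); rewrite mulr0 -[RHS]S10 /S1.
  rewrite (eq_bigr (fun p => a' (inl (p.1, p.2)) * (h ^+ p.2 * (Q.[x] * e' p.1)))) => [|[? ?] _] //.
  rewrite -(pair_bigA _ (fun (j : 'I_n) (i : 'I_m.+1) => a' (inl (j, i)) * (h ^+ i * (Q.[x] * e' j)))) /=.
  rewrite /lcomb mulr_sumr; apply: eq_bigr => l _; rewrite /g valK /= horner_poly mulr_suml mulr_sumr.
  by apply: eq_bigr => z _; rewrite inord_val; ring.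
 move=> /(ind' g gF)/(_ j (leq_trans (ltn_ord j) le)); rewrite /g valK /= => /polyP/(_ i).
 by rewrite coef_poly ltn_ord inord_val coef0.
by case: i0 ai0 => [ij|t]; rewrite ?a1 ?a2 eqxx.
Qed.

End AtX.
End Degree.

(** * Vector fields: eigenfunctions force rationality *)

Section Field.
Variable M : fieldType.
Hypotheses (char0 : char_0 M) (aclM : acl M).
Variables (F L : sfield M).
Hypothesis ffL : ffield F L.

Let hF : relacl F. Proof. by case: ffL. Qed.
Let FL : F \sub L. Proof. by case: ffL. Qed.

(** A polynomial in tau that annihilates g splits over F. Peeling off its linear factors, the last
    vector outside H is an eigenvector modulo H. *)
Lemma eigen (G H : M -> Prop) (tau : M -> M) g n :
 (forall x y, G x -> G y -> G (x + y)) -> (forall c x, c \in F -> G x -> G (c * x)) ->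
 (forall x, G x -> G (tau x)) -> H 0 ->
 (forall c x, c \in F -> c != 0 -> H (c * x) -> H x) ->
 (forall x y, G x -> G y -> tau (x + y) = tau x + tau y) ->
 (forall c x, c \in F -> G x -> tau (c * x) = c * tau x) ->
 (forall e : 'I_n.+1 -> M, (forall i, G (e i)) -> ~ indep F e) ->
 G g -> ~ H g -> exists g' a, [/\ G g', ~ H g', a \in F & H (tau g' - a * g')].
Proof.
move=> GD GZ Gt H0 HZ tD tZ fin Gg Hg.
have Git i : G (iter i tau g) by elim: i => //= i; apply: Gt.
have G0 : G 0 by rewrite -(mul0r g); apply: GZ; rewrite ?rpred0.
have t0 : tau 0 = 0.
 by have := tD 0 0 G0 G0; rewrite addr0 => /eqP; rewrite -subr_eq0 opprD addNKr oppr_eq0 => /eqP.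
have [c [cF c0 [i0 ci0]]] := not_indep (fin (fun i => iter i tau g) (fun i => Git i)).
pose ev (p : {poly M}) := \sum_(i < size p) p`_i * iter i tau g.
have evw (p : {poly M}) m : (size p <= m)%N -> ev p = \sum_(i < m) p`_i * iter i tau g.
 move=> le; rewrite /ev (big_ord_widen _ (fun i => p`_i * iter i tau g) le) big_mkcond.
 by apply: eq_bigr => i _; case: ltnP => // h; rewrite nth_default ?mul0r.
have Gsum m (f : nat -> M) : (forall i, f i \in F) -> G (\sum_(i < m) f i * iter i tau g).
 by move=> fF; apply: big_ind => // i _; apply: GZ.
have Gev p : p \over F -> G (ev p) by move=> pF; apply: Gsum => i; apply: (polyOverP pF).
have evX p a : p \over F -> ev (('X - a%:P) * p) = tau (ev p) - a * ev p.
 move=> pF.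
 have tsum m (f : nat -> M) : (forall i, f i \in F) ->
   tau (\sum_(i < m) f i * iter i tau g) = \sum_(i < m) f i * iter i.+1 tau g.
  move=> fF; elim: m => [|m IH]; first by rewrite !big_ord0.
  by rewrite !big_ord_recr /= tD ?IH ?tZ //; [exact: Gsum|exact: GZ].
 have le : (size (('X - a%:P) * p)%R <= (size p).+1)%N.
  by apply: leq_trans (size_polyMleq _ _) _; rewrite size_XsubC.
 rewrite (evw _ _ le) {2}(evw p (size p).+1 (leqnSn _)) {1}/ev tsum; last by move=> i; apply: (polyOverP pF).
 have -> : \sum_(i < size p) p`_i * iter i.+1 tau g =
   \sum_(i < (size p).+1) (('X * p)%R)`_i * iter i tau g.
  by rewrite big_ord_recl coefXM mul0r add0r; apply: eq_bigr => i _; rewrite coefXM.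
 rewrite mulr_sumr -sumrB; apply: eq_bigr => i _.
 by rewrite mulrBl coefB coefCM mulrBl mulrA.
pose p : {poly M} := \poly_(i < n.+1) c (inord i).
have pF : p \over F.
 by apply/polyOverP => i; rewrite coef_poly; case: ifP => _; rewrite ?rpred0.
have p0 : p != 0.
 apply: contraNneq ci0 => /polyP/(_ i0); rewrite coef_poly ltn_ord coef0 => <-.
 by rewrite inord_val.
have evp : H (ev p).
 rewrite (evw p n.+1 (size_poly _ _)); suff -> : \sum_(i < n.+1) p`_i * iter i tau g = 0 by [].
 by rewrite -[RHS]c0; apply: eq_bigr => i _; rewrite coef_poly ltn_ord inord_val.
move sp : (size p) => m; elim: m p sp pF p0 evp => [|m IH] p sp pF p0 evp.
 by move/eqP: sp; rewrite size_poly_eq0 (negPf p0).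
case: m => [|m] in IH sp.
 case: Hg; apply: (HZ p`_0); first exact: (polyOverP pF).
  by have := p0; rewrite -lead_coef_eq0 lead_coefE sp.
 by move: evp; rewrite /ev sp big_ord1.
have [a ra] : exists a, root p a by apply: aclM; rewrite sp.
have aF : a \in F by apply: hF; exists p; split.
have /factor_theorem[q qE] := ra; rewrite mulrC in qE.
have q0 : q != 0 by apply: contraNneq p0 => q0; rewrite qE q0 mulr0.
have qF : q \over F.
 have -> : q = p %/ ('X - a%:P) by rewrite qE mulKp ?polyXsubC_eq0.
 by apply: polyOver_quo; rewrite // rpredB ?polyOverX ?polyOverC.
have sq : size q = m.+1.
 by move: sp; rewrite qE size_mul ?polyXsubC_eq0 // size_XsubC => -[].
have [Hq|Hq] := pselect (H (ev q)); first exact: (IH q).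
by exists (ev q), a; split=> //; [exact: Gev|rewrite -evX // -qE].
Qed.

(** For a = 0 integrate termwise; otherwise the terminating series of the terms - q^(i) / a^(i+1) is
    a solution. *)
Lemma solve_exp a (q : {poly M}) : a \in F -> q \over F ->
 exists r : {poly M}, r \over F /\ r^`() - a *: r = q.
Proof.
move=> aF qF; have [->|a0] := eqVneq a 0.
 exists (\poly_(i < (size q).+1) (if i == 0%N then 0 else q`_i.-1 / i%:R)); split.
  apply/polyOverP => i; rewrite coef_poly; do 2?case: ifP => _; rewrite ?rpred0 //.
  by rewrite rpred_div ?rpred_nat ?(polyOverP qF).
 rewrite scale0r subr0; apply/polyP => i; rewrite coef_deriv coef_poly ltnS /=.
 case: ltnP => h; last by rewrite mul0rn nth_default.
 by rewrite /= -(mulr_natr (_ / _)) divfK // natr_eq0.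
have [n] := ubnP (size q); elim: n q qF => // n IH q qF sq.
have [->|q0] := eqVneq q 0; first by exists 0; rewrite rpred0 deriv0 scaler0 subr0.
have [||r [rF rE]] := IH (a^-1 *: q^`()).
- by rewrite polyOverZ ?rpredV ?polyOver_deriv.
- by rewrite size_scale ?invr_eq0 //; apply: leq_trans (lt_size_deriv q0) _; rewrite -ltnS.
exists (r - a^-1 *: q); split; first by rewrite rpredB // polyOverZ ?rpredV.
rewrite derivB derivZ scalerBr scalerA divff // scale1r -rE; ring.
Qed.

Section VectorField.
Variable v : M -> M.
Hypotheses (vD : derOn L v) (vL : stab v L)
 (v0 : kills v F)
 (vst : forall O, place F O -> stab_in v L O)
 (vnz : exists2 y, y \in L & v y != 0).

(** L is algebraic over F(y), so a derivation that kills F and y is zero on L. *)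
Lemma v_neq0 y : y \in L -> y \notin F -> v y != 0.
Proof.
move=> yL yF; apply/eqP => vy; have [z zL /eqP[]] := vnz.
have [Fy FyP] := adjF F y.
have FyL : Fy \sub L by move=> w /FyP; apply: adj_min.
have z0D : derOn L (fun=> 0) by split=> *; rewrite ?mul0r ?mulr0 addr0.
have zalg : alg Fy z.
 have [_ _ /(_ y Fy yL yF FyP)[n rkn]] := ffL.
 by have [|p [pF p0 pz _]] := rk_alg rkn (y := z); [move=> i; rewrite rpredX|exists p].
apply: (der_unique char0 zalg vD z0D FyL zL) => w /FyP[p [q [pF qF q0 ->]]].
have vp (r : {poly M}) : r \over F -> v r.[y] = 0.
 move=> rF; rewrite (der_horner vD) //; last exact: polyOver_sub rF.
 by rewrite (dpoly0 (derOn_sub FL vD) v0) // ?horner0 ?vy ?mulr0 ?addr0.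
have pL (r : {poly M}) : r \over F -> r.[y] \in L.
 by move=> rF; apply: rpred_horner => //; apply: polyOver_sub rF.
by rewrite (derQ vD) ?pL // !vp // mul0r mulr0 subr0 mul0r.
Qed.

Lemma v_const y : y \in L -> v y = 0 -> y \in F.
Proof. by move=> yL /eqP; apply: contraTT => /(v_neq0 yL). Qed.

Lemma vZ c y : c \in F -> y \in L -> v (c * y) = c * v y.
Proof. by move=> cF yL; rewrite (vD.2 c y (FL cF) yL) (v0 cF) mul0r add0r. Qed.

Lemma v_poly (p : {poly M}) x : p \over F -> x \in L -> v p.[x] = p^`().[x] * v x.
Proof.
move=> pF xL; rewrite (der_horner vD) //; last exact: polyOver_sub pF.
by rewrite (dpoly0 (derOn_sub FL vD) v0) // horner0 add0r.
Qed.

Lemma polyL (p : {poly M}) x : p \over F -> x \in L -> p.[x] \in L.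
Proof. by move=> pF xL; apply: rpred_horner => //; apply: polyOver_sub pF. Qed.

Section Log.
Variables (O : sring M) (p : M).
Hypotheses (vO : valring O) (FO : F \sub O) (pL : p \in L) (pm : p \in mx O)
 (p0 : p != 0).

Lemma logder b r u N : b \in L -> b != 0 -> un O u -> u \in L -> b ^+ N = p ^+ r * u ->
 N%:R * (v b / b) = r%:R * (v p / p) + v u / u.
Proof.
move=> bL b0 uu uL E; have u0 := un_neq0 uu.
have ld w : w \in L -> w != 0 -> forall n, v (w ^+ n) / w ^+ n = n%:R * (v w / w).
 move=> wL w0 [|n]; first by rewrite expr0 (der1 vD) mul0r mul0r.
 rewrite (derX vD) //= [w ^+ n.+1]exprS.
 by have := expf_neq0 n w0 => h; field; rewrite h w0.
rewrite -!ld // E vD.2 ?rpredX //.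
by have := expf_neq0 r p0 => h; field; rewrite h u0.
Qed.

Lemma v_mx : v p / p \in O -> forall y, y \in L -> y \in mx O -> v y \in mx O.
Proof.
move=> vp y yL ym; have [->|y0] := eqVneq y 0; first by rewrite (der0 vD) mx0.
have [N [N0 ord _ _]] := unif aclM ffL vO FO pL pm p0.
have [r [u [E uu uL _]]] := ord y yL y0 (mx_sub ym).
have pO : place F O by [].
have NF : N%:R \in F by rewrite rpred_nat.
have Nn : N%:R != 0 :> M by rewrite natr_eq0 // -lt0n.
have -> : v y = y * (N%:R^-1 * (r%:R * (v p / p) + v u / u)).
 by rewrite -(logder yL y0 uu uL E); field; rewrite y0 Nn.
apply: mx_mull => //; rewrite rpredM //; first by rewrite FO ?rpredV.
apply: rpredD; first by rewrite rpredM // rpred_nat.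
by rewrite rpredM ?(vst pO) ?(un_O uu) // (un_O (unV uu)).
Qed.

(** Take the logarithmic derivative of y^N = p^r u modulo the maximal ideal, where that of the unit
    u vanishes. *)
Lemma log_rat mu a y : mu \in F -> a \in F -> v p / p - mu \in mx O -> y \in L -> y != 0 ->
 y \in O -> v y = a * y -> exists N r : nat, (0 < N)%N /\ N%:R * a = r%:R * mu.
Proof.
move=> muF aF vp yL y0 yO vy.
have [N [N0 ord _ res]] := unif aclM ffL vO FO pL pm p0.
have [r [u [E uu uL _]]] := ord y yL y0 yO.
exists N, r; split=> //; apply/eqP; rewrite -subr_eq0; apply/eqP.
apply: (mx_F FO); first by rewrite rpredB // rpredM // rpred_nat.
have vpO : v p / p \in O by rewrite -[v p / p](subrK mu) rpredD ?(mx_sub vp) // FO.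
have := logder yL y0 uu uL E; rewrite vy mulfK // => ->.
have -> : r%:R * (v p / p) + v u / u - r%:R * mu = r%:R * (v p / p - mu) + v u / u by ring.
apply: mx_add => //; first by rewrite mx_mulr // rpred_nat.
have [c cF uc] := res u uL (un_O uu).
apply: mx_mull; last exact: un_O (unV uu).
have -> : v u = v (u - c) by rewrite (derB vD uL (FL cF)) (v0 cF) subr0.
by apply: v_mx => //; rewrite rpredB // FL.
Qed.
End Log.

(** Regularity of v, applied to b / t^m at the poles of t: the leading parts of t v b and m b v t
    cancel. *)
Lemma v_LmS t m b : t \in L -> t \notin F -> Lm F t L 2 (v t) -> Lm F t L m b ->
 Lm F t L m.+1 (v b) /\ Lm F t L m.+1 (t * v b - m%:R * (v t * b)).
Proof.
move=> tL tF [_ hw] [bL hb]; have t0 := x_neq0 tF.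
have key O : place F O -> t \notin O ->
  v (b / t ^+ m) = (t * v b - m%:R * (v t * b)) / t ^+ m.+1.
 move=> pO tO; rewrite (derQ vD) ?rpredX ?expf_neq0 // (derX vD) //.
 have h := expf_neq0 m t0; case: m h {hb} => [|m] h; first by rewrite /= expr0 expr1n expr1; field; rewrite t0.
 by rewrite /= !exprS; have := expf_neq0 m t0 => h'; field; rewrite h' t0.
have st O : place F O -> t \notin O -> (t * v b - m%:R * (v t * b)) / t ^+ m.+1 \in O.
 move=> pO tO; rewrite -(key O pO tO); apply: (vst pO); first by rewrite rpred_div // rpredX.
 by have [_ ->] := hb O pO.
split; split=> [|O pO]; rewrite ?vL //.
- have [h1 h2] := hb O pO; have [vO _] := pO.
 split=> tO; first by rewrite vst ?h1.
 have -> : v b / t ^+ m.+1 = t^-1 * ((t * v b - m%:R * (v t * b)) / t ^+ m.+1) +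
   m%:R * ((v t / t ^+ 2) * (b / t ^+ m)).
  by rewrite exprS; have := expf_neq0 m t0 => h'; field; rewrite h' t0.
 rewrite rpredD // rpredM ?st ?rpred_nat ?(mx_sub (notO_mx vO tO)) //.
 by rewrite rpredM ?h2 //; apply: (proj2 (hw O pO)).
- by rewrite rpredB ?rpredM ?vL ?rpred_nat.
- have [h1 h2] := hb O pO; split=> tO; last exact: st.
 by rewrite rpredB // !rpredM ?rpred_nat ?(vst pO) ?h1.
Qed.

(* Generic consequence of the degree bounds: functions with poles bounded by those of t. *)
Lemma Lm_fin t m : t \in L -> t \notin F -> exists n, forall e : 'I_n.+1 -> M,
 (forall i, Lm F t L m (e i)) -> ~ indep F e.
Proof.
move=> tL tF; have [n [e [d bk]]] := hasdeg_ex aclM ffL tL tF.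
pose G : {pred M} := fun y => `[< Lm F t L m y >].
exists #|{: 'I_n * 'I_m.+1}| => e' he'; apply: (Lm_rk bk (m := m) (G := G)).
 by move=> y /asboolP.
by move=> i; apply/asboolP.
Qed.

Lemma all_adj t : t \in L -> t \notin F ->
 (forall m b, Lm F t L m b -> exists2 p : {poly M}, p \over F & b = p.[t]) ->
 forall y, y \in L -> adj F t y.
Proof.
move=> tL tF h y yL; have [q [qF q0 [m /h[p pF E]]]] := denom ffL tL tF yL.
have qt := transcF ffL tF qF q0.
by exists p, q; split=> //; rewrite -E mulrAC divff // mul1r.
Qed.

(* If v t = mu t + c and some b outside F[t] has no poles outside those of t, triangularize. *)
Lemma polys_or_eigen t mu c : t \in L -> t \notin F -> mu \in F -> c \in F -> v t = mu * t + c ->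
 (forall y, y \in L -> adj F t y) \/
 exists m g a (q : {poly M}), [/\ Lm F t L m g, a \in F, q \over F, v g - a * g = q.[t] &
  forall p : {poly M}, p \over F -> g != p.[t]].
Proof.
move=> tL tF muF cF vt.
have [h|] := pselect (forall m b, Lm F t L m b -> exists2 p : {poly M}, p \over F & b = p.[t]).
 by left; apply: all_adj.
move=> /existsNP[m /existsNP[b /not_implyP[bm hb]]]; right.
have vm y : Lm F t L m y -> Lm F t L m (v y).
 move=> ym; have [yL hy] := ym; split=> [|O pO]; first exact: vL.
 have [h1 h2] := hy O pO; have [vO FO] := pO; split=> tO; first by rewrite vst ?h1.
 have t0 := x_neq0 tF.
 have -> : v y / t ^+ m = v (y / t ^+ m) + m%:R * (y / t ^+ m) * (mu + c / t).
  rewrite (derQ vD) ?rpredX ?expf_neq0 // (derX vD) // vt.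
  have h := expf_neq0 m t0; case: m h {hb bm ym hy h1 h2} => [|m] h; first by rewrite /= expr0 expr1n; field; rewrite t0.
  by rewrite /= !exprS; have := expf_neq0 m t0 => h'; field; rewrite h' t0.
 have yO := h2 tO.
 apply: rpredD; first by apply: (vst pO) => //; rewrite rpred_div // rpredX.
 apply: rpredM; first by rewrite rpredM // rpred_nat.
 apply: rpredD; first exact: FO.
 by apply: rpredM; [exact: FO|exact: mx_sub (notO_mx vO tO)].
have [n fin] := Lm_fin m tL tF.
pose H y := exists2 p : {poly M}, p \over F & y = p.[t].
have [||||||g [a [gm gH aF [q qF E]]]] := eigen (G := Lm F t L m) (H := H) (tau := v) _ _ vm _ _ _ _ fin bm hb.
- by move=> x y; apply: LmD.
- by move=> e x eF xm; rewrite -[m]add0n; apply: LmM => //; apply/(LmF ffL t).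
- by exists 0; rewrite ?rpred0 ?horner0.
- move=> e x eF e0 [p pF E]; exists (e^-1%:P * p).
  by rewrite rpredM // polyOverC rpredV.
 by rewrite hornerM hornerC -E mulKf.
- by move=> x y [xL _] [yL _]; rewrite vD.1.
- by move=> e x eF [xL _]; rewrite vZ.
by exists m, g, a, q; split=> // p pF; apply/eqP => gE; apply: gH; exists p.
Qed.

(** Otherwise [polys_or_eigen] and [solve_exp] give a nonzero y, not in F[t], with v y = a y. At a
    pole of t the logarithmic derivative of 1/t is -1/t, of residue 0, so [log_rat] forces a = 0,
    and y is a constant. *)
Lemma lin1 t : t \in L -> v t = 1 -> forall y, y \in L -> adj F t y.
Proof.
move=> tL vt; have tF : t \notin F.
 by apply/negP => /v0; rewrite vt => /eqP; rewrite oner_eq0.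
have [|//|[m [g [a [q [gm aF qF E gnp]]]]]] := polys_or_eigen tL tF (rpred0 _) (rpred1 _).
 by rewrite mul0r add0r.
have [r [rF rE]] := solve_exp aF qF.
have gL : g \in L by case: gm.
pose y := g - r.[t]; have yL : y \in L by rewrite rpredB // polyL.
have vy : v y = a * y.
 rewrite (derB vD) ?polyL // v_poly // vt mulr1 /y.
 move: E; rewrite -rE hornerD hornerN hornerZ => E.
 by rewrite -(subrK (a * g) (v g)) E; ring.
have y0 : y != 0 by rewrite subr_eq0; apply: gnp.
have [O [pO tO]] := place_inf ffL tF; have [vO FO] := pO.
have t0 := x_neq0 tF.
have pm := notO_mx vO tO; have pL : t^-1 \in L by rewrite rpredV.
have vp : v t^-1 / t^-1 - 0 \in mx O.
 rewrite (derV vD) // vt subr0; have -> : -1 / t ^+ 2 / t^-1 = - t^-1 by rewrite invrK mulN1r mulNr expr2 invfM divfK.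
 by rewrite mx_oppE.
have ti0 : t^-1 != 0 by rewrite invr_eq0.
have a0 : a = 0.
 have [yO|yO] := boolP (y \in O).
  have [N [s [N0]]] := log_rat vO FO pL pm ti0 (rpred0 _) aF vp yL y0 yO vy.
  by rewrite mulr0 => /eqP; rewrite mulf_eq0 natr_eq0 // -leqn0 leqNgt N0 => /eqP.
 have yiO := mx_sub (notO_mx vO yO).
 have yi0 : y^-1 != 0 by rewrite invr_eq0.
 have vyi : v y^-1 = - a * y^-1 by rewrite (derV vD) // vy; field.
 have yiL : y^-1 \in L by rewrite rpredV.
 have naF : - a \in F by rewrite rpredN.
 have [N [s [N0]]] := log_rat vO FO pL pm ti0 (rpred0 _) naF vp yiL yi0 yiO vyi.
 by rewrite mulr0 => /eqP; rewrite mulf_eq0 natr_eq0 // -leqn0 leqNgt N0 oppr_eq0 => /eqP.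
have yF : y \in F by apply: v_const; rewrite // vy a0 mul0r.
have rF' : r + y%:P \over F by rewrite rpredD ?polyOverC.
by have := gnp _ rF'; rewrite hornerD hornerC /y addrC subrK eqxx.
Qed.

End VectorField.
End Field.

Section VectorField.
Variable M : fieldType.
Hypotheses (char0 : char_0 M) (aclM : acl M).
Variables (F L : sfield M).
Hypothesis ffL : ffield F L.

Let hF : relacl F. Proof. by case: ffL. Qed.
Let FL : F \sub L. Proof. by case: ffL. Qed.

Variable v : M -> M.
Hypotheses (vD : derOn L v) (vL : stab v L)
 (v0 : kills v F)
 (vst : forall O, place F O -> stab_in v L O)
 (vnz : exists2 y, y \in L & v y != 0).

(** A basis over F(z) together with z stays independent over F(t): rewritten in z, a relation would
    equate degrees divisible by N with degrees congruent to 1 modulo N. *)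
Lemma root_degree t z k N n m : t \in L -> t \notin F -> z \in L -> z \notin F ->
 k \in F -> (1 < N)%N -> t = k * z ^+ N ->
 hasdeg F L z n -> hasdeg F L t m -> (n < m)%N.
Proof.
move=> tL tF zL zF kF N1 tE [e [d bz]] [e' [d' bt]].
have k0 : k != 0 by apply: contraNneq tF => k0; rewrite tE k0 mul0r rpred0.
have [[n0 e0 _] eLm ind _ _] := bz.
pose f i := if (i < n)%N then e i else z.
apply: (deg_max ffL tF bt (e' := f)).
 by move=> i _; rewrite /f; case: ltnP => // lt; have [[]] := eLm i lt.
move=> p pF; rewrite /lcomb big_ord_recr /= {2}/f ltnn => E.
pose q : {poly M} := k *: 'X^N.
have qF : q \over F by rewrite polyOverZ // rpredX // polyOverX.
have sq : size q = N.+1 by rewrite size_scale // size_polyXn.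
have qz : q.[z] = t by rewrite hornerZ hornerXn.
have s1 : (1 < size q)%N by rewrite sq ltnS ltnW.
pose P i := p i \Po q + (if i == 0%N then (p n \Po q) * 'X else 0).
have PF i : P i \over F.
 apply: rpredD; first exact: polyOver_comp.
 by case: ifP => _; rewrite ?rpred0 // rpredM ?polyOver_comp ?polyOverX.
have : lcomb z e n P = 0.
 rewrite /lcomb /P; under eq_bigr do rewrite hornerD mulrDl.
 rewrite big_split /= -[RHS]E; congr (_ + _).
  by apply: eq_bigr => i _; rewrite /f ltn_ord horner_comp qz.
 rewrite (bigD1 (Ordinal n0)) //= big1 => [|i].
  by rewrite hornerM horner_comp qz hornerX e0 mulr1 addr0.
 by rewrite -val_eqE /= => /negPf ->; rewrite horner0 mul0r.
move=> /(ind P PF) P0.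
have pz i : (p i \Po q == 0) = (p i == 0) by rewrite comp_poly_eq0.
have pn : p n = 0.
 apply/eqP/negPn/negP => pn.
 have := P0 0%N n0; rewrite /P eqxx => /eqP; rewrite addr_eq0 => /eqP.
 move=> /(congr1 (fun p : {poly M} => (size p).-1)); rewrite size_polyN size_mulX ?pz //=.
 have := size_comp_poly (p 0%N) q; rewrite sq /= => ->.
 have := size_comp_poly (p n) q; rewrite sq /=.
 have : (0 < size (p n \Po q))%N by rewrite size_poly_gt0 pz.
 case: (size (p n \Po q)) => //= a _ -> /(congr1 (modn^~ N)).
 by rewrite modnMl -addn1 modnMDl modn_small.
move=> i; rewrite ltnS leq_eqVlt => /orP[/eqP -> //|lt].
have := P0 i lt; rewrite /P pn comp_poly0 mul0r if_same addr0 => /eqP.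
by rewrite pz => /eqP.
Qed.

(** Induction on [L : F(t)]. If L is not F(t), there is a y outside F[t] with v y = a y up to a
    resonant term. If a = i mu, then y / t^i has constant derivative and [lin1] applies. Otherwise a
    is a rational multiple of mu, so powers of y and t agree up to a constant, and t is a constant
    times a proper power of some z of smaller degree. *)
Lemma lin2 t mu : t \in L -> t \notin F -> mu \in F -> v t = mu * t ->
 exists z, [/\ z \in L, z \notin F & forall y, y \in L -> adj F z y].
Proof.
move=> tL tF; have [m hm] := hasdeg_ex aclM ffL tL tF.
elim/ltn_ind: m t tL tF hm mu => m IH t tL tF hm mu muF vt.
have t0 := x_neq0 tF.
have mu0 : mu != 0.
 have := v_neq0 char0 ffL vD v0 vnz tL tF; rewrite vt mulf_eq0 negb_or.
 by case/andP.
have [|all|[k [g [a [q [gm aF qF E gnp]]]]]] :=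
  polys_or_eigen aclM ffL vD vL v0 vst tL tF muF (rpred0 F).
- by rewrite addr0.
- by exists t.
have gL : g \in L by case: gm.
have vtn i : v (t ^+ i) = i%:R * mu * t ^+ i.
 rewrite (derX vD) // vt; case: i => [|i]; first by rewrite !mul0r.
 by rewrite /= exprS; ring.
have vpoly (r : {poly M}) : r \over F ->
  v r.[t] - a * r.[t] = \sum_(i < size r) r`_i * (i%:R * mu - a) * t ^+ i.
 move=> rF; rewrite horner_coef (der_sum vD) => [|i _].
  rewrite mulr_sumr -sumrB; apply: eq_bigr => i _.
  by rewrite (vZ ffL vD v0) ?(polyOverP rF) ?rpredX // vtn; ring.
 by rewrite rpredM ?rpredX // FL // (polyOverP rF).
(* Solves v r(t) - a r(t) = q(t) coefficientwise. At a resonant index, i mu = a, the division by 0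
   returns 0 and that term of q remains. *)
pose r : {poly M} := \poly_(i < size q) (q`_i / (i%:R * mu - a)).
have rF : r \over F.
 apply/polyOverP => i; rewrite coef_poly; case: ifP => _; rewrite ?rpred0 //.
 by rewrite rpred_div ?rpredB ?rpredM ?rpred_nat // (polyOverP qF).
pose y := g - r.[t]; have rL := polyL ffL rF tL.
have yL : y \in L by rewrite rpredB.
have vyE : v y - a * y = \sum_(i < size q) (if i%:R * mu == a then q`_i else 0) * t ^+ i.
 rewrite (derB vD) //.
 have -> : v g - v r.[t] - a * y = (v g - a * g) - (v r.[t] - a * r.[t]) by rewrite /y; ring.
 rewrite E vpoly // (horner_coef q) [X in _ - X](_ : _ =
   \sum_(i < size q) r`_i * (i%:R * mu - a) * t ^+ i).
  rewrite -sumrB; apply: eq_bigr => i _; rewrite coef_poly ltn_ord -mulrBl; congr (_ * _).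
  case: eqVneq => [->|ne]; first by rewrite subrr mulr0 subr0.
  by rewrite divfK ?subrr // subr_eq0.
 rewrite (big_ord_widen _ (fun i => r`_i * (i%:R * mu - a) * t ^+ i) (size_poly _ _)) big_mkcond /=.
 by apply: eq_bigr => i _; case: ltnP => // h; rewrite nth_default ?mul0r.
have ynp (p : {poly M}) : p \over F -> y != p.[t].
 move=> pF; rewrite subr_eq -hornerD; apply: gnp; exact: rpredD.
have [[i aE]|na] := pselect (exists i : nat, i%:R * mu = a).
 have vy : v y - a * y = q`_i * t ^+ i.
  rewrite vyE; have [lt|le] := ltnP i (size q).
   rewrite (bigD1 (Ordinal lt)) //= aE eqxx big1 ?addr0 // => j ne.
   rewrite ifN ?mul0r // -aE (inj_eq (mulIf mu0)); apply: contra ne.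
   rewrite -subr_eq0; have [jl|jl] := leqP i j.
    rewrite -natrB // natr_eq0 // subn_eq0 => jl'.
    by rewrite -val_eqE /= eqn_leq jl jl'.
   rewrite -oppr_eq0 opprB -natrB 1?ltnW // natr_eq0 // subn_eq0 => jl'.
   by rewrite leqNgt jl in jl'.
  rewrite (nth_default _ le) mul0r big1 // => j _.
  rewrite ifN ?mul0r // -aE (inj_eq (mulIf mu0)).
  have jl : (j < i)%N by apply: leq_trans (ltn_ord j) le.
  by rewrite -subr_eq0 -oppr_eq0 opprB -natrB 1?ltnW // natr_eq0 // subn_eq0 -ltnNge.
 have ti0 : t ^+ i != 0 by rewrite expf_neq0.
 have vz : v (y / t ^+ i) = q`_i.
  rewrite (derQ vD) ?rpredX // vtn aE.
  have -> : v y = q`_i * t ^+ i + a * y by rewrite -vy subrK.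
  by field.
 have zL : y / t ^+ i \in L by rewrite rpred_div ?rpredX.
 have qiF : q`_i \in F by apply: (polyOverP qF).
 have [q0|q0] := eqVneq q`_i 0.
  have zF : y / t ^+ i \in F by apply: (v_const char0 ffL vD v0 vnz); rewrite // vz q0.
  have hp : (y / t ^+ i)%:P * 'X^i \over F by rewrite rpredM ?polyOverC ?rpredX ?polyOverX.
  by have := ynp _ hp; rewrite hornerM hornerC hornerXn divfK // eqxx.
 have zL' : (q`_i)^-1 * (y / t ^+ i) \in L by rewrite rpredM // FL // rpredV.
 have vz1 : v ((q`_i)^-1 * (y / t ^+ i)) = 1.
  by rewrite (vZ ffL vD v0) ?rpredV // vz mulVf.
 exists ((q`_i)^-1 * (y / t ^+ i)); split=> //; last exact: (lin1 char0 aclM ffL vD vL v0 vst vnz zL' vz1).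
 by apply/negP => /v0; rewrite vz1 => /eqP; rewrite oner_eq0.
have vy : v y = a * y.
 apply/eqP; rewrite -subr_eq0 vyE big1 // => i _; case: eqP => [ia|_]; last by rewrite mul0r.
 by case: na; exists i.
have yF : y \notin F.
 by apply/negP => yF; have := ynp y%:P; rewrite polyOverC hornerC eqxx => /(_ yF).
have y0 := x_neq0 yF.
have tiF : t^-1 \notin F by rewrite rpredV.
have [O [pO tiO]] := place_inf ffL tiF; have [vO FO] := pO.
have tm : t \in mx O by rewrite -[t]invrK notO_mx.
have tO := mx_sub tm.
have yO : y \in O.
 rewrite rpredB //; first by have [_ /(_ O pO)[->]] := gm.
 by apply: rpred_horner => //; apply: polyOver_sub rF.
have lt0 : v t / t - mu \in mx O by rewrite vt mulfK // subrr mx0.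
have [N [s [N0 Ns]]] := log_rat char0 aclM ffL vD v0 vst vO FO tL tm t0 muF aF lt0 yL y0 yO vy.
pose D := gcdn N s; have D0 : (0 < D)%N by rewrite gcdn_gt0 N0.
have DN : N = (N %/ D * D)%N by rewrite divnK ?dvdn_gcdl.
have Ds : s = (s %/ D * D)%N by rewrite divnK ?dvdn_gcdr.
set N' := (N %/ D)%N in DN; set s' := (s %/ D)%N in Ds.
have D0' : D%:R != 0 :> M by rewrite natr_eq0 // -lt0n.
have Ns' : N'%:R * a = s'%:R * mu.
 by apply: (mulfI D0'); rewrite !mulrA -!natrM ![(D * _)%N]mulnC -DN -Ds.
have N'0 : (0 < N')%N by rewrite divn_gt0 // dvdn_leq ?dvdn_gcdl.
have N'1 : (1 < N')%N.
 rewrite ltn_neqAle N'0 andbT; apply/eqP => N'1; apply: na; exists s'.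
 by rewrite -Ns' -N'1 mul1r.
(* The Bezout relation A N' = B s' + 1 yields t = c^B z^N' for z = t^A / y^B. *)
have [A B AB _] := egcdnP s' N'0.
have cop : gcdn N' s' = 1%N.
 by apply/eqP; rewrite -(eqn_pmul2r D0) mul1n muln_gcdl -DN -Ds.
rewrite cop in AB.
have vyn j : v (y ^+ j) = j%:R * a * y ^+ j.
 rewrite (derX vD) // vy; case: j => [|j]; first by rewrite !mul0r.
 by rewrite /= exprS; ring.
pose c := y ^+ N' / t ^+ s'.
have tn0 j : t ^+ j != 0 by rewrite expf_neq0.
have yn0 j : y ^+ j != 0 by rewrite expf_neq0.
have c0 : c != 0 by rewrite mulf_neq0 ?invr_eq0.
have cF : c \in F.
 apply: (v_const char0 ffL vD v0 vnz); first by rewrite rpred_div ?rpredX.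
 by rewrite (derQ vD) ?rpredX // vtn vyn Ns'; field.
pose z := t ^+ A / y ^+ B.
have zE : t = c ^+ B * z ^+ N'.
 have yN : y ^+ N' = c * t ^+ s' by rewrite divfK.
 clearbody c.
 have -> : z ^+ N' = t ^+ (A * N') / (y ^+ N') ^+ B.
  by rewrite /z expr_div_n -!exprM [(B * N')%N]mulnC.
 rewrite AB yN exprMn exprD expr1 [(B * s')%N]mulnC exprM.
 have gen (a' b w : M) : a' != 0 -> b != 0 -> w = a' * ((b * w) / (a' * b)).
  by move=> a0 b0; field; rewrite a0 b0.
 by apply: gen; rewrite !expf_neq0.
have zL : z \in L by rewrite rpred_div ?rpredX.
have zF : z \notin F.
 by apply: contra tF => zF; rewrite zE rpredM ?rpredX.
have [nz hz] := hasdeg_ex aclM ffL zL zF.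
have ltz := root_degree tL tF zL zF (rpredX B cF) N'1 zE hz hm.
apply: (IH nz ltz z zL zF hz (A%:R * mu - B%:R * a)).
 by rewrite rpredB // rpredM // rpred_nat.
rewrite (derQ vD) ?rpredX // vtn vyn /z; by field.
Qed.

End VectorField.

(** * The Lie derivative on regular differentials *)

Section VectorField.
Variable M : fieldType.
Hypotheses (char0 : char_0 M) (aclM : acl M).
Variables (F L : sfield M).
Hypothesis ffL : ffield F L.

Let hF : relacl F. Proof. by case: ffL. Qed.
Let FL : F \sub L. Proof. by case: ffL. Qed.

Variable v : M -> M.
Hypotheses (vD : derOn L v) (vL : stab v L)
 (v0 : kills v F)
 (vst : forall O, place F O -> stab_in v L O)
 (vnz : exists2 y, y \in L & v y != 0).

Lemma v_Lm2 x : x \in L -> x \notin F -> Lm F x L 2 (v x).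
Proof.
move=> xL xF; split=> [|O pO]; first exact: vL.
have [vO FO] := pO; have x0 := x_neq0 xF; split=> xO; first exact: (vst pO).
have -> : v x / x ^+ 2 = - v x^-1 by rewrite (derV vD) // mulNr opprK.
by rewrite rpredN (vst pO) ?rpredV // mx_sub // notO_mx.
Qed.

Section Functionals.
Variables (x : M) (n : nat) (e : nat -> M) (d : nat -> nat) (Fx : sfield M).
Hypotheses (xL : x \in L) (xF : x \notin F) (bk : birk F L x n e d)
 (FxP : adj_is F x Fx).
Let w := v x.

Let w0 : w != 0. Proof. exact: (v_neq0 char0 ffL vD v0 vnz). Qed.
Let wL : w \in L. Proof. exact: vL. Qed.
Let eL i : (i < n)%N -> e i \in L. Proof. exact: (birk_eL bk). Qed.
Let FxL : Fx \sub L. Proof. by move=> y /FxP; apply: adj_min. Qed.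
Let pFx p : p \over F -> p.[x] \in Fx. Proof. exact: adj_poly. Qed.

Definition lin (l : M -> M) := (forall y y', y \in L -> y' \in L -> l (y + y') = l y + l y') /\
 (forall c y, c \in Fx -> y \in L -> l (c * y) = c * l y).

(* A stand-in for the regular differentials omega, through l y = Tr (y omega / dx). *)
Definition Om (l : M -> M) := lin l /\ forall i, (i < n)%N -> exists p : {poly M},
 [/\ p \over F, (size p <= (d i).-1)%N & l (e i) = p.[x]].

Lemma lin0 l : lin l -> l 0 = 0.
Proof.
by case=> h _; have := h 0 0 (rpred0 L) (rpred0 L); rewrite addr0 => /eqP;
 rewrite -subr_eq0 opprD addNKr oppr_eq0 => /eqP.
Qed.

Lemma lin_sum l (I : finType) (c f : I -> M) : lin l -> (forall i, c i \in Fx) ->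
 (forall i, f i \in L) -> l (\sum_i c i * f i) = \sum_i c i * l (f i).
Proof.
move=> ll cF fL; suff [] : l (\sum_i c i * f i) = \sum_i c i * l (f i) /\
 \sum_i c i * f i \in L by [].
apply: (big_ind2 (fun a b => l a = b /\ a \in L)); first by rewrite (lin0 ll) rpred0.
 by move=> a b a' b' [<- aL] [<- aL']; rewrite ll.1 // rpredD.
by move=> i _; rewrite ll.2 // rpredM // FxL.
Qed.

Lemma lin_eq l l' : lin l -> lin l' -> (forall i, (i < n)%N -> l (e i) = l' (e i)) ->
 forall y, y \in L -> l y = l' y.
Proof.
move=> ll ll' h y yL; have [c cF ->] := birk_coord ffL xF bk FxP yL.
by rewrite !lin_sum // => [|i|i]; rewrite ?eL //; apply: eq_bigr => i _; rewrite h.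
Qed.

Lemma Om_Lm l m b : Om l -> Lm F x L m b -> exists p : {poly M},
 [/\ p \over F, (size p <= m.-1)%N & l b = p.[x]].
Proof.
move=> [ll lp] bm; have [_ _ _ _ /(_ m b bm)[p [pF -> sp]]] := bk.
have /choice[q hq] : forall i : 'I_n, exists p : {poly M},
  [/\ p \over F, (size p <= (d i).-1)%N & l (e i) = p.[x]] by move=> i; apply: lp.
exists (\sum_(i < n) p i * q i); split.
- by apply: rpred_sum => i _; rewrite rpredM //; have [] := hq i.
- apply: (leq_trans (size_sum _ _ _)); apply/bigmax_leqP => i _.
 have [->|pi] := eqVneq (p i) 0; first by rewrite mul0r size_poly0.
 have [->|qi] := eqVneq (q i) 0; first by rewrite mulr0 size_poly0.
 rewrite size_mul //; have [_ sq _] := hq i; have := sp i (ltn_ord i) pi.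
 move: pi qi sq; rewrite -!size_poly_gt0.
 by move: (size _) (size _) (d i) => a b' c; lia.
- rewrite lin_sum // => [|i|i]; [|exact: pFx|exact: eL].
 by rewrite horner_sum; apply: eq_bigr => i _; rewrite hornerM; have [_ _ ->] := hq i.
Qed.

(** If l y = Tr (y omega / dx), this is the functional of the Lie derivative of omega along v: on
    F(x) the map c to v c / w is d/dx, which commutes with the trace. *)
Definition T (l : M -> M) y := v (l (w * y)) / w - l (v y).

Lemma Fx_val l y : Om l -> y \in L -> l y \in Fx.
Proof.
move=> [ll lp] yL; have [c cF ->] := birk_coord ffL xF bk FxP yL.
rewrite lin_sum // => [|i]; last exact: eL.
by apply: rpred_sum => i _; rewrite rpredM //; have [p [pF _ ->]] := lp i (ltn_ord i); apply: pFx.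
Qed.

Lemma v_Fx c : c \in Fx -> v c / w \in Fx.
Proof.
move=> /FxP[p [q [pF qF q0 ->]]].
rewrite (derQ vD) ?(polyL ffL) // !(v_poly ffL vD v0) // -/w.
have -> : (p^`().[x] * w * q.[x] - p.[x] * (q^`().[x] * w)) / q.[x] ^+ 2 / w =
 (p^`().[x] * q.[x] - p.[x] * q^`().[x]) / q.[x] ^+ 2 by field; rewrite q0 w0.
by rewrite rpred_div ?rpredB ?rpredM ?rpredX // pFx // polyOver_deriv.
Qed.

(** The direct degree bound on P' - Q is one too large. [v_LmS] gives R = X Q - d_i P with a good
    bound, and the top coefficient of X P' - d_i P cancels. *)
Lemma T_Om l : Om l -> Om (T l).
Proof.
move=> ol; have [ll lp] := ol; split; first split.
- move=> y y' yL yL'; have wy := rpredM wL yL; have wy' := rpredM wL yL'.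
 rewrite /T mulrDr (ll.1 _ _ wy wy') (vD.1 _ _ (FxL (Fx_val ol wy)) (FxL (Fx_val ol wy'))).
 by rewrite (vD.1 _ _ yL yL') (ll.1 _ _ (vL yL) (vL yL')); ring.
- move=> c y cF yL; have cL := FxL cF; have wy := rpredM wL yL.
 have cvy := rpredM cL (vL yL); have cwF := v_Fx cF.
 rewrite /T mulrCA (ll.2 _ _ cF wy) (vD.2 _ _ cL (FxL (Fx_val ol wy))) (vD.2 _ _ cL yL).
 have -> : v c * y + c * v y = (v c / w) * (w * y) + c * v y by field; rewrite w0.
 rewrite (ll.1 _ _ (rpredM (FxL cwF) wy) cvy) (ll.2 _ _ cwF wy) (ll.2 _ _ cF (vL yL)).
 by field; rewrite w0.
move=> i lt; have [[n0 e0 d0] eLm ind _ _] := bk; have [em _] := eLm i lt.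
have w2 := v_Lm2 xL xF; rewrite -/w in w2.
have [P [PF sP PE]] := Om_Lm ol (LmM w2 em).
have [vm zm] := v_LmS vD vL vst xL xF w2 em; rewrite -/w in zm.
have [Q [QF sQ QE]] := Om_Lm ol vm.
have [R [RF sR RE]] := Om_Lm ol zm.
have RQ : R = 'X * Q - (d i)%:R%:P * P.
 apply/eqP; rewrite -subr_eq0; apply: contraT => ne.
 have pF : R - ('X * Q - (d i)%:R%:P * P) \over F.
  by apply: rpredB => //; apply: rpredB; rewrite rpredM ?polyOverX ?polyOverC ?rpred_nat.
 have := transcF ffL xF pF ne.
 rewrite !(hornerD, hornerN, hornerM) hornerX hornerC -RE -PE -QE.
 have dF : - (d i)%:R \in Fx by rewrite rpredN rpred_nat.
 have xFx : x \in Fx by apply/FxP/adj_gen.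
 have veL := vL (eL lt); have weL := rpredM wL (eL lt).
 have -> : x * v (e i) - (d i)%:R * (w * e i) = x * v (e i) + (- (d i)%:R) * (w * e i) by ring.
 rewrite (ll.1 _ _ (rpredM xL veL) (rpredM (FxL dF) weL)) (ll.2 _ _ xFx veL) (ll.2 _ _ dF weL).
 by rewrite mulNr subrr eqxx.
exists (P^`() - Q); split; first by rewrite rpredB ?polyOver_deriv.
 have [->|ne] := eqVneq (P^`() - Q) 0; first by rewrite size_poly0.
 have : (size ('X * (P^`() - Q))%R <= d i)%N.
  have -> : 'X * (P^`() - Q) = ('X * P^`() - (d i)%:R%:P * P) - R by rewrite RQ; ring.
  apply: (leq_trans (size_polyD _ _)); rewrite geq_max size_polyN sR andbT.
  apply/leq_sizeP => j jd; rewrite coefB coefXM coefCM.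
  case: j jd => [|j] jd; first by move: jd; rewrite leqn0 => /eqP ->; rewrite mul0r subrr.
  rewrite coef_deriv /= -(mulr_natl P`_j.+1) -mulrBl.
  move: jd; rewrite leq_eqVlt => /orP[/eqP ->|jd]; first by rewrite subrr mul0r.
  by rewrite (leq_sizeP _ _ sP) ?mulr0 //; exact: jd.
 by rewrite mulrC size_mulX //; case: (d i).
by rewrite /T PE QE (v_poly ffL vD v0) // -/w mulfK // hornerD hornerN.
Qed.

Variable l0 : M -> M.
Hypotheses (ol0 : Om l0) (l0nz : exists2 y, y \in L & l0 y != 0).

Let ll0 : lin l0. Proof. by case: ol0. Qed.

Lemma lin_mul l g : lin l -> g \in L -> lin (fun y => l (g * y)).
Proof.
move=> ll gL; split=> [y y' yL yL'|c y cF yL]; first by rewrite mulrDr ll.1 ?rpredM.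
by rewrite mulrCA (ll.2 _ _ cF (rpredM gL yL)).
Qed.

Lemma l0_inj g : g \in L -> (forall i, (i < n)%N -> l0 (g * e i) = 0) -> g = 0.
Proof.
move=> gL h; apply/eqP; apply: contraT => g0; have [y yL /eqP[]] := l0nz.
have z0 : lin (fun=> 0) by split=> *; rewrite ?mulr0 ?addr0.
have := lin_eq (lin_mul ll0 gL) z0 h (y := y / g).
by rewrite mulrCA mulfV // mulr1; apply; rewrite rpred_div.
Qed.

(** The functionals obtained from l0 by multiplying with the e_j, together with l, are n + 1
    functionals on an n-dimensional space, hence dependent; l0 being nondegenerate, the dependence
    can be solved for l. *)
Lemma duality l : Om l -> exists2 g, g \in L & forall y, y \in L -> l y = l0 (g * y).
Proof.
move=> ol; have [ll _] := ol.
pose A (k : 'I_n + 'I_1) (i : 'I_n) := if k is inl j then l0 (e j * e i) else l (e i).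
pose z : 'I_n + 'I_1 := inr ord0.
have [||c [cF c0 [k ck]]] := vec_dep (F := Fx) (A := A).
- case=> [j|j] i; rewrite /A; apply: Fx_val => //; rewrite ?rpredM ?eL //.
- by rewrite card_sum !card_ord addn1.
pose h := \sum_(j < n) c (inl j) * e j.
have hL : h \in L by apply: rpred_sum => j _; rewrite rpredM ?eL // FxL.
have hE i : (i < n)%N -> c z * l (e i) + l0 (h * e i) = 0.
 move=> lt; have := c0 (Ordinal lt); rewrite big_sumType /= big_ord1 addrC => <-; congr (_ + _).
 have -> : h * e i = \sum_(j < n) c (inl j) * (e j * e i).
  by rewrite /h mulr_suml; apply: eq_bigr => j _; rewrite mulrA.
 by rewrite lin_sum // => j; rewrite rpredM ?eL.
have cN : c z != 0.
 apply: contraNneq ck => cN; case: k => [j|j]; last by rewrite (ord1 j) cN.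
 have h0 : h = 0 by apply: l0_inj => // i lt; rewrite -[RHS](hE i lt) cN mul0r add0r.
 by rewrite (birk_indep bk (c := fun j => c (inl j)) FxP).
have cNL := FxL (cF z).
have gL : - h / c z \in L by rewrite rpred_div ?rpredN.
exists (- h / c z) => // y yL.
apply: (lin_eq ll (lin_mul ll0 gL)) => // i lt.
have -> : - h / c z * e i = - (c z)^-1 * (h * e i) by ring.
rewrite ll0.2 ?rpredN ?rpredV ?rpredM ?eL //.
have -> : l0 (h * e i) = - (c z * l (e i)) by apply/eqP; rewrite -addr_eq0 addrC hE.
by field.
Qed.

(** The multipliers g for which g omega is regular, omega being the differential behind l0. *)
Definition GOm g := g \in L /\ Om (fun y => l0 (g * y)).

Lemma GOm_fin : exists N, forall f : 'I_N.+1 -> M, (forall i, GOm (f i)) -> ~ indep F f.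
Proof.
pose D := (\max_(i < n) d i)%N.
exists #|{: 'I_n * 'I_D}| => f fG ind.
have /choice[p hp] : forall ki : 'I_(#|{: 'I_n * 'I_D}|.+1) * 'I_n, exists p : {poly M},
  [/\ p \over F, (size p <= (d ki.2).-1)%N & l0 (f ki.1 * e ki.2) = p.[x]].
 by move=> [k i]; have [_ [_ /(_ i (ltn_ord i))]] := fG k.
have [||c [cF c0 [k ck]]] := vec_dep (F := F) (A := fun k (j : 'I_n * 'I_D) => (p (k, j.1))`_j.2).
- by move=> k j; have [pF _ _] := hp (k, j.1); apply: (polyOverP pF).
- by rewrite card_ord.
have FFx : F \sub Fx by move=> y yF; apply/FxP/adj_id.
have fL k' : f k' \in L by have [] := fG k'.
have s0 : \sum_k c k * f k = 0.
 apply: l0_inj => [|i lt]; first by apply: rpred_sum => k' _; rewrite rpredM // FL.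
 rewrite mulr_suml; under eq_bigr do rewrite -mulrA.
 rewrite lin_sum // => [|k'|k']; [|exact: FFx|by rewrite rpredM ?eL].
 have E k' := let: And3 _ _ h := hp (k', Ordinal lt) in h.
 under eq_bigr do rewrite E /=.
 have sD k' : (size (p (k', Ordinal lt)) <= D)%N.
  have [_ h _] := hp (k', Ordinal lt); apply: leq_trans h _; apply: leq_trans (leq_pred _) _.
  exact: (leq_bigmax (F := fun i : 'I_n => d i) (Ordinal lt)).
 under eq_bigr do rewrite (horner_coef_wide _ (sD _)) mulr_sumr.
 rewrite exchange_big big1 //= => j _; have := c0 (Ordinal lt, j) => /= h.
 by under eq_bigr do rewrite mulrA; rewrite -mulr_suml h mul0r.
by have := ind c cF s0 k; move/eqP: ck.
Qed.

(** [tau] is the Lie derivative acting on multipliers. It has an eigenvector g1 and, as the regular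
    differentials are not all proportional over F, an eigenvector g2 modulo F g1; their quotient
    satisfies an affine equation under v. *)
Lemma pencil g : GOm g -> g \notin F -> exists t mu c,
 [/\ t \in L, t \notin F, mu \in F, c \in F & v t = mu * t + c].
Proof.
move=> Gg gF; have [a aL aE] := duality (T_Om ol0).
pose tau g := v g + a * g.
have GL g' : GOm g' -> g' \in L by case.
have FFx : F \sub Fx by move=> y yF; apply/FxP/adj_id.
have TE g' y : g' \in L -> y \in L -> T (fun y => l0 (g' * y)) y = l0 (tau g' * y).
 move=> gL yL; have gyL : g' * y \in L by rewrite rpredM.
 rewrite /tau mulrDl ll0.1 ?rpredM ?vL // -mulrA -aE // /T mulrCA vD.2 // ll0.1 ?rpredM ?vL //.
 by ring.
have Om_eq l l' : (forall y, y \in L -> l y = l' y) -> Om l -> Om l'.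
 move=> E [[h1 h2] h3]; split; first split.
 - by move=> y y' yL yL'; rewrite -!E ?rpredD ?h1.
 - by move=> c y cF yL; rewrite -!E ?rpredM ?h2 // FxL.
 by move=> i lt; rewrite -E ?eL //; apply: h3.
have tauG g' : GOm g' -> GOm (tau g').
 move=> [gL og]; split; first by rewrite rpredD ?vL ?rpredM.
 by apply: Om_eq (T_Om og) => y yL; apply: TE.
have GD y y' : GOm y -> GOm y' -> GOm (y + y').
 move=> [yL [l1 h1]] [yL' [l2 h2]]; split; first exact: rpredD.
 split; first exact: lin_mul (rpredD yL yL').
 move=> i lt; have [p [pF sp pE]] := h1 i lt; have [q [qF sq qE]] := h2 i lt.
 exists (p + q); rewrite rpredD //; split=> //.
  by apply: leq_trans (size_polyD _ _) _; rewrite geq_max sp.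
 by rewrite mulrDl ll0.1 ?rpredM ?eL // pE qE hornerD.
have GZ c y : c \in F -> GOm y -> GOm (c * y).
 move=> cF [yL [l1 h1]]; have cyL : c * y \in L by rewrite rpredM // FL.
 split=> //; split; first exact: lin_mul.
 move=> i lt; have [p [pF sp pE]] := h1 i lt; exists (c%:P * p); split.
 - by rewrite rpredM // polyOverC.
 - have [->|c0] := eqVneq c 0; first by rewrite mul0r size_poly0.
  by rewrite size_Cmul.
 - by rewrite -mulrA ll0.2 ?rpredM ?eL ?FFx // pE hornerM hornerC.
have tD y y' : GOm y -> GOm y' -> tau (y + y') = tau y + tau y'.
 by move=> /GL yL /GL yL'; rewrite /tau vD.1 //; ring.
have tZ c y : c \in F -> GOm y -> tau (c * y) = c * tau y.
 by move=> cF /GL yL; rewrite /tau (vZ ffL vD v0) //; ring.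
have [N fin] := GOm_fin.
have G1 : GOm 1 by split; [exact: rpred1|apply: Om_eq ol0 => y _; rewrite mul1r].
have [||g1 [a1 [G1' g10 a1F E1]]] :=
  eigen aclM ffL (g := 1) (H := fun y => y = 0) GD GZ tauG (erefl _) _ tD tZ fin G1.
- by move=> c y _ c0 /eqP; rewrite mulf_eq0 (negPf c0) => /eqP.
- by apply/eqP; rewrite oner_eq0.
move/eqP: g10 => g10; move/eqP: E1; rewrite subr_eq0 => /eqP E1.
pose H y := exists2 c, c \in F & y = c * g1.
have [h [Gh Hh]] : exists h, GOm h /\ ~ H h.
 have [[c cF cE]|] := pselect (H 1); last by exists 1.
 exists g; split=> // -[c' cF' cE']; move/negP: gF; apply.
 have c0 : c != 0 by apply: contra_eq_neq cE => ->; rewrite mul0r oner_eq0.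
 by rewrite cE' -[g1](mulKf c0) -cE mulr1 rpredM // rpredV.
have [||g2 [a2 [G2 Hg2 a2F [c cF E2]]]] :=
  eigen aclM ffL (g := h) (H := H) GD GZ tauG _ _ tD tZ fin Gh Hh.
- by exists 0; rewrite ?rpred0 ?mul0r.
- move=> c y cF c0 [c' cF' E]; exists (c^-1 * c'); first by rewrite rpredM ?rpredV.
 by rewrite -mulrA -E mulKf.
have g1L := GL _ G1'; have g2L := GL _ G2.
exists (g2 / g1), (a2 - a1), c; split; [exact: rpred_div| |exact: rpredB|exact: cF|].
 by apply/negP => tF; apply: Hg2; exists (g2 / g1); rewrite // divfK.
have -> : v (g2 / g1) = ((tau g2 - a2 * g2) * g1 - g2 * (tau g1 - a1 * g1)) / g1 ^+ 2 + (a2 - a1) * (g2 / g1).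
 by rewrite (derQ vD) // /tau; field.
rewrite E2 E1 subrr mulr0 subr0 addrC; congr (_ + _); by field.
Qed.

End Functionals.

(** A coordinate functional of the Birkhoff basis is regular as soon as its d_i exceeds 1; two such
    coordinates have a nonconstant ratio. *)
Lemma genus2 x n e d i1 i2 : x \in L -> x \notin F -> birk F L x n e d ->
 (i1 < n)%N -> (i2 < n)%N -> i1 != i2 -> (1 < d i1)%N -> (1 < d i2)%N ->
 exists t mu c, [/\ t \in L, t \notin F, mu \in F, c \in F & v t = mu * t + c].
Proof.
move=> xL xF bk n1 n2 i12 d1 d2; have [Fx FxP] := adjF F x.
have FFx : F \sub Fx by move=> y yF; apply/FxP/adj_id.
have FxL : Fx \sub L by move=> y /FxP; apply: adj_min.
have eL := birk_eL bk.
have /choice[co hco] : forall y, exists c : 'I_n -> M, y \in L ->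
  (forall i, c i \in Fx) /\ y = \sum_(i < n) c i * e i.
 move=> y; have [yL|yL] := boolP (y \in L); last by exists (fun=> 0).
 by have [c cF E] := birk_coord ffL xF bk FxP yL; exists c.
have cou y (c : 'I_n -> M) : y \in L -> (forall i, c i \in Fx) -> y = \sum_(i < n) c i * e i -> co y =1 c.
 move=> yL cF E i; have [coF coE] := hco y yL; apply/eqP; rewrite -subr_eq0; apply/eqP.
 apply: (birk_indep bk (c := fun i => co y i - c i) FxP) => [j|]; first by rewrite rpredB.
 by under eq_bigr do rewrite mulrBl; rewrite sumrB -coE -E subrr.
have coe (i : 'I_n) j : co (e i) j = (j == i)%:R.
 apply: (cou (e i) (fun j => (j == i)%:R)); [exact: eL|by move=> k; rewrite rpred_nat|].
 by rewrite (bigD1 i) //= eqxx mul1r big1 ?addr0 // => k /negPf ->; rewrite mul0r.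
have omk (k : 'I_n) : (1 < d k)%N -> Om x n e d Fx (fun y => if y \in L then co y k else 0).
 move=> dk; split; first split.
 - move=> y y' yL yL'; rewrite yL yL' rpredD //; have [h1 h2] := hco y yL; have [h3 h4] := hco y' yL'.
  apply: (cou _ (fun k => co y k + co y' k)); [exact: rpredD|by move=> j; rewrite rpredD|].
  by under eq_bigr do rewrite mulrDl; rewrite big_split /= -h2 -h4.
 - move=> c y cF yL; have cL := FxL _ cF; rewrite yL rpredM //; have [h1 h2] := hco y yL.
  apply: (cou _ (fun k => c * co y k)); [exact: rpredM|by move=> j; rewrite rpredM|].
  by under eq_bigr do rewrite -mulrA; rewrite -mulr_sumr -h2.
 move=> i lt; exists ((k == Ordinal lt)%:R)%:P.
 rewrite polyOverC rpred_nat eL // (coe (Ordinal lt)) hornerC; split=> //.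
 have [kE|_] := eqVneq k (Ordinal lt); last by rewrite size_polyC eqxx.
 have di : (1 < d i)%N by move: dk; rewrite kE.
 by rewrite size_polyC oner_eq0 /= -ltnS prednK // ltnW.
have o1 := omk (Ordinal n1) d1; have o2 := omk (Ordinal n2) d2.
have nz : exists2 y, y \in L & (if y \in L then co y (Ordinal n1) else 0) != 0.
 by exists (e i1); rewrite ?eL // (coe (Ordinal n1)) eqxx oner_eq0.
have [g gL gE] := duality xL xF bk FxP o1 nz o2.
apply: (pencil xL xF bk FxP o1 nz (g := g)); first split=> //.
 have [[h1 h2] h3] := o2; split; first exact: (lin_mul (proj1 o1) gL).
 by move=> i lt; have := h3 i lt; rewrite (gE _ (eL _ lt)).
apply/negP => gF; have := gE (e i2) (eL _ n2).
have e2L := eL _ n2; have geL := rpredM gL e2L.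
have := o1.1.2 g (e i2) (FFx _ gF) e2L; rewrite geL e2L => ->.
rewrite (coe (Ordinal n2) (Ordinal n2)) (coe (Ordinal n2) (Ordinal n1)) eqxx.
by rewrite -val_eqE /= (negPf i12) mulr0 => /eqP; rewrite oner_eq0.
Qed.

End VectorField.

Lemma size_arith1 a b c m : (a + c <= m.+1)%N -> (b + c <= (c + c).+1)%N -> ((a + b).-1 <= m.+1)%N.
Proof. lia. Qed.

Lemma size_arith2 a b : (1 < b)%N -> (0 < a)%N -> (a + b <= 3)%N -> b = 2%N /\ (a <= 1)%N.
Proof. lia. Qed.

Lemma size_arith3 a : (a + 2 <= 5)%N -> ((a + a).-1 <= 5)%N.
Proof. lia. Qed.

(** * Function fields with a nonzero regular vector field *)

Section Classify.
Variable M : fieldType.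
Hypotheses (char0 : char_0 M) (aclM : acl M).
Variables (F L : sfield M).
Hypothesis ffL : ffield F L.

Let hF : relacl F. Proof. by case: ffL. Qed.
Let FL : F \sub L. Proof. by case: ffL. Qed.

(** A curve s^2 = Q(x) of genus one, with Q square-free of degree 3 or 4. The bound [size B + 2]
    says that 1, s is a Birkhoff basis with degrees 0 and 2. *)
Definition quadmodel (x s : M) (Q : {poly M}) (rs : seq M) :=
 [/\ [/\ x \in L, x \notin F, s \in L, Q \over F & s ^+ 2 = Q.[x]],
  [/\ (3 < size Q <= 5)%N, Q = lead_coef Q *: \prod_(r <- rs) ('X - r%:P), uniq rs
   & rs \sub F],
  forall A B : {poly M}, A \over F -> B \over F ->
   A.[x] + B.[x] * s = 0 -> A = 0 /\ B = 0,
  forall y, y \in L -> exists q A B : {poly M}, [/\ q \over F, q != 0,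
   A \over F, B \over F & q.[x] * y = A.[x] + B.[x] * s] &
  forall m y, Lm F x L m y -> exists A B : {poly M}, [/\ A \over F, B \over F,
   (size A <= m.+1)%N, B != 0 -> (size B + 2 <= m.+1)%N & y = A.[x] + B.[x] * s]].

Lemma prod_square (rs : seq M) : rs \sub F -> ~~ uniq rs -> exists r (P : {poly M}),
 [/\ r \in F, P \over F & \prod_(r <- rs) ('X - r%:P) = ('X - r%:P) ^+ 2 * P].
Proof.
have Xr r : r \in F -> 'X - r%:P \over F.
 by move=> rF; rewrite rpredB ?polyOverX ?polyOverC.
elim: rs => [//|a rs IH] sF; have aF : a \in F by apply: sF; rewrite mem_head.
have sF' : rs \sub F by move=> r rrs; apply: sF; rewrite inE rrs orbT.
rewrite /= negb_and negbK => /orP[ars|nu].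
 exists a, (\prod_(r <- rem a rs) ('X - r%:P)); split=> //.
  by rewrite big_seq; apply: rpred_prod => r /mem_rem/sF'; apply: Xr.
 by rewrite big_cons (perm_big _ (perm_to_rem ars)) big_cons mulrA expr2.
have [r [P [rF PF E]]] := IH sF' nu; exists r, (('X - a%:P) * P); split=> //.
 by rewrite rpredM ?Xr.
by rewrite big_cons E; ring.
Qed.

Lemma simple_root (Q : {poly M}) c rs r : c != 0 -> uniq rs -> r \in rs ->
 Q = c *: (('X - r%:P) * \prod_(r <- rem r rs) ('X - r%:P)) -> Q.[r] = 0 /\ Q^`().[r] != 0.
Proof.
move=> c0 urs rrs ->; rewrite derivZ derivM derivXsubC mul1r !hornerZ hornerD !hornerM.
rewrite hornerXsubC subrr !mul0r mulr0 addr0.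
split=> //; rewrite mulf_neq0 // horner_prod prodf_seq_neq0; apply/allP => r' r'rs /=.
rewrite hornerXsubC subr_eq0; apply: contraTneq r'rs => <-.
by rewrite mem_rem_uniqF.
Qed.

Lemma quad_deriv x s Q rs r : quadmodel x s Q rs -> r \in rs -> Q.[r] = 0 /\ Q^`().[r] != 0.
Proof.
move=> [_ [sQ QE urs _] _ _ _] rrs.
have l0 : lead_coef Q != 0.
 by rewrite lead_coef_eq0 -size_poly_gt0; case/andP: sQ => h _; apply: leq_trans h.
have E : Q = lead_coef Q *: (('X - r%:P) * \prod_(r <- rem r rs) ('X - r%:P)).
 by rewrite {1}QE (perm_big _ (perm_to_rem rrs)) big_cons.
exact: simple_root l0 urs rrs E.
Qed.

Lemma quad_size x s Q rs : quadmodel x s Q rs -> size Q = (size rs).+1.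
Proof.
move=> [_ [sQ QE urs _] _ _ _]; rewrite QE size_scale ?size_prod_XsubC //.
by rewrite lead_coef_eq0 -size_poly_gt0; case/andP: sQ => h _; apply: leq_trans h.
Qed.

Variable v : M -> M.
Hypotheses (vD : derOn L v) (vL : stab v L)
 (v0 : kills v F)
 (vst : forall O, place F O -> stab_in v L O)
 (vnz : exists2 y, y \in L & v y != 0).

Let two0 : 2%:R != 0 :> M. Proof. by rewrite natr_eq0. Qed.

(** Completing the square gives s^2 = Q(x). Q has degree at least 3, or s would have simple poles
    only; it is square-free, or some s / (x - r) would be integral. Write v x = W + c s.
    Differentiating s^2 = Q shows that W vanishes at the roots of Q, too many for its degree, so W =
    0; the pole bound on v x then leaves d_1 = 2 and c constant. *)
Lemma degree2 x e d : x \in L -> x \notin F -> birk F L x 2 e d -> (1 < d 1%N)%N ->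
 exists s Q rs c, [/\ quadmodel x s Q rs, c \in F, c != 0 & v x = c * s].
Proof.
move=> xL xF bk d1; have [[_ e0 d0] eLm ind span rep] := bk.
have [em _] := eLm 1%N isT; set e1 := e 1%N in em; have [eL _] := em.
have rep' m y : Lm F x L m y -> exists A B : {poly M}, [/\ A \over F, B \over F,
  (size A <= m.+1)%N, B != 0 -> (size B + d 1%N <= m.+1)%N & y = A.[x] + B.[x] * e1].
 move=> /rep[p [pF -> sp]]; exists (p 0%N), (p 1%N); split=> //.
 - by have [->|/(sp 0%N isT)] := eqVneq (p 0%N) 0; rewrite ?size_poly0 // d0 addn0.
 - exact: (sp 1%N).
 - by rewrite /lcomb big_ord_recl big_ord1 /= e0 mulr1.
have ind' A B : A \over F -> B \over F -> A.[x] + B.[x] * e1 = 0 -> A = 0 /\ B = 0.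
 move=> AF BF AB; pose p i := if i == 0%N then A else if i == 1%N then B else 0.
 have pF i : p i \over F by rewrite /p; do 2?case: ifP => _; rewrite ?rpred0.
 have : lcomb x e 2 p = 0 by rewrite /lcomb big_ord_recl big_ord1 /= e0 mulr1.
 by move=> /(ind p pF) h; split; [apply: (h 0%N)|apply: (h 1%N)].
have [p [q [pF qF sp sq E]]] := rep' _ _ (LmM em em).
have four0 : 4%:R != 0 :> M by rewrite natr_eq0.
have halfF n : (n%:R^-1)%:P \over F by rewrite polyOverC rpredV rpred_nat.
pose h := (2%:R^-1)%:P * q; have hpF : h \over F by rewrite rpredM.
pose s := e1 - h.[x]; pose Q := p + h ^+ 2.
have e1E : e1 = s + h.[x] by rewrite subrK.
have hE : h.[x] = q.[x] / 2%:R by rewrite hornerM hornerC mulrC.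
have QF : Q \over F by rewrite rpredD // rpredX.
have sL : s \in L by rewrite rpredB // (polyL ffL).
have sQ : s ^+ 2 = Q.[x].
 rewrite hornerD horner_exp.
 have -> : p.[x] = e1 * e1 - q.[x] * e1 by rewrite E; ring.
 by rewrite /s hE; field; rewrite two0.
have sQ5 : d 1%N = 2%N -> (size Q <= 5)%N.
 move=> d1E; apply: (leq_trans (size_polyD _ _)); rewrite geq_max; move: sp; rewrite d1E => -> /=.
 have [->|h0] := eqVneq h 0; first by rewrite expr0n size_poly0.
 have q0 : q != 0 by apply: contraNneq h0 => q0; rewrite /h q0 mulr0.
 have := sq q0; rewrite d1E expr2 size_mul // /h mul_polyC size_scale ?invr_eq0 //.
 exact: size_arith3.
clearbody Q.
have indS A B : A \over F -> B \over F -> A.[x] + B.[x] * s = 0 -> A = 0 /\ B = 0.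
 move=> AF BF AB; have [||A0 B0] := ind' (A - B * h) B _ BF.
 - by rewrite rpredB // rpredM.
 - by rewrite -[RHS]AB hornerD hornerN (hornerM B h) /s; ring.
 by move: A0; rewrite B0 mul0r subr0.
have repS m y : Lm F x L m y -> exists A B : {poly M}, [/\ A \over F, B \over F,
  (size A <= m.+1)%N, B != 0 -> (size B + d 1%N <= m.+1)%N & y = A.[x] + B.[x] * s].
 move=> /rep'[A [B [AF BF sA sB ->]]]; exists (A + B * h), B; split=> //.
 - by rewrite rpredD // rpredM.
 - apply: (leq_trans (size_polyD _ _)); rewrite geq_max sA /=.
  have [->|B0] := eqVneq B 0; first by rewrite mul0r size_poly0.
  have [q0|q0] := eqVneq q 0; first by rewrite /h q0 !mulr0 size_poly0.
  apply: (leq_trans (size_polyMleq _ _)); rewrite /h mul_polyC size_scale ?invr_eq0 //.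
  exact: size_arith1 (sB B0) (sq q0).
 - by rewrite e1E hornerD (hornerM B h); ring.
have ns1 : ~ Lm F x L 1 s.
 move=> /repS[A [B [AF BF sA sB E1]]].
 have [||_ /eqP] := indS A (B - 1) AF; first by rewrite rpredB ?rpred1.
  by rewrite hornerD hornerN hornerC mulrBl mul1r addrA -E1 subrr.
 rewrite subr_eq0 => /eqP B1; have := sB; rewrite B1 oner_eq0 size_poly1 => /(_ isT).
 by move: d1; case: (d 1%N) => [|[]].
have sQ4 : (3 < size Q)%N.
 rewrite ltnNge; apply/negP => le; apply: ns1; split=> // O pO; have [vO FO] := pO.
 have [_ hQ] := Lm_poly ffL xL xF QF (m := 2) le; have [h1 h2] := hQ O pO.
 split=> xO; apply: (O_exp vO (n := 2)) => //; first by rewrite sQ h1.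
 by rewrite expr1 expr_div_n sQ h2.
have Q0 : Q != 0 by rewrite -size_poly_gt0; apply: leq_trans sQ4.
have sqf r (P : {poly M}) : r \in F -> P \over F -> Q != ('X - r%:P) ^+ 2 * P.
 move=> rF PF; apply/eqP => QE.
 have xr : x - r != 0 by rewrite subr_eq0; apply: contraNneq xF => ->.
 have xrL : x - r \in L by apply: rpredB => //; apply: FL.
 have yL : s / (x - r) \in L by exact: rpred_div.
 have yi : intcl F x L (s / (x - r)).
  split=> // O pO xO; have [vO FO] := pO; apply: (O_exp vO (n := 2)) => //.
  rewrite expr_div_n sQ QE hornerM horner_exp hornerXsubC.
  rewrite mulrAC divff ?mul1r ?expf_neq0 //.
  by apply: rpred_horner => //; apply: polyOver_sub PF.
 have [m ym] := intcl_Lm ffL xL xF yi.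
 have [A [B [AF BF _ _ E1]]] := repS _ _ ym.
 have XF : 'X - r%:P \over F by rewrite rpredB ?polyOverX ?polyOverC.
 have [||_] := indS (('X - r%:P) * A) (('X - r%:P) * B - 1) (rpredM XF AF).
 - by rewrite rpredB ?rpred1 // rpredM.
 - rewrite hornerM hornerXsubC hornerD hornerN hornerM hornerXsubC hornerC.
  have -> : (x - r) * A.[x] + ((x - r) * B.[x] - 1) * s = (x - r) * (A.[x] + B.[x] * s) - s by ring.
  by rewrite -E1 mulrC divfK // subrr.
 move=> /eqP; rewrite subr_eq0 => /eqP/(congr1 (fun p : {poly M} => p.[r])).
 by rewrite hornerM hornerXsubC hornerC subrr mul0r => /eqP; rewrite eq_sym oner_eq0.
have [rs [rsF QE]] := poly_split aclM hF QF Q0.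
have lF : lead_coef Q \in F by rewrite lead_coefE; apply: (polyOverP QF).
have urs : uniq rs.
 apply/negPn/negP => /(prod_square rsF)[r [P [rF PF PE]]].
 have := sqf r (lead_coef Q *: P) rF; rewrite polyOverZ // => /(_ isT).
 by rewrite {1}QE PE -scalerAr eqxx.
have srs : size Q = (size rs).+1 by rewrite QE size_scale ?size_prod_XsubC // lead_coef_eq0.
have w2 := v_Lm2 vD vL vst xL xF.
have [W [c [WF cF sW sc vxE]]] := repS _ _ w2.
have sO O : place F O -> x \in O -> s \in O.
 move=> [vO FO] xO; apply: (O_exp vO (n := 2)) => //; rewrite sQ.
 by apply: rpred_horner => //; apply: polyOver_sub QF.
have vsi : intcl F x L (v s).
 by split=> [|O pO xO]; [exact: vL|apply: (vst pO) => //; exact: sO].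
have [m vsm] := intcl_Lm ffL xL xF vsi.
have [A [B [AF BF _ _ vsE]]] := repS _ _ vsm.
have E2 : 2%:R * s * v s = Q^`().[x] * v x.
 by rewrite -(v_poly ffL vD v0) // -sQ (derX vD).
have Q'F : Q^`() \over F by rewrite polyOver_deriv.
have [|||BQ _] := indS (2%:R%:P * B * Q - Q^`() * W) (2%:R%:P * A - Q^`() * c).
- by rewrite rpredB // !rpredM // polyOverC rpred_nat.
- by rewrite rpredB // !rpredM // polyOverC rpred_nat.
- rewrite !(hornerD, hornerN, hornerM) !hornerC -sQ.
 have -> : 2%:R * B.[x] * s ^+ 2 - Q^`().[x] * W.[x] + (2%:R * A.[x] - Q^`().[x] * c.[x]) * s =
  2%:R * s * (A.[x] + B.[x] * s) - Q^`().[x] * (W.[x] + c.[x] * s) by ring.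
 by rewrite -vsE -vxE E2 subrr.
have qd r : r \in rs -> Q.[r] = 0 /\ Q^`().[r] != 0.
 move=> rrs; have l0 : lead_coef Q != 0 by rewrite lead_coef_eq0.
 have EQ : Q = lead_coef Q *: (('X - r%:P) * \prod_(r <- rem r rs) ('X - r%:P)).
  by rewrite {1}QE (perm_big _ (perm_to_rem rrs)) big_cons.
 exact: simple_root l0 urs rrs EQ.
have W0 : W = 0.
 apply/eqP; apply: contraT => W0.
 have rW : all (root W) rs.
  apply/allP => r rrs; have [Qr Q'r] := qd r rrs.
  have := congr1 (fun p : {poly M} => p.[r]) BQ.
  rewrite /= hornerD hornerN !hornerM Qr mulr0 sub0r horner0 => /eqP.
  by rewrite oppr_eq0 mulf_eq0 (negPf Q'r).
 have lt := leq_trans (max_poly_roots W0 rW urs) sW.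
 by rewrite ltnNge -ltnS -srs sQ4 in lt.
have c0 : c != 0.
 apply: contraNneq (v_neq0 char0 ffL vD v0 vnz xL xF) => c0.
 by rewrite vxE W0 c0 !horner0 mul0r addr0.
have d2 : d 1%N = 2%N /\ (size c <= 1)%N.
 by apply: size_arith2 (sc c0); rewrite ?size_poly_gt0.
have [d1E /size1_polyC cE] := d2.
exists s, Q, rs, c`_0; split; last 3 first.
- exact: (polyOverP cF).
- by rewrite -polyC_eq0 -cE.
- by rewrite vxE W0 horner0 add0r {1}cE hornerC.
split=> //.
- by split=> //; rewrite sQ4 sQ5.
- move=> y yL; have [q' [P [q'F q'0 PF yE]]] := span y yL.
 exists q', (P 0%N + P 1%N * h), (P 1%N); split=> //; first by rewrite rpredD ?rpredM.
 by rewrite yE /lcomb big_ord_recl big_ord1 /= e0 -/e1 e1E hornerD (hornerM _ h); ring.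
- by move=> m' y /repS[A' [B' [h1 h2 h3 h4 h5]]]; exists A', B'; split=> //; rewrite -d1E.
Qed.

(** Take x of least degree n; by [deg_drop] every d_i with i > 0 is at least 2. For n = 1 the field
    is F(x), for n = 2 [degree2] applies, and for n > 2 [genus2] provides an affine equation, which
    [lin1] or [lin2] turns into a generator. *)
Theorem classify : (exists2 x, x \in L & x \notin F /\ forall y, y \in L -> adj F x y) \/
 exists x s Q rs c, [/\ quadmodel x s Q rs, c \in F, c != 0 & v x = c * s].
Proof.
have ex : exists n x, [/\ x \in L, x \notin F & hasdeg F L x n].
 have [y yL vy] := vnz; have yF : y \notin F by apply: contraNN vy => /v0 ->.
 by have [n hn] := hasdeg_ex aclM ffL yL yF; exists n, y.
have {ex} [n [x [xL xF [e [d bk]]]] nmin] : exists2 n, exists x, [/\ x \in L, x \notin F & hasdeg F L x n]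
  & forall m x, x \in L -> x \notin F -> hasdeg F L x m -> (n <= m)%N.
 have ex' : exists n, `[< exists x, [/\ x \in L, x \notin F & hasdeg F L x n] >].
  by case: ex => n h; exists n; apply/asboolP.
 case: (ex_minnP ex') => n /asboolP h mn; exists n => // m x xL xF hm.
 by apply: mn; apply/asboolP; exists x.
have [[n0 e0 d0] eLm ind span rep] := bk.
have d2 i : (0 < i)%N -> (i < n)%N -> (1 < d i)%N.
 move=> i0 lt; have [_ /(_ i0)] := eLm i lt; rewrite leq_eqVlt => /orP[/eqP di|//].
 have [h [n' [hL hF' hn lt']]] := deg_drop aclM ffL xL xF bk i0 lt (esym di).
 by have := nmin _ _ hL hF' hn; rewrite leqNgt lt'.
case: n => [//|[|[|n]]] in n0 bk nmin eLm ind span rep d2 *.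
- left; exists x => //; split=> // y yL; have [q [p [qF q0 pF E]]] := span y yL.
 have qx := transcF ffL xF qF q0.
 exists (p 0%N), q; split=> //; apply: (mulfI qx); rewrite E /lcomb big_ord1 e0 mulr1.
 by rewrite mulrC divfK.
- right; have [s [Q [rs [c h]]]] := degree2 xL xF bk (d2 1%N isT isT).
 by exists x, s, Q, rs, c.
left; have [t [mu [c [tL tF muF cF vt]]]] :=
 genus2 char0 aclM ffL vD vL v0 vst vnz xL xF bk (i1 := 1) (i2 := 2) isT isT isT (d2 1%N isT isT) (d2 2 isT isT).
have [mu0|mu0] := eqVneq mu 0.
 have c0 : c != 0.
  by have := v_neq0 char0 ffL vD v0 vnz tL tF; rewrite vt mu0 mul0r add0r.
 have ciF : c^-1 \in F by rewrite rpredV.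
 have vt1 : v (c^-1 * t) = 1 by rewrite (vZ ffL vD v0) // vt mu0 mul0r add0r mulVf.
 have tL' : c^-1 * t \in L by rewrite rpredM // FL.
 exists (c^-1 * t) => //; split; last exact: (lin1 char0 aclM ffL vD vL v0 vst vnz tL' vt1).
 by apply/negP => /v0; rewrite vt1 => /eqP; rewrite oner_eq0.
have cmF : c / mu \in F by rewrite rpred_div.
have [||||z [zL zF zE]] := lin2 char0 aclM ffL vD vL v0 vst vnz (t := t + c / mu) (mu := mu).
- by rewrite rpredD // FL.
- by apply: contra tF => h; rewrite -[t](addrK (c / mu)) rpredB.
- by [].
- by rewrite (vD.1 _ _ tL (FL cmF)) (v0 cmF) addr0 vt; field.
by exists z.
Qed.

End Classify.

(** * Normal forms of a regular derivation *)

Section Derivation.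
Variable M : fieldType.
Hypotheses (char0 : char_0 M) (aclM : acl M).
Variables (F L : sfield M).
Hypothesis ffL : ffield F L.

Let hF : relacl F. Proof. by case: ffL. Qed.
Let FL : F \sub L. Proof. by case: ffL. Qed.

Variable D : M -> M.
Hypotheses (DD : derOn L D) (DL : stab D L)
 (DF : stab D F)
 (Dst : forall O, place F O -> stab_in D L O)
 (Dconst : forall y, y \in L -> D y = 0 -> y \in F).

Let nat0 n : n.+1%:R != 0 :> M. Proof. by rewrite natr_eq0. Qed.

(** Regularity puts D x in the space of functions with at most twice the poles of x, and for L =
    F(x) the Birkhoff basis is just 1. *)
Lemma riccati_of_rational x : x \in L -> x \notin F -> (forall y, y \in L -> adj F x y) ->
 exists a0 a1 a2, [/\ a0 \in F, a1 \in F, a2 \in F & D x = a2 * x ^+ 2 + a1 * x + a0].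
Proof.
move=> xL xF gen; have [n [e [d bk]]] := hasdeg_ex aclM ffL xL xF.
have [[n0 e0 d0] eLm ind span rep] := bk.
have n1 : n = 1%N.
 case: n n0 bk eLm ind span rep => [//|[//|n]] _ bk eLm ind _ _; exfalso.
 have [p [q [pF qF q0 E]]] := gen _ (birk_eL bk (i := 1) isT).
 pose P i : {poly M} := if i == 0%N then - p else if i == 1%N then q else 0.
 have PF i : P i \over F by rewrite /P; do 2?case: ifP => _; rewrite ?rpredN ?rpred0.
 have : lcomb x e n.+2 P = 0.
  rewrite /lcomb !big_ord_recl big1 => [|i _]; last by rewrite horner0 mul0r.
  by rewrite /= e0 /bump /= addn0 E hornerN mulr1 addr0 mulrC divfK // addNr.
 by move=> /(ind P PF)/(_ 1%N isT); rewrite /P /= => q00; move: q0; rewrite q00 horner0 eqxx.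
have [p [pF E sp]] := rep _ _ (v_Lm2 DD DL Dst xL xF).
exists (p 0%N)`_0, (p 0%N)`_1, (p 0%N)`_2; split; try exact: (polyOverP (pF _)).
have s3 : (size (p 0%N) <= 3)%N.
 by have [->|/(sp 0%N n0)] := eqVneq (p 0%N) 0; rewrite ?size_poly0 // d0 addn0.
rewrite E /lcomb; move: (n0) => _; rewrite n1 big_ord1 e0 mulr1 (horner_coef_wide _ s3).
by rewrite !big_ord_recl big_ord0 /= /bump /=; ring.
Qed.

(* From Legendre form to Weierstrass form. *)
Lemma weierstrass_of_legendre t la ga : t \in L -> la \in F -> ga \in F -> D la = 0 ->
 la != 0 -> la != 1 -> D t ^+ 2 = ga * (t * (t - 1) * (t - la)) ->
 exists c a g2 g3, [/\ c \in F, [/\ a \in F, g2 \in F & g3 \in F], D g2 = 0 /\ D g3 = 0,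
  27%:R * g3 ^+ 2 - g2 ^+ 3 != 0
  & D c = 0 /\ D t ^+ 2 = a ^+ 2 * (4%:R * (t - c) ^+ 3 - g2 * (t - c) - g3)].
Proof.
move=> tL laF gaF Dla la0 la1 E.
have [a ra] : exists a, root ('X^2 - (ga / 4%:R)%:P) a by apply: aclM; rewrite size_XnsubC.
have a2 : a ^+ 2 = ga / 4%:R.
 by move: ra; rewrite rootE hornerD hornerN hornerXn hornerC subr_eq0 => /eqP.
have gF : ga / 4%:R \in F by rewrite rpred_div ?rpred_nat.
have aF : a \in F.
 apply: hF; exists ('X^2 - (ga / 4%:R)%:P); split=> //.
  by rewrite rpredB ?rpredX ?polyOverX ?polyOverC.
 by rewrite -size_poly_gt0 size_XnsubC.
have iF n (z : M) : z \in F -> z / n%:R \in F by move=> zF; rewrite rpred_div ?rpred_nat.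
(* Translation by the mean of the roots 0, 1, la removes the quadratic term of the cubic. *)
pose c := (1 + la) / 3%:R; pose e1 := - c; pose e2 := 1 - c; pose e3 := la - c.
have cF : c \in F by rewrite iF // rpredD ?rpred1.
have e1F : e1 \in F by rewrite rpredN.
have e2F : e2 \in F by rewrite rpredB ?rpred1.
have e3F : e3 \in F by rewrite rpredB.
have FD := derOn_sub FL DD.
have D0n (n : nat) : D n%:R = 0 by rewrite (dern FD).
have Dc : D c = 0.
 rewrite /c (derQ FD) ?rpredD ?rpred1 ?rpred_nat // D0n mulr0 subr0 FD.1 ?rpred1 // Dla (der1 FD).
 by rewrite add0r mul0r mul0r.
have De1 : D e1 = 0 by rewrite (derN FD) // Dc oppr0.
have De2 : D e2 = 0 by rewrite (derB FD) ?rpred1 // Dc (der1 FD) subr0.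
have De3 : D e3 = 0 by rewrite (derB FD) // Dc Dla subr0.
have cons x y : x \in F -> y \in F -> D x = 0 -> D y = 0 -> D (x * y) = 0 /\ D (x + y) = 0.
 by move=> xF yF dx dy; rewrite FD.2 // FD.1 // dx dy mul0r mulr0 addr0.
have nF n : n%:R \in F by rewrite rpred_nat.
have [d12 _] := cons _ _ e1F e2F De1 De2; have [d13 _] := cons _ _ e1F e3F De1 De3.
have [d23 _] := cons _ _ e2F e3F De2 De3.
have [d123 _] := cons _ _ (rpredM e1F e2F) e3F d12 De3.
have [_ ds] := cons _ _ (rpredM e1F e2F) (rpredM e1F e3F) d12 d13.
have [_ ds3] := cons _ _ (rpredD (rpredM e1F e2F) (rpredM e1F e3F)) (rpredM e2F e3F) ds d23.
have sF := rpredD (rpredD (rpredM e1F e2F) (rpredM e1F e3F)) (rpredM e2F e3F).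
have pF := rpredM (rpredM e1F e2F) e3F.
exists c, a, (- (4%:R * (e1 * e2 + e1 * e3 + e2 * e3))), (4%:R * (e1 * e2 * e3)); split.
- exact: cF.
- by rewrite rpredN !(rpredM (nF 4)).
- rewrite (derN FD) ?(rpredM (nF 4)) //.
 have [-> _] := cons _ _ (nF 4) sF (D0n 4) ds3; have [-> _] := cons _ _ (nF 4) pF (D0n 4) d123.
 by rewrite oppr0.
- have -> : 27%:R * (4%:R * (e1 * e2 * e3)) ^+ 2 - (- (4%:R * (e1 * e2 + e1 * e3 + e2 * e3))) ^+ 3 =
  - (16%:R * (la ^+ 2 * (la - 1) ^+ 2)).
  by rewrite /e1 /e2 /e3 /c; field; rewrite nat0.
 by rewrite oppr_eq0 mulf_neq0 ?nat0 // mulf_neq0 ?expf_neq0 // subr_eq0.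
split=> //; rewrite E a2 /e1 /e2 /e3 /c; field; by rewrite !nat0.
Qed.

Section Quad.
Variables (x s : M) (Q : {poly M}) (rs : seq M).
Hypothesis qm : quadmodel F L x s Q rs.

(** Differentiate s^2 = Q(x) and compare the parts free of s: at a simple root r of Q this says D r
    = A(r), so all finite branch points solve one Riccati equation. *)
Lemma quad_der : exists A b, [/\ A \over F, (size A <= 3)%N, b \in F,
 D x = A.[x] + b * s & forall r, r \in rs -> D r = A.[r]].
Proof.
have [[xL xF sL QF sQ] [/andP[sQ4 _] QE urs rsF] indS _ repS] := qm.
have [A [B [AF BF sA sB xE]]] := repS _ _ (v_Lm2 DD DL Dst xL xF).
have B1 : (size B <= 1)%N.
 have [->|/sB] := eqVneq B 0; first by rewrite size_poly0.
 by rewrite addn2.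
have sO O : place F O -> x \in O -> s \in O.
 move=> [vO FO] xO; apply: (O_exp vO (n := 2)) => //; rewrite sQ.
 by apply: rpred_horner => //; apply: polyOver_sub QF.
have vsi : intcl F x L (D s).
 by split=> [|O pO xO]; [exact: DL|apply: (Dst pO) => //; exact: sO].
have [m vsm] := intcl_Lm ffL xL xF vsi.
have [W' [W [W'F WF _ _ vsE]]] := repS _ _ vsm.
have QL : Q \over L by apply: polyOver_sub QF.
have E2 : 2%:R * s * D s = (dpoly D Q).[x] + Q^`().[x] * D x.
 by rewrite -(der_horner DD QL xL) -sQ (derX DD).
have Q'F : Q^`() \over F by rewrite polyOver_deriv.
have dQF : dpoly D Q \over F.
 by apply/polyOverP => i; rewrite (coef_dpoly DD); apply/DF/(polyOverP QF).
have nF n : n%:R%:P \over F by rewrite polyOverC rpred_nat.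
have [|||E3 _] := indS (2%:R%:P * W * Q - (dpoly D Q + Q^`() * A)) (2%:R%:P * W' - Q^`() * B).
- by rewrite rpredB // ?rpredD // !rpredM.
- by rewrite rpredB // !rpredM.
- rewrite !(hornerD, hornerN, hornerM) !hornerC -sQ.
 have -> : 2%:R * W.[x] * s ^+ 2 - ((dpoly D Q).[x] + Q^`().[x] * A.[x]) + (2%:R * W'.[x] - Q^`().[x] * B.[x]) * s =
  2%:R * s * (W'.[x] + W.[x] * s) - ((dpoly D Q).[x] + Q^`().[x] * (A.[x] + B.[x] * s)) by ring.
 by rewrite -vsE -xE E2 subrr.
exists A, B`_0; split=> //; first exact: (polyOverP BF).
 by rewrite xE {1}(size1_polyC B1) hornerC.
move=> r rrs; have [Qr Q'r] := quad_deriv qm rrs.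
have := congr1 (fun p : {poly M} => p.[r]) E3.
rewrite /= !(hornerD, hornerN, hornerM) Qr mulr0 sub0r horner0 => /eqP; rewrite oppr_eq0 => /eqP e4.
have := der_horner DD QL (FL (rsF _ rrs)); rewrite Qr (der0 DD) => e5.
by apply: (mulfI Q'r); apply: (addrI (dpoly D Q).[r]); rewrite -e5 e4.
Qed.

Lemma quad_gen (G : sfield M) : F \sub G -> x \in G -> s \in G -> L \sub G.
Proof.
have [[xL xF sL QF sQ] _ _ span _] := qm.
move=> FG xG sG y yL; have [q [A [B [qF q0 AF BF E]]]] := span y yL.
have qx := transcF ffL xF qF q0.
have pG (p : {poly M}) : p \over F -> p.[x] \in G.
 by move=> pF; apply: rpred_horner => //; apply: polyOver_sub pF.
by rewrite -[y](mulKf qx) E rpredM ?rpredV ?rpredD ?rpredM ?pG.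
Qed.

(* When Q is cubic, the place at infinity is ramified and forces the quadratic part of A to vanish. *)
Lemma quad_affine A b : A \over F -> (size A <= 3)%N -> b \in F ->
 D x = A.[x] + b * s -> size Q = 4%N -> A`_2 = 0.
Proof.
have [[xL xF sL QF sQ] _ _ _ _] := qm.
move=> AF sA bF E sQ4; have x0 := x_neq0 xF.
have [O [pO xO]] := place_inf ffL xF; have [vO FO] := pO.
have xm := notO_mx vO xO; have xi := mx_sub xm.
have Q3 : Q`_3 != 0.
 by have : lead_coef Q != 0 by [rewrite lead_coef_eq0 -size_poly_gt0 sQ4]; rewrite lead_coefE sQ4.
have s0 : s != 0.
 apply/eqP => s0; have := sQ; rewrite s0 expr0n => /esym/eqP.
 by apply/negP; apply: (transcF ffL xF QF); rewrite -size_poly_gt0 sQ4.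
pose w := Q`_3 + (Q`_2 + (Q`_1 + Q`_0 / x) / x) / x.
have wE : s ^+ 2 = w * x ^+ 3.
 rewrite sQ horner_coef sQ4 !big_ord_recl big_ord0 /= /bump /= /w; field; by rewrite x0.
have QO i : Q`_i \in O by rewrite FO // (polyOverP QF).
have uw : un O w.
 apply: un_add; first exact: vO; first by apply: (un_F FO) => //; apply: (polyOverP QF).
 by rewrite mx_mulr // !rpredD // !rpredM // !rpredD // !rpredM.
have wL : w \in L.
 have QL i : Q`_i \in L by rewrite FL // (polyOverP QF).
 by rewrite /w !rpredD ?rpred_div ?rpredD ?rpred_div ?rpredD ?rpred_div.
have w0 := un_neq0 uw.
have ym : x / s \in mx O.
 apply: (mx_exp (n := 2)).
  apply: (O_exp vO (n := 2)) => //; rewrite expr_div_n wE.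
  have -> : x ^+ 2 / (w * x ^+ 3) = w^-1 / x by field; rewrite x0 w0.
  by rewrite rpredM // (un_O (unV uw)).
 rewrite expr_div_n wE; have -> : x ^+ 2 / (w * x ^+ 3) = w^-1 / x by field; rewrite x0 w0.
 by rewrite mx_mulr // (un_O (unV uw)).
have yL : x / s \in L by rewrite rpred_div.
have e1 : x^-1 = (x / s) ^+ 2 * w.
 by rewrite expr_div_n wE; field; rewrite x0 w0.
have Dxi : D x^-1 \in mx O.
 rewrite e1 DD.2 ?rpredX // (derX DD) // expr1 mx_add //.
  rewrite mx_mull ?(un_O uw) // mx_mull ?(Dst pO) ?(mx_sub ym) // mx_mulr // rpred_nat //.
 by rewrite mx_mull ?(Dst pO) ?(un_O uw) // expr2 mx_mull // mx_sub.
have sx : s / x ^+ 2 \in mx O.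
 have e2 : (s / x ^+ 2) ^+ 2 = w / x by rewrite expr_div_n wE; field; rewrite x0.
 apply: (mx_exp (n := 2)); last by rewrite e2 mx_mulr // un_O.
 by apply: (O_exp vO (n := 2)) => //; rewrite e2 rpredM // un_O.
have A3 : A.[x] = A`_0 + A`_1 * x + A`_2 * x ^+ 2.
 by rewrite (horner_coef_wide _ sA) !big_ord_recl big_ord0 /= /bump /=; ring.
apply: (mx_F FO); first exact: (polyOverP AF).
have -> : A`_2 = - D x^-1 - b * (s / x ^+ 2) - (A`_0 / x + A`_1) / x.
 by rewrite (derV DD) // E A3; field; rewrite x0.
have AO i : A`_i \in O by rewrite FO // (polyOverP AF).
rewrite !mx_subr ?mx_oppE //; first by rewrite mx_mulr // FO.
by rewrite mx_mulr // rpredD // rpredM.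
Qed.

(** Three branch points are moved to 0, 1 and infinity. The image la of the fourth is a cross ratio
    of solutions of one Riccati equation, hence a constant. *)
Lemma legendre_of_quad : exists t la ga, [/\ t \in L, la \in F, ga \in F, D la = 0 &
 [/\ la != 0, la != 1, D t ^+ 2 = ga * (t * (t - 1) * (t - la)) &
  forall G : sfield M, F \sub G -> t \in G -> D t \in G -> L \sub G]].
Proof.
have [A [b [AF sA bF xE rE]]] := quad_der.
have [[xL xF sL QF sQ] [/andP[sQ4 sQ5] QE urs rsF] indS _ repS] := qm.
have sQrs := quad_size qm.
have Av y : A.[y] = A`_0 + A`_1 * y + A`_2 * y ^+ 2.
 by rewrite (horner_coef_wide _ sA) !big_ord_recl big_ord0 /= /bump /=; ring.
set l := lead_coef Q in QE.
have lF : l \in F by rewrite /l lead_coefE; apply: (polyOverP QF).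
have ne r r' : r \in rs -> r' \in rs -> r != r' -> r - r' != 0 by rewrite subr_eq0.
have xne r : r \in rs -> x - r != 0.
 by move=> /rsF rF; rewrite subr_eq0; apply: contraNneq xF => ->.
have b0 : b != 0 -> True by [].
have FD := derOn_sub FL DD.
have tconst t : t \in L -> t \notin F -> D t != 0.
 by move=> tL; apply: contraNneq => /(Dconst tL).
case: rs QE urs rsF sQrs rE ne xne => [|r1 [|r2 [|r3 [|r4 [|r5 rs']]]]] QE urs rsF sQrs rE ne xne;
 rewrite ?sQrs //= in sQ4 sQ5.
- have r1F : r1 \in F by apply: rsF; rewrite !inE eqxx.
 have r2F : r2 \in F by apply: rsF; rewrite !inE eqxx orbT.
 have r3F : r3 \in F by apply: rsF; rewrite !inE eqxx !orbT.
 move: urs; rewrite /= !inE !negb_or => /and3P[/andP[n12 n13] n23 _].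
 have h21 : r2 - r1 != 0 by rewrite subr_eq0 eq_sym.
 have h31 : r3 - r1 != 0 by rewrite subr_eq0 eq_sym.
 have h32 : r3 - r2 != 0 by rewrite subr_eq0 eq_sym.
 have d1 : D r1 = A`_0 + A`_1 * r1.
  by rewrite rE ?inE ?eqxx // Av (quad_affine AF sA bF xE sQrs) mul0r addr0.
 have d2 : D r2 = A`_0 + A`_1 * r2.
  by rewrite rE ?inE ?eqxx ?orbT // Av (quad_affine AF sA bF xE sQrs) mul0r addr0.
 have d3 : D r3 = A`_0 + A`_1 * r3.
  by rewrite rE ?inE ?eqxx ?orbT // Av (quad_affine AF sA bF xE sQrs) mul0r addr0.
 have A2 := quad_affine AF sA bF xE sQrs; rewrite Av A2 mul0r addr0 in xE.
 have sE : s ^+ 2 = l * ((x - r1) * (x - r2) * (x - r3)).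
  rewrite sQ QE hornerZ !big_cons big_nil !hornerM !hornerXsubC hornerC; ring.
 (* Degree 3: infinity is already a branch point, and an affine map moves r1, r2 to 0, 1. *)
 pose t := (x - r1) / (r2 - r1); pose la := (r3 - r1) / (r2 - r1).
 have BF r r' : r \in F -> r' \in F -> r - r' \in F by move=> h h'; rewrite rpredB.
 have laF : la \in F by rewrite rpred_div ?BF.
 have xr1L : x - r1 \in L by apply: rpredB => //; apply: FL.
 have r21L : r2 - r1 \in L by rewrite FL // BF.
 have tL : t \in L by rewrite rpred_div.
 have tF : t \notin F.
  apply: contra xF => tF; have -> : x = t * (r2 - r1) + r1 by rewrite /t; field.
  by rewrite rpredD // rpredM // BF.
 have Dt : D t = b * s / (r2 - r1).
  by rewrite /t (derQ DD xr1L r21L h21) (derB DD xL (FL r1F)) (derB DD (FL r2F) (FL r1F)) xE d1 d2; field.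
 have bn : b != 0.
  by apply: contraNneq (tconst t tL tF) => b00; rewrite Dt b00 !mul0r.
 exists t, la, (b ^+ 2 * l * (r2 - r1)); split=> //.
 - by rewrite !rpredM ?rpredX ?BF.
 - by rewrite /la (derQ FD (BF _ _ r3F r1F) (BF _ _ r2F r1F) h21) (derB FD r3F r1F) (derB FD r2F r1F) d1 d2 d3; field.
 split.
 - by rewrite mulf_neq0 // invr_eq0.
 - rewrite -subr_eq0; have -> : la - 1 = (r3 - r2) / (r2 - r1) by rewrite /la; field.
  by rewrite mulf_neq0 // invr_eq0.
 - rewrite Dt expr_div_n exprMn sE /t /la; by field.
 move=> G FG tG DtG; apply: quad_gen => //.
  have -> : x = t * (r2 - r1) + r1 by rewrite /t; field.
  exact: rpredD (rpredM tG (FG _ (BF _ _ r2F r1F))) (FG _ r1F).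
 have -> : s = D t * (r2 - r1) / b by rewrite Dt; field; rewrite bn h21.
 exact: rpred_div (rpredM DtG (FG _ (BF _ _ r2F r1F))) (FG _ bF).
- have r1F : r1 \in F by apply: rsF; rewrite !inE eqxx.
 have r2F : r2 \in F by apply: rsF; rewrite !inE eqxx orbT.
 have r3F : r3 \in F by apply: rsF; rewrite !inE eqxx !orbT.
 have r4F : r4 \in F by apply: rsF; rewrite !inE eqxx !orbT.
 have xr1 : x - r1 != 0 by apply: xne; rewrite !inE eqxx.
 move: urs; rewrite /= !inE !negb_or => /and4P[/and3P[n12 n13 n14] /andP[n23 n24] n34 _].
 have h21 : r2 - r1 != 0 by rewrite subr_eq0 eq_sym.
 have h31 : r3 - r1 != 0 by rewrite subr_eq0 eq_sym.
 have h41 : r4 - r1 != 0 by rewrite subr_eq0 eq_sym.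
 have h32 : r3 - r2 != 0 by rewrite subr_eq0 eq_sym.
 have h42 : r4 - r2 != 0 by rewrite subr_eq0 eq_sym.
 have h43 : r4 - r3 != 0 by rewrite subr_eq0 eq_sym.
 have d1 : D r1 = A`_0 + A`_1 * r1 + A`_2 * r1 ^+ 2 by rewrite rE ?inE ?eqxx // Av.
 have d2 : D r2 = A`_0 + A`_1 * r2 + A`_2 * r2 ^+ 2 by rewrite rE ?inE ?eqxx ?orbT // Av.
 have d3 : D r3 = A`_0 + A`_1 * r3 + A`_2 * r3 ^+ 2 by rewrite rE ?inE ?eqxx ?orbT // Av.
 have d4 : D r4 = A`_0 + A`_1 * r4 + A`_2 * r4 ^+ 2 by rewrite rE ?inE ?eqxx ?orbT // Av.
 rewrite Av in xE.
 have sE : s ^+ 2 = l * ((x - r1) * (x - r2) * (x - r3) * (x - r4)).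
  rewrite sQ QE hornerZ !big_cons big_nil !hornerM !hornerXsubC hornerC; ring.
 have BF r r' : r \in F -> r' \in F -> r - r' \in F by move=> h h'; rewrite rpredB.
 have BL r : r \in F -> x - r \in L by move=> h; apply: rpredB => //; apply: FL.
 (* Degree 4: the Moebius map z to ka h(z) moves r2, r3, r1 to 0, 1, infinity, and r4 to la. *)
 pose ka := (r3 - r1) / (r3 - r2); have kaF : ka \in F by rewrite rpred_div ?BF.
 have ka0 : ka != 0 by rewrite mulf_neq0 // invr_eq0.
 have Dka : D ka = ((D r3 - D r1) * (r3 - r2) - (r3 - r1) * (D r3 - D r2)) / (r3 - r2) ^+ 2.
  by rewrite /ka (derQ FD (BF _ _ r3F r1F) (BF _ _ r3F r2F) h32) (derB FD r3F r1F) (derB FD r3F r2F).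
 pose h z := (z - r2) / (z - r1).
 pose t := ka * h x; pose la := ka * h r4.
 have hxL : h x \in L by rewrite rpred_div ?BL.
 have h4F : h r4 \in F by rewrite rpred_div ?BF.
 have laF : la \in F by rewrite rpredM.
 have tL : t \in L by rewrite rpredM // FL.
 have kt : ka - t != 0.
  have -> : ka - t = ka * (r2 - r1) / (x - r1) by rewrite /t /h; field.
  by rewrite !mulf_neq0 // invr_eq0.
 have xt : x = (ka * r2 - t * r1) / (ka - t).
  apply: (mulIf kt); rewrite divfK // /t /h; by field.
 have tF : t \notin F.
  by apply: contra xF => tF; rewrite xt; exact: rpred_div (rpredB (rpredM kaF r2F) (rpredM tF r1F)) (rpredB kaF tF).
 have Dt : D t = ka * (r2 - r1) / (x - r1) ^+ 2 * (b * s).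
  rewrite /t (DD.2 _ _ (FL kaF) hxL) /h (derQ DD (BL _ r2F) (BL _ r1F) xr1) (derB DD xL (FL r2F)) (derB DD xL (FL r1F)) Dka xE d1 d2 d3 /ka; field.
  by rewrite h32 xr1.
 have bn : b != 0.
  by apply: contraNneq (tconst t tL tF) => b00; rewrite Dt b00 mul0r mulr0.
 exists t, la, (b ^+ 2 * l * (r3 - r2) * (r4 - r1)); split=> //.
 - by rewrite !rpredM ?rpredX ?BF.
 - rewrite /la (FD.2 _ _ kaF h4F) /h (derQ FD (BF _ _ r4F r2F) (BF _ _ r4F r1F) h41) (derB FD r4F r2F) (derB FD r4F r1F) Dka d1 d2 d3 d4 /ka; field.
  by rewrite h32 h41.
 split.
 - by rewrite !mulf_neq0 // invr_eq0.
 - rewrite -subr_eq0; have -> : la - 1 = (r4 - r3) * (r2 - r1) / ((r4 - r1) * (r3 - r2)).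
   by rewrite /la /h /ka; field; rewrite h32 h41.
  by rewrite !mulf_neq0 // invr_eq0 mulf_neq0.
 - rewrite Dt exprMn [(b * s) ^+ 2]exprMn sE /t /la /h /ka; field.
  by rewrite h32 h41 xr1.
 move=> G FG tG DtG.
 have xG : x \in G by rewrite xt; exact: rpred_div (rpredB (rpredM (FG _ kaF) (FG _ r2F)) (rpredM tG (FG _ r1F))) (rpredB (FG _ kaF) tG).
 apply: quad_gen => //.
 have -> : s = D t * (x - r1) ^+ 2 / (ka * (r2 - r1) * b).
  by rewrite Dt; field; rewrite bn h21 ka0 xr1.
 apply: rpred_div; first by apply: rpredM => //; apply/rpredX/rpredB => //; apply: FG.
 exact: FG _ (rpredM (rpredM kaF (BF _ _ r2F r1F)) bF).
Qed.

End Quad.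
End Derivation.

(** * Function fields generated by two elements *)

Section FunctionFields.
Variable M : fieldType.

(** By exchange u is algebraic over F(x) for every nonconstant x, and then so is w. *)
Lemma ffield_two (F F1 F2 : sfield M) u w : relacl F -> u \notin F ->
 (adj_is F u F1) -> (adj_is F1 w F2) -> alg F1 w ->
 ffield F F2.
Proof.
move=> hF uF F1P F2P wa.
have FF1 : F \sub F1 by move=> y yF; apply/F1P/adj_id.
have F12 : F1 \sub F2 by move=> y yF; apply/F2P/adj_id.
split=> // [y /FF1/F12//|x Fx xF2 xF FxP].
have xa : alg F1 x by apply: alg_adj wa _; apply/F2P.
have xna : ~ alg F x by move=> /hF; apply/negP.
have ux : alg Fx u := alg_exchange F1P FxP xa xna.
have FFx : F \sub Fx by move=> y yF; apply/FxP/adj_id.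
have [Fxu FxuP] := adjF Fx u; have [Fxuw FxuwP] := adjF Fxu w.
have FxFxu : Fx \sub Fxu by move=> y yF; apply/FxuP/adj_id.
have F1Fxu : F1 \sub Fxu.
 move=> y /F1P; apply: adj_min; first by move=> z /FFx/FxFxu.
 by apply/FxuP/adj_gen.
have wx : alg Fx w.
 apply: (alg_trans (G := Fxu)); first by move=> y /FxuP; apply: alg_adj.
 exact: alg_subset wa.
have [n rkn] := rk_adj2 FxuP FxuwP ux wx; exists n; apply: rk_sub rkn => // y /F2P.
by apply: adj_min; [move=> z /F1Fxu zF; apply/FxuwP/adj_id|apply/FxuwP/adj_gen].
Qed.

Lemma ffield_sub (F L L' : sfield M) : ffield F L -> F \sub L' ->
 L' \sub L -> ffield F L'.
Proof.
move=> [hF FL fin] FL' LL'; split=> // x Fx xL' xF FxP.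
by have [n rkn] := fin x Fx (LL' _ xL') xF FxP; exists n; apply: rk_sub rkn.
Qed.

Lemma ffield_alg (F L : sfield M) x y (Fx : sfield M) : ffield F L ->
 x \in L -> x \notin F -> (adj_is F x Fx) -> y \in L -> alg Fx y.
Proof.
move=> [hF FL fin] xL xF FxP yL; have [n rkn] := fin x Fx xL xF FxP.
by have [|p [pF p0 py _]] := rk_alg rkn (y := y); [move=> i; rewrite rpredX|exists p].
Qed.
End FunctionFields.

(** * Stability deduced from a stable subring *)

Section Regular.
Variable M : fieldType.
Hypotheses (char0 : char_0 M) (aclM : acl M).
Variables (F L : sfield M).
Hypothesis ffL : ffield F L.
Let FL : F \sub L. Proof. by case: ffL. Qed.
Variables (O R : sring M) (D : M -> M).
Hypotheses (vO : valring O) (FO : F \sub O) 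
 (RO : R \sub O) (RL : R \sub L)
 (frac : forall y, y \in L -> is_frac R y)
 (DD : derOn L D) (DL : stab D L)
 (DR : stab D R).

(* (p / D p) D fixes p, so it lowers no order at O; on R, whose image under D stays in O, this
  forces every order to be a multiple of the order of p. *)
Lemma regular_uniformizer p : p \in R -> p \in mx O -> D p \notin mx O ->
 (forall y, y \in F -> D y \in O) ->
 forall b, b \in L -> b \in mx O -> b / p \in O.
Proof.
move=> pR pm Dpu DFO.
have pL := RL pR; have DpO := RO (DR pR).
have p0 : p != 0 by apply: contraNneq Dpu => ->; rewrite (der0 DD) mx0.
have [Dp0 DpV] := unitO DpO Dpu.
pose g := p / D p; have gm : g \in mx O by rewrite mx_mull.
have gL : g \in L by rewrite rpred_div ?DL.
pose E y := g * D y.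
have ED : derOn L E.
 split=> y z yL zL; first by rewrite /E DD.1 // mulrDr.
 by rewrite /E DD.2 //; ring.
have EL y : y \in L -> E y \in L by move=> yL; rewrite rpredM ?DL.
have Ep : E p = p by rewrite /E divfK.
have EpO : E p \in O by rewrite Ep mx_sub.
have EF y : y \in F -> E y \in O by move=> yF; exact: rpredM (mx_sub gm) (DFO _ yF).
have Est : stab_in E L O.
 apply: (der_place_stable char0 aclM ffL vO FO ED EL EF pL pm p0 EpO).
 by left; rewrite Ep divff // rpred1.
have [N [N0 ord _ res]] := unif aclM ffL vO FO pL pm p0.
have Nn : N%:R != 0 :> M by rewrite natr_eq0 // -lt0n.
have NO : N%:R^-1 \in O by rewrite FO // rpredV rpred_nat.
(* the order of E y is that of y unless y is a unit *)
have logE y r u : y \in L -> y != 0 -> y ^+ N = p ^+ r * u -> un O u -> u \in L ->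
  E y = y * (N%:R^-1 * (r%:R + E u / u)).
 move=> yL y0 yE uu uL; have u0 := un_neq0 uu.
 have := congr1 E yE; rewrite (derX ED) // ED.2 ?rpredX // (derX ED) // Ep => H.
 have yN : y ^+ N = y ^+ N.-1 * y by rewrite -exprSr prednK.
 have yN0 : y ^+ N.-1 != 0 by rewrite expf_neq0.
 have pr : r%:R * p ^+ r.-1 * p = r%:R * p ^+ r.
  by case: (r) => [|r']; [rewrite !mul0r|rewrite /= exprSr mulrA].
 apply: (mulfI Nn); apply: (mulfI yN0).
 transitivity (y ^+ N * (r%:R + E u / u)); last by rewrite yN; field; rewrite Nn u0.
 by rewrite mulrCA mulrA H yE pr; field.
have Emx y : y \in L -> y \in mx O -> E y \in mx O.
 move=> yL ym; have [->|y0] := eqVneq y 0; first by rewrite (der0 ED) mx0.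
 have [r [u [yE uu uL r0]]] := ord y yL y0 (mx_sub ym).
 rewrite (logE y r u) //; apply: mx_mull => //; rewrite rpredM // rpredD ?rpred_nat //.
 by rewrite rpredM ?Est ?(un_O uu) // (un_O (unV uu)).
have Eu u : un O u -> u \in L -> E u / u \in mx O.
 move=> uu uL; have [c cF uc] := res u uL (un_O uu).
 apply: mx_mull; last exact: un_O (unV uu).
 have cL := FL cF; have ucL := rpredB uL cL.
 rewrite -[u](subrK c) (ED.1 _ _ ucL cL); apply: mx_add => //; first exact: Emx.
 exact: mx_mull gm (DFO _ cF).
(* For a nonunit a of R, D a is a unit times a / p and lies in R again; the induction descends by
   the order of p until a unit is reached. *)
have key s : forall a r u, a \in R -> a != 0 -> a ^+ N = p ^+ r * u -> un O u -> u \in L -> (r < s)%N ->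
  exists n w, [/\ a = p ^+ n * w, un O w & a \in mx O -> (0 < n)%N].
 elim: s => // s IH a r u aR a0 aE uu uL rs; have aL := RL aR.
 have [am|am] := boolP (a \in mx O); last first.
  by exists 0%N, a; rewrite expr0 mul1r /un RO.
 have r0 : (0 < r)%N.
  rewrite lt0n; apply: contraTneq am => r0; rewrite r0 expr0 mul1r in aE.
  by apply/negP => /mx_mull/(_ (rpredX N.-1 (RO aR))); rewrite -exprS prednK // aE; apply/negP/un_nm.
 have w0 : un O (N%:R^-1 * (r%:R + E u / u)).
  rewrite unM //; first by rewrite (un_F FO) ?rpredV ?rpred_nat ?invr_eq0.
  by rewrite un_add ?Eu // (un_F FO) ?rpred_nat // natr_eq0 // -lt0n.
 move: (logE a r u aL a0 aE uu uL) w0; set w := N%:R^-1 * _ => Ea' w0.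
 have wL : w \in L.
  by rewrite rpredM ?rpredV ?rpred_nat // rpredD ?rpred_nat // rpred_div ?EL.
 clearbody w.
 have Ea : g * D a = a * w by [].
 have Da : D a = a * w * D p / p by rewrite -Ea /g; field; rewrite p0 Dp0.
 have wn := un_neq0 w0.
 have Da0 : D a != 0.
  rewrite Da; apply: mulf_neq0; last by rewrite invr_eq0.
  by apply: mulf_neq0 => //; apply: mulf_neq0.
 have uDp : un O (D p) by rewrite unE Dp0 DpO.
 pose u' := u * (w * D p) ^+ N.
 have uu' : un O u' by rewrite unM // unX // unM.
 have DaN : D a ^+ N * p ^+ N = p ^+ r * u'.
  rewrite Da /u'; have -> : a * w * D p / p = a * (w * D p) / p by ring.
  by rewrite expr_div_n divfK ?expf_neq0 // exprMn aE mulrA.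
 have DaO := RO (DR aR).
 have Nr : (N <= r)%N.
  rewrite leqNgt; apply/negP => rN.
  have E1 : p ^+ (N - r).-1.+1 * D a ^+ N = u'.
   rewrite prednK ?subn_gt0 //; apply: (mulfI (expf_neq0 r p0)).
   by rewrite -DaN mulrA -exprD subnKC ?(ltnW rN) // mulrC.
  have := un_nm uu'; rewrite -E1 exprS -mulrA mx_mull //.
  by rewrite rpredM ?rpredX // mx_sub.
 have DaE : D a ^+ N = p ^+ (r - N) * u'.
  by apply: (mulIf (expf_neq0 N p0)); rewrite DaN mulrAC -exprD subnK.
 have u'L : u' \in L by rewrite rpredM ?rpredX // rpredM ?DL.
 have [|n [z [DaE' uz _]]] := IH _ _ _ (DR aR) Da0 DaE uu' u'L.
  by apply: (@leq_trans r); rewrite ?ltn_subrL ?N0 ?r0.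
 exists n.+1, (z / (w * D p)); split=> //; last by rewrite unM // unV // unM.
 have -> : a = D a * p / (w * D p) by rewrite Da; field; rewrite wn Dp0 p0.
 by rewrite DaE' exprS; field; rewrite wn Dp0.
have keyR a : a \in R -> a != 0 -> exists n w, [/\ a = p ^+ n * w, un O w & a \in mx O -> (0 < n)%N].
 move=> aR a0; have [r [u [aE uu uL _]]] := ord a (RL aR) a0 (RO aR).
 exact: (key r.+1 a r u).
move=> b bL bm; have [->|b0] := eqVneq b 0; first by rewrite mul0r rpred0.
have [a [c [aR cR c0 bE]]] := frac bL.
have a0 : a != 0 by apply: contraNneq b0 => a0; rewrite bE a0 mul0r.
have [n [w [aE uw _]]] := keyR a aR a0; have [m [z [cE uz _]]] := keyR c cR c0.
have wn := un_neq0 uw; have zn := un_neq0 uz.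
have uwz : un O (w / z) by rewrite unM // unV.
have pn j : p ^+ j != 0 by rewrite expf_neq0.
have nm : (m < n)%N.
 rewrite ltnNge; apply/negP => nm.
 have : p ^+ (m - n) * b \in mx O by rewrite mx_mulr // rpredX // mx_sub.
 have -> : p ^+ (m - n) * b = w / z.
  rewrite bE aE cE -[in p ^+ m](subnK nm) exprD.
  by have := pn (m - n)%N => h; have := pn n => h'; field; rewrite zn h h'.
 by rewrite (negPf (un_nm uwz)).
have -> : b / p = p ^+ (n - m).-1 * (w / z).
 rewrite bE aE cE -[in p ^+ n](subnK (ltnW nm)) exprD -[in p ^+ (n - m)](prednK (_ : 0 < n - m)%N) ?subn_gt0 //.
 by rewrite exprS; have := pn m => h'; field; rewrite zn p0 h'.
by rewrite rpredM ?(un_O uwz) // rpredX // mx_sub.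
Qed.

(** Choose q of least positive order in R. If D q is a nonunit, minimality makes D q / q integral;
    if D q is a unit, q is a uniformizer by [regular_uniformizer]; [der_place_stable] covers both.
    If R has no such q, all denominators in R are units and the quotient rule suffices. *)
Lemma der_stable_subring : (stab D F) ->
 stab_in D L O.
Proof.
move=> DF; have DFO y : y \in F -> D y \in O by move=> /DF/FO.
have [[p [pR pm p0]]|np] := pselect (exists p, [/\ p \in R, p \in mx O & p != 0]); last first.
 move=> y yL yO; have [a [b [aR bR b0 ->]]] := frac yL.
 have bm : b \notin mx O by apply/negP => bm; apply: np; exists b.
 have [_ bi] := unitO (RO bR) bm.
 by rewrite (derQ DD) ?RL // rpredM ?exprVn ?rpredX // -?exprVn ?rpredX // rpredB // rpredM ?RO ?DR.
have [q [qR qm q0] qmin] : exists2 q, [/\ q \in R, q \in mx O & q != 0] &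
  D q \in mx O -> D q / q \in O.
 have [N [N0 ord _ _]] := unif aclM ffL vO FO (RL pR) pm p0.
 pose P r := `[< exists q u, [/\ q \in R, q \in mx O, q != 0, q ^+ N = p ^+ r * u & un O u] >].
 have ex : exists r, P r.
  have [r [u [E uu _ _]]] := ord p (RL pR) p0 (mx_sub pm).
  by exists r; apply/asboolP; exists p, u.
 case: (ex_minnP ex) => r /asboolP[q [u [qR qm q0 qE uu]]] rmin.
 exists q; first by []. move=> Dqm; have [->|Dq0] := eqVneq (D q) 0; first by rewrite mul0r rpred0.
 have [r' [u' [E uu' _ _]]] := ord (D q) (DL (RL qR)) Dq0 (mx_sub Dqm).
 have le : (r <= r')%N by apply: rmin; apply/asboolP; exists (D q), u'; split=> //; apply: DR.
 apply: (O_exp vO N0); rewrite expr_div_n E qE -(subnK le) exprD.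
 have -> : p ^+ (r' - r) * p ^+ r * u' / (p ^+ r * u) = p ^+ (r' - r) * (u' / u).
  by have := expf_neq0 r p0 => h; field; rewrite h (un_neq0 uu).
 by rewrite rpredM ?rpredX ?(mx_sub pm) // (un_O (unM uu' (unV uu))).
have DqO := RO (DR qR).
apply: (der_place_stable char0 aclM ffL vO FO DD DL DFO (RL qR) qm q0 DqO).
have [Dqm|Dqm] := boolP (D q \in mx O); first by left; apply: qmin.
by right; apply: regular_uniformizer.
Qed.

End Regular.

(** * Linear disjointness through derivations *)

Section Compositum.
Variable M : fieldType.
Implicit Types (A B K : {pred M}) (N G : sfield M).

(** The image in M of a tensor product. *)
Definition tens A B z := exists r (a b : 'I_r -> M),
 [/\ forall i, a i \in A, forall i, b i \in B & z = \sum_i a i * b i].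

Lemma fin_rep (I : finType) A B (a b : I -> M) : (forall i, a i \in A) -> (forall i, b i \in B) ->
 tens A B (\sum_i a i * b i).
Proof.
move=> aA bB; exists #|I|, (fun i => a (enum_val i)), (fun i => b (enum_val i)); split=> //.
by rewrite (reindex (@enum_val _ (mem I))) //=; apply: onW_bij; apply: enum_val_bij.
Qed.

Lemma tens_l A (S : sring M) a : a \in A -> tens A S a.
Proof. by move=> aA; exists 1%N, (fun=> a), (fun=> 1); rewrite big_ord1 mulr1; split=> // _; apply: rpred1. Qed.
Lemma tens_r (S : sring M) B b : b \in B -> tens S B b.
Proof. by move=> bB; exists 1%N, (fun=> 1), (fun=> b); rewrite big_ord1 mul1r; split=> // _; apply: rpred1. Qed.

Lemma tens_ring (S T : sring M) : exists R : sring M, forall z, z \in R <-> tens S T z.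
Proof.
apply: mkR; first exact: tens_l (rpred1 _).
 move=> _ _ [r [a [b [aS bT ->]]]] [r' [a' [b' [aS' bT' ->]]]].
 have -> : \sum_i a i * b i - \sum_i a' i * b' i =
   \sum_(i : 'I_r + 'I_r') (match i with inl j => a j | inr j => - a' j end) *
     (match i with inl j => b j | inr j => b' j end).
  by rewrite big_sumType /= -sumrN; congr (_ + _); apply: eq_bigr => i _; rewrite mulNr.
 by apply: fin_rep => -[i|i] //; rewrite rpredN.
move=> _ _ [r [a [b [aS bT ->]]]] [r' [a' [b' [aS' bT' ->]]]].
rewrite mulr_suml; under eq_bigr do rewrite mulr_sumr.
rewrite pair_bigA /= (eq_bigr (fun p => (a p.1 * a' p.2) * (b p.1 * b' p.2))) => [|p _]; last by ring.
by apply: fin_rep => p; rewrite rpredM.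
Qed.

Lemma frac_field (R : sring M) : exists G : sfield M, forall z, z \in G <->
 is_frac R z.
Proof.
apply: mkF; split.
- by exists 1, 1; rewrite rpred1 oner_eq0 divr1.
- move=> _ _ [a [b [aR bR b0 ->]]] [a' [b' [aR' bR' b0' ->]]].
 exists (a * b' - a' * b), (b * b'); rewrite rpredB ?rpredM // mulf_neq0 //; split=> //.
 by field; rewrite b0 b0'.
- move=> _ _ [a [b [aR bR b0 ->]]] [a' [b' [aR' bR' b0' ->]]].
 have [->|a0] := eqVneq a' 0; first by exists 0, 1; rewrite rpred0 rpred1 oner_eq0; split=> //; rewrite !(mul0r, invr0, mulr0).
 exists (a * b'), (b * a'); rewrite !rpredM // mulf_neq0 //; split=> //.
 by field; rewrite b0 b0' a0.
Qed.

(* A relation of minimal support, normalized, has coefficients killed by all the derivations. *)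
Lemma const_indep (Del : (M -> M) -> Prop) N (N0 : sfield M) r (b : 'I_r -> M) :
 (forall D, Del D -> isder D) -> (forall D, Del D -> stab D N) ->
 (forall y, y \in N -> (forall D, Del D -> D y = 0) -> y \in N0) ->
 (forall D, Del D -> forall i, D (b i) = 0) ->
 indep N0 b -> indep N b.
Proof.
move=> der DN cN cb ind n nN n0 i; apply/eqP; apply: contraT => ni.
pose supp (n : 'I_r -> M) := #|[pred i | n i != 0]|.
pose P s := `[< exists n i, [/\ forall i, n i \in N, \sum_i n i * b i = 0, n i != 0 & supp n = s] >].
have ex : exists s, P s by exists (supp n); apply/asboolP; exists n, i.
case: (ex_minnP ex) => s /asboolP[m [i0 [mN m0 mi sE]]] smin.
pose c j := m j / m i0.
have cN' j : c j \in N by rewrite rpred_div.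
have c0 : \sum_j c j * b j = 0.
 transitivity ((\sum_j m j * b j) / m i0); last by rewrite m0 mul0r.
 by rewrite mulr_suml; apply: eq_bigr => j _; rewrite /c mulrAC.
have ci0 : c i0 = 1 by rewrite /c divff.
have Dc D j : Del D -> D (c j) = 0.
 move=> dD; have DD : derOn N D := isder_on _ (der D dD).
 have Dsum : \sum_j D (c j) * b j = 0.
  have [T hT] := fullF M; have DT : derOn T D := isder_on _ (der D dD).
  have := der0 DT; rewrite -{1}c0 (der_sum DT) => [E|k _]; last exact: hT.
  by rewrite -[RHS]E; apply: eq_bigr => k _; rewrite ((der D dD).2 (c k) (b k)) (cb D dD) mulr0 addr0.
 apply/eqP; apply: contraT => nz.
 have : (s <= supp (fun j => D (c j)))%N.
  by apply: smin; apply/asboolP; exists (fun j => D (c j)), j; split=> // k; apply: DN.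
 rewrite leqNgt -sE; case/negP; apply: proper_card; apply/fintype.properP; split.
  apply/fintype.subsetP => k; rewrite !inE; apply: contraNneq => mk.
  by rewrite /c mk mul0r (der0 DD).
 by exists i0; rewrite !inE ?ci0 ?(der1 DD) ?eqxx.
have cN0 j : c j \in N0 by apply: cN => // D dD; apply: Dc.
by have := ind c cN0 c0 i0; rewrite ci0 => /eqP; rewrite oner_eq0.
Qed.

(* y (sum p b) = sum q b with as few b as possible: the b are then independent over N0. *)
Lemma rel_reduce (N0 : sfield M) G K y r
  (p q b : 'I_r -> M) : N0 \sub G ->
 (forall i, p i \in G) -> (forall i, q i \in G) -> (forall i, b i \in K) ->
 \sum_i p i * b i != 0 -> y * \sum_i p i * b i = \sum_i q i * b i ->
 exists r (p q b : 'I_r -> M), [/\ forall i, p i \in G, forall i, q i \in G,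
  (forall i, b i \in K) /\ indep N0 b, \sum_i p i * b i != 0 & y * \sum_i p i * b i = \sum_i q i * b i].
Proof.
move=> N0G.
elim: r p q b => [|r IH] p q b pG qG bK nz E.
 by exists 0%N, p, q, b; split=> //; split=> // c _ _ [].
have [ind|nind] := pselect (indep N0 b); first by exists r.+1, p, q, b.
have [c [cN c0 [l cl]]] := not_indep nind.
pose f i := c (lift l i) / c l.
have bl : b l = - \sum_i f i * b (lift l i).
 have E0 : c l * b l + \sum_(i < r) c (lift l i) * b (lift l i) = 0.
  by rewrite -[RHS]c0 [RHS](bigD1_ord l).
 apply: (mulfI cl); rewrite mulrN mulr_sumr; apply/eqP; rewrite -addr_eq0; apply/eqP.
 by rewrite -[RHS]E0; congr (_ + _); apply: eq_bigr => i _; rewrite /f mulrA [c l * _]mulrC divfK.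
have fG i : f i \in G.
 by apply: N0G; rewrite rpred_div.
have sumE (h : 'I_r.+1 -> M) : \sum_i h i * b i = \sum_i (h (lift l i) - h l * f i) * b (lift l i).
 rewrite (bigD1_ord l) //= bl mulrN mulr_sumr -sumrN -big_split /=.
 by apply: eq_bigr => i _; ring.
have hG h : (forall i, h i \in G) -> forall i, h (lift l i) - h l * f i \in G.
 by move=> hh i; exact: rpredB (hh _) (rpredM (hh _) (fG _)).
by apply: (IH (fun i => p (lift l i) - p l * f i) (fun i => q (lift l i) - q l * f i) (fun i => b (lift l i)));
 rewrite -?sumE //; apply: hG.
Qed.

(** Numerator and denominator are brought to one common family b by padding with zero
    coefficients. *)
Lemma rel_of_frac (A B : {pred M}) (hA : 0 \in A) y : (exists a b, [/\ tens A B a, tens A B b, b != 0 & y = a / b]) ->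
 exists r (p q b : 'I_r -> M), [/\ forall i, p i \in A, forall i, q i \in A, forall i, b i \in B,
  \sum_i p i * b i != 0 & y * \sum_i p i * b i = \sum_i q i * b i].
Proof.
move=> [_ [_ [[r [a [b [aA bB ->]]]] [r' [a' [b' [aA' bB' ->]]]] nz ->]]].
pose I : finType := ('I_r + 'I_r')%type.
pose p (i : 'I_r + 'I_r') := match i with inl j => 0 | inr j => a' j end.
pose q (i : 'I_r + 'I_r') := match i with inl j => a j | inr j => 0 end.
pose c (i : 'I_r + 'I_r') := match i with inl j => b j | inr j => b' j end.
have sE (h : I -> M) : \sum_(i < #|{: I}|) h (enum_val i) * c (enum_val i) = \sum_i h i * c i.
 by rewrite [RHS](reindex (@enum_val _ (mem I))) //=; apply: onW_bij; apply: enum_val_bij.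
have pE : \sum_i p i * c i = \sum_i a' i * b' i.
 by rewrite big_sumType /= big1 ?add0r // => i _; rewrite mul0r.
have qE : \sum_i q i * c i = \sum_i a i * b i.
 by rewrite big_sumType /= [X in _ + X]big1 ?addr0 // => i _; rewrite mul0r.
exists #|{: I}|, (fun i => p (enum_val i)), (fun i => q (enum_val i)), (fun i => c (enum_val i)).
rewrite !sE pE qE; split=> //; [| | |by rewrite divfK] => i; case: (enum_val i) => j //=.
Qed.

(** When the b_i are independent over N, the relation y sum p_i b_i = sum q_i b_i can be compared
    coefficientwise: y p_i = q_i. *)
Lemma indep_descend (N0 : sfield M) N K G y : N0 \sub G -> G \sub N ->
 (forall r (b : 'I_r -> M), (forall i, b i \in K) -> indep N0 b -> indep N b) ->
 y \in N -> (exists a b, [/\ tens G K a, tens G K b, b != 0 & y = a / b]) -> y \in G.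
Proof.
move=> N0G GN LD yN /(rel_of_frac (rpred0 G))[r [p [q [b [pG qG bK nz E]]]]].
have {p q b pG qG bK nz E} [r' [p [q [b [pG qG [bK ind] nz E]]]]] := rel_reduce N0G pG qG bK nz E.
have [i pi] : exists i, p i != 0.
 apply: contrapT => h; move: nz; rewrite big1 ?eqxx // => i _.
 have [->|pi] := eqVneq (p i) 0; first by rewrite mul0r.
 by case: h; exists i.
have hN j : y * p j - q j \in N by exact: rpredB (rpredM yN (GN _ (pG j))) (GN _ (qG j)).
have E0 : \sum_j (y * p j - q j) * b j = 0.
 by under eq_bigr do rewrite mulrBl; rewrite sumrB -E mulr_sumr; under eq_bigr do rewrite -mulrA; rewrite subrr.
have /eqP := LD _ b bK ind _ hN E0 i.
rewrite subr_eq0 => /eqP yp; rewrite -[y](mulfK pi) yp rpred_div //.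
Qed.

End Compositum.

Section Adj.
Variable M : fieldType.
Implicit Types (F L N : sfield M).

Lemma der_adj_in F L N D x y : derOn L D -> F \sub L -> x \in L -> F \sub N -> x \in N ->
 D x \in N -> (forall z, z \in F -> D z \in N) -> adj F x y -> D y \in N.
Proof.
move=> DD FL xL FN xN DxN DFN [p [q [pF qF q0 ->]]].
have pl (r : {poly M}) : r \over F -> r.[x] \in L /\ r.[x] \in N.
 by move=> rF; split; apply: rpred_horner => //; apply: polyOver_sub rF.
have Dp (r : {poly M}) : r \over F -> D r.[x] \in N.
 move=> rF; rewrite (der_horner DD) //; last exact: polyOver_sub rF.
 rewrite rpredD ?rpredM ?rpred_horner //.
  by apply/polyOverP => i; rewrite (coef_dpoly DD) DFN // (polyOverP rF).
 by rewrite polyOver_deriv //; apply: polyOver_sub rF.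
have [pL pN] := pl p pF; have [qL qN] := pl q qF.
rewrite (derQ DD) //; apply: rpred_div; last exact: rpredX.
by apply: rpredB; apply: rpredM => //; apply: Dp.
Qed.

Lemma der_adj0 F L D x y : derOn L D -> F \sub L -> x \in L ->
 D x = 0 -> (kills D F) -> adj F x y -> D y = 0.
Proof.
move=> DD FL xL Dx DF [p [q [pF qF q0 ->]]].
have Dp (r : {poly M}) : r \over F -> D r.[x] = 0.
 move=> rF; rewrite (der_horner DD) //; last exact: polyOver_sub rF.
 by rewrite (dpoly0 (derOn_sub FL DD) DF) // horner0 Dx mulr0 addr0.
have pL (r : {poly M}) : r \over F -> r.[x] \in L.
 by move=> rF; apply: rpred_horner => //; apply: polyOver_sub rF.
by rewrite (derQ DD) ?pL // !Dp // mul0r mulr0 subr0 mul0r.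
Qed.

Lemma mkI (S T : sring M) : exists R : sring M, forall z, z \in R <-> z \in S /\ z \in T.
Proof.
apply: mkR; first by rewrite !rpred1.
 by move=> x y [xS xT] [yS yT]; rewrite !rpredB.
by move=> x y [xS xT] [yS yT]; rewrite !rpredM.
Qed.

Lemma mkIF (S T : sfield M) : exists R : sfield M, forall z, z \in R <-> z \in S /\ z \in T.
Proof.
apply: mkF; split; first by rewrite !rpred1.
 by move=> x y [xS xT] [yS yT]; rewrite !rpredB.
by move=> x y [xS xT] [yS yT]; rewrite !rpred_div.
Qed.
End Adj.

(** * Descent of a vector field from U to k *)

Section Core.
Variable M : fieldType.
Hypotheses (char0 : char_0 M) (aclM : acl M).
Variables (k U K UK : sfield M) (w : M) (dl : M -> M).
Hypotheses (hk : relacl k) (hU : relacl U) (kU : k \sub U) (kK : k \sub K)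
 (ffK : ffield k K) (ffUK : ffield U UK) (wK : w \in K) (wU : w \notin U)
 (UUK : U \sub UK) (KUK : K \sub UK)
 (UKP : forall y, y \in UK -> exists a b, [/\ tens U K a, tens U K b, b != 0 & y = a / b]).
Hypotheses (dd : isder dl) (dk : stab dl k)
 (dU : stab dl U) (dK : stab dl K)
 (constK : forall y, y \in K -> dl y = 0 -> y \in k)
 (constU : forall y, y \in U -> dl y = 0 -> y \in k).

(** Derivations along the factor U of the compositum. They replace a Galois group: their constants
    are k in U, K in UK and K0 in N. *)
Definition Del (ep : M -> M) := [/\ isder ep, stab ep U &
 kills ep K].

Let wk : w \notin k. Proof. by apply: contra wU => /kU. Qed.
Let full : exists T : sfield M, forall x, x \in T. Proof. exact: fullF. Qed.

(** For u transcendental over k, d/du extends to U, then by zero to w, and so kills K, which is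
    algebraic over k(w). *)
Lemma Del_k u : u \in U -> (forall ep, Del ep -> ep u = 0) -> u \in k.
Proof.
move=> uU h; apply/negPn/negP => uk; have [T hT] := full.
have nau : ~ alg k u by move=> /hk; apply/negP.
have z0 : derOn k (fun=> 0 : M) by split=> *; rewrite ?mul0r ?mulr0 addr0.
have zU : forall x, x \in k -> (fun=> 0 : M) x \in U by move=> *; apply: rpred0.
have [D [DD DU D0 Du]] := der_ext_transc char0 z0 kU zU uU (rpred1 U) nau.
have naw : ~ alg U w by move=> /hU; apply/negP.
have UT : U \sub T by move=> *; apply: hT.
have DT : forall x, x \in U -> D x \in T by move=> *; apply: hT.
have [E [EE _ E0 Ew]] := der_ext_transc char0 DD UT DT (hT w) (rpred0 T) naw.
have [kw kwP] := adjF k w.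
have EK y : y \in K -> E y = 0.
 move=> yK; have ya := ffield_alg ffK wK wk kwP yK.
 have zT : derOn T (fun=> 0 : M) by split=> *; rewrite ?mul0r ?mulr0 addr0.
 apply: (der_unique char0 ya EE zT _ (hT y)); first by move=> *; apply: hT.
 move=> z /kwP; apply: (der_adj0 EE _ (hT w) Ew); first by move=> *; apply: hT.
 by move=> x xk; rewrite E0 ?kU // D0.
have : Del E.
 by split=> // [|y yU]; [apply: (derOn_full hT EE)|rewrite E0 // DU].
move=> /h; rewrite E0 // Du => /eqP; by rewrite oner_eq0.
Qed.

Lemma UK_indep r (b : 'I_r -> M) : (forall i, b i \in K) -> indep k b -> indep U b.
Proof.
move=> bK; apply: (const_indep (Del := Del)) => [D []|D []|y yU|D [] _ _ h i] //.
 exact: Del_k.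
exact: h.
Qed.

(** Write y = sum q b / sum p b with b independent over k. If y were outside K, the b_j and y b_j
    together would be independent over k, hence over U by [const_indep], but p and -q relate
    them. *)
Lemma Del_UK y : y \in UK -> (forall ep, Del ep -> ep y = 0) -> y \in K.
Proof.
move=> yUK h; have := UKP yUK => /(rel_of_frac (rpred0 U))[r [p [q [b [pU qU bK nz E]]]]].
have {p q b pU qU bK nz E} [r' [p [q [b [pU qU [bK ind] nz E]]]]] := rel_reduce kU pU qU bK nz E.
apply: contrapT => yK.
pose I : finType := ('I_r' + 'I_r')%type.
pose c (i : 'I_r' + 'I_r') := match i with inl j => y * b j | inr j => b j end.
pose f (i : 'I_r' + 'I_r') := match i with inl j => p j | inr j => - q j end.
have sE (g : I -> M) : \sum_(i < #|{: I}|) g (enum_val i) * c (enum_val i) = \sum_i g i * c i.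
 by rewrite [RHS](reindex (@enum_val _ (mem I))) //=; apply: onW_bij; apply: enum_val_bij.
have ic : indep k (fun i : 'I_#|{: I}| => c (enum_val i)).
 move=> ka kaF; pose g (i : I) := ka (enum_rank i).
 have -> : \sum_i ka i * c (enum_val i) = \sum_(i : I) g i * c i.
  by rewrite -sE; apply: eq_bigr => i _; rewrite /g enum_valK.
 rewrite big_sumType /= => s0 i.
 have s1 : y * \sum_j g (inl j) * b j = - \sum_j g (inr j) * b j.
  apply/eqP; rewrite -addr_eq0 -[X in _ == X]s0 mulr_sumr; apply/eqP; congr (_ + _).
  by apply: eq_bigr => j _; rewrite mulrCA.
 have bs (f' : 'I_r' -> M) : (forall j, f' j \in k) -> \sum_j f' j * b j \in K.
  by move=> fk; apply: rpred_sum => j _; rewrite rpredM // kK.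
 have l0 : \sum_j g (inl j) * b j = 0.
  apply/eqP; apply: contraT => nz'; case: yK.
  by rewrite -[y](mulfK nz') s1 rpred_div ?rpredN ?bs // => j; apply: kaF.
 have gl := ind (fun j => g (inl j)) (fun j => kaF _) l0.
 have r0 : \sum_j g (inr j) * b j = 0.
  by apply: oppr_inj; rewrite -s1 l0 mulr0 oppr0.
 have gr := ind (fun j => g (inr j)) (fun j => kaF _) r0.
 have -> : ka i = g (enum_val i) by rewrite /g enum_valK.
 by case: (enum_val i) => j; [apply: gl|apply: gr].
have cD D : Del D -> forall i : 'I_#|{: I}|, D (c (enum_val i)) = 0.
 move=> dD i; have [Dd _ DK] := dD; case: (enum_val i) => j /=; last exact: DK.
 by rewrite Dd.2 (h D dD) DK // mul0r mulr0 addr0.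
have iU : indep U (fun i : 'I_#|{: I}| => c (enum_val i)).
 apply: (const_indep (Del := Del)) cD ic => [D []|D []|z zU] //; exact: Del_k.
have s0 : \sum_(i < #|{: I}|) f (enum_val i) * c (enum_val i) = 0.
 rewrite sE big_sumType /=; have -> : \sum_i p i * (y * b i) = y * \sum_i p i * b i.
  by rewrite mulr_sumr; apply: eq_bigr => i _; rewrite mulrCA.
 by rewrite E -big_split big1 // => i _; rewrite mulNr /= subrr.
have fU (i : 'I_#|{: I}|) : f (enum_val i) \in U by case: (enum_val i) => j //=; rewrite rpredN.
have f0 := iU _ fU s0; move/negP: nz; case; apply/eqP; apply: big1 => i _.
by have := f0 (enum_rank (inl i : I)); rewrite enum_rankK /= => ->; rewrite mul0r.
Qed.

Variables (N K0 : sfield M) (R0 : sring M) (x : M).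
Hypotheses (UN : U \sub N) (NUK : N \sub UK) (K0P : forall y, y \in K0 <-> y \in N /\ y \in K)
 (R0P : forall y, y \in R0 <-> tens U K0 y)
 (dN : stab dl N) (DN : forall D, Del D -> stab D N)
 (xN : x \in N) (xU : x \notin U) (dx : dl x = 0).

Let K0N : K0 \sub N. Proof. by move=> y /K0P[]. Qed.
Let K0K : K0 \sub K. Proof. by move=> y /K0P[]. Qed.
Lemma kK0 : k \sub K0. Proof. by move=> y yk; apply/K0P; rewrite kK // UN // kU. Qed.
Lemma dK0 y : y \in K0 -> dl y \in K0.
Proof. by move=> /K0P[yN yK]; apply/K0P; rewrite dN // dK. Qed.
Lemma ffK0 : ffield k K0. Proof. exact: ffield_sub ffK kK0 K0K. Qed.
Lemma ffN : ffield U N. Proof. exact: ffield_sub ffUK UN NUK. Qed.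
Lemma UR0 : U \sub R0. Proof. by move=> y yU; apply/R0P/tens_l. Qed.
Lemma K0R0 : K0 \sub R0. Proof. by move=> y yK; apply/R0P/tens_r. Qed.
Lemma R0N : R0 \sub N.
Proof.
move=> _ /R0P[r [a [b [aU bK ->]]]]; apply: rpred_sum => i _.
by apply: rpredM; [apply: UN|apply: K0N].
Qed.

Lemma N_const y : y \in N -> (forall ep, Del ep -> ep y = 0) -> y \in K0.
Proof. by move=> yN h; apply/K0P; split=> //; apply: Del_UK => //; apply: NUK. Qed.

(** N is stable under [Del], so it is generated over U by its [Del]-constants K0; this is the
    descent of [indep_descend]. *)
Lemma N_frac y : y \in N -> is_frac R0 y.
Proof.
have [G GP] := frac_field R0; move=> yN; apply/GP.
have R0G z : z \in R0 -> z \in G by move=> zR; apply/GP; exists z, 1; rewrite rpred1 oner_eq0 divr1.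
have K0G : K0 \sub G by move=> z /K0R0/R0G.
have UG z : z \in U -> z \in G by move=> /UR0/R0G.
have GN : G \sub N by move=> z /GP[a [b [aR bR b0 ->]]]; rewrite rpred_div ?R0N.
apply: (indep_descend (K := K) K0G GN _ yN).
 move=> r b bK; apply: (const_indep (Del := Del)) => [D []|D dD|z zN|D [] _ _ h i] //.
 - exact: DN.
 - exact: N_const.
 - exact: h.
have [a [b [[r [a1 [a2 [h1 h2 ->]]]] [r' [b1 [b2 [h3 h4 ->]]]] b0 ->]]] := UKP (NUK yN).
exists (\sum_i a1 i * a2 i), (\sum_i b1 i * b2 i); split=> //.
- by exists r, a1, a2; split=> // i; apply: UG.
- by exists r', b1, b2; split=> // i; apply: UG.
Qed.

Lemma R0_der D : isder D -> (stab D U) -> (stab D K0) ->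
 stab D R0.
Proof.
move=> Dd DU DK _ /R0P[r [a [b [aU bK ->]]]]; have [T hT] := full.
rewrite (der_sum (isder_on T Dd)) => [|i _]; last exact: hT.
apply: rpred_sum => i _; rewrite Dd.2; apply: rpredD; apply: rpredM.
- exact/UR0/DU.
- exact: K0R0.
- exact: UR0.
- exact/K0R0/DK.
Qed.

Lemma stable_generic O D : valring O -> U \sub O -> K0 \sub O -> isder D ->
 (stab D U) -> (stab D K0) ->
 (stab D N) -> stab_in D N O.
Proof.
move=> vO UO KO Dd DU DK DNN.
have RO : R0 \sub O.
 by move=> _ /R0P[r [a [b [aU bK ->]]]]; apply: rpred_sum => i _; apply: rpredM; [apply: UO|apply: KO].
exact: (der_stable_subring char0 aclM ffN vO UO RO R0N N_frac (isder_on N Dd) DNN (R0_der Dd DU DK) DU).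
Qed.

(** If O contains K0, the subring [R0] is stable. If not, some nonzero element of K0 lies in the
    maximal ideal and is killed by ep, so [der_place_stable] applies to it. *)
Lemma Del_stable ep O : Del ep -> valring O -> U \sub O -> stab_in ep N O.
Proof.
move=> hep vO UO; have [epd epU epK] := hep.
have [KO|/existsNP[z /not_implyP[zK /negP zO]]] := pselect (forall z, z \in K0 -> z \in O).
 apply: stable_generic => // [z zK|]; last exact: DN.
 by rewrite epK ?rpred0 // K0K.
have pm := notO_mx vO zO; have pK : z^-1 \in K0 by rewrite rpredV.
have p0 : z^-1 != 0 by rewrite invr_eq0; apply: contraNneq zO => ->; rewrite rpred0.
have Dp : ep z^-1 = 0 by apply/epK/K0K.
have epO y : y \in U -> ep y \in O by move=> /epU/UO.
apply: (der_place_stable char0 aclM ffN vO UO (isder_on N epd) (DN hep) epO (K0N pK) pm p0).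
 by rewrite Dp rpred0.
by left; rewrite Dp mul0r rpred0.
Qed.

Hypothesis dst : forall O, valring O -> U \sub O -> stab_in dl N O.

(** Some ep in [Del] moves x, since otherwise x would be a constant of K, hence in U; ex is the
    derivation agreeing with ep on U that kills x. For regularity of ex where x has a residue be: if
    be is constant, ex kills x - be; if not, the derivative of x - be under [dl] is the unit -
    [dl be], so x - be is a uniformizer. *)
Lemma vector_field : exists v, [/\ isder v, stab v N, kills v U,
 v x != 0 & forall O, valring O -> U \sub O -> stab_in v N O].
Proof.
have [T hT] := full; have UT : U \sub T by move=> *; apply: hT.
have [ep [hep epx]] : exists ep, Del ep /\ ep x != 0.
 apply: contrapT => h; have xK0 : x \in K0.
  by apply: N_const => // ep hep; apply/eqP/negPn/negP => nz; apply: h; exists ep.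
 by move/negP: xU; apply; apply/kU/constK => //; apply: K0K.
have [epd epU epK] := hep.
have nax : ~ alg U x by move=> /hU; apply/negP.
have epT : forall x, x \in U -> ep x \in T by move=> *; apply: hT.
have [ex [exd _ exU exx]] := der_ext_transc char0 (isder_on U epd) UT epT (hT x) (rpred0 T) nax.
have {}exd := derOn_full hT exd.
have [Ux UxP] := adjF U x.
have exN y : y \in N -> ex y \in N.
 move=> yN; have ya := ffield_alg ffN xN xU UxP yN.
 have UxT : Ux \sub T by move=> *; apply: hT.
 have UxN : Ux \sub N by move=> z /UxP; apply: adj_min.
 apply: (der_stable char0 ya (isder_on T exd) UxT (hT y) UxN yN) => z /UxP.
 apply: (der_adj_in (isder_on T exd)) => // [|z' zU]; first by rewrite exx rpred0.
 by rewrite exU // UN // epU.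
have exst O : valring O -> U \sub O -> stab_in ex N O.
 move=> vO UO; have exUO y : y \in U -> ex y \in O by move=> yU; rewrite exU // UO // epU.
 have x0 : x != 0 by apply: contraNneq xU => ->; rewrite rpred0.
 have st p : p \in N -> p \in mx O -> p != 0 -> ex p \in O ->
   (ex p / p \in O \/ (forall b, b \in N -> b \in mx O -> b / p \in O)) ->
   stab_in ex N O.
  by move=> pN pm p0 exp; apply: (der_place_stable char0 aclM ffN vO UO (isder_on N exd) exN exUO).
 have [xO|xO] := boolP (x \in O); last first.
  have e0 : ex x^-1 = 0 by rewrite (derV (isder_on T exd)) ?hT // exx oppr0 mul0r.
  apply: (st x^-1); rewrite ?e0 ?rpred0 ?rpredV ?invr_eq0 ?notO_mx //.
  by left; rewrite mul0r rpred0.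
 have [NO|/existsNP[z /not_implyP[zN /negP zO]]] := pselect (forall z, z \in N -> z \in O).
  by move=> y yN _; apply/NO/exN.
 have nLO : N \nsub O by exists z.
 have [be beU bem] := residue aclM ffN vO UO nLO xN xO.
 have xb0 : x - be != 0 by rewrite subr_eq0; apply: contraNneq xU => ->.
 have beN := UN beU; have xbN := rpredB xN beN.
 have exb : ex (x - be) = - ep be.
  by rewrite (derB (isder_on T exd) (hT _) (hT _)) exx exU // sub0r.
 have [db|db] := eqVneq (dl be) 0.
  have e0 : ex (x - be) = 0 by rewrite exb epK ?oppr0 // kK // constU.
  by apply: (st (x - be)); rewrite ?e0 ?rpred0 //; left; rewrite mul0r rpred0.
 apply: (st (x - be)) => //; first by rewrite exb rpredN UO // epU.
 right; have [R RP] := mkI O N.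
 have RO : R \sub O by move=> y /RP[].
 have RN : R \sub N by move=> y /RP[].
 have fr y : y \in N -> is_frac R y.
  move=> yN; have /orP[yO|yO] := vO y.
   by exists y, 1; rewrite rpred1 oner_eq0 divr1; split=> //; apply/RP.
  have [->|y0] := eqVneq y 0; first by exists 0, 1; rewrite rpred1 rpred0 oner_eq0 mul0r.
  by exists 1, y^-1; rewrite rpred1 invr_eq0 y0 div1r invrK; split=> //; apply/RP; rewrite yO rpredV.
 have DR y : y \in R -> dl y \in R by move=> /RP[yO yN]; apply/RP; rewrite dN // dst.
 have dUO y : y \in U -> dl y \in O by move=> /dU/UO.
 apply: (regular_uniformizer char0 aclM ffN vO UO RO RN fr (isder_on N dd) dN DR) => //.
  by apply/RP; split=> //; apply: mx_sub.
 rewrite (derB (isder_on T dd) (hT _) (hT _)) dx sub0r mx_oppE.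
 by apply/negP => /(mx_F UO (dU beU)) e0; rewrite e0 eqxx in db.
exists (fun y => ep y - ex y); split.
- by split=> y z; rewrite ?epd.1 ?exd.1 ?epd.2 ?exd.2; ring.
- by move=> y yN; rewrite rpredB ?exN // DN.
- by move=> y yU; rewrite exU // subrr.
- by rewrite exx subr0.
- by move=> O vO UO y yN yO; rewrite rpredB ?exst // Del_stable.
Qed.

(* Functions on the generic fibre: no pole at the places trivial on K0. *)
Let A z := z \in N /\ forall O, valring O -> U \sub O -> K0 \sub O -> z \in O.

Let A_R0 z : z \in R0 -> A z.
Proof.
move=> zR; split=> [|O vO UO KO]; first exact: R0N.
by have /R0P[r [a [b [aU bK ->]]]] := zR; apply: rpred_sum => i _; apply: rpredM; [apply: UO|apply: KO].
Qed.

Let AM z z' : A z -> A z' -> A (z * z').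
Proof.
by move=> [zN h] [zN' h']; split=> [|O vO UO KO]; rewrite rpredM // ?h ?h'.
Qed.

Let ADel z ep : Del ep -> A z -> A (ep z).
Proof.
move=> hep [zN h]; split=> [|O vO UO KO]; first exact: (DN hep).
exact: (Del_stable hep vO UO zN (h O vO UO KO)).
Qed.

Lemma K0_notk : K0 \nsub k.
Proof.
apply: contrapT => h; move/negP: xU; apply.
have K0U : K0 \sub U.
 by move=> y yK; apply: kU; apply/negPn/negP => yk; apply: h; exists y.
have [a [b [/R0P[r [a1 [a2 [h1 h2 ->]]]] /R0P[r' [b1 [b2 [h3 h4 ->]]]] _ ->]]] := N_frac xN.
by apply: rpred_div; apply: rpred_sum => i _; apply: rpredM => //; apply: K0U.
Qed.

Lemma K0_U y : y \in K0 -> y \in U -> y \in k.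
Proof. by move=> /K0K yK yU; apply: Del_k => // ep [_ _]; apply. Qed.

Let A_bounded y0 : y0 \in K0 -> y0 \notin k ->
 exists b, [/\ b \in R0, b != 0 & forall z, A z -> b * z \in R0].
Proof.
move=> yK yk; have yN := K0N yK.
have yU : y0 \notin U by apply: contra yk; apply: K0_U.
have den rs : rs \sub U -> forall z, A z -> intcl U y0 N ((\prod_(r <- rs) (y0 - r)) * z) ->
  exists q : {poly M}, [/\ q \over k, q != 0 & intcl U y0 N (q.[y0] * z)].
 elim: rs => [_ z Az|r rs IH rsU z Az].
  by rewrite big_nil mul1r => iz; exists 1; rewrite rpred1 oner_eq0 -polyC1 hornerC mul1r.
 have rU : r \in U by apply: rsU; rewrite mem_head.
 have rsU' : rs \sub U by move=> r' h; apply: rsU; rewrite inE h orbT.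
 rewrite big_cons => iz.
 have yrR : y0 - r \in R0 by exact: rpredB (K0R0 yK) (UR0 rU).
 have [rk|rk] := boolP (r \in k).
  have [|q [qk q0 iq]] := IH rsU' ((y0 - r) * z) (AM (A_R0 yrR) Az).
   by rewrite mulrA [_ * (y0 - r)]mulrC.
  exists (q * ('X - r%:P)); rewrite mulf_neq0 ?polyXsubC_eq0 // hornerM hornerXsubC -mulrA.
  by split=> //; rewrite rpredM // rpredB ?polyOverX ?polyOverC.
 apply: (IH rsU' z Az); set z' := _ * z.
 have Az' : A z'.
  apply: AM => //; apply: A_R0; rewrite big_seq; apply: rpred_prod => r' /rsU' rU'.
  exact: rpredB (K0R0 yK) (UR0 rU').
 split=> [|O [vO UO] yO]; first by case: Az'.
 have zO := iz.2 O (conj vO UO) yO; rewrite -mulrA -/z' in zO.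
 have yrO : y0 - r \in O by rewrite rpredB // UO.
 have [m|nm] := boolP (y0 - r \in mx O); last first.
  have [yr0 yri] := unitO yrO nm; by rewrite -[z'](mulKf yr0) rpredM.
 have [KO|/existsNP[t /not_implyP[tK /negP tO]]] := pselect (forall t, t \in K0 -> t \in O).
  by apply: Az'.2.
 have nLO : K0 \nsub O by exists t.
 have kO : k \sub O by move=> c ck; rewrite UO // kU.
 have [b bk bm] := residue aclM ffK0 vO kO nLO yK yO.
 have rb : r - b = 0.
  apply: (mx_F UO); first by rewrite rpredB // kU.
  have -> : r - b = (y0 - b) - (y0 - r) by ring.
  exact: mx_subr.
 by move/eqP: rb; rewrite subr_eq0 => /eqP rb; rewrite rb bk in rk.
have [n [e [d bk]]] := birkhoff aclM ffN yN yU.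
have [_ eLm _ _ rep] := bk.
have /choice[ab hab] : forall i : 'I_n, exists ab : M * M, [/\ ab.1 \in R0, ab.2 \in R0, ab.2 != 0 & e i = ab.1 / ab.2].
 move=> i; have [[eN _] _] := eLm i (ltn_ord i).
 by have [a [b h]] := N_frac eN; exists (a, b).
pose b := \prod_i (ab i).2.
have bR : b \in R0 by apply: rpred_prod => i _; have [] := hab i.
have b0 : b != 0 by apply/prodf_neq0 => i _; have [] := hab i.
have beR (i : 'I_n) : b * e i \in R0.
 have [h1 h2 h3 ->] := hab i; rewrite /b (bigD1 i) //= [_ * (\prod_(j | _) _)]mulrC.
 have gen (P a' c : M) : c != 0 -> P * c * (a' / c) = P * a' by move=> c0; field.
 by rewrite gen // rpredM //; apply: rpred_prod => j _; have [] := hab j.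
exists b; split=> // z Az; have [zN _] := Az.
have [Q [QU Q0 [m Qz]]] := denom ffN yN yU zN.
have [rs [rsU QE]] := poly_split aclM hU QU Q0.
have l0 : lead_coef Q != 0 by rewrite lead_coef_eq0.
have lU : lead_coef Q \in U by rewrite lead_coefE (polyOverP QU).
have iz : intcl U y0 N ((\prod_(r <- rs) (y0 - r)) * z).
 have [h1 h2] := Lm_intcl Qz.
 have E : (\prod_(r <- rs) (y0 - r)) * z = (lead_coef Q)^-1 * (Q.[y0] * z).
  have -> : Q.[y0] = lead_coef Q * \prod_(r <- rs) (y0 - r).
   by rewrite {1}QE hornerZ horner_prod; congr (_ * _); apply: eq_bigr => r _; rewrite hornerXsubC.
  by rewrite -!mulrA mulKf.
 rewrite E; split=> [|O [vO UO] yO]; first by rewrite rpredM // UN // rpredV.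
 by apply: rpredM; [rewrite UO // rpredV|apply: (h2 O (conj vO UO))].
have [q [qk q0 iqz]] := den rs rsU z Az iz.
have [l lz] := intcl_Lm ffN yN yU iqz.
have [p [pU pE _]] := rep _ _ lz.
have qy0 : q.[y0] != 0 := transcF ffK0 yk qk q0.
have qK : q.[y0] \in K0 by apply: rpred_horner => //; apply: polyOver_sub qk; apply: kK0.
have -> : b * z = (q.[y0])^-1 * (b * (q.[y0] * z)) by field.
apply: rpredM; first by rewrite K0R0 // rpredV.
rewrite pE mulr_sumr; apply: rpred_sum => i _; rewrite mulrCA; apply: rpredM => //.
by apply: rpred_horner; [apply: polyOver_sub (pU i); apply: UR0|apply: K0R0].
Qed.

(** The conductor J of A into [R0] is stable under U and [Del]. An element of J with the fewest
    terms, scaled so that one coefficient is 1, is killed by [Del] and so lies in K0: the conductor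
    contains a unit. *)
Let A_tens z : A z -> z \in R0.
Proof.
have [y0 yK yk] := K0_notk; have [b [bR b0 hb]] := A_bounded yK yk.
pose J g := g \in R0 /\ forall z, A z -> g * z \in R0.
have JZ u g : u \in U -> J g -> J (u * g).
 move=> uU [gR gJ]; split=> [|z' Az']; first exact: rpredM (UR0 uU) gR.
 rewrite -mulrA; exact: rpredM (UR0 uU) (gJ _ Az').
have JDel g ep : Del ep -> J g -> J (ep g).
 move=> hep [gR gJ]; have [epd epU epK] := hep.
 have eR y : y \in R0 -> ep y \in R0.
  by apply: R0_der => // y' yK'; rewrite epK ?rpred0 // K0K.
 split=> [|z' Az']; first exact: eR.
 have -> : ep g * z' = ep (g * z') - g * ep z' by rewrite epd.2; ring.
 by apply: rpredB; [apply/eR/gJ|apply/gJ/ADel].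
pose P r := `[< exists (u m : 'I_r -> M), [/\ forall i, u i \in U, forall i, m i \in K0,
  \sum_i u i * m i != 0 & J (\sum_i u i * m i)] >].
have ex : exists r, P r.
 by have /R0P[r [u [m [uU mK bE]]]] := bR; exists r; apply/asboolP; exists u, m; rewrite -bE.
case: (ex_minnP ex) => -[|r] /asboolP[u [m [uU mK g0 Jg]]] rmin.
 by move: g0; rewrite big_ord0 eqxx.
have u0 : u ord0 != 0.
 apply/eqP => u0; suff /rmin : P r by rewrite ltnn.
 apply/asboolP; exists (fun i => u (lift ord0 i)), (fun i => m (lift ord0 i)).
 by move: g0 Jg; rewrite big_ord_recl u0 mul0r add0r; split.
pose c i := (u ord0)^-1 * u i; have cU i : c i \in U by rewrite rpredM ?rpredV.
have gE : \sum_i c i * m i = (u ord0)^-1 * \sum_i u i * m i.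
 by rewrite mulr_sumr; apply: eq_bigr => i _; rewrite mulrA.
set g := \sum_i c i * m i in gE.
have {}g0 : g != 0 by rewrite gE mulf_neq0 ?invr_eq0.
have {}Jg : J g by rewrite gE; apply: JZ => //; rewrite rpredV.
have gK : g \in K0.
 apply: N_const; first by case: Jg => /R0N.
 move=> ep hep; have [epd epU epK] := hep; have [T hT] := full.
 apply/eqP; apply: contraT => nz; suff /rmin : P r by rewrite ltnn.
 have E : ep g = \sum_(i < r) ep (c (lift ord0 i)) * m (lift ord0 i).
  rewrite /g (der_sum (isder_on T epd)) => [|i _]; last exact: hT.
  rewrite big_ord_recl {1}/c mulVf // mul1r epK ?K0K // add0r.
  by apply: eq_bigr => i _; rewrite epd.2 (epK (m _)) ?mulr0 ?addr0 // K0K.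
 apply/asboolP; exists (fun i => ep (c (lift ord0 i))), (fun i => m (lift ord0 i)).
 by rewrite -E; split=> //; [move=> i; apply: epU|apply: JDel].
by move=> Az; rewrite -[z](mulKf g0); apply: rpredM; [apply: K0R0; rewrite rpredV|apply: Jg.2].
Qed.

Let indep_min z : z \in R0 -> z != 0 -> exists r (u m : 'I_r.+1 -> M), [/\ forall i, u i \in U, forall i, m i \in K0,
  indep k u, m ord0 != 0 & z = \sum_i u i * m i].
Proof.
move=> /R0P hz z0; pose P r := `[< exists (u m : 'I_r -> M), [/\ forall i, u i \in U, forall i, m i \in K0 & z = \sum_i u i * m i] >].
have ex : exists r, P r.
 by have [r [u [m h]]] := hz; exists r; apply/asboolP; exists u, m.
case: (ex_minnP ex) => -[|r] /asboolP[u [m [uU mK zE]]] rmin.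
 by move: z0; rewrite zE big_ord0 eqxx.
exists r, u, m; split=> //.
- move=> c ck c0 l; apply/eqP; apply: contraT => cl; suff /rmin : P r by rewrite ltnn.
 apply/asboolP; exists (fun i => u (lift l i)), (fun i => m (lift l i) - c (lift l i) / c l * m l).
 have ul : u l = - \sum_i c (lift l i) / c l * u (lift l i).
  have E0 : c l * u l + \sum_(i < r) c (lift l i) * u (lift l i) = 0.
   by rewrite -[RHS]c0 [RHS](bigD1_ord l).
  apply: (mulfI cl); rewrite mulrN mulr_sumr; apply/eqP; rewrite -addr_eq0; apply/eqP.
  by rewrite -[RHS]E0; congr (_ + _); apply: eq_bigr => i _; rewrite mulrA [c l * _]mulrC divfK.
 split=> // [i|]; first by rewrite rpredB // rpredM // rpred_div // kK0.
 rewrite zE (bigD1_ord l) //= ul mulNr mulr_suml -sumrN -big_split /=.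
 by apply: eq_bigr => i _; ring.
- apply/eqP => m0; suff /rmin : P r by rewrite ltnn.
 apply/asboolP; exists (fun i => u (lift ord0 i)), (fun i => m (lift ord0 i)).
 by split=> //; rewrite zE big_ord_recl m0 mulr0 add0r.
Qed.

(* Gauss extension of a place of K0 / k to N / U. *)
Lemma gauss O1 : place k O1 -> exists O, [/\ valring O, U \sub O,
 forall y, y \in K0 -> y \in O = (y \in O1) &
 forall r (u m : 'I_r -> M), (forall i, u i \in U) -> (forall i, m i \in K0) -> indep k u ->
  \sum_i u i * m i \in O -> forall i, m i \in O1].
Proof.
move=> [vO1 kO1]; have [S SP] := mkI O1 K0; have [R RP] := tens_ring U S.
pose J z := exists r (u m : 'I_r -> M), [/\ forall i, u i \in U, forall i, m i \in mx O1 /\ m i \in K0 & z = \sum_i u i * m i].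
have finJ (I : finType) (u m : I -> M) : (forall i, u i \in U) -> (forall i, m i \in mx O1 /\ m i \in K0) ->
  J (\sum_i u i * m i).
 move=> uU mm; exists #|I|, (fun i => u (enum_val i)), (fun i => m (enum_val i)); split=> //.
 by rewrite (reindex (@enum_val _ (mem I))) //=; apply: onW_bij; apply: enum_val_bij.
have [||||| O [vO RO JO]] := @valring_ext _ R J.
- move=> _ [r [u [m [uU mm ->]]]]; apply/RP; exists r, u, m; split=> // i.
 by apply/SP; have [h1 h2] := mm i; split=> //; apply: mx_sub.
- by exists 0%N, (fun=> 0), (fun=> 0); rewrite big_ord0; split=> // -[].
- move=> _ _ [r [u [m [uU mm ->]]]] [r' [u' [m' [uU' mm' ->]]]].
 have -> : \sum_i u i * m i - \sum_i u' i * m' i =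
   \sum_(i : 'I_r + 'I_r') (match i with inl j => u j | inr j => - u' j end) *
     (match i with inl j => m j | inr j => m' j end).
  by rewrite big_sumType /= -sumrN; congr (_ + _); apply: eq_bigr => i _; rewrite mulNr.
 by apply: finJ => -[i|i] //; rewrite rpredN.
- move=> _ _ /RP[r [u [m [uU mm ->]]]] [r' [u' [m' [uU' mm' ->]]]].
 rewrite mulr_suml; under eq_bigr do rewrite mulr_sumr.
 rewrite pair_bigA /= (eq_bigr (fun p => (u p.1 * u' p.2) * (m p.1 * m' p.2))) => [|p _]; last by ring.
 apply: finJ => p; first by rewrite rpredM.
 by have /SP[h1 h2] := mm p.1; have [h3 h4] := mm' p.2; rewrite rpredM //; split=> //; apply: mx_mulr.
- move=> hJ; pose P r := `[< exists (u m : 'I_r -> M), [/\ forall i, u i \in U,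
   forall i, m i \in mx O1 /\ m i \in K0 & 1 = \sum_i u i * m i] >].
 have ex : exists r, P r by have [r [u [m h]]] := hJ; exists r; apply/asboolP; exists u, m.
 case: (ex_minnP ex) => -[|r] /asboolP[u [m [uU mm oneE]]] rmin.
  by move/eqP: oneE; rewrite big_ord0 oner_eq0.
 (* If 1 and the m_j are independent over k, they are so over U, against 1 = sum u m. A dependence
    over k cannot involve 1, the m_j having residue 0, and shortens the expression. *)
 pose b (i : 'I_r.+2) := if unlift ord0 i is Some j then m j else 1.
 have bK i : b i \in K by rewrite /b; case: (unlift ord0 i) => [j|]; rewrite ?rpred1 // K0K //; have [] := mm j.
 have [ind|nind] := pselect (indep k b).
  have iU := UK_indep bK ind.
  pose n (i : 'I_r.+2) := if unlift ord0 i is Some j then u j else -1.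
  have nU i : n i \in U by rewrite /n; case: (unlift ord0 i) => [j|] //; rewrite rpredN1.
  have := iU n nU; rewrite big_ord_recl /n /b unlift_none mulN1r.
  under eq_bigr do rewrite liftK; rewrite -oneE addNr => /(_ (erefl _) ord0).
  by rewrite unlift_none => /eqP; rewrite oppr_eq0 oner_eq0.
 have [c [ck c0 [l cl]]] := not_indep nind.
 move: c0; rewrite big_ord_recl /b unlift_none mulr1.
 under eq_bigr do rewrite liftK; set s := \sum_(i < r.+1) _ => c0.
 have sm : s \in mx O1.
  by apply: mx_sum => // i _; rewrite mx_mulr ?kO1 //; have [] := mm i.
 have cz : c ord0 = 0.
  by apply: (mx_F kO1 (ck _)); have -> : c ord0 = - s by [apply/eqP; rewrite -addr_eq0 c0]; rewrite mx_oppE.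
 have {l cl} [l cl] : exists l, c (lift ord0 l) != 0.
  case: (unliftP ord0 l) cl => [j ->|->]; first by exists j.
  by rewrite cz eqxx.
 have ml : m l = - \sum_i c (lift ord0 (lift l i)) / c (lift ord0 l) * m (lift l i).
  have E0 : c (lift ord0 l) * m l + \sum_(i < r) c (lift ord0 (lift l i)) * m (lift l i) = 0.
   by rewrite -[RHS]c0 cz add0r /s [RHS](bigD1_ord l).
  apply: (mulfI cl); rewrite mulrN mulr_sumr; apply/eqP; rewrite -addr_eq0; apply/eqP.
  by rewrite -[RHS]E0; congr (_ + _); apply: eq_bigr => i _; rewrite mulrA [c (lift ord0 l) * _]mulrC divfK.
 suff /rmin : P r by rewrite ltnn.
 apply/asboolP; exists (fun i => u (lift l i) - u l * (c (lift ord0 (lift l i)) / c (lift ord0 l))), (fun i => m (lift l i)).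
 split=> // [i|]; first by rewrite rpredB // rpredM // kU // rpred_div.
 rewrite oneE (bigD1_ord l) //= ml mulrN mulr_sumr -sumrN -big_split /=.
 by apply: eq_bigr => i _; ring.
have UO : U \sub O by move=> y yU; apply/RO/RP/tens_l.
have S1 y : y \in K0 -> y \in O1 -> y \in O.
 by move=> yK yO; apply/RO/RP/tens_r; apply/SP.
have mm1 y : y \in K0 -> y \in mx O1 -> y \in mx O.
 move=> yK ym; apply: JO; exists 1%N, (fun=> 1), (fun=> y); rewrite big_ord1 mul1r.
 by split=> // _; rewrite rpred1.
have KO y : y \in K0 -> y \in O = (y \in O1).
 move=> yK; apply/idP/idP; last exact: S1.
 apply: contraTT => yO; apply/negP => yO'.
 have ym : y^-1 \in mx O by apply: mm1; rewrite ?rpredV // notO_mx.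
 have y0 : y != 0 by apply: contraNneq yO => ->; rewrite rpred0.
 by have := mx_mulr yO' ym; rewrite divff // (negPf (mx1 O)).
exists O; split=> // r u m uU mK ind zO i.
have [mi|mi] := eqVneq (m i) 0; first by rewrite mi rpred0.
have [K0O|/existsNP[t /not_implyP[tK /negP tO]]] := pselect (forall t, t \in K0 -> t \in O1).
 exact: K0O.
have nLO : K0 \nsub O1 by exists t.
have [l [ml hl]] := comb vO1 mi.
have /choice[b hb] : forall j, exists b, b \in k /\ m j / m l - b \in mx O1.
 move=> j; have mjK : m j / m l \in K0 by rewrite rpred_div.
 by have [b bk bm] := residue aclM ffK0 vO1 kO1 nLO mjK (hl j); exists b.
have bl : b l = 1.
 have [bk] := hb l; rewrite divff // => bm; apply/esym/eqP; rewrite -subr_eq0; apply/eqP.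
 by apply: (mx_F kO1) => //; rewrite rpredB ?rpred1.
have sU : \sum_j b j * u j \in U by apply: rpred_sum => j _; rewrite rpredM // kU //; have [] := hb j.
have s0 : \sum_j b j * u j != 0.
 apply/eqP => s0; have /eqP := ind b (fun j => (hb j).1) s0 l.
 by rewrite bl oner_eq0.
(* Divided by the m_l of least order, the sum reduces to a nontrivial combination of the u_j over k,
   nonzero by independence: there is no cancellation. *)
have us : un O (\sum_j u j * m j / m l).
 have -> : \sum_j u j * m j / m l = \sum_j b j * u j + \sum_j u j * (m j / m l - b j).
  by rewrite -big_split /=; apply: eq_bigr => j _; ring.
 apply: un_add => //; first exact: (un_F UO).
 apply: mx_sum => // j _; apply: mx_mulr; first exact: UO.
 by apply: mm1; [rewrite rpredB ?rpred_div // kK0 //; have [] := hb j|have [] := hb j].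
rewrite -mulr_suml in us.
have mlO : m l \in O1.
 apply: contraT => mlO; have mlm : (m l)^-1 \in mx O by apply: mm1; rewrite ?rpredV // notO_mx.
 by have := mx_mulr zO mlm; rewrite (negPf (un_nm us)).
by rewrite -[m i](divfK ml) rpredM.
Qed.

Theorem descended_field : (exists v, [/\ derOn K0 v, stab v K0,
  kills v k, exists2 y, y \in K0 & v y != 0 &
  forall O, place k O -> stab_in v K0 O]) /\
 forall O, place k O -> stab_in dl K0 O.
Proof.
split; last first.
 move=> O1 pO1 y yK yO1; have [O [vO UO KO _]] := gauss pO1.
 by rewrite -KO ?dK0 // dst ?K0N // KO.
have [V [Vd VN VU Vx Vst]] := vector_field.
have [y0 yK yk] := K0_notk.
have nay : ~ alg k y0 by move=> /hk; apply/negP.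
have z0 : derOn k (fun=> 0 : M) by split=> *; rewrite ?mul0r ?mulr0 addr0.
have zK : forall x, x \in k -> (fun=> 0 : M) x \in K0 by move=> *; apply: rpred0.
have [D [DD DK D0 Dy]] := der_ext_transc char0 z0 kK0 zK yK (rpred1 K0) nay.
pose h := V y0.
have [ky kyP] := adjF k y0.
have VE y : y \in K0 -> V y = h * D y.
 move=> yK'; have ya := ffield_alg ffK0 yK yk kyP yK'.
 have kyK : ky \sub K0 by move=> z /kyP; apply: adj_min => //; apply: kK0.
 have hD : derOn K0 (fun y => V y - h * D y).
  by split=> a b aK bK; rewrite ?Vd.1 ?DD.1 ?Vd.2 ?DD.2 //; ring.
 have zD : derOn K0 (fun=> 0 : M) by split=> *; rewrite ?mul0r ?mulr0 addr0.
 have := der_unique char0 ya hD zD kyK yK' => /(_ _)/eqP; rewrite subr_eq0 => E; apply/eqP/E.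
 move=> z /kyP; apply: (der_adj0 hD kK0 yK); first by rewrite Dy mulr1 subrr.
 by move=> c ck; rewrite D0 // VU ?kU // mulr0 subr0.
have h0 : h != 0.
 apply: contraNneq Vx => h0.
 have [a [b [aR bR b0 ->]]] := N_frac xN.
 have [T hT] := full; have VT := isder_on T Vd.
 have VR z : z \in R0 -> V z = 0.
  move=> /R0P[r [u [m [uU mK ->]]]]; rewrite (der_sum VT) => [|i _]; last exact: hT.
  by apply: big1 => i _; rewrite Vd.2 VU // VE // h0 !mul0r mulr0 addr0.
 by rewrite (derQ VT) ?hT // !VR // mul0r mulr0 subr0 mul0r.
have hR : h \in R0.
 apply: A_tens; split=> [|O vO UO KO]; first exact/VN/K0N.
 by apply: Vst => //; [apply: K0N|apply: KO].
have [r [u [m [uU mK ind m0 hE]]]] := indep_min hR h0.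
exists (fun y => m ord0 * D y); split.
- by split=> a b aK bK; rewrite ?DD.1 ?DD.2 //; ring.
- by move=> y yK'; rewrite rpredM ?DK.
- by move=> y yk'; rewrite D0 // mulr0.
- by exists y0; rewrite // Dy mulr1.
move=> O1 pO1 y yK' yO1; have [O [vO UO KO gO]] := gauss pO1.
have VO : V y \in O by rewrite Vst ?K0N // KO.
have VE' : V y = \sum_i u i * (m i * D y).
 by rewrite VE // hE mulr_suml; apply: eq_bigr => i _; rewrite mulrA.
rewrite VE' in VO; apply: (gO _ u (fun i => m i * D y) uU _ ind VO ord0) => i.
by rewrite rpredM ?DK.
Qed.

End Core.

(** * The two outcomes and how the vector field arises *)

Section Outcome.
Variable M : fieldType.
Hypotheses (char0 : char_0 M) (aclM : acl M).
Implicit Types (k L : sfield M) (D : M -> M).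

(** Both normal forms include generation: L = k(x) here, L = k(t, D t) in [weierstrass_in]. *)
Definition riccati_in k L D := exists x a0 a1 a2, [/\ [/\ x \in L, x \notin k & forall y, y \in L -> adj k x y],
 a0 \in k, a1 \in k, a2 \in k & D x = a2 * x ^+ 2 + a1 * x + a0].

Definition weierstrass_in k L D := exists t a g2 g3, [/\ t \in L, [/\ a \in k, g2 \in k & g3 \in k],
 D g2 = 0 /\ D g3 = 0, 27%:R * g3 ^+ 2 - g2 ^+ 3 != 0 &
 D t ^+ 2 = a ^+ 2 * (4%:R * t ^+ 3 - g2 * t - g3) /\
 forall G : sfield M, k \sub G -> t \in G -> D t \in G -> L \sub G].

Definition has_vector_field k L := exists v, [/\ derOn L v, stab v L,
  kills v k, exists2 y, y \in L & v y != 0 &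
  forall O, place k O -> stab_in v L O].

Lemma dichotomy k L D : ffield k L -> has_vector_field k L -> isder D -> (stab D L) ->
 (stab D k) -> (forall y, y \in L -> D y = 0 -> y \in k) ->
 (forall O, place k O -> stab_in D L O) ->
 riccati_in k L D \/ weierstrass_in k L D.
Proof.
move=> ffL [v [vD vL v0 vnz vst]] Dd DL Dk cst Dst; have DD := isder_on L Dd.
have kL : k \sub L by case: ffL.
have [[x xL [xk gen]]|[x [s [Q [rs [c [qm _ _ _]]]]]]] := classify char0 aclM ffL vD vL v0 vst vnz.
 left; have [a0 [a1 [a2 [h0 h1 h2 E]]]] := riccati_of_rational aclM ffL DD DL Dst xL xk gen.
 by exists x, a0, a1, a2.
right; have [t [la [ga [tL laF gaF Dla [la0 la1 E gen]]]]] := legendre_of_quad ffL DD DL Dk Dst cst qm.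
have [c' [a [g2 [g3 [cF [aF g2F g3F] dg disc [Dc E2]]]]]] := weierstrass_of_legendre char0 aclM ffL DD tL laF gaF Dla la0 la1 E.
have Dt : D (t - c') = D t by rewrite (derB DD tL (kL _ cF)) Dc subr0.
exists (t - c'), a, g2, g3; split=> //; first by rewrite rpredB // kL.
split; first by rewrite Dt.
move=> G kG tG DG; apply: gen => //; last by rewrite -Dt.
by rewrite -[t](subrK c') rpredD // kG.
Qed.

End Outcome.

Section Towers.
Variable M : fieldType.
Hypotheses (char0 : char_0 M) (aclM : acl M).
Variables (k U K UK : sfield M) (w : M) (dl : M -> M).
Hypotheses (hk : relacl k) (hU : relacl U) (kU : k \sub U) (kK : k \sub K)
 (ffK : ffield k K) (ffUK : ffield U UK) (wK : w \in K) (wU : w \notin U)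
 (UUK : U \sub UK) (KUK : K \sub UK)
 (UKP : forall y, y \in UK -> exists a b, [/\ tens U K a, tens U K b, b != 0 & y = a / b]).
Hypotheses (dd : isder dl) (dk : stab dl k)
 (dU : stab dl U) (dK : stab dl K)
 (constK : forall y, y \in K -> dl y = 0 -> y \in k)
 (constU : forall y, y \in U -> dl y = 0 -> y \in k).

Let DelUK := Del U K.
Let full : exists T : sfield M, forall x, x \in T. Proof. exact: fullF. Qed.

Lemma Del_comm D : DelUK D -> DelUK (fun y => dl (D y) - D (dl y)).
Proof.
move=> [Dd DU DK]; split.
- by split=> a b; rewrite ?Dd.1 ?dd.1 ?Dd.1 ?Dd.2 ?dd.2 ?dd.1 ?Dd.1 ?dd.2 ?Dd.2; ring.
- by move=> y yU; rewrite rpredB ?dU ?DU // dU.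
- move=> y yK; rewrite !DK ?dK // subr0.
 by have [T hT] := full; apply: (der0 (isder_on T dd)).
Qed.

Lemma Del_UK_stable D : DelUK D -> stab D UK.
Proof.
move=> [Dd DU DK] y /UKP[_ [_ [[r [a [b [aU bK ->]]]] [r' [a' [b' [aU' bK' ->]]]] nz ->]]].
have [T hT] := full; have DT := isder_on T Dd.
have st n (a1 b1 : 'I_n -> M) : (forall i, a1 i \in U) -> (forall i, b1 i \in K) ->
  \sum_i a1 i * b1 i \in UK /\ D (\sum_i a1 i * b1 i) \in UK.
 move=> h1 h2; split; first by apply: rpred_sum => i _; apply: rpredM; [apply: UUK|apply: KUK].
 rewrite (der_sum DT) => [|i _]; last exact: hT.
 apply: rpred_sum => i _; rewrite Dd.2 (DK _ (h2 i)) mulr0 addr0.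
 by apply: rpredM; [apply/UUK/DU|apply: KUK].
have [h1 h2] := st _ a b aU bK; have [h3 h4] := st _ a' b' aU' bK'.
rewrite (derQ DT) ?hT //; apply: rpred_div; last exact: rpredX.
by apply: rpredB; apply: rpredM.
Qed.

Section CaseB.
Variable Cst : sfield M.
Hypotheses (CstP : forall y, y \in Cst <-> y \in UK /\ dl y = 0)
 (UKC : forall y, y \in UK -> exists a b, [/\ tens U Cst a, tens U Cst b, b != 0 & y = a / b]).

Lemma UK_dstable y : y \in UK -> dl y \in UK.
Proof.
move=> /UKP[_ [_ [[r [a [b [aU bK ->]]]] [r' [a' [b' [aU' bK' ->]]]] nz ->]]].
have [T hT] := full; have DT := isder_on T dd.
have st n (a1 b1 : 'I_n -> M) : (forall i, a1 i \in U) -> (forall i, b1 i \in K) ->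
  \sum_i a1 i * b1 i \in UK /\ dl (\sum_i a1 i * b1 i) \in UK.
 move=> h1 h2; split; first by apply: rpred_sum => i _; apply: rpredM; [apply: UUK|apply: KUK].
 rewrite (der_sum DT) => [|i _]; last exact: hT.
 apply: rpred_sum => i _; rewrite dd.2.
 by apply: rpredD; apply: rpredM; [apply/UUK/dU|apply: KUK|apply: UUK|apply/KUK/dK].
have [h1 h2] := st _ a b aU bK; have [h3 h4] := st _ a' b' aU' bK'.
rewrite (derQ DT) ?hT //; apply: rpred_div; last exact: rpredX.
by apply: rpredB; apply: rpredM.
Qed.

(** Here N = UK and K0 = K. Regularity of [dl] at O: if O contains the constants, U and [Cst]
    generate a stable subring of O; if not, a constant with a pole has its inverse in the maximal
    ideal, killed by [dl]. *)
Theorem strongly_normal_case : [/\ has_vector_field k K,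
 forall O, place k O -> stab_in dl K O &
 riccati_in k K dl \/ weierstrass_in k K dl].
Proof.
have [T hT] := full; have DT := isder_on T dd.
have [R0 R0P] := tens_ring U K.
have K0P y : y \in K <-> y \in UK /\ y \in K by split=> [yK|[]] //; split=> //; apply: KUK.
have UUK' : UK \sub UK by [].
have [x [xUK dx xU]] : exists x, [/\ x \in UK, dl x = 0 & x \notin U].
 apply: contrapT => h; have CU : Cst \sub U.
  by move=> y /CstP[yUK dy]; apply/negPn/negP => yU; apply: h; exists y.
 move/negP: wU; apply; have [_ [_ [[r [a [b [aU bK ->]]]] [r' [a' [b' [aU' bK' ->]]]] nz ->]]] := UKC (KUK wK).
 by apply: rpred_div; apply: rpred_sum => i _; apply: rpredM => //; apply: CU.
have dst O : valring O -> U \sub O -> stab_in dl UK O.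
 move=> vO UO; have dUO y : y \in U -> dl y \in O by move=> /dU/UO.
 have [CO|/existsNP[z /not_implyP[zC /negP zO]]] := pselect (forall z, z \in Cst -> z \in O).
  have [R RP] := tens_ring U Cst.
  have RO : R \sub O.
   by move=> _ /RP[r [a [b [aU bC ->]]]]; apply: rpred_sum => i _; apply: rpredM; [apply: UO|apply: CO].
  have RL : R \sub UK.
   move=> _ /RP[r [a [b [aU bC ->]]]]; apply: rpred_sum => i _; apply: rpredM; first exact: UUK.
   by have /CstP[] := bC i.
  have fr y : y \in UK -> is_frac R y.
   by move=> /UKC[a [b [h1 h2 h3 h4]]]; exists a, b; split=> //; apply/RP.
  have DR y : y \in R -> dl y \in R.
   move=> /RP[r [a [b [aU bC ->]]]]; rewrite (der_sum DT) => [|i _]; last exact: hT.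
   apply: rpred_sum => i _; have /CstP[_ db] := bC i; rewrite dd.2 db mulr0 addr0.
   by apply: rpredM; apply/RP; [apply/tens_l/dU|apply/tens_r].
  exact: (der_stable_subring char0 aclM ffUK vO UO RO RL fr (isder_on UK dd) UK_dstable DR dU).
 have /CstP[zUK dz] := zC.
 have pm := notO_mx vO zO; have pK : z^-1 \in UK by rewrite rpredV.
 have p0 : z^-1 != 0 by rewrite invr_eq0; apply: contraNneq zO => ->; rewrite rpred0.
 have Dp : dl z^-1 = 0 by rewrite (derV DT) ?hT // dz oppr0 mul0r.
 apply: (der_place_stable char0 aclM ffUK vO UO (isder_on UK dd) UK_dstable dUO pK pm p0).
  by rewrite Dp rpred0.
 by left; rewrite Dp mul0r rpred0.
have [vf st] := descended_field char0 aclM hk hU kU kK ffK ffUK wK wU UKP dd dU dK constK constU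
 UUK UUK' K0P R0P UK_dstable Del_UK_stable xUK xU dx dst.
by split; [exact: vf|exact: st|]; apply: (dichotomy char0 aclM ffK vf dd dK dk constK st).
Qed.
End CaseB.

Section CaseA.
Variable x : M.
Hypotheses (xUK : x \in UK) (xU : x \notin U) (dx : dl x = 0).

(** N is the smallest field containing U and x and stable under [Del]; it is stable under [dl]
    because commutators of [dl] with [Del] stay in [Del]. Regularity of [dl] is shown on U(x)
    directly and spreads, again by commutators, to the ring that [Del] generates from the elements
    of U(x) in O. *)
Theorem new_constant_case : exists K0 : sfield M, [/\ k \sub K0, K0 \sub K, ffield k K0,
 K0 \nsub k &
 riccati_in k K0 dl \/ weierstrass_in k K0 dl].
Proof.
have [T hT] := full; have DT := isder_on T dd.
have UT : U \sub T by move=> *; apply: hT.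
pose closed (G : sfield M) := [/\ U \sub G, x \in G & forall D, DelUK D -> stab D G].
have [N NP] : exists N : sfield M, forall y, y \in N <-> forall G, closed G -> y \in G.
 apply: mkF; split=> [G _|y z hy hz G hG|y z hy hz G hG]; first exact: rpred1.
  by rewrite rpredB ?hy ?hz.
 by rewrite rpred_div ?hy ?hz.
have UN : U \sub N by move=> y yU; apply/NP => G [h _ _]; apply: h.
have xN : x \in N by apply/NP => G [].
have DN D : DelUK D -> stab D N.
 by move=> hD y /NP yN; apply/NP => G hG; have [_ _ h] := hG; apply: h => //; apply: yN.
have Nmin G : closed G -> N \sub G by move=> hG y /NP; apply.
have NUK : N \sub UK by apply: Nmin; split=> //; apply: Del_UK_stable.
have dN y : y \in N -> dl y \in N.
 have [G GP] : exists G : sfield M, forall y, y \in G <-> y \in N /\ dl y \in N.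
  apply: mkF; split=> [|a b [aN da] [bN db]|a b [aN da] [bN db]].
  - by rewrite (der1 DT) rpred1 rpred0.
  - by rewrite (derB DT) ?hT // !rpredB.
  have [->|b0] := eqVneq b 0; first by rewrite invr0 mulr0 (der0 DT) rpred0.
  rewrite (derQ DT) ?hT // rpred_div //; split=> //; apply: rpred_div; last exact: rpredX.
  by apply: rpredB; apply: rpredM.
 move=> yN; suff /GP[] : y \in G by [].
 apply: (Nmin G) yN; split.
 - by move=> z zU; apply/GP; split; apply: UN => //; apply: dU.
 - by apply/GP; rewrite dx rpred0.
 move=> D hD z /GP[zN dz]; apply/GP; split; first exact: DN.
 have -> : dl (D z) = (dl (D z) - D (dl z)) + D (dl z) by ring.
 by rewrite rpredD ?(DN _ (Del_comm hD)) // DN.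
have [K0 K0P] := mkIF N K; have [R0 R0P] := tens_ring U K0.
have ffN : ffield U N := ffield_sub ffUK UN NUK.
have kK0 : k \sub K0 by move=> y yk; apply/K0P; rewrite kK // UN // kU.
have K0K : K0 \sub K by move=> y /K0P[].
have ff0 : ffield k K0 := ffield_sub ffK kK0 K0K.
have dK0 y : y \in K0 -> dl y \in K0 by move=> /K0P[h1 h2]; apply/K0P; rewrite dN ?dK.
have [Ux UxP] := adjF U x.
have UUx : U \sub Ux by move=> y yU; apply/UxP/adj_id.
have xUx : x \in Ux by apply/UxP/adj_gen.
have UxN : Ux \sub N by move=> y /UxP; apply: adj_min.
have ffUx : ffield U Ux := ffield_sub ffN UUx UxN.
have dUx y : y \in Ux -> dl y \in Ux.
 move=> /UxP; apply: (der_adj_in DT UT (hT x) UUx xUx); first by rewrite dx rpred0.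
 by move=> z zU; apply/UUx/dU.
have dUxO O : valring O -> U \sub O -> stab_in dl Ux O.
 move=> vO UO; have dUO y : y \in U -> dl y \in O by move=> /dU/UO.
 have [xO|xO] := boolP (x \in O); last first.
  have pm := notO_mx vO xO; have pL : x^-1 \in Ux by rewrite rpredV.
  have p0 : x^-1 != 0 by rewrite invr_eq0; apply: contraNneq xO => ->; rewrite rpred0.
  have Dp : dl x^-1 = 0 by rewrite (derV DT) ?hT // dx oppr0 mul0r.
  apply: (der_place_stable char0 aclM ffUx vO UO (isder_on Ux dd) dUx dUO pL pm p0).
   by rewrite Dp rpred0.
  by left; rewrite Dp mul0r rpred0.
 have [UxO|/existsNP[z /not_implyP[zC /negP zO]]] := pselect (forall z, z \in Ux -> z \in O).
  by move=> y yUx _; apply/UxO/dUx.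
 have nLO : Ux \nsub O by exists z.
 have [be beU pm] := residue aclM ffUx vO UO nLO xUx xO.
 have p0 : x - be != 0 by rewrite subr_eq0; apply: contraNneq xU => ->.
 have pL : x - be \in Ux by rewrite rpredB // UUx.
 apply: (der_place_stable char0 aclM ffUx vO UO (isder_on Ux dd) dUx dUO pL pm p0).
  by rewrite (derB DT) ?hT // dx sub0r rpredN dUO.
 right=> b bUx bm; have [->|b0] := eqVneq b 0; first by rewrite mul0r rpred0.
 have [Up UpP] := adjF U (x - be).
 have UUp : U \sub Up by move=> y yU; apply/UpP/adj_id.
 have bp : adj U (x - be) b.
  move/UxP: bUx => bUx; apply/UpP; apply: adj_min bUx => //.
  have pUp : x - be \in Up by apply/UpP/adj_gen.
  by have := rpredD pUp (UUp _ beU); rewrite subrK.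
 have [e [c [u [bE uu _ _]]]] := adj_ord vO UO pm p0 bp b0.
 case: e bE => [[|n]|n] bE.
 - by move: bm; rewrite bE expr0z mul1r (negPf (un_nm uu)).
 - rewrite bE -exprnP exprS; have -> : (x - be) * (x - be) ^+ n * u / (x - be) = (x - be) ^+ n * u by field.
  by rewrite rpredM ?(un_O uu) // rpredX // mx_sub.
 have hO : (x - be) ^+ n.+1 * u^-1 \in O.
  by apply: rpredM; [rewrite rpredX // mx_sub|exact: un_O (unV uu)].
 have := mx_mulr hO bm.
 rewrite bE NegzE -exprnN; have pn := expf_neq0 n.+1 p0; have u0 := un_neq0 uu.
 have -> : (x - be) ^+ n.+1 / u * ((x - be) ^- n.+1 * u) = 1 by rewrite mulrACA divff // mulVf // mul1r.
 by rewrite (negPf (mx1 O)).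
have dst O : valring O -> U \sub O -> stab_in dl N O.
 move=> vO UO.
 have [KO|nKO] := pselect (forall z, z \in K0 -> z \in O).
  exact: (stable_generic char0 aclM hk hU kU kK ffK ffUK wK wU UKP UN NUK K0P R0P DN vO UO KO dd dU dK0 dN).
 pose clR (S : sring M) := (forall y, y \in Ux -> y \in O -> y \in S) /\
  forall D, DelUK D -> stab D S.
 have [R RP] : exists R : sring M, forall y, y \in R <-> forall S, clR S -> y \in S.
  apply: mkR => [S _|y z hy hz S hS|y z hy hz S hS]; first exact: rpred1.
   by rewrite rpredB ?hy ?hz.
  by rewrite rpredM ?hy ?hz.
 have Rgen y : y \in Ux -> y \in O -> y \in R by move=> h1 h2; apply/RP => S [h _]; apply: h.
 have RDel D : DelUK D -> stab D R.
  by move=> hD y /RP yR; apply/RP => S hS; have [_ h] := hS; apply: h => //; apply: yR.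
 have Rmin S : clR S -> R \sub S by move=> hS y /RP; apply.
 have RON y : y \in R -> y \in O /\ y \in N.
  have [S SP] := mkI O N; move=> yR; apply/SP; apply: (Rmin S) yR; split.
   by move=> z zUx zO; apply/SP; split=> //; apply: UxN.
  move=> D hD z /SP[zO zN]; apply/SP; split; last exact: DN.
  exact: (Del_stable char0 aclM hk hU kU kK ffK ffUK wK wU UKP UN NUK K0P R0P DN hD vO UO zN zO).
 have DR y : y \in R -> dl y \in R.
  have [S SP] : exists S : sring M, forall y, y \in S <-> y \in R /\ dl y \in R.
   apply: mkR => [|a b [aR da] [bR db]|a b [aR da] [bR db]].
   - by rewrite (der1 DT) rpred1 rpred0.
   - by rewrite (derB DT) ?hT // !rpredB.
   by rewrite dd.2 rpredM // rpredD // rpredM.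
  move=> yR; suff /SP[] : y \in S by [].
  apply: (Rmin S) yR; split.
   by move=> z zUx zO; apply/SP; split; apply: Rgen => //; [apply: dUx|apply: dUxO].
  move=> D hD z /SP[zR dz]; apply/SP; split; first exact: RDel.
  have -> : dl (D z) = (dl (D z) - D (dl z)) + D (dl z) by ring.
  by rewrite rpredD ?(RDel _ (Del_comm hD)) // RDel.
 have fr y : y \in N -> is_frac R y.
  have [G GP] := frac_field R; move=> yN; apply/GP; apply: (Nmin G) yN; split.
  - move=> z zU; apply/GP; exists z, 1; rewrite rpred1 oner_eq0 divr1; split=> //.
   by apply: Rgen; [apply: UUx|apply: UO].
  - apply/GP; have [xO|xO] := boolP (x \in O).
    by exists x, 1; rewrite rpred1 oner_eq0 divr1; split=> //; apply: Rgen.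
   have x0 : x != 0 by apply: contraNneq xO => ->; rewrite rpred0.
   exists 1, x^-1; rewrite rpred1 invr_eq0 x0 div1r invrK; split=> //.
   by apply: Rgen; rewrite ?rpredV // mx_sub // notO_mx.
  move=> D hD _ /GP[a [b [aR bR b0 ->]]]; apply/GP; have [Dd _ _] := hD.
  exists (D a * b - a * D b), (b ^+ 2); rewrite (derQ (isder_on T Dd)) ?hT // expf_neq0 // rpredX //.
  by split=> //; rewrite rpredB // rpredM // RDel.
 have RO : R \sub O by move=> y /RON[].
 have RN : R \sub N by move=> y /RON[].
 exact: (der_stable_subring char0 aclM ffN vO UO RO RN fr (isder_on N dd) dN DR dU).
have [vf st] := descended_field char0 aclM hk hU kU kK ffK ffUK wK wU UKP dd dU dK constK constU
 UN NUK K0P R0P dN DN xN xU dx dst.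
exists K0; split=> //.
 have [v [_ _ v0 [y yK vy] _]] := vf; exists y => //.
 by apply: contra vy => /v0 ->.
apply: (dichotomy char0 aclM ff0 vf dd dK0 dk _ st).
by move=> y /K0K; apply: constK.
Qed.
End CaseA.
End Towers.

(** * Existence of an algebraic closure *)

Open Scope quotient_scope.

Lemma field_of_ring (R : comNzRingType) : (forall x : R, x != 0 -> exists y, y * x = 1) ->
 exists (K : fieldType) (f : {rmorphism R -> K}), injective f.
Proof.
move=> h; have /choice[g hg] : forall x : R, exists y, x != 0 -> y * x = 1.
 by move=> x; have [->|/h[y E]] := eqVneq x 0; [exists 0|exists y].
pose inv x := if x == 0 then 0 else g x.
have mV x : x != 0 -> inv x * x = 1 by move=> x0; rewrite /inv (negPf x0) hg.
have i0 : inv 0 = 0 by rewrite /inv eqxx.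
pose K := HB.pack_for fieldType R (GRing.ComNzRing_isField.Build R mV i0).
by exists K, (idfun : {rmorphism R -> R}).
Qed.

Lemma residue_field (R : comNzRingType) (J : set R) : J 0 -> (forall x y, J x -> J y -> J (x - y)) ->
 (forall a x, J x -> J (a * x)) -> ~ J 1 ->
 exists (K : fieldType) (f : {rmorphism R -> K}), forall x, J x -> f x = 0.
Proof.
move=> J0 JB JM J1.
pose good (I : set R) := [/\ (forall x, J x -> I x), (forall x y, I x -> I y -> I (x - y)),
 (forall a x, I x -> I (a * x)) & ~ I 1].
have [||I [[IJ IB IM I1] Imax]] := @Zorn_nonempty _ good J.
- by split.
- move=> C Cg tot [A CA]; split.
 + by move=> x Jx; exists A => //; have [h _ _ _] := Cg _ CA; apply: h.
 + move=> x y [B CB Bx] [B' CB' By].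
  by have [le|le] := tot _ _ CB CB'; [exists B' => //; have [_ h _ _] := Cg _ CB'; apply: h => //; apply: le|
   exists B => //; have [_ h _ _] := Cg _ CB; apply: h => //; apply: le].
 + by move=> a x [B CB Bx]; exists B => //; have [_ _ h _] := Cg _ CB; apply: h.
 + by move=> [B CB B1]; have [_ _ _] := Cg _ CB.
pose S : {pred R} := fun x => `[< I x >].
have SP x : x \in S <-> I x by split => [/asboolP|?]; last exact/asboolP.
have Sc : idealr_closed S.
 split; first exact/SP/IJ.
  by apply/negP => /SP.
 move=> a x y /SP Ix /SP Iy; apply/SP; have -> : a * x + y = a * x - (0 - y) by ring.
 exact: IB _ _ (IM a x Ix) (IB _ _ (IJ _ J0) Iy).
pose SI := HB.pack_for (idealr R) (S : R -> bool) (isIdealr.Build R S Sc).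
pose pi : {rmorphism R -> {ideal_quot SI}} := \pi_{ideal_quot SI}.
have qP x : x \in S -> pi x = 0.
 move=> xS; apply/eqP; rewrite -[0](rmorph0 pi) -(Quotient.idealrBE SI) subr0.
 exact: xS.
have [|K [f _]] := field_of_ring (R := {ideal_quot SI}).
 move=> x; rewrite -[x]reprK; set r := repr x => nz.
 have nI : ~ I r by move=> /SP/qP e; rewrite e eqxx in nz.
 pose I' : set R := [set y | exists a b, I b /\ y = b + a * r]%classic.
 have [[a [b [Ib E]]]|nI1] := pselect (I' 1).
  exists (pi a); have := congr1 pi E; rewrite rmorph1 rmorphD rmorphM qP ?add0r; last exact/SP.
  by move=> ->.
 have h1 y : I y -> I' y by move=> Iy; exists 0, y; rewrite mul0r addr0.
 have h2 : good I'.
  split=> //.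
  - by move=> y Jy; apply: h1; apply: IJ.
  - move=> _ _ [a [b [Ib ->]]] [a' [b' [Ib' ->]]]; exists (a - a'), (b - b').
   by split; [apply: IB|ring].
  - by move=> c _ [a [b [Ib ->]]]; exists (c * a), (c * b); split; [apply: IM|ring].
 case: nI; apply: (Imax I' h1 h2); exists 1, 0; rewrite mul1r add0r; split=> //; exact: IJ.
exists K, (f \o pi) => x Jx /=.
by rewrite qP ?rmorph0 //; apply/SP/IJ.
Qed.

Lemma irreducible_factor (F : fieldType) (p : {poly F}) : (1 < size p)%N ->
 exists2 g, irreducible_poly g & g %| p.
Proof.
move=> sp; pose P n := `[< exists g : {poly F}, [/\ (1 < size g)%N, g %| p & size g = n] >].
have ex : exists n, P n by exists (size p); apply/asboolP; exists p; rewrite dvdpp.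
case: (ex_minnP ex) => n /asboolP[g [sg gp gn]] nmin.
exists g => //; split=> // q sq qg.
have g0 : g != 0 by rewrite -size_poly_gt0; apply: leq_trans sg.
have q0 : q != 0 by apply: contraNneq g0 => q0; move: qg; rewrite q0 dvd0p.
have sq1 : (1 < size q)%N by rewrite ltn_neqAle eq_sym sq size_poly_gt0.
rewrite -dvdp_size_eqp // eqn_leq dvdp_leq //= gn; apply: nmin.
by apply/asboolP; exists q; split=> //; apply: dvdp_trans gp.
Qed.

Lemma splitting_field (F : fieldType) (p : {poly F}) : p != 0 ->
 exists (E : fieldType) (i : {rmorphism F -> E}) (rs : seq E) c,
  map_poly i p = c *: \prod_(r <- rs) ('X - r%:P).
Proof.
have [n] := ubnP (size p); elim: n F p => // n IH F p sp p0.
have [s1|s1] := leqP (size p) 1.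
 exists F, (idfun : {rmorphism F -> F}), [::], p`_0.
 by rewrite big_nil map_poly_id // -mul_polyC mulr1 -size1_polyC.
have [g gi gp] := irreducible_factor s1.
have [L _ [z rz _]] := irredp_FAdjoin gi.
have rp : root (map_poly (in_alg L) p) z.
 by apply: root_dvdp rz; rewrite dvdp_map.
have /factor_theorem[q qE] := rp.
have p0' : map_poly (in_alg L) p != 0 by rewrite map_poly_eq0.
have q0 : q != 0 by apply: contraNneq p0' => q0; rewrite qE q0 mul0r.
have sq : (size q < n)%N.
 have : size (map_poly (in_alg L) p) = size p by rewrite size_map_poly.
 by rewrite qE size_mul ?polyXsubC_eq0 // size_XsubC addn2 /= => E; rewrite -ltnS E.
have [E [i [rs [c Ec]]]] := IH L q sq q0.
exists E, (i \o in_alg L), (i z :: rs), c.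
rewrite map_poly_comp qE rmorphM /= Ec big_cons rmorphB /= map_polyX map_polyC /=.
by rewrite mulrC scalerAr.
Qed.

Section ProductRing.
Variables (I : choiceType) (E : I -> fieldType) (i0 : I).

Definition prodr : Type := forall i, E i.
HB.instance Definition _ := gen_eqMixin prodr.
HB.instance Definition _ := gen_choiceMixin prodr.
Definition pr0 : prodr := fun=> 0.
Definition pr1 : prodr := fun=> 1.
Definition propp (f : prodr) : prodr := fun i => - f i.
Definition pradd (f g : prodr) : prodr := fun i => f i + g i.
Definition prmul (f g : prodr) : prodr := fun i => f i * g i.
Let ext (f g : prodr) : (forall i, f i = g i) -> f = g. Proof. exact: functional_extensionality_dep. Qed.
Lemma praddA : associative pradd. Proof. by move=> f g h; apply: ext => i; apply: addrA. Qed.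
Lemma praddC : commutative pradd. Proof. by move=> f g; apply: ext => i; apply: addrC. Qed.
Lemma pradd0 : left_id pr0 pradd. Proof. by move=> f; apply: ext => i; apply: add0r. Qed.
Lemma praddN : left_inverse pr0 propp pradd. Proof. by move=> f; apply: ext => i; apply: addNr. Qed.
HB.instance Definition _ := GRing.isZmodule.Build prodr praddA praddC pradd0 praddN.
Lemma prmulA : associative prmul. Proof. by move=> f g h; apply: ext => i; apply: mulrA. Qed.
Lemma prmulC : commutative prmul. Proof. by move=> f g; apply: ext => i; apply: mulrC. Qed.
Lemma prmul1 : left_id pr1 prmul. Proof. by move=> f; apply: ext => i; apply: mul1r. Qed.
Lemma prmulD : left_distributive prmul +%R. Proof. by move=> f g h; apply: ext => i; apply: mulrDl. Qed.
Lemma pr10 : is_true (pr1 != pr0 :> prodr).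
Proof. by apply/eqP => /(congr1 (fun f : prodr => f i0))/eqP; rewrite /= oner_eq0. Qed.
Definition prodr_com := GRing.Zmodule_isComNzRing.Build prodr prmulA prmulC prmul1 prmulD pr10.
Definition prodRing : comNzRingType := HB.pack_for comNzRingType prodr prodr_com.
End ProductRing.

(** A product of splitting fields, one for each polynomial p, modulo a maximal ideal containing the
    families that vanish at all nonzero multiples of some q. At these coordinates q splits, hence it
    splits in the quotient. *)
Lemma all_split_field (F : fieldType) : exists (K : fieldType) (i : {rmorphism F -> K}),
 forall p : {poly F}, p != 0 -> exists (rs : seq K) c, map_poly i p = c *: \prod_(r <- rs) ('X - r%:P).
Proof.
have sp (p : {poly F}) : {E : fieldType & {i : {rmorphism F -> E} & {rs : seq E & {c : E |
  p != 0 -> map_poly i p = c *: \prod_(r <- rs) ('X - r%:P)}}}}.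
 have ex : exists E : fieldType, exists (i : {rmorphism F -> E}), exists rs : seq E, exists c : E,
   p != 0 -> map_poly i p = c *: \prod_(r <- rs) ('X - r%:P).
  have [p0|p0] := eqVneq p 0.
   by exists F, (idfun : {rmorphism F -> F}), [::], 0.
  by have [E [i [rs [c h]]]] := splitting_field p0; exists E, i, rs, c.
 have [E h1] := cid ex; have [i h2] := cid h1; have [rs h3] := cid h2; have [c h4] := cid h3.
 by exists E, i, rs, c.
pose E (p : {poly F}) := projT1 (sp p).
pose em (p : {poly F}) : {rmorphism F -> E p} := projT1 (projT2 (sp p)).
pose R := prodRing E 0.
pose J : set R := [set f : prodr E | exists2 q : {poly F}, q != 0 & forall p, p != 0 -> q %| p -> f p = 0]%classic.
have [||||K [f fJ]] := @residue_field R J.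
- by exists 1; rewrite ?oner_eq0.
- move=> x y [q q0 hq] [q' q0' hq']; exists (q * q'); first by rewrite mulf_neq0.
 move=> p p0 dp; rewrite -[LHS]/(x p - y p) hq ?hq' ?subr0 //; apply: dvdp_trans dp.
  exact: dvdp_mull.
 exact: dvdp_mulr.
- move=> a x [q q0 hq]; exists q => // p p0 dp; rewrite -[LHS]/(a p * x p) hq ?mulr0 //.
- by move=> [q q0 /(_ q q0 (dvdpp q))/eqP]; rewrite oner_eq0.
pose cst (a : F) : R := (fun p => em p a) : prodr E.
have cstB : zmod_morphism cst by move=> a b; apply: functional_extensionality_dep => p; apply: rmorphB.
have cstM : monoid_morphism cst.
 by split=> [|a b]; apply: functional_extensionality_dep => p; [apply: rmorph1|apply: rmorphM].
pose cst' : {rmorphism F -> R} := rmorph_of cstB cstM.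
exists K, (f \o cst') => q q0.
pose n := (size q).-1.
have spl (p : {poly F}) : exists (r : 'I_n -> E p), q %| p -> p != 0 ->
  map_poly (em p) q = em p (lead_coef q) *: \prod_i ('X - (r i)%:P).
 have [[p0 dq]|h] := pselect (p != 0 /\ q %| p); last by exists (fun=> 0) => h1 h2; case: h.
 have [c /(_ p0) hp] := projT2 (projT2 (projT2 (sp p))).
 set rs := projT1 (projT2 (projT2 (sp p))) in hp.
 have hp' : map_poly (em p) p = c *: \prod_(r <- rs) ('X - r%:P) := hp.
 have c0 : c != 0.
  apply/eqP => c0; have : map_poly (em p) p != 0 by rewrite map_poly_eq0.
  by rewrite hp' c0 scale0r eqxx.
 have : map_poly (em p) q %| \prod_(r <- rs) ('X - r%:P).
  by rewrite -(dvdpZr _ _ c0) -hp' dvdp_map.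
 move=> /dvdp_prod_XsubC[m /eqp_eq]; set ss := mask m rs.
 rewrite lead_coef_map (monicP (monic_prod_XsubC _ _ _)) scale1r => E1.
 have ss_n : size ss = n.
  have : size (map_poly (em p) q) = (size ss).+1.
   by rewrite E1 size_scale ?size_prod_XsubC // fmorph_eq0 lead_coef_eq0.
  by rewrite size_map_poly /n => ->.
 exists (fun i => ss`_i) => _ _; rewrite E1 (big_nth 0) big_mkord ss_n; by [].
pose r p := projT1 (cid (spl p)).
have hr p : q %| p -> p != 0 -> map_poly (em p) q = em p (lead_coef q) *: \prod_i ('X - (r p i)%:P).
 exact: (projT2 (cid (spl p))).
pose rr (i : 'I_n) : R := (fun p => r p i) : prodr E.
pose P : {poly R} := map_poly cst' q - (cst' (lead_coef q))%:P * \prod_i ('X - (rr i)%:P).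
have evM (p : {poly F}) : zmod_morphism (fun f : R => (f : prodr E) p) by [].
have evM' (p : {poly F}) : monoid_morphism (fun f : R => (f : prodr E) p) by [].
pose ev p : {rmorphism R -> E p} := HB.pack_for {rmorphism R -> E p} (fun f : R => (f : prodr E) p)
 (GRing.isZmodMorphism.Build _ _ _ (evM p)) (GRing.isMonoidMorphism.Build _ _ _ (evM' p)).
have PJ i : J P`_i.
 exists q => // p p0 dq.
 have mE : map_poly (ev p) P = map_poly (em p) q - (em p (lead_coef q))%:P * \prod_i ('X - (r p i)%:P).
  rewrite /P rmorphB rmorphM rmorph_prod; congr (_ - _ * _).
  - by transitivity (map_poly (ev p \o cst') q); [exact/esym/map_poly_comp|exact: eq_map_poly].
  - exact: map_polyC.
  - by apply: eq_bigr => k _; rewrite rmorphB; congr (_ - _); [exact: map_polyX|exact: map_polyC].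
 by rewrite -[LHS]/(ev p P`_i) -(coef_map (ev p)) mE hr // mul_polyC subrr coef0.
exists [seq f (rr i) | i <- enum 'I_n], (f (cst' (lead_coef q))).
apply/eqP; rewrite -subr_eq0; apply/eqP/polyP => i; rewrite coef0.
have -> : map_poly (f \o cst') q - f (cst' (lead_coef q)) *: \prod_(r <- [seq f (rr i) | i <- enum 'I_n]) ('X - r%:P) =
  map_poly f P.
 rewrite /P rmorphB rmorphM rmorph_prod -mul_polyC big_map big_enum; congr (_ - _ * _).
 - exact: map_poly_comp.
 - by apply/esym/map_polyC.
 - by apply: eq_bigr => k _; rewrite rmorphB; congr (_ - _); apply/esym; [exact: map_polyX|exact: map_polyC].
by rewrite (coef_map f); apply: fJ; apply: PJ.
Qed.

(** Take the elements algebraic over F in a field where all polynomials over F split. A root of an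
    irreducible g over them is algebraic over F, so g divides a polynomial over F and splits with
    it. *)
Theorem algebraic_closure (F : fieldType) : exists (M : fieldType) (i : {rmorphism F -> M}), acl M.
Proof.
have [K [i spl]] := all_split_field F.
have [S SP] : exists S : sfield K, forall x, x \in S <-> exists a, x = i a.
 apply: mkF; split; first by exists 1; rewrite rmorph1.
  by move=> _ _ [a ->] [b ->]; exists (a - b); rewrite rmorphB.
 by move=> _ _ [a ->] [b ->]; exists (a / b); rewrite fmorph_div.
have [G GP] := alg_closure S.
have iG a : i a \in G by apply/GP/alg_id/SP; exists a.
pose M : fieldType := subF G.
pose j (a : F) : M := SubF (iG a).
have jB : zmod_morphism j by move=> a b; apply: val_inj; rewrite /= rmorphB.
have jM : monoid_morphism j.
 by split=> [|a b]; apply: val_inj; rewrite /= ?rmorph1 ?rmorphM.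
pose j' : {rmorphism F -> M} := rmorph_of jB jM.
exists M, j' => p sp; have [g gi gp] := irreducible_factor sp.
suff [x rx] : exists x, root g x by exists x; apply: root_dvdp rx.
have [L _ [z rz _]] := irredp_FAdjoin gi.
have [SL SLP] : exists S : sfield L, forall x, x \in S <-> exists a, x = in_alg L (j' a).
 apply: mkF; split; first by exists 1; rewrite !rmorph1.
  by move=> _ _ [a ->] [b ->]; exists (a - b); rewrite !rmorphB.
 by move=> _ _ [a ->] [b ->]; exists (a / b); rewrite !fmorph_div.
have [GL GLP] : exists S : sfield L, forall x, x \in S <-> exists a : M, x = in_alg L a.
 apply: mkF; split; first by exists 1; rewrite !rmorph1.
  by move=> _ _ [a ->] [b ->]; exists (a - b); rewrite !rmorphB.
 by move=> _ _ [a ->] [b ->]; exists (a / b); rewrite !fmorph_div.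
have liftS (q : {poly K}) : q \over S -> exists q' : {poly F}, q = map_poly i q'.
 move=> qS; have /choice[c hc] : forall n, exists a, q`_n = i a by move=> n; apply/SP/(polyOverP qS).
 exists (\poly_(n < size q) c n); apply/polyP => n; rewrite coef_map coef_poly.
 by case: ltnP => h; [exact: hc|rewrite /= rmorph0 nth_default].
have vj q' : map_poly (val : M -> K) (map_poly j' q') = map_poly i q' by rewrite -map_poly_comp.
have zalg : alg SL z.
 apply: (alg_trans (G := GL)); last first.
  exists (map_poly (in_alg L) g); rewrite map_poly_eq0 irredp_neq0 //; split=> //.
  by apply/polyOverP => n; rewrite coef_map; apply/GLP; exists g`_n.
 move=> _ /GLP[a ->]; have /GP[q [qS q0 rq]] := subvalP a.
 have [q' qE] := liftS q qS; exists (map_poly (in_alg L \o j') q'); split.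
 - by apply/polyOverP => n; rewrite coef_map; apply/SLP; exists q'`_n.
 - by rewrite map_poly_eq0; apply: contraNneq q0 => q0'; rewrite qE q0' rmorph0.
 rewrite map_poly_comp fmorph_root -(fmorph_root (val : M -> K)) vj -qE; exact: rq.
have [q [qS q0 rq]] := zalg.
have [q' qE] : exists q' : {poly F}, q = map_poly (in_alg L \o j') q'.
 have /choice[c hc] : forall n, exists a, q`_n = in_alg L (j' a) by move=> n; apply/SLP/(polyOverP qS).
 exists (\poly_(n < size q) c n); apply/polyP => n; rewrite coef_map coef_poly.
 by case: ltnP => h; [exact: hc|rewrite nth_default //; apply/esym; exact: (rmorph0 (in_alg L \o j'))].
have q0' : q' != 0 by apply: contraNneq q0 => e; rewrite qE e rmorph0.
have gq : g %| map_poly j' q'.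
 apply: contraT; rewrite -(irreducible_poly_coprime _ gi) => cop.
 have := coprimep_root (p := map_poly (in_alg L) g) (q := map_poly (in_alg L) (map_poly j' q')) (x := z).
 by rewrite coprimep_map => /(_ cop rz); rewrite -map_poly_comp -qE (rootP rq) eqxx.
have [rs [c E]] := spl q' q0'.
have c0 : c != 0.
 apply/eqP => c0; have : map_poly i q' != 0 by rewrite map_poly_eq0.
 by rewrite E c0 scale0r eqxx.
have gd : map_poly (val : M -> K) g %| \prod_(r <- rs) ('X - r%:P).
 by rewrite -(dvdpZr _ _ c0) -E -vj dvdp_map.
have [m gm] := dvdp_prod_XsubC gd.
have : (1 < size (map_poly (val : M -> K) g))%N by rewrite size_map_poly; case: gi.
rewrite (eqp_size gm) size_prod_XsubC; case: (mask m rs) gm => // r rs' gm _.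
have rg : root (map_poly (val : M -> K) g) r by rewrite (eqp_root gm) big_cons rootM root_XsubC eqxx.
have rG : r \in G.
 apply/GP/(alg_trans (G := G)); first by move=> y /GP.
 exists (map_poly (val : M -> K) g); rewrite map_poly_eq0 irredp_neq0 //; split=> //.
 exact: polyOver_map.
by exists (SubF rG); rewrite -(fmorph_root (val : M -> K)).
Qed.
Close Scope quotient_scope.

(** * Power series and Taylor morphisms *)

Section PowerSeries.
Variable R : idomainType.

Definition series : Type := nat -> R.
HB.instance Definition _ := gen_eqMixin series.
HB.instance Definition _ := gen_choiceMixin series.
Implicit Types f g h : series.
Definition ps0 : series := fun=> 0.
Definition psC (c : R) : series := fun n => if n == 0%N then c else 0.
Definition psopp f : series := fun n => - f n.
Definition psadd f g : series := fun n => f n + g n.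
Definition psmul f g : series := fun n => \sum_(i < n.+1) f i * g (n - i)%N.

Lemma psaddA : associative psadd. Proof. by move=> f g h; apply: funext => i; apply: addrA. Qed.
Lemma psaddC : commutative psadd. Proof. by move=> f g; apply: funext => i; apply: addrC. Qed.
Lemma psadd0 : left_id ps0 psadd. Proof. by move=> f; apply: funext => i; apply: add0r. Qed.
Lemma psaddN : left_inverse ps0 psopp psadd. Proof. by move=> f; apply: funext => i; apply: addNr. Qed.
HB.instance Definition _ := GRing.isZmodule.Build series psaddA psaddC psadd0 psaddN.

(* truncations compare power series with polynomials *)
Definition trunc m f : {poly R} := \poly_(i < m) f i.
Lemma coef_trunc m f i : (i < m)%N -> (trunc m f)`_i = f i.
Proof. by rewrite coef_poly => ->. Qed.
Lemma psmulE m f g i : (i < m)%N -> psmul f g i = (trunc m f * trunc m g)`_i.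
Proof.
move=> im; rewrite coefM; apply: eq_bigr => j _.
have ji : (j <= i)%N by rewrite -ltnS.
by rewrite !coef_trunc // (leq_ltn_trans _ im) // leq_subr.
Qed.
Lemma trunc_mul m (f g : series) (p : {poly R}) i : (i < m)%N ->
 (trunc m (psmul f g) * p)`_i = (trunc m f * trunc m g * p)`_i.
Proof.
move=> im; rewrite !coefM; apply: eq_bigr => j _; congr (_ * _).
have jm : (j < m)%N by apply: leq_ltn_trans im; rewrite -ltnS.
by rewrite coef_trunc // (psmulE _ _ jm).
Qed.

Lemma psmulC : commutative psmul.
Proof. by move=> f g; apply: funext => i; rewrite !(@psmulE i.+1) // mulrC. Qed.
Lemma psmulA : associative psmul.
Proof.
move=> f g h; apply: funext => i; rewrite (psmulC f) !(@psmulE i.+1) //.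
by rewrite !trunc_mul // [trunc i.+1 g * trunc i.+1 h * _]mulrC mulrA.
Qed.
Lemma psmul1 : left_id (psC 1) psmul.
Proof.
move=> f; apply: funext => i; rewrite /psmul big_ord_recl /= subn0 mul1r big1 ?addr0 // => j _.
by rewrite /psC /= mul0r.
Qed.
Lemma psmulD : left_distributive psmul +%R.
Proof.
move=> f g h; apply: funext => i; rewrite -[RHS]/(psmul f h i + psmul g h i) /psmul -big_split /=.
by apply: eq_bigr => j _; rewrite -mulrDl.
Qed.
Lemma ps10 : is_true (psC 1 != ps0 :> series).
Proof. by apply/eqP => /(congr1 (fun f : series => f 0%N))/eqP; rewrite /= oner_eq0. Qed.
HB.instance Definition _ := GRing.Zmodule_isComNzRing.Build series psmulA psmulC psmul1 psmulD ps10.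

Lemma ps_order f : f != 0 -> exists n, f n != 0 /\ forall i, (i < n)%N -> f i = 0.
Proof.
move=> f0; have ex : exists n, f n != 0.
 apply: contrapT => h; move/eqP: f0; apply; apply: funext => n; apply/eqP/negPn/negP => fn.
 by apply: h; exists n.
case: (ex_minnP ex) => n fn nmin; exists n; split=> // i lt; apply/eqP; apply: contraTT lt => /nmin.
by rewrite -leqNgt.
Qed.

Lemma ps_domain f g : f * g = 0 -> (f == 0) || (g == 0).
Proof.
move=> fg; apply/orP; apply: contrapT => /not_orP[/negP/ps_order[n [fn nl]] /negP/ps_order[m [gm ml]]].
have := congr1 (fun h : series => h (n + m)%N) fg; rewrite /= -[f * g]/(psmul f g) /psmul => /eqP.
have lt : (n < (n + m).+1)%N by rewrite ltnS leq_addr.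
rewrite (bigD1 (Ordinal lt)) //= addKn big1 => [|i].
 by rewrite addr0 mulf_eq0 (negPf fn) (negPf gm).
rewrite -val_eqE /= => ne; have [lti|le] := ltnP i n; first by rewrite nl // mul0r.
have lti : (n < i)%N by rewrite ltn_neqAle eq_sym ne.
rewrite [g _]ml ?mulr0 //.
by rewrite ltn_subLR ?ltn_add2r // -ltnS.
Qed.

Lemma series_domain : exists (A : idomainType) (i : {rmorphism series -> A}), injective i.
Proof.
pose un : {pred series} := fun x => `[< exists y, y * x = 1 >].
have unP x : x \in un <-> exists y, y * x = 1 by split => [/asboolP|?]; last exact/asboolP.
have /choice[iv hiv] : forall x : series, exists y, if x \in un then y * x = 1 else y = x.
 move=> x; have [[y E]|nE] := pselect (exists y, y * x = 1).
  by exists y; case: ifP => // /negP[]; apply/unP; exists y.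
 by exists x; case: ifP => // /unP.
have h1 : {in un, left_inverse 1 iv *%R}.
 by move=> x xu; have := hiv x; rewrite xu.
have h2 x y : y * x = 1 -> un x by move=> E; apply/asboolP; exists y.
have h3 : {in [predC un], iv =1 id}.
 by move=> x; rewrite inE => /negPf xu; have := hiv x; rewrite xu.
pose U := HB.pack_for comUnitRingType series (GRing.ComNzRing_hasMulInverse.Build series h1 h2 h3).
pose A := HB.pack_for idomainType U (GRing.ComUnitRing_isIntegral.Build U ps_domain).
by exists A, (idfun : {rmorphism series -> series}).
Qed.

Definition psder f : series := fun n => n.+1%:R * f n.+1.
Lemma psderD f g : psder (f + g) = psder f + psder g.
Proof. by apply: funext => n; rewrite -[RHS]/(psder f n + psder g n) /psder -mulrDr. Qed.
Lemma psderM f g : psder (f * g) = psder f * g + f * psder g.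
Proof.
apply: funext => n; rewrite -[RHS]/(psmul (psder f) g n + psmul f (psder g) n).
rewrite -[LHS]/(n.+1%:R * psmul f g n.+1) !(@psmulE n.+2) //.
rewrite mulr_natl -coef_deriv derivM coefD; congr (_ + _); rewrite !coefM; apply: eq_bigr => j _.
 have jn : (j < n.+1)%N by [].
 congr (_ * _); rewrite coef_deriv (@coef_trunc n.+2 f j.+1 jn) (@coef_trunc n.+2 (psder f) j (ltnW jn)).
 by rewrite /psder mulr_natl.
have jn : (n - j < n.+1)%N by rewrite ltnS leq_subr.
congr (_ * _); rewrite coef_deriv (@coef_trunc n.+2 g (n - j).+1 jn) (@coef_trunc n.+2 (psder g) (n - j) (ltnW jn)).
by rewrite /psder mulr_natl.
Qed.

Lemma psC_morph : zmod_morphism psC /\ monoid_morphism psC.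
Proof.
split; first by move=> a b; apply: funext => -[|n]; rewrite -[RHS]/(psC a _ - psC b _) /psC //= subr0.
split=> // a b; apply: funext => n; rewrite -[RHS]/(psmul (psC a) (psC b) n) /psmul big_ord_recl /= subn0.
rewrite big1 ?addr0 => [|j _]; last by rewrite /psC /= mul0r.
by rewrite /psC; case: n => //= n; rewrite mulr0.
Qed.
End PowerSeries.

(* exp (s eps) is a ring morphism *)
Lemma taylor_morph (X : fieldType) (R : idomainType) (h : {rmorphism X -> R}) (D : X -> X) :
 char_0 X -> (forall x y, D (x + y) = D x + D y) -> (forall x y, D (x * y) = D x * y + x * D y) ->
 let T (x : X) : series R := fun n => h (iter n D x / n`!%:R) in
 [/\ zmod_morphism T, monoid_morphism T & forall x, psder (T x) = T (D x)].
Proof.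
move=> char0 DD DM T.
have n0 n : n`!%:R != 0 :> X by rewrite natr_eq0 // -lt0n fact_gt0.
have D0 : D 0 = 0 by have := DD 0 0; rewrite addr0 => /eqP; rewrite -subr_eq0 opprD addNKr oppr_eq0 => /eqP.
have DN x : D (- x) = - D x by apply/eqP; rewrite -addr_eq0 -DD addNr D0.
have itD n x y : iter n D (x - y) = iter n D x - iter n D y by elim: n => //= n ->; rewrite DD DN.
have TD x : psder (T x) = T (D x).
 apply: funext => n; rewrite /psder /T -(rmorph_nat h) -rmorphM; congr (h _).
 rewrite -iterSr factS natrM; have s0 : n.+1%:R != 0 :> X by rewrite natr_eq0.
 by rewrite invfM mulrCA (mulrA n.+1%:R) mulfV // mul1r.
have TB : zmod_morphism T.
 by move=> x y; apply: funext => n; rewrite -[RHS]/(T x n - T y n) /T itD mulrBl rmorphB.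
have T0 : T 0 = 0 by rewrite -(subrr 0) TB subrr.
have TN y : T (- y) = - T y by rewrite -sub0r TB T0 sub0r.
have TA x y : T (x + y) = T x + T y by rewrite -{1}[y]opprK TB TN opprK.
have T1 : T 1 = 1.
 have D1 : D 1 = 0.
  have := DM 1 1; rewrite !mulr1 mul1r => /eqP.
  by rewrite -subr_eq0 opprD addNKr oppr_eq0 => /eqP.
 apply: funext => -[|n]; rewrite -[RHS]/(psC 1 _) /T /psC /=; first by rewrite fact0 divr1 rmorph1.
 have -> : D (iter n D 1) = 0 by rewrite -iterS iterSr D1; elim: n => //= n ->.
 by rewrite mul0r rmorph0.
split=> //; split=> // x y; apply: funext => n; elim: n x y => [|n IH] x y.
 rewrite -[RHS]/(psmul (T x) (T y) 0) /psmul big_ord1 /T /= fact0 !divr1.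
 exact: rmorphM.
have s0 : n.+1%:R != 0 :> R by rewrite -(rmorph_nat h) fmorph_eq0 natr_eq0.
apply: (mulfI s0); rewrite -[LHS]/(psder (T (x * y)) n) -[RHS]/(psder (T x * T y) n).
rewrite TD DM TA psderM !TD -[LHS]/(T (D x * y) n + T (x * D y) n) !IH //.
Qed.

(** * Generic differential isomorphisms *)

Section Extend.
Variables (A : comNzRingType) (M : fieldType) (io : {rmorphism A -> M}) (D : A -> A).
Hypotheses (char0 : char_0 M) (io_inj : injective io)
 (DD : forall x y, D (x + y) = D x + D y) (DM : forall x y, D (x * y) = D x * y + x * D y).

(** The quotient rule defines dl on the fractions of the image, and [der_ext] extends it to M. *)
Lemma der_from_domain : exists dl : M -> M, isder dl /\ forall a, dl (io a) = io (D a).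
Proof.
have nz (c : A) : c != 0 -> io c != 0 by move=> c0; rewrite -(rmorph0 io) (inj_eq io_inj).
have m0 (a b : A) : a != 0 -> b != 0 -> a * b != 0.
 by move=> a0 b0; rewrite -(inj_eq io_inj) rmorph0 rmorphM mulf_neq0 ?nz.
have [S SP] : exists S : sfield M, forall z, z \in S <-> exists a b, b != 0 /\ z = io a / io b.
 apply: mkF; split; first by exists 1, 1; rewrite oner_eq0 rmorph1 divr1.
 - move=> _ _ [a [b [b0 ->]]] [a' [b' [b0' ->]]]; exists (a * b' - a' * b), (b * b').
  rewrite m0 //; split=> //; rewrite rmorphB !rmorphM.
  have i0 : io b != 0 by rewrite -(rmorph0 io) (inj_eq io_inj).
  have i0' : io b' != 0 by rewrite -(rmorph0 io) (inj_eq io_inj).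
  by field; rewrite i0 i0'.
 move=> _ _ [a [b [b0 ->]]] [a' [b' [b0' ->]]]; have [->|a0] := eqVneq a' 0.
  by exists 0, 1; rewrite oner_eq0 rmorph0 !mul0r invr0 mulr0.
 exists (a * b'), (b * a'); rewrite m0 //; split=> //; rewrite !rmorphM.
  by field; rewrite !nz.
pose q a b := (io (D a) * io b - io a * io (D b)) / io b ^+ 2.
have /choice[d0 hd] : forall z, exists w, forall a b, b != 0 -> z = io a / io b -> w = q a b.
 move=> z; have [/SP[a [b [b0 zE]]]|zS] := boolP (z \in S); last first.
  by exists 0 => a b b0 zE; case/negP: zS; apply/SP; exists a, b.
 exists (q a b) => a' b' b0' zE'.
 have cross : a * b' = a' * b.
  apply: io_inj; rewrite !rmorphM; have : io a / io b = io a' / io b' by rewrite -zE.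
  by move=> /eqP; rewrite eqr_div ?nz // => /eqP.
 have := congr1 (fun x => io (D x)) cross; rewrite /= !DM !rmorphD !rmorphM => c2.
 have c1 : io a * io b' = io a' * io b by rewrite -!rmorphM cross.
 have b1 := nz _ b0; have b1' := nz _ b0'; rewrite /q.
 have aE : io a = io a' * io b / io b' by rewrite -c1 mulfK.
 have daE : io (D a) = (io (D a') * io b + io a' * io (D b) - io a * io (D b')) / io b'.
  by rewrite -c2; field.
 by rewrite daE aE; field; rewrite b1 b1'.
have hd' a b : b != 0 -> d0 (io a / io b) = q a b by move=> b0; apply: hd.
have SD : derOn S d0.
 split=> _ _ /SP[a [b [b0 ->]]] /SP[a' [b' [b0' ->]]]; have b1 := nz _ b0; have b1' := nz _ b0'.
 - have -> : io a / io b + io a' / io b' = io (a * b' + a' * b) / io (b * b').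
   by rewrite rmorphD !rmorphM; field; rewrite b1 b1'.
  rewrite !hd' ?m0 // /q !(DD, DM, rmorphD, rmorphM); field.
  by rewrite b1 b1'.
 have -> : (io a / io b) * (io a' / io b') = io (a * a') / io (b * b').
  by rewrite !rmorphM; field; rewrite b1 b1'.
 rewrite !hd' ?m0 // /q !(DM, rmorphD, rmorphM); field.
 by rewrite b1 b1'.
have [T hT] := fullF M.
have ST : S \sub T by move=> *; apply: hT.
have dT x : x \in S -> d0 x \in T by move=> *; apply: hT.
have [dl [dlD _ dlS]] := der_ext char0 SD ST dT.
exists dl; split; first exact: derOn_full hT dlD.
move=> a; have -> : io a = io a / io 1 by rewrite rmorph1 divr1.
rewrite dlS; last by apply/SP; exists a, 1; rewrite oner_eq0.
have D1 : D 1 = 0.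
 have := DM 1 1; rewrite !mulr1 mul1r => /eqP.
 by rewrite -subr_eq0 opprD addNKr oppr_eq0 => /eqP.
by rewrite hd' ?oner_eq0 // /q D1 rmorph1 rmorph0 mulr0 subr0 mulr1 expr1n divr1.
Qed.
End Extend.

Lemma horner_shift (X R : comNzRingType) (h : {rmorphism X -> R}) (p : {poly X}) u z :
 (map_poly h p).[h u + z] = (map_poly h (p \Po ('X + u%:P))).[z].
Proof.
by rewrite map_comp_poly horner_comp rmorphD /= map_polyX map_polyC /= hornerD hornerX hornerC addrC.
Qed.

Lemma horner_map_MXaddC (X R : comNzRingType) (h : {rmorphism X -> R}) (r : {poly X}) c z :
 (map_poly h (r * 'X + c%:P)).[z] = z * (map_poly h r).[z] + h c.
Proof.
by rewrite rmorphD rmorphM /= map_polyX map_polyC /= hornerD hornerM hornerX hornerC mulrC.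
Qed.

(* sigma is generic over j: its constant term in t is u + s, transcendental over X. *)
Theorem generic_embeddings (X : diffFieldType) (S : sfield X) (u : X) : char_0 X ->
 (stab der S) -> ~ alg S u ->
 exists (M : fieldType) (dl : M -> M) (j sg : {rmorphism X -> M}),
 [/\ acl M, char_0 M, isder dl /\ (forall x, dl (j x) = j (der x)) /\ (forall x, dl (sg x) = sg (der x)),
   forall x, x \in S -> sg x = j x &
   forall p : {poly X}, p != 0 -> (map_poly j p).[sg u] != 0].
Proof.
move=> char0 dS nau; have [T hT] := fullF X.
have z0 : derOn S (fun=> 0 : X) by split=> *; rewrite ?mul0r ?mulr0 addr0.
have ST : S \sub T by move=> *; apply: hT.
have zT : forall x, x \in S -> (fun=> 0 : X) x \in T by move=> *; apply: rpred0.
(* ep extends d/du from S(u) to X; its exponential in a variable s fixes S and sends u to u + s. *)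
have [ep [epD _ ep0 epu]] := der_ext_transc char0 z0 ST zT (hT u) (rpred1 T) nau.
have {}epD := derOn_full hT epD.
have [tB tM _] := taylor_morph ((idfun : {rmorphism X -> X})) char0 epD.1 epD.2.
set t0 := fun x => _ in tB tM.
have [A [a a_inj]] := series_domain X.
pose tau0 : {rmorphism X -> series X} := rmorph_of tB tM.
have [cB cM] := psC_morph X.
pose cst : {rmorphism X -> series X} := rmorph_of cB cM.
pose tau : {rmorphism X -> A} := a \o tau0; pose io : {rmorphism X -> A} := a \o cst.
(* Taylor series in a second variable t for the derivation of X, with coefficients embedded by [io]
   or twisted by [tau]; in both cases d/dt induces the derivation. *)
have [jB jM jd] := taylor_morph (io) char0 (@derD X) (@derM X).
set j0 := fun x => _ in jB jM jd.
have [sB sM sd] := taylor_morph (tau) char0 (@derD X) (@derM X).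
set s0 := fun x => _ in sB sM sd.
pose j1 : {rmorphism X -> series A} := rmorph_of jB jM.
pose s1 : {rmorphism X -> series A} := rmorph_of sB sM.
have [B [b b_inj]] := series_domain A.
have [M [i acM]] := algebraic_closure {fraction B}.
pose k : {rmorphism series A -> M} := i \o (@tofrac B : {rmorphism B -> {fraction B}}) \o b.
have k_inj : injective k.
 by move=> x y /fmorph_inj/eqP; rewrite tofrac_eq => /eqP/b_inj.
have charM : char_0 M.
 by move=> p; rewrite (fmorph_pchar (k \o j1)).
have [dl [dld dlk]] := der_from_domain (io := k) (D := @psder A) charM k_inj (@psderD A) (@psderM A).
exists M, dl, (k \o j1), (k \o s1); split=> //.
- by split=> //; split=> x; rewrite /= dlk ?jd ?sd.
- move=> x xS /=; congr (k _); apply: funext => n; rewrite /s0 /j0 /tau /io /=; congr (a _).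
 have yS m : iter m der x \in S by elim: m => //= m; apply: dS.
 have y'S : iter n der x / n`!%:R \in S by rewrite rpred_div ?rpred_nat.
 apply: funext => m; rewrite /t0 /psC; case: m => [|m] /=; first by rewrite fact0 divr1.
 set y := _ / _ in y'S *; have -> : ep (iter m ep y) = 0.
  by rewrite -iterS iterSr ep0 //; elim: m => //= m ->; apply: ep0; apply: rpred0.
 by rewrite mul0r.
move=> p p0.
have -> : (map_poly (k \o j1) p).[(k \o s1) u] = k (map_poly j1 p).[s1 u].
 by rewrite map_poly_comp horner_map.
rewrite -(rmorph0 k) (inj_eq k_inj); apply/eqP => /(congr1 (fun f : series A => f 0%N)) /= E.
pose ev0 (f : series A) : A := f 0%N.
have evB : zmod_morphism ev0 by [].
have evM : monoid_morphism ev0.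
 by split=> // f g; rewrite -[LHS]/(psmul f g 0) /psmul big_ord1.
pose ev : {rmorphism series A -> A} := rmorph_of evB evM.
have : ev (map_poly j1 p).[s1 u] = 0 := E.
have evj x : ev (j1 x) = io x by rewrite /ev /= /ev0 /j0 /= fact0 divr1.
have evs x : ev (s1 x) = tau x by rewrite /ev /= /ev0 /s0 /= fact0 divr1.
rewrite -horner_map -map_poly_comp evs (eq_map_poly evj) /tau /io map_poly_comp horner_map.
move=> /eqP; rewrite -(rmorph0 a) (inj_eq a_inj) => /eqP.
have uE : tau0 u = cst u + (fun n => (n == 1%N)%:R : X).
 apply: funext => n; rewrite -[RHS]/(psC u n + (n == 1%N)%:R) /t0 /psC.
 have e1 : ep 1 = 0 by apply: ep0; apply: rpred1.
 have ez m : iter m ep 0 = 0 by elim: m => //= m ->; apply: ep0; apply: rpred0.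
 case: n => [|[|n]]; rewrite ?fact0 ?divr1 ?addr0 //=.
 - by rewrite /t0 /= fact0 divr1.
 - by rewrite /t0 /= epu add0r (_ : 1`! = 1%N) // divr1.
 by rewrite /t0 iterSr iterSr epu e1 ez mul0r rmorph0.
pose z : series X := fun n => (n == 1%N)%:R.
have zX (f : series X) n : (z * f) n = if n is m.+1 then f m else 0.
 rewrite -[LHS]/(psmul z f n) /psmul; case: n => [|n]; first by rewrite big_ord1 mul0r.
 rewrite big_ord_recl mul0r add0r big_ord_recl /= mul1r subSS subn0 big1 ?addr0 // => l _.
 by rewrite mul0r.
pose q := p \Po ('X + u%:P).
have q0 : q != 0 by rewrite comp_poly2_eq0 ?size_XaddC.
have -> : (map_poly cst p).[tau0 u] = (map_poly cst q).[z].
 by rewrite uE; apply: horner_shift.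
have coefz (r : {poly X}) n : (map_poly cst r).[z] n = r`_n.
 elim/poly_ind: r n => [|r c IH] n; first by rewrite rmorph0 horner0 coef0.
 have -> : (map_poly cst (r * 'X + c%:P)).[z] = z * (map_poly cst r).[z] + cst c.
  exact: horner_map_MXaddC.
 rewrite -[LHS]/((z * (map_poly cst r).[z]) n + psC c n) zX coefD coefMX coefC /psC.
 by case: n => [|n] //=; rewrite IH.
move=> E0; case/eqP: q0; apply/polyP => n; rewrite -coefz E0 coef0 //.
Qed.

(** * Constants in strongly normal extensions *)

Definition dmorph_of (A B : diffFieldType) (f : {rmorphism A -> B}) (fd : {morph f : x / der x}) : A ~> B :=
 HB.pack_for (A ~> B) (f : A -> B) (GRing.RMorphism.on f) (isDiffMorphism.Build A B f fd).

Lemma der_isder (X : diffFieldType) : isder (@der X).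
Proof. by split; [exact: derD|exact: derM]. Qed.

Lemma der_0 (X : diffFieldType) : der (0 : X) = 0.
Proof. by apply: (addrI (der 0)); rewrite -derD !addr0. Qed.

(* A constant algebraic over a differential field has a minimal polynomial with constant coefficients. *)
Lemma const_alg (M : fieldType) (char0 : char_0 M) (F : sfield M) (D : M -> M) c :
 isder D -> (stab D F) -> alg F c -> D c = 0 ->
 exists p, [/\ p \over F, p != 0, root p c & forall i, D p`_i = 0].
Proof.
move=> dD DF ac Dc; have [T hT] := fullF M; have DT := isder_on T dD.
have [m [mF mm rm mmin]] := minpoly ac; exists m; split=> //; first exact: monic_neq0.
have mT : m \over T by apply/polyOverP=> i; apply: hT.
have E : (dpoly D m).[c] = 0.
 by have := der_horner DT mT (hT c); rewrite Dc mulr0 addr0 (rootP rm) (der0 DT).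
have dF : dpoly D m \over F by apply/polyOverP=> i; rewrite (coef_dpoly DT); apply/DF/polyOverP.
have /mmin dvd : dpoly D m \over F := dF.
move=> i; rewrite -(coef_dpoly DT); suff -> : dpoly D m = 0 by rewrite coef0.
apply/eqP; apply: contraT => d0; have /dvdp_leq := dvd (introT rootP E); move=> /(_ d0).
rewrite leqNgt => /negP[]; have m0 := monic_neq0 mm.
have sm : (0 < size m)%N by rewrite size_poly_gt0.
rewrite -(prednK sm) ltnS; apply/leq_sizeP => l; rewrite leq_eqVlt => /orP[/eqP <-|].
 by rewrite (coef_dpoly DT) -[_`_(size m).-1]/(lead_coef m) (monicP mm) (der1 DT).
by rewrite prednK // => h; rewrite (coef_dpoly DT) nth_default ?(der0 DT).
Qed.

(** Dividing p by X - r for a root r in C leaves coefficients in C, computed from the top down, and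
    c is a root of the quotient unless c = r. *)
Lemma rootless_alg (M : fieldType) (C : M -> Prop) :
 (forall x y, C x -> C y -> C (x + y)) -> (forall x y, C x -> C y -> C (x * y)) ->
 (forall p : {poly M}, (forall i, C p`_i) -> (1 < size p)%N -> exists2 c, C c & root p c) ->
 forall (p : {poly M}) c, (forall i, C p`_i) -> p != 0 -> root p c -> C c.
Proof.
move=> CD CM Ccl p c; have [n] := ubnP (size p); elim: n p => // n IH p sp Cp p0 rc.
have s1 : (1 < size p)%N by apply: (root_size_gt1 p0 rc).
have [r Cr /factor_theorem[q pE]] := Ccl p Cp s1.
have [->//|cr] := eqVneq c r.
have q0 : q != 0 by apply: contraNneq p0 => q0; rewrite pE q0 mul0r.
have sq : size p = (size q).+1 by rewrite pE size_Mmonic ?monicXsubC // size_XsubC addn2.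
apply: (IH q) => //.
- by rewrite -ltnS -sq.
- have qE i : q`_i = p`_i.+1 + q`_i.+1 * r.
  by rewrite pE mulrBr coefB coefMX coefMC /= subrK.
 move=> i; have [m] := ubnP (size q - i); elim: m i => // m IHm i hm.
 have [le|lt] := leqP (size q) i.
  rewrite nth_default //; have := Cp (size p); rewrite nth_default //.
 rewrite qE; apply: CD; first exact: Cp.
 by apply: CM => //; apply: IHm; rewrite ltnS in hm; lia.
- by move: rc; rewrite pE rootM root_XsubC (negPf cr) orbF.
Qed.

Section ConstField.
Variables (k X : diffFieldType) (i : k ~> X).
Hypothesis Ccl : constants_alg_closed k.

Lemma char0_dmorph : char_0 k -> char_0 X.
Proof. by move=> h p; rewrite (fmorph_pchar i). Qed.

Definition base_const (c : X) := exists2 a : k, der a = 0 & c = i a.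

Lemma base_const_der c : base_const c -> der c = 0.
Proof. by case=> a da ->; rewrite -dmorph_der da rmorph0. Qed.

Lemma base_const_lift (q : {poly X}) : (forall l, base_const q`_l) ->
 exists2 r : {poly k}, forall l, der r`_l = 0 & q = map_poly i r.
Proof.
move=> qC; have /choice[g gP] : forall l, exists a, der a = 0 /\ q`_l = i a by move=> l; have [a] := qC l; exists a.
exists (\poly_(l < size q) g l).
 by move=> l; rewrite coef_poly; case: ifP => _; [exact: (gP l).1|exact: der_0].
apply/polyP => l; rewrite coef_map coef_poly; case: ltnP => h /=; first exact: (gP l).2.
by rewrite rmorph0 nth_default.
Qed.

Lemma base_const_root (p : {poly X}) c : (forall l, base_const p`_l) -> p != 0 -> root p c -> base_const c.
Proof.
apply: rootless_alg.
- by move=> _ _ [a da ->] [b db ->]; exists (a + b); rewrite ?rmorphD // derD da db addr0.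
- by move=> _ _ [a da ->] [b db ->]; exists (a * b); rewrite ?rmorphM // derM da db mul0r mulr0 addr0.
move=> _ /base_const_lift[r r0 ->]; rewrite size_map_poly => sr; have [c' c'C c'r] := @Ccl r r0 sr.
by exists (i c'); [exists c'|rewrite fmorph_root].
Qed.

(** By [const_alg] the minimal polynomial of c has constant coefficients, and all its roots come
    from the algebraically closed constants of k. *)
Lemma base_const_alg (F : sfield X) c : char_0 X -> (stab der F) ->
 (forall x, x \in F -> der x = 0 -> base_const x) -> alg F c -> der c = 0 -> base_const c.
Proof.
move=> char0 dF FC ac dc; have [p [pF p0 rp dp]] := const_alg char0 (@der_isder X) dF ac dc.
by apply: (base_const_root _ p0 rp) => l; apply: FC => //; apply/polyOverP.
Qed.

Lemma no_newP : no_new_constants i <-> forall c, der c = 0 -> base_const c.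
Proof.
split=> [h c dc|h].
 by have : constants c := dc; rewrite h => -[a da <-]; exists a.
apply/seteqP; split=> c; first by move=> /h[a da ->]; exists a.
by case=> a da <-; apply: base_const_der; exists a.
Qed.

End ConstField.

Lemma comp_dmorph (A B C : diffFieldType) (f : A ~> B) (g : B ~> C) :
 exists h : A ~> C, forall x, h x = g (f x).
Proof.
have h : {morph (g \o f) : x / der x} by move=> x /=; rewrite !dmorph_der.
pose hh : A ~> C := dmorph_of h.
by exists hh.
Qed.

Lemma img_field (A B : fieldType) (f : {rmorphism A -> B}) :
 exists F : sfield B, forall x, x \in F <-> exists a, x = f a.
Proof.
apply: mkF; split; first by exists 1; rewrite rmorph1.
- by move=> _ _ [a ->] [b ->]; exists (a - b); rewrite rmorphB.
- by move=> _ _ [a ->] [b ->]; exists (a / b); rewrite fmorph_div.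
Qed.

Lemma img_diff_field (A B : diffFieldType) (f : A ~> B) :
 exists F : sfield B, (forall x, x \in F <-> exists a, x = f a) /\ stab der F.
Proof.
have [F FP] : exists F : sfield B, forall x, x \in F <-> exists a, x = f a := img_field f.
by exists F; split=> // _ /FP[a ->]; apply/FP; exists (der a); rewrite dmorph_der.
Qed.

Lemma img_alg (A B : fieldType) (f : {rmorphism A -> B}) (F : sfield B) x :
 (forall x, x \in F <-> exists a, x = f a) -> alg F x <-> exists2 p : {poly A}, p != 0 & (map_poly f p).[x] = 0.
Proof.
move=> FP; split=> [[p [pF p0 rp]]|[p p0 rp]].
 have /choice[g gP] : forall i, exists a, p`_i = f a by move=> i; apply/FP/polyOverP.
 have E : p = map_poly f (\poly_(i < size p) g i).
  apply/polyP => i; rewrite coef_map coef_poly; case: ltnP => h //=.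
  by rewrite rmorph0 nth_default.
 exists (\poly_(i < size p) g i); last by rewrite -E; apply/rootP.
 by apply: contraNneq p0 => h; rewrite E h map_poly0.
exists (map_poly f p); split; rewrite ?map_poly_eq0 //; last exact/rootP.
by apply/polyOverP => i; rewrite coef_map; apply/FP; exists p`_i.
Qed.

(** A renamed copy of M, to which D can be attached as its derivation. *)
Definition diffized (M : fieldType) (D : M -> M) of isder D : Type := M.
HB.instance Definition _ (M : fieldType) (D : M -> M) (dD : isder D) := GRing.Field.on (diffized dD).
HB.instance Definition _ (M : fieldType) (D : M -> M) (dD : isder D) :=
 Field_hasDerivation.Build (diffized dD) (dD.1 : {morph (D : diffized dD -> diffized dD) : x y / x + y})
 (dD.2 : forall x y : diffized dD, D (x * y) = D x * y + x * D y).

Lemma differential_embeddings (X : diffFieldType) (S : sfield X) (u : X) : char_0 X ->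
 (stab der S) -> ~ alg S u ->
 exists (M : diffFieldType) (j sg : X ~> M),
 [/\ acl M, char_0 M, forall x, x \in S -> sg x = j x &
   forall p : {poly X}, p != 0 -> (map_poly j p).[sg u] != 0].
Proof.
move=> char0 dS nau; have [M [dl [j [sg [acM cM [dd [dj ds]] agree gen]]]]] := generic_embeddings char0 dS nau.
pose MM : diffFieldType := diffized dd.
have hj : {morph (j : X -> MM) : x / der x} by move=> x; rewrite -dj.
have hs : {morph (sg : X -> MM) : x / der x} by move=> x; rewrite -ds.
pose jj : X ~> MM := dmorph_of hj.
pose ss : X ~> MM := dmorph_of hs.
by exists MM, jj, ss.
Qed.

(** A new constant would be transcendental over k, and a generic isomorphism would move it, whereas
    strong normality keeps constants fixed. *)
Lemma strongly_normal_no_new (k E : diffFieldType) (i : k ~> E) : char_0 k ->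
 constants_alg_closed k -> strongly_normal i -> no_new_constants i.
Proof.
move=> char0 Ccl [_ sn]; apply/no_newP => c dc; have [S [SP dS]] := img_diff_field i; have cE := char0_dmorph i char0.
apply: contrapT => nb; have nac : ~ alg S c.
 move=> ac; apply: nb; apply: (base_const_alg Ccl cE dS _ ac dc) => _ /SP[a ->]; rewrite -dmorph_der.
 by move=> /eqP; rewrite fmorph_eq0 => /eqP da; exists a.
have [M [j [sg [acM cM agree gen]]]] := differential_embeddings cE dS nac.
have [|_ _ /(_ c dc) E0] := sn M j sg; first by move=> x; apply: agree; apply/SP; exists x.
have := gen ('X - c%:P); rewrite -size_poly_eq0 size_XsubC => /(_ isT).
by rewrite rmorphB /= map_polyX map_polyC /= hornerD hornerN hornerX hornerC E0 subrr eqxx.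
Qed.

Lemma constants_closed_ext (k E : diffFieldType) (i : k ~> E) :
 constants_alg_closed k -> no_new_constants i -> constants_alg_closed E.
Proof.
move=> Ccl /no_newP nn q qC; have [l|r r0 ->] := @base_const_lift _ _ i q; first exact/nn/qC.
rewrite size_map_poly => sr; have [c c'C c'r] := @Ccl r r0 sr.
by exists (i c); [apply: (base_const_der (i := i)); exists c|rewrite fmorph_root].
Qed.

Lemma isn_no_new (k E : diffFieldType) (i : k ~> E) : char_0 k ->
 constants_alg_closed k -> iterated_strongly_normal i -> no_new_constants i.
Proof.
move=> char0 Ccl; elim=> {E i} [E i iT|F E i j ji _ IH sn jiE]; apply/no_newP => c dc.
 have [a _ aE] : range i c by rewrite iT.
 exists a; last by rewrite aE.
 by apply: (fmorph_inj i); rewrite rmorph0 -dc -aE -dmorph_der.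
have /no_newP/(_ c dc)[b db bE] := strongly_normal_no_new (char0_dmorph i char0) (constants_closed_ext Ccl IH) sn.
by have /no_newP/(_ b db)[a da aE] := IH; exists a; rewrite ?bE ?jiE ?aE.
Qed.

Lemma adjoin_min (M : fieldType) (A B : set M) (G : sfield M) x :
 (forall y, A y -> y \in G) -> (forall y, B y -> y \in G) -> adjoin A B x -> x \in G.
Proof.
move=> AG BG /(_ (fun y => is_true (y \in G))); apply; split; last by move=> y [/AG|/BG].
by split=> [|y z yG zG|y z yG zG] /=; [exact: rpred1|exact: rpredB|exact: rpred_div].
Qed.

Lemma adjoin_gen (M : fieldType) (A B : set M) x : A x \/ B x -> adjoin A B x.
Proof. by move=> h S [_]; apply. Qed.

Lemma eval2_map (k X M : fieldType) (i : {rmorphism k -> X}) (g : {rmorphism X -> M}) (h : {rmorphism k -> M})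
 (f : {poly {poly k}}) u v : (forall a, h a = g (i a)) -> eval2 h f (g u) (g v) = g (eval2 i f u v).
Proof.
move=> hE; rewrite /eval2.
have -> : map_poly (map_poly h) f = map_poly (map_poly g) (map_poly (map_poly i) f).
 by rewrite -map_poly_comp; apply: eq_map_poly => c /=; rewrite -map_poly_comp; apply: eq_map_poly.
have -> : (g v)%:P = map_poly g v%:P by rewrite map_polyC.
by rewrite horner_map horner_map.
Qed.

Lemma eval2_horner (k M : fieldType) (h : {rmorphism k -> M}) (f : {poly {poly k}}) u v :
 eval2 h f u v = (map_poly (fun c => (map_poly h c).[u]) f).[v].
Proof.
rewrite /eval2 -[LHS]/(horner_eval u _) -horner_map -map_poly_comp /= horner_evalE hornerC.
by congr (_.[v]); apply: eq_map_poly.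
Qed.

(** f(u, Z) is a nonzero polynomial in Z: its leading coefficient is a nonzero polynomial over k
    taken at the transcendental u. *)
Lemma eval2_alg (k M : fieldType) (h : {rmorphism k -> M}) (f : {poly {poly k}}) (F G : sfield M) u v :
 (forall x, x \in F <-> exists a, x = h a) -> ~ alg F u -> F \sub G -> u \in G ->
 (1 < size f)%N -> eval2 h f u v = 0 -> alg G v.
Proof.
move=> FP nu FG uG sf; rewrite eval2_horner => E; set q := map_poly _ f in E.
have qG : q \over G.
 apply/polyOverP => i; rewrite coef_map_id0 ?map_poly0 ?horner0 //.
 apply: rpred_horner => //; apply/polyOverP => l; rewrite coef_map; apply: FG.
 by apply/FP; exists (f`_i)`_l.
exists q; split=> //; last exact/rootP.
apply: contra_notN nu => /eqP q0; apply/(img_alg u FP); exists (lead_coef f).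
 by rewrite lead_coef_eq0 -size_poly_gt0 (ltn_trans _ sf).
have := congr1 (fun p : {poly M} => p`_(size f).-1) q0.
by rewrite coef0 coef_map_id0 ?map_poly0 ?horner0.
Qed.

Lemma constant_field (M : diffFieldType) : exists Cs : sfield M, forall c, c \in Cs <-> der c = 0.
Proof.
have [T hT] := fullF M; have DT := isder_on T (@der_isder M).
apply: mkF; split; first exact: (der1 DT).
- by move=> x y dx dy; rewrite (derB DT) ?hT // dx dy subr0.
- by move=> x y dx dy; rewrite derM dx (derV DT) ?hT // dy mul0r oppr0 mul0r mulr0 addr0.
Qed.

Lemma clear_denominators (M : fieldType) (R : sring M) (G : sfield M) w :
 (forall z, z \in G <-> is_frac R z) -> alg G w ->
 exists p, [/\ p \over R, p != 0 & p.[w] = 0].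
Proof.
move=> GP [p [pG p0 rp]].
have /choice[a /choice[b ab]] : forall i, exists a b, [/\ a \in R, b \in R, b != 0 & p`_i = a / b].
 by move=> i; apply/GP/polyOverP.
pose c := \prod_(i < size p) b i.
have c0 : c != 0 by apply/prodf_neq0 => i _; have [] := ab i.
exists (c *: p); split; last by rewrite hornerZ (rootP rp) mulr0.
 apply/polyOverP => i; rewrite coefZ; have [le|lt] := leqP (size p) i.
  by rewrite nth_default // mulr0 rpred0.
 rewrite /c (bigD1 (Ordinal lt)) //=; have [aR bR b0 ->] := ab i.
 rewrite mulrC mulrA divfK //; apply: rpredM => //.
 by apply: rpred_prod => l _; have [] := ab l.
by rewrite scaler_eq0 negb_or c0 p0.
Qed.

(** * The solution field of a strongly normal step *)

Section ConstCombinations.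
Variables (M : diffFieldType) (N0 N U : sfield M) (w : M).
Hypotheses (UN : forall x, x \in U -> x \in N) (wN : w \in N) (dN : stab der N)
 (NN0 : forall x, x \in N -> der x = 0 -> x \in N0) (N0U : forall x, x \in N0 -> x \in U)
 (nw : forall p : {poly M}, p \over U -> p != 0 -> p.[w] != 0).

(** Constants independent over N0 stay independent over N, so every A_l vanishes at w, which is
    transcendental over U; a dependence among the constants shortens the sum. *)
Lemma const_comb_eq0 r (c : 'I_r -> M) (A : 'I_r -> {poly M}) : (forall l, der (c l) = 0) ->
 (forall l, A l \over U) -> (\sum_l c l *: A l).[w] = 0 -> \sum_l c l *: A l = 0.
Proof.
elim: r c A => [|r IH] c A dc AU E; first by rewrite big_ord0.
have [ind|/not_indep[d [dN0 dE [m dm]]]] := pselect (indep N0 c).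
 have Aw l : (A l).[w] = 0.
  apply: (const_indep (Del := fun D => D = @der M) (N := N) _ _ _ _ ind (c := fun l => (A l).[w])).
  - by move=> _ ->; apply: der_isder.
  - by move=> _ ->.
  - by move=> y yN h; apply: NN0 => //; apply: h.
  - by move=> _ ->.
  - by move=> i; apply: rpred_horner => //; apply/polyOverP => n; apply: UN; apply/polyOverP.
  - by rewrite -[RHS]E horner_sum; apply: eq_bigr => i _; rewrite hornerZ mulrC.
 by rewrite big1 // => l _; apply/eqP; rewrite scaler_eq0; apply/orP; right; apply: contraTT (introT eqP (Aw l)) => /(nw (AU l)).
have cm : c m = - (\sum_(l < r) d (lift m l) / d m * c (lift m l)).
 have : d m * c m = - \sum_(l < r) d (lift m l) * c (lift m l).
  apply/eqP; rewrite -addr_eq0; apply/eqP; rewrite -[RHS]dE (bigD1_ord m) //.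
 move=> E1; rewrite -[LHS](mulKf dm) E1 mulrN mulr_sumr; congr (- _); apply: eq_bigr => l _; ring.
have pE : \sum_l c l *: A l = \sum_(l < r) c (lift m l) *: (A (lift m l) - (d (lift m l) / d m) *: A m).
 rewrite (bigD1_ord m) //= cm scaleNr scaler_suml addrC -sumrB; apply: eq_bigr => l _.
 by rewrite scalerBr scalerA [in RHS]mulrC.
rewrite pE; apply: IH; first by move=> l; apply: dc.
 by move=> l; rewrite rpredB // polyOverZ //; apply: N0U; apply: rpred_div.
by rewrite -pE.
Qed.

(** With denominators cleared, an equation of w is a combination of polynomials over U with constant
    coefficients. Used by contradiction: if w is algebraic over U and constants, U(w, w') has a
    constant outside U. *)
Lemma not_alg_over_constants (Cs G : sfield M) (R : sring M) : (forall c, c \in Cs <-> der c = 0) ->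
 (forall z, z \in R <-> tens U Cs z) ->
 (forall z, z \in G <-> is_frac R z) -> ~ alg G w.
Proof.
move=> CsP RP GP /(clear_denominators GP)[p [pR p0 pw]].
pose H (q : {poly M}) := exists S : seq (M * {poly M}), (forall s, s \in S -> der s.1 = 0 /\ s.2 \over U) /\
 q = \sum_(s <- S) s.1 *: s.2.
have H0 : H 0 by exists [::]; rewrite big_nil.
have HD q1 q2 : H q1 -> H q2 -> H (q1 + q2).
 move=> [S1 [h1 ->]] [S2 [h2 ->]]; exists (S1 ++ S2); rewrite big_cat; split=> // s.
 by rewrite mem_cat => /orP[/h1|/h2].
have [S [SP pE]] : H p.
 rewrite -[p]coefK poly_def; apply: big_ind => // i _.
 have /RP[r [a [b [aU bC ->]]]] : p`_i \in R by apply/polyOverP.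
 rewrite scaler_suml; apply: big_ind => // l _; exists [:: (b l, a l *: 'X^i)].
 rewrite big_seq1 /= scalerA mulrC; split=> // s; rewrite inE => /eqP -> /=.
 by split; [apply/CsP|rewrite polyOverZ // rpredX // polyOverX].
case/eqP: p0; move: pw; rewrite pE (big_nth (0, 0)) big_mkord; apply: const_comb_eq0 => l.
 by have [] := SP _ (mem_nth (0, 0) (ltn_ord l)).
by have [] := SP _ (mem_nth (0, 0) (ltn_ord l)).
Qed.
End ConstCombinations.

Lemma two_generated (M : diffFieldType) (F : sfield M) (w : M) : char_0 M -> relacl F ->
 (stab der F) -> w \notin F ->
 (forall G : sfield M, F \sub G -> w \in G -> alg G (der w)) ->
 exists K : sfield M, [/\ ffield F K, F \sub K, w \in K /\ der w \in K,
  forall G : sfield M, F \sub G -> w \in G -> der w \in G -> K \sub G &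
  stab der K].
Proof.
move=> char0 hF dF wF aw; have [F1 F1P] := adjF F w; have [K KP] := adjF F1 (der w).
have FF1 : F \sub F1 by move=> x xF; apply/F1P/adj_id.
have wF1 : w \in F1 by apply/F1P/adj_gen.
have F1K : F1 \sub K by move=> x xF; apply/KP/adj_id.
have dwK : der w \in K by apply/KP/adj_gen.
have FK : F \sub K by move=> x /FF1/F1K.
have a1 : alg F1 (der w) by apply: aw.
have [T hT] := fullF M; have DT := isder_on T (@der_isder M).
have sT (A : sfield M) : A \sub T by move=> x _; apply: hT.
exists K; split=> //; first exact: (ffield_two hF wF F1P KP a1).
- by split=> //; apply: F1K.
- by move=> G FG wG dwG x /KP; apply: adj_min => // y /F1P; apply: adj_min.
have dF1 x : x \in F1 -> der x \in K.
 move=> /F1P; apply: (der_adj_in DT (sT F) (hT w) FK (F1K _ wF1) dwK) => z zF.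
 exact: FK (dF _ zF).
move=> x /KP; apply: (der_adj_in DT (sT F1) (hT _) F1K dwK _ dF1).
exact: (der_stable char0 a1 DT (sT F1) (hT _) F1K dwK dF1).
Qed.

Lemma alg_closure_relacl (M : fieldType) (F G : sfield M) : (forall x, x \in G <-> alg F x) -> relacl G.
Proof. by move=> GP y ay; apply/GP; apply: (alg_trans (G := G)) ay => z /GP. Qed.

Lemma alg_closure_stable (M : diffFieldType) (F G : sfield M) : char_0 M ->
 (forall x, x \in G <-> alg F x) -> (stab der F) -> stab der G.
Proof.
move=> char0 GP dF x xG; have [T hT] := fullF M; have DT := isder_on T (@der_isder M).
have FG y : y \in F -> y \in G by move=> yF; apply/GP/alg_id.
apply: (der_stable char0 (iffLR (GP x) xG) DT _ (hT _) FG xG) => y; first by move=> _; apply: hT.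
by move=> /dF/FG.
Qed.

(** F is the image of k in M, k' its algebraic closure in M, and K = k'(w, w') for a nonalgebraic
    solution w, all of whose constants come from k. *)
Definition solution_field (k : diffFieldType) (f : {poly {poly k}}) (M : diffFieldType) (j : k ~> M)
  (w : M) (F k' K : sfield M) : Prop :=
 [/\ acl M /\ char_0 M,
   (forall x, x \in F <-> exists a, x = j a) /\ (forall x, x \in k' <-> alg F x),
   [/\ eval2 j f w (der w) = 0, w \notin k', w \in K & der w \in K],
   [/\ k' \sub K, ffield k' K &
    forall G : sfield M, k' \sub G -> w \in G -> der w \in G -> K \sub G] &
   forall y, y \in K -> der y = 0 -> base_const j y].

Section StronglyNormalStep.
Variables (k F E X : diffFieldType) (i : F ~> E) (e : E ~> X) (ik : k ~> X)
 (f : {poly {poly k}}) (S T : sfield X) (u : X).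
Hypotheses (char0 : char_0 k) (Ccl : constants_alg_closed k) (sf : (1 < size f)%N)
 (sn : strongly_normal i) (SP : forall x, x \in S <-> exists a, x = e (i a)) (TP : forall x, x \in T <-> exists a, x = e a)
 (ikS : forall a, ik a \in S) (nn : forall c, der c = 0 -> base_const ik c)
 (au : alg T u) (nu : ~ alg S u) (fu : eval2 ik f u (der u) = 0).

(** By strong normality [sg] maps E into the field G generated by U and the constants of M. As w =
    sg u is algebraic over the image of E, [not_alg_over_constants] yields a constant of UK outside
    U, the input of [new_constant_case]. When X is E, all of UK lies in G, the input of
    [strongly_normal_case]. *)
Theorem strongly_normal_step : exists (M : diffFieldType) (j : k ~> M) (w : M) (F0 k' K : sfield M),
 [/\ solution_field f j w F0 k' K,
   exists K0 : sfield M, [/\ k' \sub K0, K0 \sub K, ffield k' K0,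
    K0 \nsub k' & riccati_in k' K0 der \/ weierstrass_in k' K0 der] &
   (forall x, exists a, x = e a) -> [/\ has_vector_field k' K,
    forall O, place k' O -> stab_in der K O &
    riccati_in k' K der \/ weierstrass_in k' K der]].
Proof.
have cX := char0_dmorph ik char0.
have dS x : x \in S -> der x \in S by move=> /SP[a ->]; apply/SP; exists (der a); rewrite !dmorph_der.
have [M [J [sg [acM cM agree gen]]]] := differential_embeddings cX dS nu.
have [jk jkE] := comp_dmorph ik J.
have jkE' a : jk a = sg (ik a) by rewrite jkE agree.
have [F0 [F0P dF0]] := img_diff_field jk.
have [JX [JXP dJX]] := img_diff_field J.
have [SX [SXP dSX]] := img_diff_field sg.
have [k' k'P] := alg_closure F0; have [U UP] := alg_closure JX.
pose w := sg u.
have F0J : F0 \sub JX by move=> _ /F0P[a ->]; apply/JXP; exists (ik a); rewrite jkE.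
have F0S : F0 \sub SX by move=> _ /F0P[a ->]; apply/SXP; exists (ik a); rewrite jkE'.
have kU : k' \sub U by move=> y /k'P/(alg_subset F0J)/UP.
have wU : w \notin U.
 apply/negP => /UP/(img_alg w JXP)[p p0 E0]; have := gen p p0; rewrite -/w.
 by rewrite -[map_poly _ _]/(map_poly J p) E0 eqxx.
have wk : w \notin k' by apply: contra wU => /kU.
have dw : der w = sg (der u) by rewrite /w dmorph_der.
have fw : eval2 jk f w (der w) = 0 by rewrite dw (eval2_map (i := ik) (g := sg)) // fu rmorph0.
have aw (G : sfield M) : F0 \sub G -> w \in G -> alg G (der w).
 move=> FG wG; apply: (eval2_alg F0P _ FG wG sf fw) => /k'P; exact/negP.
have hk : relacl k' := alg_closure_relacl k'P.
have hU : relacl U := alg_closure_relacl UP.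
have Fk : F0 \sub k' by move=> x xF; apply/k'P/alg_id.
have dk := alg_closure_stable cM k'P dF0.
have dU := alg_closure_stable cM UP dJX.
have [|K [ffK kK [wK dwK] Kmin dK]] := two_generated cM hk dk wk.
 by move=> G kG; apply: aw => x /Fk/kG.
have [|UK [ffUK UUK [wUK dwUK] UKmin dUK]] := two_generated cM hU dU wU.
 by move=> G UG; apply: aw => x /Fk/kU/UG.
have KUK : K \sub UK by apply: Kmin => // x /kU/UUK.
have constJ c : c \in U -> der c = 0 -> base_const jk c.
 move=> /UP ac dc; apply: (base_const_alg Ccl cM dJX _ ac dc) => _ /JXP[a ->]; rewrite -dmorph_der.
 move=> /eqP; rewrite fmorph_eq0 => /eqP/nn[b db ->]; by exists b; rewrite ?jkE.
(* K is built on w = sg u, so it lies in the algebraic closure of the image of [sg], whose constants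
   come from k. *)
have [A AP] := alg_closure SX.
have KA : K \sub A.
 apply: Kmin; first by move=> x /k'P/(alg_subset F0S)/AP.
  by apply/AP/alg_id/SXP; exists u.
 by apply/AP/alg_id/SXP; exists (der u).
have constK c : c \in K -> der c = 0 -> base_const jk c.
 move=> /KA/AP ac dc; apply: (base_const_alg Ccl cM dSX _ ac dc) => _ /SXP[a ->]; rewrite -dmorph_der.
 move=> /eqP; rewrite fmorph_eq0 => /eqP/nn[b db ->]; by exists b; rewrite ?jkE'.
have bk c : base_const jk c -> c \in k' by move=> [a _ ->]; apply: Fk; apply/F0P; exists a.
have cK y : y \in K -> der y = 0 -> y \in k' by move=> yK dy; apply/bk/constK.
have cU y : y \in U -> der y = 0 -> y \in k' by move=> yK dy; apply/bk/constJ.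
have UKP y : y \in UK -> exists a b, [/\ tens U K a, tens U K b, b != 0 & y = a / b].
 have [R RP] := tens_ring U K; have [G GP] := frac_field R.
 have RG z : z \in R -> z \in G by move=> zR; apply/GP; exists z, 1; rewrite rpred1 oner_eq0 divr1.
 have {}UKmin : UK \sub G.
  by apply: UKmin => [x xU||]; apply/RG/RP; [exact: tens_l|exact: tens_r|exact: tens_r].
 by move=> /UKmin/GP[a [b [/RP aR /RP bR b0 ->]]]; exists a, b.
have [Cs CsP] := constant_field M.
have [R RP] := tens_ring U Cs; have [G GP] := frac_field R.
have RG z : z \in R -> z \in G by move=> zR; apply/GP; exists z, 1; rewrite rpred1 oner_eq0 divr1.
have UG z : z \in U -> z \in G by move=> zU; apply/RG/RP/tens_l.
have CG z : z \in Cs -> z \in G by move=> zU; apply/RG/RP/tens_r.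
have JU x : J x \in U by apply/UP/alg_id/JXP; exists x.
have sgG x : sg (e x) \in G.
 have [Je JeE] := comp_dmorph e J; have [se seE] := comp_dmorph e sg.
 have [|EE _ _] := sn.2 M Je se.
  by move=> a; rewrite JeE seE agree //; apply/SP; exists a.
 have : adjoin (range Je) (range se) (sg (e x)) by apply: adjoin_gen; right; exists x; rewrite ?seE.
 rewrite EE; apply: adjoin_min => y; first by move=> [a _ <-]; rewrite JeE; apply: UG.
 by move=> [_ dy]; apply: CG; apply/CsP.
have [N0 N0P] : exists N0 : sfield M, forall y, y \in N0 <-> y \in UK /\ der y = 0.
 apply: mkF; split; first by rewrite rpred1; split=> //; apply/CsP; apply: rpred1.
 - by move=> x y [xU /CsP xC] [yU /CsP yC]; split; [exact: rpredB|apply/CsP; exact: rpredB].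
 - by move=> x y [xU /CsP xC] [yU /CsP yC]; split; [exact: rpred_div|apply/CsP; exact: rpred_div].
exists M, jk, w, F0, k', K; split; first by split.
- have [x [xUK xU dx]] : exists x, [/\ x \in UK, x \notin U & der x = 0].
  apply: contrapT => none; have N0U y : y \in N0 -> y \in U.
   by move=> /N0P[yUK dy]; apply/negPn/negP => yU; apply: none; exists y.
  have NN0 y : y \in UK -> der y = 0 -> y \in N0 by move=> *; apply/N0P.
  have nw (p : {poly M}) : p \over U -> p != 0 -> p.[w] != 0.
   by move=> pU p0; apply: contra wU => /eqP/rootP rp; apply: hU; exists p.
  have nG := not_alg_over_constants UUK wUK dUK NN0 N0U nw CsP RP GP.
  apply: nG; have /(img_alg u TP)[p p0 pu] := au.
  have [se seE] := comp_dmorph e sg.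
  exists (map_poly se p); rewrite map_poly_eq0 p0; split=> //.
   by apply/polyOverP => l; rewrite coef_map -[X in X \in _]/(se p`_l) seE sgG.
  apply/rootP; rewrite (eq_map_poly seE) map_poly_comp -[w]/(sg u) horner_map.
  by rewrite -[map_poly _ p]/(map_poly e p) pu rmorph0.
 exact: (new_constant_case cM acM hk hU kU kK ffK ffUK wK wU UUK KUK UKP (@der_isder M) dk dU dK cK cU xUK xU dx).
move=> esurj; have sG x : sg x \in G by have [a ->] := esurj x.
have UKG : UK \sub G by apply: UKmin => //; [exact: sG|rewrite dw; exact: sG].
apply: (strongly_normal_case cM acM hk hU kU kK ffK ffUK wK wU UUK KUK UKP (@der_isder M) dk dU dK cK cU N0P) => y yUK.
have [R1 R1P] := tens_ring U N0; have [G1 G1P] := frac_field R1.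
have RG1 z : z \in R1 -> z \in G1 by move=> zR; apply/G1P; exists z, 1; rewrite rpred1 oner_eq0 divr1.
suff /G1P[a [b [/R1P aR /R1P bR b0 ->]]] : y \in G1 by exists a, b.
have UG1 z : z \in U -> z \in G1 by move=> zU; apply/RG1/R1P/tens_l.
have NG1 : N0 \sub G1 by move=> z zN; apply/RG1/R1P/tens_r.
have N0UK z : z \in N0 -> z \in UK by move=> /N0P[].
have R1UK z : z \in R1 -> z \in UK.
 move=> /R1P[r [a [b [aU bN ->]]]]; apply: rpred_sum => l _; apply: rpredM; first exact: UUK.
 exact: N0UK.
have GUK : G1 \sub UK.
 by move=> z /G1P[a [b [aR bR _ ->]]]; apply: rpred_div; apply: R1UK.
(* Constants independent over N0 stay independent over UK; so membership in G, which uses constants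
   of M, descends to the constants N0 of UK. *)
have ind r (b : 'I_r -> M) : (forall l, b l \in Cs) -> indep N0 b -> indep UK b.
 move=> bC; apply: (const_indep (Del := fun D => D = @der M)).
 - by move=> _ ->; apply: der_isder.
 - by move=> _ ->.
 - by move=> z zN h; apply/N0P; split=> //; apply: h.
 - by move=> _ -> l; apply/CsP.
apply: (indep_descend NG1 GUK ind yUK).
have /GP[a [b [/RP[r [p [q [pU qC aE]]]] /RP[r' [p' [q' [pU' qC' bE]]]] b0 yE]]] := UKG _ yUK.
exists a, b; split=> //; first by exists r, p, q; split=> // l; apply: UG1.
by exists r', p', q'; split=> // l; apply: UG1.
Qed.
End StronglyNormalStep.

(** Induction down the tower with the field X of the solution kept fixed: one descends while u is
    still algebraic over the lower field, and the first failure is the step to use. *)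
Lemma iterated_solution_field (k E : diffFieldType) (i : k ~> E) (f : {poly {poly k}}) : char_0 k ->
 constants_alg_closed k -> (1 < size f)%N -> iterated_strongly_normal i ->
 forall (X : diffFieldType) (e : E ~> X) (ik : k ~> X) (u : X) (T S : sfield X),
 (forall a, ik a = e (i a)) -> (forall x, x \in T <-> exists a, x = e a) -> (forall x, x \in S <-> exists a, x = ik a) ->
 (forall c, der c = 0 -> base_const ik c) -> alg T u -> ~ alg S u -> eval2 ik f u (der u) = 0 ->
 exists (M : diffFieldType) (j : k ~> M) (w : M) (F0 k' K : sfield M),
 solution_field f j w F0 k' K /\
 exists K0 : sfield M, [/\ k' \sub K0, K0 \sub K, ffield k' K0,
    K0 \nsub k' & riccati_in k' K0 der \/ weierstrass_in k' K0 der].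
Proof.
move=> char0 Ccl sf; elim=> {E i} [E i iT|F E i j ji _ IH sn jiE] X e ik u T S ikE TP SP nn au nu fu.
 case: nu; apply: (alg_subset _ au) => _ /TP[a ->]; apply/SP.
 have : range i a by rewrite iT.
 by move=> [b _ <-]; exists b; rewrite ikE.
have [ej ejE] := comp_dmorph j e; have [T' [T'P _]] := img_diff_field ej.
have [au'|nu'] := pselect (alg T' u).
 by apply: (IH X ej ik u T' S) => // a; rewrite ikE jiE ejE.
have T'P' x : x \in T' <-> exists a, x = e (j a).
 by split=> [/T'P[a ->]|[a ->]]; [exists a|apply/T'P; exists a]; rewrite ejE.
have ikT a : ik a \in T' by apply/T'P'; exists (i a); rewrite ikE jiE.
have [M [jm [w [F0 [k' [K [sol res _]]]]]]] := strongly_normal_step char0 Ccl sf sn T'P' TP ikT nn au nu' fu.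
by exists M, jm, w, F0, k', K.
Qed.

(** * Riccati elements exclude genus one, Weierstrass elements genus zero *)

Section PlacePolynomials.
Variables (M : fieldType) (F : sfield M) (O : sring M).
Hypotheses (vO : valring O) (FO : F \sub O).

Lemma poly_residue (p : {poly M}) x b : p \over F -> x \in O -> b \in F -> x - b \in mx O ->
 p.[x] - p.[b] \in mx O.
Proof.
move=> pF xO bF xb; rewrite !horner_coef -sumrB; apply: (mx_sum vO) => i _.
have pO : p`_i \in O by apply: FO; apply/polyOverP.
rewrite -mulrBr subrXX; apply: mx_mulr => //; apply: mx_mull => //.
by apply: rpred_sum => l _; apply: rpredM; rewrite rpredX // FO.
Qed.

Lemma poly_lead_residue (p : {poly M}) x n : p \over F -> x != 0 -> x^-1 \in mx O -> (size p <= n.+1)%N ->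
 p.[x] / x ^+ n - p`_n \in mx O.
Proof.
move=> pF x0 xm sp; rewrite (horner_coef_wide _ sp) big_ord_recr /= mulrDl mulfK ?expf_neq0 // addrK.
rewrite mulr_suml; apply: (mx_sum vO) => i _.
have -> : p`_i * x ^+ i / x ^+ n = p`_i * (x^-1 * x^-1 ^+ (n - i).-1).
 have := ltn_ord i => lt; rewrite -mulrA; congr (_ * _); rewrite -exprS prednK ?subn_gt0 //.
 have -> : x ^+ n = x ^+ i * x ^+ (n - i) by rewrite -exprD subnKC // ltnW.
 by rewrite invfM exprVn mulrA mulfV ?mul1r // expf_neq0.
apply: mx_mulr; first by apply: FO; apply/polyOverP.
by apply: mx_mull => //; rewrite rpredX // mx_sub.
Qed.

Lemma mxF0 x : x \in F -> x \in mx O -> x = 0.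
Proof. by move=> xF xm; apply/eqP; apply: contraTT xF => /(mx_notF FO xm). Qed.

Lemma unit_div x : x \in O -> x \notin mx O -> forall y, y \in O -> x * y \in mx O -> y \in mx O.
Proof. by move=> xO xm y yO /(mx_prime xO yO)[] // h; case/negP: xm. Qed.
End PlacePolynomials.

Lemma degree_cases m : (3 < m <= 5)%N -> [/\ (0 < m)%N & exists2 n, m = n.+1 & n = 3%N \/ n = 4%N].
Proof. by case: m => [|[|[|[|[|[|]]]]]] // _; split=> //; [exists 3%N|exists 4%N] => //; [left|right]. Qed.

Section VectorField.
Variables (M : fieldType).
Hypotheses (char0 : char_0 M) (aclM : acl M).
Variables (F L : sfield M) (v : M -> M).
Hypotheses (ffL : ffield F L) (dv : isder v) (vL : stab v L)
 (v0 : kills v F).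

Let FL : F \sub L. Proof. by have [] := ffL. Qed.
Let natF n : n%:R \in F. Proof. exact: rpred_nat. Qed.
Let nat0 n : (n.+1%:R == 0 :> M) = false. Proof. by rewrite (natr_eq0 char0). Qed.
Let T := projT1 (cid (fullF M)).
Let hT x : x \in T. Proof. exact: (projT2 (cid (fullF M)) x). Qed.
Let DT : derOn T v. Proof. by case: dv => a b; split=> *; [apply: a|apply: b]. Qed.
Let DL : derOn L v. Proof. by case: dv => a b; split=> *; [apply: a|apply: b]. Qed.

Section Nowhere.
Hypotheses (vst : forall O, place F O -> stab_in v L O).
Variables (x s c : M) (Q : {poly M}) (rs : seq M).
Hypotheses (qm : quadmodel F L x s Q rs) (cF : c \in F) (c0 : c != 0) (vx : v x = c * s).

(** A nonzero regular vector field in genus one has no zeros. Explicit parameters: x - a at an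
    ordinary finite point, s at a branch point, 1/x at infinity in degree 4, x/s in degree 3. *)
Lemma quad_nowhere_zero O : place F O -> (L \nsub O) ->
 exists p, [/\ p \in L, p \in mx O & v p \notin mx O].
Proof.
move=> [vO FO] nLO; have [[xL xF sL QF s2] [sQ QE urs rsF] _ _ _] := qm.
have [sQ0 [n nE nn]] := degree_cases sQ.
have cO := FO _ cF; have cm : c \notin mx O by apply: contra_neqN c0 => /(mxF0 FO cF).
have n2 : 2%:R != 0 :> M by rewrite nat0.
have s0 : s != 0.
 apply: contraNneq (transcF ffL xF QF _) => [h|]; last by rewrite -size_poly_gt0.
 by rewrite -s2 h expr2 mulr0.
have vs : v s = c * Q^`().[x] / 2%:R.
 have E : 2%:R * s * v s = Q^`().[x] * (c * s).
  by rewrite -vx -(v_poly ffL DL v0 QF xL) -s2 (derX DT) ?hT // expr1.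
 apply: (mulfI s0); apply: (mulfI n2); rewrite !mulrA E; field.
 by rewrite n2.
have x0 : x != 0 by apply: contraNneq xF => ->; rewrite rpred0.
have [xO|xO] := boolP (x \in O).
 have sO : s \in O.
  by apply: (O_exp vO (n := 2)) => //; rewrite s2 rpred_horner //; apply/polyOverP => i; apply/FO/polyOverP.
 have [a aF xa] := residue aclM ffL vO FO nLO xL xO.
 have [sm|sm] := boolP (s \in mx O); last first.
  exists (x - a); split=> //; first by rewrite rpredB // FL.
  by rewrite (derB DT) ?hT // (v0 aF) subr0 vx; apply: mx_unitM.
 exists s; split=> //; rewrite vs; apply/negP => h.
 have Qa : Q.[a] = 0.
  apply: (mxF0 FO); first exact: rpred_horner.
  rewrite -[Q.[a]](subKr Q.[x]); apply: (mx_subr vO); last exact: (poly_residue vO FO).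
  by rewrite -s2 expr2; apply: mx_mull.
 have ars : a \in rs.
  have lQ : lead_coef Q != 0 by rewrite lead_coef_eq0 -size_poly_gt0.
  have : root (lead_coef Q *: \prod_(r <- rs) ('X - r%:P)) a by rewrite -QE; apply/rootP.
  by rewrite (rootZ _ _ lQ) root_prod_XsubC.
 have [_ /negP[]] := quad_deriv qm ars.
 have Q'F : Q^`() \over F by apply: polyOver_deriv.
 apply/eqP/(mxF0 FO); first exact: rpred_horner.
 have Q'm : Q^`().[x] \in mx O.
  apply: (unit_div cO cm); first by rewrite rpred_horner //; apply/polyOverP => i; apply/FO/polyOverP.
  have -> : c * Q^`().[x] = 2%:R * (c * Q^`().[x] / 2%:R) by field.
  by apply: mx_mulr => //; rewrite rpred_nat.
 by rewrite -[_.[a]](subKr Q^`().[x]); apply: (mx_subr vO) => //; apply: (poly_residue vO FO).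
have ym := notO_mx vO xO; have yO := mx_sub ym.
have Q0 : Q.[x] != 0 by rewrite -s2 expf_neq0.
have lF : Q`_n \in F by apply/polyOverP.
have l0 : Q`_n != 0 by rewrite -[n]/(n.+1.-1) -nE -[_`__]/(lead_coef Q) lead_coef_eq0 -size_poly_gt0.
have lm : Q`_n \notin mx O by apply: contra_neqN l0 => /(mxF0 FO lF).
have Ql : Q.[x] / x ^+ n - Q`_n \in mx O by apply: (poly_lead_residue vO FO); rewrite ?nE.
have QO : Q.[x] / x ^+ n \in O by rewrite -[_ / _](subrK Q`_n) rpredD ?(mx_sub Ql) ?FO.
have Qm : Q.[x] / x ^+ n \notin mx O.
 by apply: contra lm => h; rewrite -[Q`_n](subKr (Q.[x] / x ^+ n)); apply: (mx_subr vO).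
case: nn => nn; subst n; last first.
 exists x^-1; rewrite rpredV; split=> //; rewrite (derV DT) ?hT // vx.
 have E : (s / x ^+ 2) ^+ 2 = Q.[x] / x ^+ 4 by rewrite -s2; field.
 have hO : s / x ^+ 2 \in O by apply: (O_exp vO (n := 2)); rewrite // E.
 have hm : s / x ^+ 2 \notin mx O by apply: contra Qm => h; rewrite -E expr2; apply: mx_mull.
 by rewrite mulNr mx_oppE -mulrA; apply: mx_unitM.
have E : (x / s) ^+ 2 = x^-1 / (Q.[x] / x ^+ 3) by rewrite -s2; field; rewrite s0 x0.
have [_ Qi] := unitO QO Qm.
have h2 : (x / s) ^+ 2 \in mx O by rewrite E; apply: mx_mull.
have pO : x / s \in O by apply: (O_exp vO (n := 2)) => //; apply: mx_sub.
have pm := mx_exp pO h2; have pL : x / s \in L by rewrite rpred_div.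
exists (x / s); split=> //; apply/negP => hm.
have Q'F : Q^`() \over F by apply: polyOver_deriv.
have Q'l : Q^`().[x] / x ^+ 2 - Q^`()`_2 \in mx O.
 by apply: (poly_lead_residue vO FO) => //; rewrite -ltnS -nE; apply: lt_size_deriv; rewrite -size_poly_gt0 nE.
rewrite coef_deriv in Q'l; have [mD mN] := (mx_subr vO, mx_mulr (O := O)).
have h1 : c / 2%:R * (Q^`().[x] / x ^+ 2 - Q`_3 *+ 3) \in mx O.
 by apply: mx_mulr => //; apply: FO; apply: rpred_div.
have h3 : c * (Q.[x] / x ^+ 3 - Q`_3) \in mx O by apply: mx_mulr.
have h4 : v (x / s) * (Q.[x] / x ^+ 3) \in mx O by apply: mx_mull.
have E4 : v (x / s) * (Q.[x] / x ^+ 3) = c * (Q.[x] / x ^+ 3) - c / 2%:R * (Q^`().[x] / x ^+ 2).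
 rewrite (derQ DT) ?hT // vs vx -s2; field; by rewrite n2 x0 s0.
have h5 : c / 2%:R * Q`_3 \in mx O.
 have -> : c / 2%:R * Q`_3 = (c * (Q.[x] / x ^+ 3 - Q`_3) - c / 2%:R * (Q^`().[x] / x ^+ 2 - Q`_3 *+ 3))
   - (c * (Q.[x] / x ^+ 3) - c / 2%:R * (Q^`().[x] / x ^+ 2)) by field; rewrite ?n2 ?x0.
 by rewrite -E4; apply: (mx_subr vO) => //; apply: (mx_subr vO).
have : c / 2%:R * Q`_3 == 0 by apply/eqP/(mxF0 FO) => //; rewrite rpredM // rpred_div.
by rewrite !mulf_eq0 invr_eq0 (negPf c0) (negPf n2) (negPf l0).
Qed.

(* t/v(t) would be a regular function vanishing at the zeros of t. *)
Lemma quad_no_riccati (D : M -> M) t a0 a1 a2 : isder D -> (stab D L) ->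
 (stab D F) ->
 (forall O, place F O -> stab_in D L O) -> t \in L -> t \notin F ->
 a0 \in F -> a1 \in F -> a2 \in F -> D t = a2 * t ^+ 2 + a1 * t + a0 ->
 (forall b, b \in F -> D b = a2 * b ^+ 2 + a1 * b + a0 -> b = 0) -> False.
Proof.
move=> dD DDL DF Dst tL tF a0F a1F a2F Dt sol.
have t0 : t != 0 by apply: contraNneq tF => ->; rewrite rpred0.
have DTD : derOn T D by case: dD => a b; split=> *; [apply: a|apply: b].
have vnz : exists2 y, y \in L & v y != 0.
 have [[xL xF sL QF s2] [/degree_cases[sQ0 _] _ _ _] _ _ _] := qm.
 exists x => //; rewrite vx mulf_neq0 //; apply: contraNneq (transcF ffL xF QF _) => [h|].
  by rewrite -s2 h expr2 mulr0.
 by rewrite -size_poly_gt0.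
have vt : v t != 0 := v_neq0 char0 ffL DL v0 vnz tL tF.
have zL : t / v t \in L by rewrite rpred_div // vL.
have main O : place F O -> (L \nsub O) ->
  t / v t \in O /\ (t \in mx O -> t / v t \in mx O).
 move=> pl nLO; have [vO FO] := pl; have [p [pL pm vpm]] := quad_nowhere_zero pl nLO.
 have pO := mx_sub pm; have vpO : v p \in O by apply: vst pO.
 have p0 : p != 0 by apply: contraNneq vpm => ->; rewrite (der0 DT) mx0.
 have [N [N0 Nu _ _]] := unif aclM ffL vO FO pL pm p0.
 (* v b / b has a pole: N p v b / b = r v p + p v u / u is a unit, because v p is one. *)
 have dlog b : b \in L -> b != 0 -> v b != 0 -> b \in mx O -> b / v b \in mx O.
  move=> bL b0 vb bm; have [r [u [E /andP[uO um] uL /(_ bm) r0]]] := Nu b bL b0 (mx_sub bm).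
  have uu : un O u by rewrite /un uO.
  have ld := logder DL pL p0 bL b0 uu uL E.
  have [u0 uV] := unitO uO um.
  have wO : r%:R * v p + p * (v u / u) \in O.
   by rewrite rpredD ?rpredM ?rpred_nat //; apply: vst.
  have wm : r%:R * v p + p * (v u / u) \notin mx O.
   apply/negP => h; have : r%:R * v p \in mx O.
    rewrite -[_ * _](addrK (p * (v u / u))); apply: (mx_subr vO) => //.
    by apply: mx_mull => //; rewrite rpredM //; apply: vst.
   apply/negP; apply: mx_unitM => //; first by rewrite rpred_nat.
   by apply/negP => /(mxF0 FO (natF r))/eqP; rewrite (natr_eq0 char0) (gtn_eqF r0).
  have [w0 wV] := unitO wO wm.
  have N1 : N%:R != 0 :> M by rewrite (natr_eq0 char0) (gtn_eqF N0).
  have -> : b / v b = N%:R * p * (r%:R * v p + p * (v u / u))^-1.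
   have -> : r%:R * v p + p * (v u / u) = p * (N%:R * (v b / b)) by rewrite ld; field; rewrite u0 p0.
   by field; rewrite p0 N1 b0 vb.
  by apply: mx_mull => //; apply: mx_mulr; rewrite // rpred_nat.
 (* p is a multiple of such a q, so if v q vanished at O, v p would vanish too. *)
 have ramified q : q \in L -> q \in mx O -> q != 0 -> (forall b, b \in L -> b \in mx O -> b / q \in O) -> v q \notin mx O.
  move=> qL qm' q0 qmin; apply: contra vpm => h; have bO := qmin p pL pm.
  have -> : p = q * (p / q) by field.
  rewrite dv.2; apply: (mx_add vO); first exact: mx_mull.
  by apply: mx_mull => //; apply: vst; rewrite ?rpred_div.
 have [tO|tO] := boolP (t \in O); last first.
  have tm := notO_mx vO tO; have E : v t^-1 = - v t / t ^+ 2 by rewrite (derV DT).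
  have h : t^-1 / v t^-1 \in mx O.
   apply: dlog; rewrite ?rpredV ?invr_eq0 //.
   by rewrite E mulf_neq0 ?oppr_eq0 // invr_eq0 expf_neq0.
  have -> : t / v t = - (t^-1 / v t^-1).
   rewrite E; move: (v t) vt t0 => d d0 h0; by field; rewrite ?oppr_eq0 ?d0 ?h0.
  have h' : - (t^-1 / v t^-1) \in mx O by rewrite mx_oppE.
  by split=> //; apply: mx_sub.
 have [b bF tb] := residue aclM ffL vO FO nLO tL tO; have bO := FO _ bF.
 (* If the residue b solves the equation, then b = 0 and t vanishes at O. If not, D (t - b) is a
    unit, so t - b is a uniformizer and v t = v (t - b) is a unit. *)
 have [r0|r0] := eqVneq (a2 * b ^+ 2 + a1 * b + a0 - D b) 0.
  have b0 : b = 0 by apply: sol => //; apply/eqP; rewrite eq_sym -subr_eq0 r0.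
  have tm : t \in mx O by rewrite -[t]subr0 -b0.
  by have h := dlog t tL t0 vt tm; split=> //; apply: mx_sub.
 have rF : a2 * b ^+ 2 + a1 * b + a0 - D b \in F.
  by rewrite rpredB ?DF // !rpredD // rpredM // rpredX.
 have qL : t - b \in L by rewrite rpredB // FL.
 have Dq : D (t - b) - (a2 * b ^+ 2 + a1 * b + a0 - D b) \in mx O.
  have -> : D (t - b) - (a2 * b ^+ 2 + a1 * b + a0 - D b) = (t - b) * (a2 * (t + b) + a1).
   by rewrite (derB DTD) // Dt; ring.
  by apply: mx_mull => //; rewrite rpredD ?rpredM ?rpredD // FO.
 have Dqm : D (t - b) \notin mx O.
  apply/negP => h; case/eqP: r0; apply: (mxF0 FO rF).
  by rewrite -[X in X \in _](subKr (D (t - b))); apply: (mx_subr vO).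
 have q0 : t - b != 0 by rewrite subr_eq0; apply: contraNneq tF => ->.
 have [R RP] : exists R : sring M, forall y, y \in R <-> y \in O /\ y \in L.
  apply: mkR; first by rewrite !rpred1.
  - by move=> y w [yO yL] [wO wL]; rewrite !rpredB.
  - by move=> y w [yO yL] [wO wL]; rewrite !rpredM.
 have vq : v (t - b) \notin mx O.
  apply: ramified => // w wL wm.
  apply: (regular_uniformizer char0 aclM ffL (R := R) (D := D) vO FO) => //.
  - by move=> y /RP[].
  - by move=> y /RP[].
  - move=> y yL; have [->|y0] := eqVneq y 0.
    by exists 0, 1; rewrite mul0r oner_eq0; split=> //; apply/RP; rewrite ?rpred0 ?rpred1.
   have /orP[yO|yO] := vO y.
    by exists y, 1; rewrite divr1 oner_eq0; split=> //; apply/RP; rewrite ?rpred1.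
   exists 1, y^-1; rewrite invrK mul1r invr_eq0; split=> //; apply/RP; rewrite ?rpred1 //.
   by rewrite rpredV.
  - by case: dD => aa bb; split=> *; [apply: aa|apply: bb].
  - by move=> y /RP[yO yL]; apply/RP; split; [exact: Dst|exact: DDL].
  - by apply/RP; split=> //; rewrite rpredB.
  - by move=> y /DF/FO.
 have vtq : v (t - b) = v t by rewrite (derB DT) // (v0 bF) subr0.
 rewrite vtq in vq; have vtO : v t \in O by apply: vst.
 have [_ vV] := unitO vtO vq.
 by split=> [|tm]; [exact: rpredM|exact: mx_mull].
have zF : t / v t \in F.
 apply: (in_all_places ffL) => O pl.
 have [nLO|h] := pselect (L \nsub O); first by have [] := main O pl nLO.
 by apply/negPn/negP => h'; apply: h; exists (t / v t).
have tVF : t^-1 \notin F by rewrite rpredV.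
have [O [pl tO]] := place_inf ffL tVF; have [vO FO] := pl.
have [] := main O pl; first by exists t^-1; rewrite ?rpredV.
have tm : t \in mx O by rewrite -[t]invrK; apply: notO_mx.
move=> _ /(_ tm)/(mxF0 FO zF)/eqP; by rewrite mulf_eq0 invr_eq0 (negPf t0) (negPf vt).
Qed.
End Nowhere.

(** [classify] leaves genus one to exclude. Without solutions in F, [quad_no_riccati] applies to t.
    A single solution b is shifted to 0. From two solutions, z = (t - b) / (t - b') satisfies D z =
    a z, whose only solution in F is 0, as the quotient of z by another one would be a constant. *)
Theorem riccati_of_vector_field (D : M -> M) t a0 a1 a2 :
 (forall O, place F O -> stab_in v L O) ->
 (exists2 y, y \in L & v y != 0) -> isder D -> (stab D L) ->
 (stab D F) -> (forall y, y \in L -> D y = 0 -> y \in F) ->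
 (forall O, place F O -> stab_in D L O) -> t \in L -> t \notin F ->
 a0 \in F -> a1 \in F -> a2 \in F -> D t = a2 * t ^+ 2 + a1 * t + a0 -> riccati_in F L D.
Proof.
move=> vst vnz dD DDL DF cst Dst tL tF a0F a1F a2F Dt.
have DLD : derOn L D by case: dD => a b; split=> *; [apply: a|apply: b].
have DTD : derOn T D by case: dD => a b; split=> *; [apply: a|apply: b].
have [[x xL [xF gen]]|[x [s [Q [rs [c [qm cF c0 vx]]]]]]] := classify char0 aclM ffL DL vL v0 vst vnz.
 have [b0 [b1 [b2 [b0F b1F b2F Dx]]]] := riccati_of_rational aclM ffL DLD DDL Dst xL xF gen.
 by exists x, b0, b1, b2.
have none := quad_no_riccati vst qm cF c0 vx dD DDL DF Dst.
pose sol b := D b = a2 * b ^+ 2 + a1 * b + a0.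
have [[b bF bs]|no] := pselect (exists2 b, b \in F & sol b); last first.
 by case: (none t a0 a1 a2) => // b bF bs; case: no; exists b.
have [[b' bF' [bs' bb]]|uniq] := pselect (exists2 b', b' \in F & sol b' /\ b' != b); last first.
 case: (none (t - b) 0 (2%:R * a2 * b + a1) a2) => //.
 - by rewrite rpredB // FL.
 - by apply: contra tF => h; rewrite -[t](subrK b) rpredD.
 - exact: rpred0.
 - by rewrite rpredD // !rpredM.
 - by rewrite (derB DTD) // Dt bs; ring.
 move=> d dF Dd; apply: contrapT => /eqP d0; apply: uniq; exists (d + b); first exact: rpredD.
 by split; [rewrite /sol dD.1 Dd bs; ring|rewrite -subr_eq0 addrK].
have tb : t - b' != 0 by rewrite subr_eq0; apply: contraNneq tF => ->.
have tb0 : t - b != 0 by rewrite subr_eq0; apply: contraNneq tF => ->.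
have bb0 : b' - b != 0 by rewrite subr_eq0.
pose z := (t - b) / (t - b'); have zL : z \in L by rewrite rpred_div // rpredB // FL.
have z0 : z != 0 by rewrite mulf_neq0 // invr_eq0.
have zE : z - 1 = (b' - b) / (t - b') by rewrite /z; field.
have zF : z \notin F.
 apply: contra tF => h; have h1 : z - 1 \in F := rpredB h (rpred1 F).
 have : (b' - b) / (z - 1) \in F by rewrite rpred_div // rpredB.
 rewrite zE; have -> : (b' - b) / ((b' - b) / (t - b')) = t - b' by field; rewrite tb bb0.
 by move=> h2; rewrite -[t](subrK b') rpredD.
have Dz : D z = a2 * (b - b') * z.
 by rewrite /z (derQ DTD) // !(derB DTD) // Dt bs bs'; field.
case: (none z 0 (a2 * (b - b')) 0) => //; rewrite ?rpred0 ?rpredM ?rpredB //; first by rewrite Dz; ring.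
move=> d dF Dd; apply: contrapT => /eqP d0; case/negP: zF.
have : z / d \in F.
 apply: cst; first by rewrite rpred_div // FL.
 by rewrite (derQ DTD) // Dz Dd; field.
by move=> h; rewrite -[z](divfK d0) rpredM.
Qed.
End VectorField.

Section RationalWeierstrass.
Variables (M : fieldType).
Hypotheses (char0 : char_0 M) (aclM : acl M).
Variables (F L : sfield M) (x : M).
Hypotheses (ffL : ffield F L) (xL : x \in L) (xF : x \notin F) (gen : forall y, y \in L -> adj F x y).

Let FL : F \sub L. Proof. by have [] := ffL. Qed.

(** Write y = p(xi) / q(xi), cancel factors xi - b, with b the residue of xi, until q(xi) is a unit,
    and use the quotient rule. *)
Lemma rational_der_regular (w : M -> M) (O : sring M) xi : derOn L w -> (kills w F) ->
 valring O -> F \sub O -> (L \nsub O) -> xi \in L -> xi \in O -> xi \notin F ->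
 (forall y, y \in L -> adj F xi y) -> forall y, y \in L -> y \in O -> exists2 g, g \in O & w y = g * w xi.
Proof.
move=> dw w0 vO FO nLO zL zO zF zgen y yL yO; have [b bF zb] := residue aclM ffL vO FO nLO zL zO.
have pO (p : {poly M}) : p \over F -> p.[xi] \in O.
 by move=> pF; rewrite rpred_horner //; apply/polyOverP => i; apply/FO/polyOverP.
have pL (p : {poly M}) : p \over F -> p.[xi] \in L.
 by move=> pF; rewrite rpred_horner //; apply/polyOverP => i; apply/FL/polyOverP.
have rt (p : {poly M}) : p \over F -> p.[xi] \in mx O -> exists2 q, q \over F & p = q * ('X - b%:P).
 move=> pF pm; have rb : root p b.
  apply/rootP/(mxF0 FO); first exact: rpred_horner.
  by rewrite -[p.[b]](subKr p.[xi]); apply: (mx_subr vO) => //; apply: (poly_residue vO FO).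
 exists (p %/ ('X - b%:P)); last by rewrite divpK // dvdp_XsubCl.
 by apply: polyOver_quo => //; rewrite polyOverXsubC.
have [p [q [pF qF q0 yE]]] := zgen y yL.
have [n] := ubnP (size q); elim: n p q pF qF q0 yE => // n IH p q pF qF q0 yE sq.
have [qm|qm] := boolP (q.[xi] \in mx O).
 have pm : p.[xi] \in mx O by rewrite -[p.[xi]](divfK q0) -yE; apply: mx_mulr.
 have [p1 p1F pE] := rt p pF pm; have [q1 q1F qE] := rt q qF qm.
 have xb : xi - b != 0 by rewrite subr_eq0; apply: contraNneq zF => ->.
 have q10 : q1.[xi] != 0 by apply: contraNneq q0 => h; rewrite qE hornerM h mul0r.
 apply: (IH p1 q1) => //.
  by rewrite yE pE qE !hornerM !hornerXsubC -mulf_div divff // mulr1.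
 have q1n : q1 != 0 by apply: contraNneq q10 => ->; rewrite horner0.
 by rewrite qE size_Mmonic ?monicXsubC // size_XsubC addn2 ltnS in sq.
have [_ qV] := unitO (pO _ qF) qm.
have p'F : p^`() \over F by apply: polyOver_deriv.
have q'F : q^`() \over F by apply: polyOver_deriv.
exists ((p^`().[xi] * q.[xi] - p.[xi] * q^`().[xi]) * q.[xi]^-1 ^+ 2).
 by apply: rpredM; [apply: rpredB; apply: rpredM; apply: pO|apply: rpredX].
by rewrite yE (derQ dw) ?pL // !(v_poly ffL dw w0) //; field.
Qed.

(* dt/s would be a regular differential on the projective line, so dt = 0. *)
Theorem rational_no_weierstrass t s a g2 g3 : t \in L -> t \notin F -> s \in L -> s != 0 -> a \in F -> g2 \in F -> g3 \in F ->
 27%:R * g3 ^+ 2 - g2 ^+ 3 != 0 -> s ^+ 2 = a ^+ 2 * (4%:R * t ^+ 3 - g2 * t - g3) -> False.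
Proof.
move=> tL tF sL s0 aF g2F g3F disc sE.
have hF : relacl F by have [] := ffL.
have nx : ~ alg F x by move=> /hF h; case/negP: xF.
have z0 : derOn F (fun=> 0 : M) by split=> *; rewrite ?mul0r ?mulr0 addr0.
have [v [dv vL v0 vx]] := der_ext_transc char0 z0 FL (fun y _ => rpred0 L) xL (rpred1 L) nx.
have vnz : exists2 y, y \in L & v y != 0 by exists x; rewrite ?vx ?oner_eq0.
have vt : v t != 0 := v_neq0 char0 ffL dv v0 vnz tL tF.
have t0 : t != 0 by apply: contraNneq tF => ->; rewrite rpred0.
have x0 : x != 0 by apply: contraNneq xF => ->; rewrite rpred0.
have n0 n : n.+1%:R != 0 :> M by rewrite (natr_eq0 char0).
have a0 : a != 0 by apply: contraNneq s0 => a0; rewrite -sqrf_eq0 sE a0 expr0n mul0r.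
have zL : v t / s \in L by rewrite rpred_div // vL.
have vs : 2%:R * s * v s = a ^+ 2 * (12%:R * t ^+ 2 - g2) * v t.
 have E : s ^+ 2 = (a ^+ 2 *: (4%:R *: 'X^3 - g2 *: 'X - g3%:P)).[t].
  by rewrite sE !hornerE.
 have := congr1 v E; rewrite (derX dv) // expr1 (v_poly ffL dv v0) //.
  move=> ->; rewrite !derivE !hornerE /=; ring.
 have XF n : 'X^n \over F by rewrite polyOverXn.
 by rewrite polyOverZ ?rpredX // !rpredB ?polyOverC ?polyOverZ ?polyOverX ?rpred_nat.
have reg O : place F O -> (L \nsub O) -> (stab_in v L O) ->
  v t / s \in O /\ ((forall y, y \in L -> y \in O -> v y \in mx O) -> v t / s \in mx O).
 move=> [vO FO] nLO vst; have kO := FO; have [aO g2O g3O] := And3 (FO _ aF) (FO _ g2F) (FO _ g3F).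
 have nO n : n%:R \in O by apply: rpred_nat.
 have FM c : c \in F -> c != 0 -> c \notin mx O by move=> cF c0; apply: contra_neqN c0 => /(mxF0 FO cF).
 have a2O : a ^+ 2 \in O by apply: rpredX.
 have a2m : a ^+ 2 \notin mx O by apply: FM; rewrite ?rpredX ?expf_neq0.
 have n2m : 2%:R \notin mx O by apply: FM; rewrite ?rpred_nat.
 have [tO|tO] := boolP (t \in O).
  have PO : 4%:R * t ^+ 3 - g2 * t - g3 \in O by rewrite !rpredB // rpredM // rpredX.
  have sO : s \in O by apply: (O_exp vO (n := 2)) => //; rewrite sE rpredM.
  have [sm|sm] := boolP (s \in mx O); last first.
   by have [_ sV] := unitO sO sm; split=> [|h]; [apply: rpredM => //; apply: vst|apply: mx_mull => //; apply: h].
  have P'O : 12%:R * t ^+ 2 - g2 \in O by rewrite rpredB // rpredM // rpredX.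
  have Pm : 4%:R * t ^+ 3 - g2 * t - g3 \in mx O.
   by apply: (unit_div a2O a2m PO); rewrite -sE expr2; apply: mx_mull.
  have P'm : 12%:R * t ^+ 2 - g2 \notin mx O.
   apply/negP => h; case/eqP: disc; apply: (mxF0 FO).
    by rewrite rpredB ?rpredM ?rpredX ?rpred_nat.
   (* l equals 2 g2 t + 3 g3. It is a combination of the cubic and its derivative, hence so is the
      discriminant: a common zero is impossible. *)
   pose l := t * (12%:R * t ^+ 2 - g2) - 3%:R * (4%:R * t ^+ 3 - g2 * t - g3).
   have lm : l \in mx O by apply: (mx_subr vO); apply: mx_mulr.
   have lO := mx_sub lm.
   have -> : 27%:R * g3 ^+ 2 - g2 ^+ 3 = g2 ^+ 2 * (12%:R * t ^+ 2 - g2) - l * (3%:R * l - 18%:R * g3).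
    by rewrite /l; ring.
   apply: (mx_subr vO); first by apply: mx_mulr => //; apply: rpredX.
   by apply: mx_mull => //; rewrite rpredB // rpredM.
  have uO : a ^+ 2 * (12%:R * t ^+ 2 - g2) \in O by apply: rpredM.
  have um : a ^+ 2 * (12%:R * t ^+ 2 - g2) \notin mx O by apply: mx_unitM.
  have [u0 uV] := unitO uO um.
  have E : v t / s = 2%:R * v s * (a ^+ 2 * (12%:R * t ^+ 2 - g2))^-1.
   apply: (mulIf u0); rewrite divfK // mulrAC [v t * _]mulrC -vs; field; exact: s0.
  rewrite E; split=> [|h]; first by apply: rpredM => //; apply: rpredM => //; apply: vst.
  by apply: mx_mull => //; apply: mx_mulr => //; apply: h.
 (* At a pole of t the same argument is made with T = s / t^2 in place of s. *)
 have ym := notO_mx vO tO; have yO := mx_sub ym; pose T := s / t ^+ 2.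
 have TL : T \in L by rewrite rpred_div // rpredX.
 pose W := 4%:R - t^-1 * (3%:R * g2 * t^-1 + 4%:R * g3 * t^-1 ^+ 2).
 have wm : t^-1 * (3%:R * g2 * t^-1 + 4%:R * g3 * t^-1 ^+ 2) \in mx O.
  by apply: mx_mull => //; rewrite rpredD // !rpredM // rpredX.
 have WO : W \in O by rewrite rpredB // mx_sub.
 have Wm : W \notin mx O.
  apply/negP => h; have : 4%:R \in mx O.
   by rewrite -[4%:R](subrK (t^-1 * (3%:R * g2 * t^-1 + 4%:R * g3 * t^-1 ^+ 2))); apply: (mx_add vO).
  by apply/negP/FM; rewrite ?rpred_nat.
 have T2 : T ^+ 2 \in mx O.
  have -> : T ^+ 2 = t^-1 * (a ^+ 2 * (4%:R - g2 * t^-1 ^+ 2 - g3 * t^-1 ^+ 3)).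
   by rewrite /T expr_div_n sE; field.
  by apply: mx_mull => //; rewrite rpredM // !rpredB // rpredM // rpredX.
 have TO : T \in O by apply: (O_exp vO (n := 2)) => //; apply: mx_sub.
 have uO : a ^+ 2 * W \in O by apply: rpredM.
 have um : a ^+ 2 * W \notin mx O by apply: mx_unitM.
 have [u0 uV] := unitO uO um.
 have vT : v T = v s / t ^+ 2 - 2%:R * s * v t / t ^+ 3.
  by rewrite /T (derQ dv) ?rpredX ?expf_neq0 // (derX dv) // expr1; field.
 have E : v t / s = - 2%:R * v T * (a ^+ 2 * W)^-1.
  apply: (mulIf u0); rewrite divfK //; apply: (mulfI s0); apply: (mulfI s0).
  have -> : s * (s * (v t / s * (a ^+ 2 * W))) = s * v t * (a ^+ 2 * W) by field.
  have -> : s * (s * (- 2%:R * v T)) = 4%:R * s * s ^+ 2 * v t / t ^+ 3 - s * (2%:R * s * v s / t ^+ 2).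
   by rewrite vT; field.
  by rewrite vs sE /W; field.
 rewrite E; split=> [|h]; first by apply: rpredM => //; apply: rpredM; rewrite ?rpredN //; apply: vst.
 by apply: mx_mull => //; apply: mx_mulr; rewrite ?rpredN //; apply: h.
(* d/dx is regular on the whole line and vanishes at infinity, where it sends 1/x to -1/x^2. *)
have cases O : place F O -> (L \nsub O) -> (stab_in v L O) /\
  (x \notin O -> forall y, y \in L -> y \in O -> v y \in mx O).
 move=> [vO FO] nLO; have [xO|xO] := boolP (x \in O).
  split=> // y yL yO; have [g gO ->] := rational_der_regular dv v0 vO FO nLO xL xO xF gen yL yO.
  by rewrite vx mulr1.
 have ym := notO_mx vO xO; have yO := mx_sub ym.
 have [G GP] := adjF F x^-1; have FG : F \sub G by move=> c cF; apply/GP/adj_id.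
 have xG : x \in G by rewrite -[x]invrK rpredV; apply/GP/adj_gen.
 have gen' y : y \in L -> adj F x^-1 y by move=> /gen h; apply/GP; apply: adj_min h.
 have key y : y \in L -> y \in O -> v y \in mx O.
  have xVL : x^-1 \in L by rewrite rpredV.
  have xVF : x^-1 \notin F by rewrite rpredV.
  move=> yL yO'; have [g gO ->] := rational_der_regular dv v0 vO FO nLO xVL yO xVF gen' yL yO'.
  rewrite (derV dv) // vx; apply: mx_mulr => //.
  by rewrite mulNr mx_oppE mul1r -exprVn expr2; apply: mx_mull.
 by split=> // y yL yO'; apply/mx_sub/key.
have zF : v t / s \in F.
 apply: (in_all_places ffL) => O pl.
 have [nLO|h] := pselect (L \nsub O).
  by have [h _] := cases O pl nLO; have [] := reg O pl nLO h.
 by apply/negPn/negP => h'; apply: h; exists (v t / s).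
have [O [pl xO]] := place_inf ffL xF; have nLO : L \nsub O by exists x.
have [h1 h2] := cases O pl nLO; have [_ /(_ (h2 xO)) zm] := reg O pl nLO h1.
have := mxF0 pl.2 zF zm; move/eqP; by rewrite mulf_eq0 invr_eq0 (negPf vt) (negPf s0).
Qed.
End RationalWeierstrass.

(** Both sides are determined by the minimal polynomial of x over B, whose derivative does not
    vanish at x. *)
Lemma rmorph_diff (A X : diffFieldType) (e : {rmorphism A -> X}) (B : sfield A) : char_0 A ->
 (forall x, x \in B -> e (der x) = der (e x)) -> (forall x, alg B x) -> forall x, e (der x) = der (e x).
Proof.
move=> char0 eB aB x; have [T hT] := fullF A; have DT := isder_on T (@der_isder A).
have [T' hT'] := fullF X; have DT' := isder_on T' (@der_isder X).
have [m [mB mm rm m'x _]] := minpoly_sep char0 (aB x).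
have mT : m \over T by apply/polyOverP => i; apply: hT.
have emT : map_poly e m \over T' by apply/polyOverP => i; apply: hT'.
have E1 := der_horner DT mT (hT x); have E2 := der_horner DT' emT (hT' (e x)).
have Ed : dpoly der (map_poly e m) = map_poly e (dpoly der m).
 apply/polyP => i; rewrite (coef_dpoly DT') !coef_map /= (coef_dpoly DT) eB //; exact/polyOverP.
move: E1 E2; rewrite (rootP rm) (der_0 A) horner_map (rootP rm) rmorph0 (der_0 X) Ed horner_map deriv_map horner_map.
move=> /(congr1 e); rewrite rmorph0 rmorphD rmorphM => -> /addrI/mulfI; apply.
by rewrite fmorph_eq0.
Qed.

(** * The field k(f) and its embeddings *)

Section Eval2.
Variables (k X : fieldType) (h : {rmorphism k -> X}) (u v : X).
Lemma eval2_C (p : {poly k}) : eval2 h p%:P u v = (map_poly h p).[u].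
Proof. by rewrite /eval2 (map_polyC (map_poly h)) hornerC. Qed.
Lemma eval2_X : eval2 h 'X u v = v.
Proof. by rewrite /eval2 (map_polyX (map_poly h)) hornerX hornerC. Qed.
Lemma eval2_B f g : eval2 h (f - g) u v = eval2 h f u v - eval2 h g u v.
Proof. by rewrite /eval2 (rmorphB (map_poly (map_poly h))) hornerD hornerN hornerD hornerN. Qed.
Lemma eval2_D f g : eval2 h (f + g) u v = eval2 h f u v + eval2 h g u v.
Proof. by rewrite /eval2 (rmorphD (map_poly (map_poly h))) hornerD hornerD. Qed.
Lemma eval2_M f g : eval2 h (f * g) u v = eval2 h f u v * eval2 h g u v.
Proof. by rewrite /eval2 (rmorphM (map_poly (map_poly h))) hornerM hornerM. Qed.
Lemma eval2_1 : eval2 h 1 u v = 1.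
Proof.
have -> : (1 : {poly {poly k}}) = 1%:P%:P by rewrite !polyC1.
by rewrite eval2_C map_polyC hornerC /= rmorph1.
Qed.
Lemma eval2_0 : eval2 h 0 u v = 0.
Proof. by rewrite -(subrr 0) eval2_B subrr. Qed.
Lemma eval2_Xn g n : eval2 h (g ^+ n) u v = eval2 h g u v ^+ n.
Proof. by elim: n => [|n IH]; rewrite ?eval2_1 // !exprS eval2_M IH. Qed.
Lemma eval2_in (G : sfield X) f : (forall a, h a \in G) -> u \in G -> v \in G -> eval2 h f u v \in G.
Proof.
move=> hG uG vG; rewrite eval2_horner rpred_horner //; apply/polyOverP => i.
rewrite coef_map_id0 ?map_poly0 ?horner0 // rpred_horner //.
by apply/polyOverP => l; rewrite coef_map; apply: hG.
Qed.
End Eval2.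

Section FunctionField.
Variables (k K : diffFieldType) (f : {poly {poly k}}) (iK : k ~> K) (y : K).
Hypotheses (char0 : char_0 k) (sf : (1 < size f)%N) (Kf : is_k_of_f f iK y).
Variable F : sfield K.
Hypothesis FP : forall x, x \in F <-> exists a, x = iK a.

Lemma f_eval : eval2 iK f y (der y) = 0.
Proof. by apply/Kf.1; exists 1; rewrite mul1r. Qed.

(** A nonzero polynomial in Y alone is no multiple of f, which has positive degree in Z. *)
Lemma generator_transc : ~ alg F y.
Proof.
move=> /(img_alg y FP)[p p0 py]; have /Kf.1[h E] : eval2 iK p%:P y (der y) = 0 by rewrite eval2_C.
have h0 : h != 0 by apply: contraNneq p0 => h0; move: E; rewrite h0 mul0r => /eqP; rewrite polyC_eq0.
have f0 : f != 0 by rewrite -size_poly_gt0 (ltn_trans _ sf).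
have := size_polyC_leq1 p; rewrite E size_mul //; move: h0; rewrite -size_poly_gt0.
by case: (size h) => // n _; rewrite addSn /= leqNgt (leq_trans sf) // leq_addl.
Qed.

Lemma generated (G : sfield K) x : (forall a, iK a \in G) -> y \in G -> der y \in G -> x \in G.
Proof. by move=> iG yG dG; have [g [h [_ ->]]] := Kf.2 x; rewrite rpred_div ?eval2_in. Qed.

Section Embed.
Variables (X : diffFieldType) (j : k ~> X) (u : X) (Fu : sfield X).
Hypotheses (FuP : forall x, x \in Fu <-> exists a, x = j a) (nu : ~ alg Fu u) (fu : eval2 j f u (der u) = 0).

Lemma eval2_zero g : eval2 iK g y (der y) = 0 -> eval2 j g u (der u) = 0.
Proof. by move=> /Kf.1[h ->]; rewrite eval2_M fu mulr0. Qed.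

(* The norm of g over k(y) would vanish at u. *)
Lemma eval2_nonzero g : eval2 iK g y (der y) != 0 -> eval2 j g u (der u) != 0.
Proof.
set z := eval2 iK g y (der y) => z0; have [F1 F1P] := adjF F y.
have FF1 : F \sub F1 by move=> x xF; apply/F1P/adj_id.
have yF1 : y \in F1 by apply/F1P/adj_gen.
have [A AP] := alg_closure F1; have F1A x : x \in F1 -> x \in A by move=> xF; apply/AP/alg_id.
have zA : alg F1 z.
 apply/AP; apply: eval2_in; first by move=> a; apply/F1A/FF1/FP; exists a.
  exact: F1A.
 by apply/AP; apply: (eval2_alg FP generator_transc FF1 yF1 sf f_eval).
have [P [PF [i0 Pi0] Pz]] := alg_bivar F1P zA.
have ex : exists i, (P`_i).[y] != 0 by exists i0.
(* Dividing the relation of z by z^i leaves a constant term c_i(y) that is nonzero. Carried to u,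
   the vanishing of g there would give c_i(u) = 0. *)
case: (ex_minnP ex) => i {i0 Pi0} Pi imin.
have /choice[c cP] : forall l, exists p : {poly k}, P`_l = map_poly iK p.
 move=> l; have /choice[b bP] : forall n, exists a, P`_l`_n = iK a.
  by move=> n; apply/FP; move: n; apply/polyOverP.
 exists (\poly_(n < size P`_l) b n); apply/polyP => n; rewrite coef_map coef_poly /=.
 by case: ltnP => hn //; rewrite rmorph0 nth_default.
pose R := \sum_(l < size P) (c (i + l)%N)%:P * g ^+ l.
have evR (X' : fieldType) (h : {rmorphism k -> X'}) a b : eval2 h R a b =
  \sum_(l < size P) (map_poly h (c (i + l)%N)).[a] * eval2 h g a b ^+ l.
 rewrite /R; elim/big_ind2: _ => [|p q p' q' <- <-|l _]; first exact: eval2_0.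
  exact: eval2_D.
 by rewrite eval2_M eval2_C eval2_Xn.
have iP : (i < size P)%N by rewrite ltnNge; apply: contra Pi => h; rewrite nth_default // horner0.
have RK : eval2 iK R y (der y) = 0.
 apply: (mulfI (expf_neq0 i z0)); rewrite mulr0 -Pz (horner_coef_wide _ (leq_addl i (size P))).
 rewrite big_split_ord /= hornerD !horner_sum big1 => [|l _]; last first.
  rewrite !hornerE; have -> : (P`_l).[y] = 0; last by rewrite mul0r.
  by apply/eqP; apply: contraTT (ltn_ord l) => /imin; rewrite -leqNgt.
 rewrite add0r evR mulr_sumr; apply: eq_bigr => l _.
 by rewrite hornerM -rmorphXn hornerC cP exprD -/z; ring.
apply: contra_notN nu => /eqP gu; apply/(img_alg u FuP); exists (c i).
 by apply: contraNneq Pi => ci; rewrite cP ci map_poly0 horner0.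
have := eval2_zero RK; rewrite evR gu.
have sP : (0 < size P)%N by apply: leq_ltn_trans iP.
rewrite -(prednK sP) big_ord_recl /= addn0 expr0 mulr1 big1 ?addr0 // => l _.
by rewrite exprS mul0r mulr0.
Qed.

(** Quotients of values at (y, y') go to the same quotients at (u, u'): [eval2_zero] makes this well
    defined, [eval2_nonzero] keeps denominators nonzero. Compatibility with the derivations is clear
    on k(y) and passes to K by [rmorph_diff]. *)
Theorem function_field_embedding : exists e : K ~> X, (forall a, e (iK a) = j a) /\ e y = u.
Proof.
pose num g := eval2 iK g y (der y); pose val g := eval2 j g u (der u).
have wd a b a' b' : num b != 0 -> num b' != 0 -> num a / num b = num a' / num b' -> val a / val b = val a' / val b'.
 move=> b0 b0' /eqP; rewrite eqr_div // -subr_eq0 -!eval2_M -eval2_B => /eqP/eval2_zero.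
 rewrite eval2_B !eval2_M => /eqP; rewrite subr_eq0 => E; apply/eqP.
 by rewrite eqr_div //; apply: eval2_nonzero.
have /choice[e0 e0P] : forall x, exists z, forall a b, num b != 0 -> x = num a / num b -> z = val a / val b.
 move=> x; have [a [b [b0 ->]]] := Kf.2 x; exists (val a / val b) => a' b' b0'; exact: wd.
have eE a b : num b != 0 -> e0 (num a / num b) = val a / val b by move=> b0; apply: e0P.
have n1 : num 1 = 1 by apply: eval2_1.
have v1 : val 1 = 1 by apply: eval2_1.
have eE1 a : e0 (num a) = val a.
 by have := eE a 1; rewrite n1 v1 !divr1 oner_eq0; apply.
have eB : zmod_morphism e0.
 move=> x x'; have [a [b [b0 ->]]] := Kf.2 x; have [a' [b' [b0' ->]]] := Kf.2 x'.
 rewrite -/(num a) -/(num b) -/(num a') -/(num b') !eE //.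
 have -> : num a / num b - num a' / num b' = num (a * b' - a' * b) / num (b * b').
  by rewrite /num eval2_B !eval2_M; field; rewrite b0 b0'.
 have := eval2_nonzero b0; have := eval2_nonzero b0' => v0' v0.
 rewrite eE; last by rewrite /num eval2_M mulf_neq0.
 by rewrite /val eval2_B !eval2_M; field; rewrite v0 v0'.
have eM : monoid_morphism e0.
 split=> [|x x']; first by rewrite -n1 eE1.
 have [a [b [b0 ->]]] := Kf.2 x; have [a' [b' [b0' ->]]] := Kf.2 x'.
 rewrite -/(num a) -/(num b) -/(num a') -/(num b') !eE //.
 rewrite mulf_div -!eval2_M -/(num _) -/(num _) eE; last by rewrite /num eval2_M mulf_neq0.
 by rewrite /val !eval2_M mulf_div.
pose e1 : {rmorphism K -> X} := rmorph_of eB eM.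
have eC a : e1 (iK a) = j a.
 have -> : iK a = num a%:P%:P by rewrite /num eval2_C map_polyC hornerC.
 by rewrite -[LHS]/(e0 _) eE1 /val eval2_C map_polyC hornerC.
have ey : e1 y = u.
 have -> : y = num 'X%:P by rewrite /num eval2_C map_polyX hornerX.
 by rewrite -[LHS]/(e0 _) eE1 /val eval2_C map_polyX hornerX.
have edy : e1 (der y) = der u.
 have -> : der y = num 'X by rewrite /num eval2_X.
 by rewrite -[LHS]/(e0 _) eE1 /val eval2_X.
have cK := char0_dmorph iK char0; have [F1 F1P] := adjF F y.
have FF1 : F \sub F1 by move=> x xF; apply/F1P/adj_id.
have yF1 : y \in F1 by apply/F1P/adj_gen.
have [A AP] := alg_closure F1; have F1A x : x \in F1 -> x \in A by move=> xF; apply/AP/alg_id.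
have [T hT] := fullF K; have DT := isder_on T (@der_isder K).
have [T' hT'] := fullF X; have DT' := isder_on T' (@der_isder X).
have [S SP] : exists S : sfield K, forall x, x \in S <-> e1 (der x) = der (e1 x).
 apply: mkF; split; first by rewrite (der1 DT) rmorph1 (der1 DT') rmorph0.
 - by move=> x x' h h'; rewrite (derB DT) // !rmorphB (derB DT') // h h'.
 - move=> x x' h h'; have [->|x0] := eqVneq x' 0; first by rewrite invr0 mulr0 !(rmorph0, der_0).
  have nz : e1 x' != 0 by rewrite fmorph_eq0.
  have E2 := derQ DT' (hT' (e1 x)) (hT' (e1 x')) nz.
  by rewrite (derQ DT) // (fmorph_div e1 x x') E2 -h -h' fmorph_div rmorphB !rmorphM.
have F1S : F1 \sub S.
 move=> x /F1P; apply: adj_min; first by move=> _ /FP[a ->]; apply/SP; rewrite -dmorph_der !eC dmorph_der.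
 by apply/SP; rewrite ey.
have ed : forall x, e1 (der x) = der (e1 x).
 apply: (rmorph_diff (B := F1) cK); first by move=> x /F1S/SP.
 move=> x; apply/AP; apply: generated; [by move=> a; apply/F1A/FF1/FP; exists a|exact: F1A|].
 by apply/AP; apply: (eval2_alg FP generator_transc FF1 yF1 sf f_eval).
pose e : K ~> X := dmorph_of ed.
by exists e.
Qed.
End Embed.
End FunctionField.

(** * Extension of embeddings to composita *)

Definition homOn (L M : fieldType) (S : {pred L}) (phi : L -> M) :=
 [/\ phi 1 = 1, {in S &, forall x y, phi (x - y) = phi x - phi y} & {in S &, forall x y, phi (x * y) = phi x * phi y}].

(** [th] is sent to a root in M of its transported minimal polynomial. *)
Lemma hom_extend1 (L M : fieldType) (S : sfield L) (phi : L -> M) th : acl M -> homOn S phi -> alg S th ->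
 exists (S' : sfield L) (phi' : L -> M), [/\ S \sub S', th \in S', homOn S' phi' & {in S, phi' =1 phi}].
Proof.
move=> acM [p1 pB pM] ath.
pose r0 (a : subF S) : M := phi (val a).
have rB : zmod_morphism r0 by move=> a b; apply: pB; apply: subvalP.
have rM : monoid_morphism r0 by split=> [|a b]; [exact: p1|apply: pM; apply: subvalP].
pose r : {rmorphism subF S -> M} := rmorph_of rB rM.
have [m [mS mm rm mmin]] := minpoly ath; have [m0 m0E] := polyOver_lift mS.
have sm : (1 < size (map_poly r m0))%N.
 rewrite size_map_poly -(size_map_poly (val : {rmorphism subF S -> L})) -m0E.
 by apply: (root_size_gt1 (monic_neq0 mm) rm).
have [th' th'r] := acM _ sm.
pose ev p := (map_poly (val : {rmorphism subF S -> L}) p).[th]; pose ev' p := (map_poly r p).[th'].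
have wd p q : ev p = ev q -> ev' p = ev' q.
 move=> /eqP; rewrite -subr_eq0 -hornerN -hornerD -rmorphB => /eqP h.
 have := mmin _ (polyOver_map (p - q)) (introT rootP h); rewrite m0E dvdp_map => /dvdpP[d dE].
 apply/eqP; rewrite -subr_eq0 -hornerN -hornerD -rmorphB dE rmorphM hornerM (rootP th'r) mulr0 //.
have [S' S'P] := adjF S th; have [d dP] := alg_adj_poly ath.
have rep x : x \in S' -> exists p, x = ev p.
 by move=> /S'P/dP[p [/polyOver_lift[q ->] _ ->]]; exists q.
have /choice[phi' phi'P] : forall x, exists z, forall p, x = ev p -> z = ev' p.
 move=> x; have [[p ->]|h] := pselect (exists p, x = ev p); first by exists (ev' p) => q; apply: wd.
 by exists 0 => p xE; case: h; exists p.
have phE p : phi' (ev p) = ev' p by apply: phi'P.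
have phS x : x \in S -> phi' x = phi x.
 move=> xS; have -> : x = ev (SubF xS)%:P by rewrite /ev map_polyC hornerC.
 by rewrite phE /ev' map_polyC hornerC /= /ev map_polyC hornerC.
exists S', phi'; split=> //; first by move=> x xS; apply/S'P/adj_id.
- by apply/S'P/adj_gen.
- split; first by rewrite phS ?rpred1.
 + move=> x z /rep[p ->] /rep[q ->]; have -> : ev p - ev q = ev (p - q) by rewrite /ev rmorphB hornerD hornerN.
  by rewrite !phE /ev' rmorphB hornerD hornerN.
 + move=> x z /rep[p ->] /rep[q ->]; have -> : ev p * ev q = ev (p * q) by rewrite /ev rmorphM hornerM.
  by rewrite !phE /ev' rmorphM hornerM.
Qed.

Lemma hom_extend (L M : fieldType) (S : sfield L) (phi : L -> M) (s : seq L) : acl M -> homOn S phi ->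
 (forall x, x \in s -> alg S x) ->
 exists (S' : sfield L) (phi' : L -> M), [/\ S \sub S', s \sub S', homOn S' phi' & {in S, phi' =1 phi}].
Proof.
move=> acM; elim: s S phi => [|a s IH] S phi h sa; first by exists S, phi; split=> // x; rewrite in_nil.
have [S1 [phi1 [SS1 aS1 h1 e1]]] := hom_extend1 acM h (sa a (mem_head _ _)).
have [|S2 [phi2 [S12 sS2 h2 e2]]] := IH S1 phi1 h1.
 by move=> x xs; apply: (alg_subset SS1); apply: sa; rewrite inE xs orbT.
exists S2, phi2; split=> //; first by move=> x /SS1/S12.
- by move=> x; rewrite inE => /orP[/eqP ->|/sS2//]; apply: S12.
- by move=> x xS; rewrite e2 ?e1 // SS1.
Qed.

Lemma finite_over_alg (L : fieldType) (S : set L) (G : sfield L) : finite_over S -> (forall x, S x -> x \in G) ->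
 forall x, alg G x.
Proof.
move=> [s sP] SG x; have [T hT] := fullF L; have h : rk G T (size s).
 apply: (rk_span (s := fun i : 'I_(size s) => s`_i)) => z _; have [c cS ->] := sP z.
 by exists c => // i; apply: SG.
by have [|p [pG p0 rp _]] := rk_alg h (y := x); [move=> i; apply: hT|exists p].
Qed.

(** kt is spanned over k by finitely many elements, algebraic over K, to which e is extended one at
    a time; [rmorph_diff] makes the result differential. *)
Theorem compositum_embedding (k K kt L M : diffFieldType) (iK : k ~> K) (ikt : k ~> kt)
  (jK : K ~> L) (jkt : kt ~> L) (e : K ~> M) : char_0 k -> acl M ->
 finite_compositum iK ikt jK jkt -> exists phi : L ~> M, forall x, phi (jK x) = e x.
Proof.
move=> char0 acM [fo comp adjT]; have [Ik [IkP _]] := img_diff_field ikt; have [S [SP dS]] := img_diff_field jK.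
have ktalg a : alg S (jkt a).
 have [p [pI p0 /rootP rp]] : alg Ik a.
  by apply: (finite_over_alg fo) => _ [b _ <-]; apply/IkP; exists b.
 exists (map_poly jkt p); rewrite map_poly_eq0 p0; split=> //; last by apply/rootP; rewrite horner_map rp rmorph0.
 apply/polyOverP => i; rewrite coef_map /=; have /IkP[b ->] : p`_i \in Ik by apply/polyOverP.
 by apply/SP; exists (iK b); rewrite -comp.
have /choice[phi0 phi0P] : forall x, exists z, forall a, x = jK a -> z = e a.
 move=> x; have [[a ->]|h] := pselect (exists a, x = jK a); first by exists (e a) => b /fmorph_inj ->.
 by exists 0 => a xE; case: h; exists a.
have phi0E a : phi0 (jK a) = e a by apply: phi0P.
have h0 : homOn S phi0.
 split; first by rewrite -(rmorph1 jK) phi0E rmorph1.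
  by move=> _ _ /SP[a ->] /SP[b ->]; rewrite -rmorphB !phi0E rmorphB.
 by move=> _ _ /SP[a ->] /SP[b ->]; rewrite -rmorphM !phi0E rmorphM.
have [s sP] := fo.
have [|S' [phi [SS' sS' [p1 pB pM] pE]]] := hom_extend (s := [seq jkt a | a <- s]) acM h0.
 by move=> _ /mapP[a _ ->].
have S'T x : x \in S'.
 have : adjoin (range jkt) (range jK) x by rewrite adjT.
 apply: adjoin_min => [_ [a _ <-]|_ [a _ <-]]; last by apply/SS'/SP; exists a.
 have [c cI ->] := sP a; rewrite rmorph_sum; apply: rpred_sum => i _; rewrite rmorphM rpredM //.
  by have [b _ <-] := cI i; rewrite -[X in X \in _]/(jkt (ikt b)) comp; apply/SS'/SP; exists (iK b).
 by apply/sS'/map_f/mem_nth.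
have fB : zmod_morphism phi by move=> x z; apply: pB.
have fM : monoid_morphism phi by split=> // x z; apply: pM.
pose f1 : {rmorphism L -> M} := rmorph_of fB fM.
have fE a : f1 (jK a) = e a by rewrite -[LHS]/(phi _) pE ?phi0E //; apply/SP; exists a.
have [A AP] := alg_closure S.
have fd : forall x, f1 (der x) = der (f1 x).
 apply: (rmorph_diff (B := S) (char0_dmorph jK (char0_dmorph iK char0))).
  by move=> _ /SP[a ->]; rewrite -dmorph_der !fE dmorph_der.
 move=> x; apply/AP; have : adjoin (range jkt) (range jK) x by rewrite adjT.
 apply: adjoin_min => [_ [a _ <-]|_ [a _ <-]]; apply/AP; first exact: ktalg.
 by apply/alg_id/SP; exists a.
pose fd' : L ~> M := dmorph_of fd.
by exists fd'.
Qed.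

(** * Descent from k' to a finite extension of k *)

Lemma field_type (M : diffFieldType) (F : sfield M) : (stab der F) ->
 exists (T : diffFieldType) (v : T ~> M), forall x, x \in F <-> exists a, x = v a.
Proof.
move=> dF; pose D (a : subF F) : subF F := SubF (dF _ (subvalP a)).
have dD : isder D by split=> a b; apply: val_inj => /=; rewrite ?rmorphD ?rmorphM /= ?derD ?derM.
pose T : diffFieldType := diffized dD.
have vd : {morph (\val : T -> M) : x / der x} by [].
pose v : T ~> M := dmorph_of vd.
exists T, v => x; split=> [xF|[a ->]]; last exact: subvalP.
by exists (SubF xF).
Qed.

Lemma factor_dmorph (M T X : diffFieldType) (v : T ~> M) (g : X ~> M) :
 (forall x, exists a, g x = v a) -> exists h : X ~> T, forall x, v (h x) = g x.
Proof.
move=> /choice[h0 hP]; have hP' x : (v : {rmorphism T -> M}) (h0 x) = (g : {rmorphism X -> M}) x by rewrite -[RHS]/(g x) hP.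
have hB : zmod_morphism h0 by move=> x z; apply: (fmorph_inj v); rewrite rmorphB !hP' rmorphB.
have hM : monoid_morphism h0.
 by split=> [|x z]; apply: (fmorph_inj v); rewrite ?rmorphM !hP' ?rmorphM ?rmorph1.
pose h1 : {rmorphism X -> T} := rmorph_of hB hM.
have hd : {morph (h1 : X -> T) : x / der x}.
 by move=> x; apply: (fmorph_inj v); rewrite -[LHS]/(v (h0 (der x))) -hP dmorph_der hP -dmorph_der.
pose h : X ~> T := dmorph_of hd.
by exists h => x; rewrite -[LHS]/(v (h0 x)) -hP.
Qed.

Lemma gen_field (M : fieldType) (A : M -> Prop) : exists G : sfield M, (forall x, A x -> x \in G) /\
 forall H : sfield M, (forall x, A x -> x \in H) -> G \sub H.
Proof.
have [G GP] : exists G : sfield M, forall x, x \in G <-> forall H : sfield M, (forall z, A z -> z \in H) -> x \in H.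
 apply: mkF; split=> [H _|x z hx hz H AH|x z hx hz H AH]; first exact: rpred1.
  by rewrite rpredB ?hx ?hz.
 by rewrite rpred_div ?hx ?hz.
by exists G; split=> [x xA|H AH x /GP]; [apply/GP => H; apply|apply].
Qed.

Lemma preim_field (A B : fieldType) (g : {rmorphism A -> B}) (H : sfield B) :
 exists G : sfield A, forall x, x \in G <-> g x \in H.
Proof.
apply: mkF; split=> [|x z hx hz|x z hx hz]; rewrite ?rmorph1 ?rpred1 //.
 by rewrite rmorphB rpredB.
by rewrite fmorph_div rpred_div.
Qed.

Lemma adjoin_subfield (M : fieldType) (A B : set M) : subfield (adjoin A B).
Proof.
split=> [S [[]] //|x z hx hz S hS|x z hx hz S hS]; have [[_ SB SD] _] := hS.
 by apply: SB; [apply: hx|apply: hz].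
by apply: SD; [apply: hx|apply: hz].
Qed.

(** Turns minimality among subfields of M into a statement of generation inside T. *)
Lemma adjoin_lift (T M : fieldType) (v : {rmorphism T -> M}) (A B : set T) (G : sfield M) :
 (forall H : sfield M, (forall x, A x -> v x \in H) -> (forall x, B x -> v x \in H) -> G \sub H) ->
 forall x, v x \in G -> adjoin A B x.
Proof.
move=> Gmin x xG; have [s1 sB sD] := adjoin_subfield A B.
have [H HP] : exists H : sfield M, forall z, z \in H <-> exists2 x, adjoin A B x & z = v x.
 apply: mkF; split; first by exists 1; rewrite ?rmorph1.
  by move=> _ _ [a ha ->] [b hb ->]; exists (a - b); rewrite ?rmorphB //; apply: sB.
 by move=> _ _ [a ha ->] [b hb ->]; exists (a / b); rewrite ?fmorph_div //; apply: sD.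
have /HP[x' hx' /fmorph_inj -> //] : v x \in H.
by apply: Gmin xG => z hz; apply/HP; exists z => //; apply: adjoin_gen; [left|right].
Qed.

Definition spanned (M : fieldType) (A B : {pred M}) := exists (I : finType) (e : I -> M), (forall i, e i \in B) /\
 forall y, y \in B -> exists2 c : I -> M, (forall i, c i \in A) & y = \sum_i c i * e i.

Lemma spanned_trans (M : fieldType) (A B C : sfield M) : B \sub C -> spanned A B -> spanned B C -> spanned A C.
Proof.
move=> BC [I [e [eB eP]]] [J [g [gC gP]]]; exists (I * J)%type, (fun p => e p.1 * g p.2); split.
 by move=> p; rewrite rpredM // BC.
move=> y /gP[b bB ->]; have /choice[c cP] : forall j, exists c : I -> M, (forall i, c i \in A) /\ b j = \sum_i c i * e i.
 by move=> j; have [c cA cE] := eP _ (bB j); exists c.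
exists (fun p => c p.2 p.1); first by move=> p; apply: (cP p.2).1.
rewrite -(pair_bigA _ (fun i j => c j i * (e i * g j))) exchange_big; apply: eq_bigr => j _ /=.
by rewrite (cP j).2 mulr_suml; apply: eq_bigr => i _; rewrite mulrA.
Qed.

Lemma spanned_list (M : fieldType) (F : sfield M) (s : seq M) : (forall a, a \in s -> alg F a) ->
 exists G : sfield M, [/\ F \sub G, s \sub G,
  forall H : sfield M, F \sub H -> s \sub H -> G \sub H & spanned F G].
Proof.
elim: s F => [|a s IH] F sa.
 exists F; split=> //; exists unit, (fun=> 1); split=> [_|y yF]; first exact: rpred1.
 by exists (fun=> y) => //; rewrite big_const card_unit /= mulr1 addr0.
have aa : alg F a by apply: sa; rewrite mem_head.
have [F1 F1P] := adjF F a; have FF1 : F \sub F1 by move=> x xF; apply/F1P/adj_id.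
have aF1 : a \in F1 by apply/F1P/adj_gen.
have sp1 : spanned F F1.
 have [d dP] := alg_adj_poly aa; exists ('I_d : finType), (fun i : 'I_d => a ^+ i); split=> [i|y /F1P/dP[p [pF sp ->]]]; first exact: rpredX.
 by exists (fun i : 'I_d => p`_i); [move=> i; apply/polyOverP|rewrite (horner_coef_wide _ sp)].
have [|G [F1G sG Gmin spG]] := IH F1.
 by move=> b bs; apply: (alg_subset FF1); apply: sa; rewrite inE bs orbT.
exists G; split.
- by move=> x /FF1/F1G.
- by move=> x; rewrite inE => /orP[/eqP ->|/sG//]; apply: F1G.
- move=> H FH sH; apply: Gmin; last by move=> x xs; apply: sH; rewrite inE xs orbT.
 by move=> x /F1P; apply: adj_min => //; apply: sH; rewrite mem_head.
- exact: (spanned_trans F1G sp1 spG).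
Qed.

Lemma spanned_finite_over (M T : fieldType) (v : {rmorphism T -> M}) (A B : sfield M) (S : set T) : A \sub B ->
 spanned A B -> (forall x, x \in B <-> exists a, x = v a) -> (forall x, v x \in A -> S x) -> finite_over S.
Proof.
move=> AB [I [e [eB eP]]] BP AS.
have /choice[t tP] : forall i, exists a, e i = v a by move=> i; apply/BP.
pose s := [tuple t (enum_val l) | l < #|I|]; exists s => x.
have vB : v x \in B by apply/BP; exists x.
have [c cA xE] := eP _ vB.
have /choice[c' c'P] : forall i, exists a, c i = v a by move=> i; apply/BP/AB.
have sz : size s = #|I| := size_tuple s.
exists (fun l => c' (enum_val (cast_ord sz l))); first by move=> l; apply: AS; rewrite -c'P.
apply: (fmorph_inj v); rewrite xE rmorph_sum.
rewrite (reindex (fun l : 'I_(size s) => enum_val (cast_ord sz l))) /=; last first.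
 exists (fun i => cast_ord (esym sz) (enum_rank i)) => i _; first by rewrite enum_valK cast_ordK.
 by rewrite cast_ordKV enum_rankK.
apply: eq_bigr => l _; rewrite rmorphM c'P tP; congr (_ * v _).
by rewrite -(tnth_nth 0 s (cast_ord sz l)) tnth_mktuple.
Qed.

Section FiniteSupport.
Variables (M : fieldType) (k' : sfield M).

(** The elements obtainable from B and finitely many elements of k' form a subfield that contains k'
    and B. *)
Lemma finite_support (B : seq M) (ys : seq M) :
 (forall G : sfield M, k' \sub G -> B \sub G -> ys \sub G) ->
 exists A : seq M, A \sub k' /\ forall H : sfield M, A \sub H -> B \sub H -> ys \sub H.
Proof.
pose supp y := exists A : seq M, A \sub k' /\ forall H : sfield M, A \sub H -> B \sub H -> y \in H.
have cat2 y z op : supp y -> supp z -> (forall (H : sfield M), y \in H -> z \in H -> op y z \in H) -> supp (op y z).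
 move=> [A [Ak hA]] [A' [A'k hA']] hop; exists (A ++ A'); split=> [x|H hH BH].
  by rewrite mem_cat => /orP[/Ak|/A'k].
 by apply: hop; [apply: hA|apply: hA'] => // x xA; apply: hH; rewrite mem_cat xA ?orbT.
have [S SP] : exists S : sfield M, forall y, y \in S <-> supp y.
 apply: mkF; split; first by exists [::]; split=> [x|H _ _]; [rewrite in_nil|exact: rpred1].
  by move=> x z hx hz; apply: (cat2 x z (fun a b => a - b)) => // H; apply: rpredB.
 by move=> x z hx hz; apply: (cat2 x z (fun a b => a / b)) => // H; apply: rpred_div.
move=> /(_ S) h; have {h} ysS : ys \sub S.
 apply: h => x xk; apply/SP.
  exists [:: x]; split=> [z|H hH _]; first by rewrite inE => /eqP ->.
  by apply: hH; rewrite mem_head.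
 by exists [::]; split=> [z|H _]; [rewrite in_nil|apply].
elim: ys ysS => [|y ys IH] ysS.
 by exists [::]; split=> [x|H _ _ x]; rewrite in_nil.
have [|A [Ak hA]] := IH; first by move=> x xs; apply: ysS; rewrite inE xs orbT.
have /SP[A' [A'k hA']] : y \in S by apply: ysS; rewrite mem_head.
exists (A ++ A'); split=> [x|H hH BH x]; first by rewrite mem_cat => /orP[/Ak|/A'k].
have h1 : A \sub H by move=> z zA; apply: hH; rewrite mem_cat zA.
have h2 : A' \sub H by move=> z zA; apply: hH; rewrite mem_cat zA orbT.
by rewrite inE => /orP[/eqP ->|]; [apply: hA'|apply: hA].
Qed.
End FiniteSupport.

Lemma alg_gen_stable (M : diffFieldType) (F G : sfield M) : char_0 M ->
 F \sub G -> (stab der F) -> (forall x, x \in G -> alg F x) -> stab der G.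
Proof.
move=> char0 FG dF aG x xG; have [T hT] := fullF M; have DT := isder_on T (@der_isder M).
apply: (der_stable char0 (aG x xG) DT _ (hT _) FG xG) => y; first by move=> _; apply: hT.
by move=> /dF/FG.
Qed.

(** Of k' one keeps As, the elements needed to express ts through w and w' and, if ts generates,
    those needed for the converse. They generate the finite extension KT of k, and L is KT(w, w').
    The proposition [gen] lets one proof serve the versions with and without generation. *)
Theorem descent (k K M : diffFieldType) (f : {poly {poly k}}) (iK : k ~> K) (y : K) (j : k ~> M)
  (w : M) (F0 k' K1 : sfield M) (e : K ~> M) (As ts : seq M) (gen : Prop) :
 (1 < size f)%N -> is_k_of_f f iK y -> solution_field f j w F0 k' K1 -> (forall a, e (iK a) = j a) -> e y = w ->
 As \sub k' -> ts \sub K1 -> (ts \nsub k') ->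
 (gen -> forall G : sfield M, k' \sub G -> ts \sub G -> K1 \sub G) ->
 exists (kt L : diffFieldType) (ikt : k ~> kt) (jK : K ~> L) (jkt : kt ~> L)
  (v : L ~> M),
 [/\ finite_compositum iK ikt jK jkt, finite_over (adjoin (range jkt) (fun x => v x \in ts)),
   forall a, a \in As -> exists b, v (jkt b) = a,
   (forall t, t \in ts -> exists x, v x = t) /\ (forall a, v (jkt (ikt a)) = j a) &
   gen -> adjoin (range jkt) (fun x => v x \in ts) = setT].
Proof.
move=> sf Kf [[acM cM] [F0P k'P] [fw wk wK dwK] [kK ffK Kmin] noC] eiK ey Ask tsK [t tts tk] genP.
have [A1 [A1k A1P]] : exists A : seq M, A \sub k' /\
  forall H : sfield M, A \sub H -> [:: w; der w] \sub H -> ts \sub H.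
 apply: finite_support => G kG hG x /tsK; apply: Kmin => //; apply: hG; rewrite !inE eqxx ?orbT //.
have [A2 [A2k A2P]] : exists A : seq M, A \sub k' /\
  (gen -> forall H : sfield M, A \sub H -> ts \sub H -> [:: w; der w] \sub H).
 have [g|ng] := pselect gen; last by exists [::]; split=> [x|/ng//]; rewrite in_nil.
 have [G kG hG x|A [Ak hA]] := finite_support (k' := k') (B := ts) (ys := [:: w; der w]); last by exists A.
 by rewrite !inE => /orP[/eqP ->|/eqP ->]; apply: (genP g).
pose A := As ++ A1 ++ A2; have AK : A \sub k' by move=> x; rewrite !mem_cat => /or3P[/Ask|/A1k|/A2k].
have [|KT [FKT AKT KTmin spKT]] := spanned_list (F := F0) (s := A); first by move=> a /AK/k'P.
have [T hT] := fullF M; have DT := isder_on T (@der_isder M).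
have sT (B : sfield M) : B \sub T by move=> x _; apply: hT.
have KTk : KT \sub k' by apply: KTmin => // x xF; apply/k'P/alg_id.
have aKT x : x \in KT -> alg F0 x by move=> /KTk/k'P.
have dF0 x : x \in F0 -> der x \in F0 by move=> /F0P[a ->]; apply/F0P; exists (der a); rewrite dmorph_der.
have dKT := alg_gen_stable cM FKT dF0 aKT.
have [KTt [KTt1 KTtmin]] := gen_field (fun x => x \in KT \/ x \in ts).
have KTKTt : KT \sub KTt by move=> x xK; apply: KTt1; left.
have tsKTt : ts \sub KTt by move=> x xK; apply: KTt1; right.
have aK x : x \in K1 -> alg KTt x.
 move=> xK; have [kt ktP] := adjF k' t; have axk := ffield_alg ffK (tsK _ tts) tk ktP xK.
 have [B BP] := alg_closure KTt; apply: (alg_trans _ axk) => z /ktP hz; apply/BP; apply: adj_min hz.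
  by move=> u /k'P au; apply/BP; apply: alg_subset au => r /FKT/KTKTt.
 by apply/BP/alg_id/tsKTt.
have [|LT [KTtL wL Lmin0 spL]] := spanned_list (F := KTt) (s := [:: w; der w]).
 by move=> a; rewrite !inE => /orP[/eqP ->|/eqP ->]; apply: aK.
have wLT : w \in LT by apply: wL; rewrite mem_head.
have dwLT : der w \in LT by apply: wL; rewrite !inE eqxx orbT.
have KTL : KT \sub LT by move=> x /KTKTt/KTtL.
have Lmin (H : sfield M) : KT \sub H -> w \in H -> der w \in H -> LT \sub H.
 move=> KH wH dwH; have wdw : [:: w; der w] \sub H by move=> x; rewrite !inE => /orP[/eqP ->|/eqP ->].
 apply: Lmin0 => //; apply: KTtmin => x [/KH//|]; apply: A1P => // z zA.
 by apply/KH/AKT; rewrite !mem_cat zA orbT.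
have nw : ~ alg F0 w by move=> /k'P; apply/negP.
have dLT x : x \in LT -> der x \in LT.
 have [F1 F1P] := adjF KT w; have KF1 : KT \sub F1 by move=> z zF; apply/F1P/adj_id.
 have wF1 : w \in F1 by apply/F1P/adj_gen.
 have F1L : F1 \sub LT by move=> z /F1P; apply: adj_min.
 have dF1 z : z \in F1 -> der z \in LT.
  by move=> /F1P; apply: (der_adj_in DT (sT KT) (hT w) KTL wLT dwLT) => r /dKT/KTL.
 have F0F1 : F0 \sub F1 by move=> z /FKT/KF1.
 have a1 : alg F1 (der w) := eval2_alg F0P nw F0F1 wF1 sf fw.
 have ddw : der (der w) \in LT := der_stable cM a1 DT (sT F1) (hT _) F1L dwLT dF1.
 have [S SP] : exists S : sfield M, forall z, z \in S <-> z \in LT /\ der z \in LT.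
  apply: mkF; split; first by rewrite rpred1 (der1 DT) rpred0.
   by move=> a b [aL daL] [bL dbL]; rewrite (derB DT) // !rpredB.
  move=> a b [aL daL] [bL dbL]; split; first by rewrite rpred_div.
  have [->|b0] := eqVneq b 0; first by rewrite invr0 mulr0 der_0 rpred0.
  by rewrite (derQ DT) // rpred_div ?rpredX // rpredB // rpredM.
 move=> xL; suff /SP[] : x \in S by [].
 apply: (Lmin S) xL => [z zK||]; apply/SP => //.
 by split; [apply: KTL|apply/KTL/dKT].
have [kt [vk vkP]] := field_type dKT; have [L [v vP]] := field_type dLT.
have [ikt iktE] : exists h : k ~> kt, forall x, vk (h x) = j x.
 by apply: factor_dmorph => x; apply/vkP/FKT/F0P; exists x.
have [jkt jktE] : exists h : kt ~> L, forall x, v (h x) = vk x.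
 by apply: factor_dmorph => x; apply/vP/KTL/vkP; exists x.
have eL x : e x \in LT.
 have [G GP] := preim_field e LT; apply/GP; apply: (generated Kf).
 - by move=> a; apply/GP; rewrite -[X in X \in _]/(e (iK a)) eiK; apply/KTL/FKT/F0P; exists a.
 - by apply/GP; rewrite -[X in X \in _]/(e y) ey.
 - by apply/GP; rewrite -[X in X \in _]/(e (der y)) dmorph_der ey.
have [jK jKE] : exists h : K ~> L, forall x, v (h x) = e x.
 by apply: factor_dmorph => x; apply/vP/eL.
have inK (H : sfield M) : (forall x, range jkt x -> v x \in H) -> KT \sub H.
 by move=> h z /vkP[b ->]; rewrite -jktE; apply: h; exists b.
exists kt, L, ikt, jK, jkt, v; split.
- split.
 + apply: (spanned_finite_over (v := vk) FKT spKT vkP) => x /F0P[a xE]; exists a => //.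
  by apply: (fmorph_inj vk); rewrite -[LHS]/(vk (ikt a)) iktE -xE.
 + by move=> a; apply: (fmorph_inj v); rewrite -[LHS]/(v (jkt (ikt a))) -[RHS]/(v (jK (iK a))) jktE iktE jKE eiK.
 + apply/seteqP; split=> // x _; apply: (adjoin_lift (v := v) (G := LT)); last by apply/vP; exists x.
  move=> H h1 h2; apply: Lmin; first exact: inK.
   by rewrite -ey -jKE; apply: h2; exists y.
  by rewrite -ey -dmorph_der -jKE; apply: h2; exists (der y).
- apply: (spanned_finite_over (v := v) KTtL spL vP) => x; apply: adjoin_lift => H h1 h2.
 apply: KTtmin => z [|zts]; first exact: inK.
 by have /KTtL/vP[b zE] := tsKTt _ zts; rewrite zE; apply: h2; rewrite -zE.
- by move=> a aA; have /vkP[b ->] : a \in KT; [apply: AKT; rewrite mem_cat aA|exists b; rewrite jktE].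
- split; last by move=> a; rewrite jktE iktE.
 by move=> z /tsKTt/KTtL/vP[x ->]; exists x.
move=> g; apply/seteqP; split=> // x _; apply: (adjoin_lift (v := v) (G := LT)); last by apply/vP; exists x.
move=> H h1 h2; have KH := inK H h1; have tH : ts \sub H.
 by move=> z zts; have /KTtL/vP[b zE] := tsKTt _ zts; rewrite zE; apply: h2; rewrite -zE.
have wH : [:: w; der w] \sub H.
 by apply: (A2P g) => // z zA; apply/KH/AKT; rewrite !mem_cat zA !orbT.
by apply: Lmin => //; apply: wH; rewrite !inE eqxx ?orbT.
Qed.

Lemma id_dmorph (A : diffFieldType) : exists h : A ~> A, forall x, h x = x.
Proof.
have hd : {morph (idfun : A -> A) : x / der x} by [].
pose h : A ~> A := dmorph_of (f := (idfun : {rmorphism A -> A})) hd.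
by exists h.
Qed.

(** * Passage between solution fields and the data of the two types *)

Section Produce.
Variables (k K M : diffFieldType) (f : {poly {poly k}}) (iK : k ~> K) (y : K) (j : k ~> M)
 (w : M) (F0 k' K1 : sfield M) (e : K ~> M).
Hypotheses (sf : (1 < size f)%N) (Kf : is_k_of_f f iK y) (sol : solution_field f j w F0 k' K1)
 (eiK : forall a, e (iK a) = j a) (ey : e y = w).

Lemma solution_stable : (stab der k') /\ (stab der K1).
Proof.
have [[acM cM] [F0P k'P] [fw wk wK dwK] [kK ffK Kmin] noC] := sol.
have dF0 x : x \in F0 -> der x \in F0 by move=> /F0P[a ->]; apply/F0P; exists (der a); rewrite dmorph_der.
have dk := alg_closure_stable cM k'P dF0; split=> // z.
have nw : ~ alg F0 w by move=> /k'P; apply/negP.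
have [|K2 [_ kK2 [wK2 dwK2] K2min dK2]] := two_generated cM (alg_closure_relacl k'P) dk wk.
 move=> G kG wG; apply: (eval2_alg F0P nw _ wG sf fw) => x xF; apply/kG/k'P/alg_id; exact: xF.
have K12 : K1 \sub K2 by apply: Kmin.
have K21 : K2 \sub K1 by apply: K2min.
by move=> /K12/dK2/K21.
Qed.

Lemma produce_riccati t a0 a1 a2 (gen : Prop) : t \in K1 -> t \notin k' -> a0 \in k' -> a1 \in k' -> a2 \in k' ->
 der t = a2 * t ^+ 2 + a1 * t + a0 -> (gen -> forall z, z \in K1 -> adj k' t z) ->
 exists (kt L : diffFieldType) (ikt : k ~> kt) (jK : K ~> L) (jkt : kt ~> L) (t' : L),
  riccati_data iK ikt jK jkt t' /\ (gen -> adjoin (range jkt) [set t']%classic = setT).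
Proof.
move=> tK tk a0k a1k a2k Dt genP.
have [||||kt [L [ikt [jK [jkt [v [fc fo lift [tsP jP] gP]]]]]]] := descent (As := [:: a0; a1; a2]) (ts := [:: t]) (gen := gen) sf Kf sol eiK ey.
- by move=> a; rewrite !inE => /or3P[] /eqP ->.
- by move=> a; rewrite inE => /eqP ->.
- by exists t; rewrite ?mem_head.
- move=> g G kG tG z /(genP g); apply: adj_min => //; apply: tG; exact: mem_head.
have [t' vt] := tsP t (mem_head _ _).
have TS : (fun x => is_true (v x \in [:: t])) = [set t']%classic.
 apply/seteqP; split=> x /=; first by rewrite inE -vt => /eqP/(fmorph_inj v).
 by move=> ->; rewrite vt mem_head.
rewrite TS in fo gP; exists kt, L, ikt, jK, jkt, t'; split=> //; split=> //.
have [b0 b0E] : exists b, v (jkt b) = a0 by apply: lift; rewrite !inE eqxx.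
have [b1 b1E] : exists b, v (jkt b) = a1 by apply: lift; rewrite !inE eqxx orbT.
have [b2 b2E] : exists b, v (jkt b) = a2 by apply: lift; rewrite !inE eqxx !orbT.
exists b0, b1, b2; split.
 (* If all coefficients vanished, t would be a constant, hence an element of k'. *)
 move=> [z0 z1 z2]; case/negP: tk; have [_ [F0P k'P] _ _ noC] := sol; apply/k'P.
 have [|a _ ->] := noC t tK; last by apply/alg_id/F0P; exists a.
 by rewrite Dt -b0E -b1E -b2E z0 z1 z2 !(rmorph0, mul0r, addr0).
have E : (v : {rmorphism L -> M}) (der t') = v (jkt b2) * v t' ^+ 2 + v (jkt b1) * v t' + v (jkt b0).
 by rewrite -[LHS]/(v (der t')) dmorph_der vt b0E b1E b2E.
by apply: (fmorph_inj v); rewrite E !rmorphD !rmorphM.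
Qed.

Lemma produce_weierstrass t a g2 g3 (gen : Prop) : t \in K1 -> der t \in K1 -> t \notin k' -> a \in k' -> g2 \in k' -> g3 \in k' ->
 der g2 = 0 -> der g3 = 0 -> 27%:R * g3 ^+ 2 - g2 ^+ 3 != 0 ->
 der t ^+ 2 = a ^+ 2 * (4%:R * t ^+ 3 - g2 * t - g3) ->
 (gen -> forall G : sfield M, k' \sub G -> t \in G -> der t \in G -> K1 \sub G) ->
 exists (kt L : diffFieldType) (ikt : k ~> kt) (jK : K ~> L) (jkt : kt ~> L) (t' : L),
  weierstrass_data iK ikt jK jkt t' /\ (gen -> adjoin (range jkt) [set t'; der t']%classic = setT).
Proof.
move=> tK dtK tk ak g2k g3k dg2 dg3 disc Dt genP; have [_ _ _ [kK _ _] noC] := sol.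
have [||||kt [L [ikt [jK [jkt [v [fc fo lift [tsP jP] gP]]]]]]] := descent (As := [:: a]) (ts := [:: t; der t]) (gen := gen) sf Kf sol eiK ey.
- by move=> b; rewrite inE => /eqP ->.
- by move=> b; rewrite !inE => /orP[] /eqP ->.
- by exists t; rewrite ?mem_head.
- by move=> g G kG tG; apply: (genP g) => //; apply: tG; rewrite !inE eqxx ?orbT.
have [t' vt] := tsP t (mem_head _ _); have vdt : v (der t') = der t by rewrite dmorph_der vt.
have TS : (fun x => is_true (v x \in [:: t; der t])) = [set t'; der t']%classic.
 apply/seteqP; split=> x /=; last by case=> ->; rewrite ?vt ?vdt !inE eqxx ?orbT.
 by rewrite !inE -vdt -vt => /orP[] /eqP/(fmorph_inj v); [left|right].
rewrite TS in fo gP; exists kt, L, ikt, jK, jkt, t'; split=> //; split=> //.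
have [b bE] : exists b, v (jkt b) = a by apply: lift; rewrite mem_head.
have [c2 dc2 c2E] := noC g2 (kK _ g2k) dg2; have [c3 dc3 c3E] := noC g3 (kK _ g3k) dg3.
exists c2, c3, b; split=> //.
 have E : (j : {rmorphism k -> M}) (27%:R * c3 ^+ 2 - c2 ^+ 3) = 27%:R * g3 ^+ 2 - g2 ^+ 3.
  by rewrite c2E c3E rmorphB rmorphM !rmorphXn rmorph_nat.
 by rewrite -(fmorph_eq0 j) E.
have E : (v : {rmorphism L -> M}) (der t' ^+ 2) = v (jkt b) ^+ 2 * (4%:R * v t' ^+ 3 - v (jkt (ikt c2)) * v t' - v (jkt (ikt c3))).
 by rewrite rmorphXn -[(_ : {rmorphism _ -> _}) (der t')]/(v (der t')) vdt vt bE !jP -c2E -c3E.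
apply: (fmorph_inj v); rewrite E rmorphM !rmorphB !rmorphM rmorph_nat.
by [].
Qed.

(** Carries data on an arbitrary finite compositum into K1. The last clause keeps elements
    nonalgebraic: if S mapped into k' and L were finite over S, then w would be algebraic over
    k'. *)
Lemma embed_compositum (kt L : diffFieldType) (ikt : k ~> kt) (jK : K ~> L) (jkt : kt ~> L) :
 char_0 k -> finite_compositum iK ikt jK jkt -> exists phi : L ~> M,
 [/\ forall x, phi x \in K1, forall b, phi (jkt b) \in k', forall a, phi (jkt (ikt a)) = j a &
  forall S : set L, finite_over S -> ~ (forall x, S x -> phi x \in k')].
Proof.
move=> char0 fc; have [[acM cM] [F0P k'P] [fw wk wK dwK] [kK ffK Kmin] noC] := sol.
have [phi phiE] := compositum_embedding e char0 acM fc; have [fo comp adjT] := fc.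
have pj a : phi (jkt (ikt a)) = j a by rewrite comp phiE eiK.
have [Ik [IkP _]] := img_diff_field ikt; have ktalg := finite_over_alg (G := Ik) fo.
have pk b : phi (jkt b) \in k'.
 have [|p [pI p0 /rootP rp]] := ktalg _ b; first by move=> _ [a _ <-]; apply/IkP; exists a.
 have [h hE] := comp_dmorph jkt phi; rewrite -hE; apply/k'P; exists (map_poly h p).
 rewrite map_poly_eq0 p0; split=> //; last by apply/rootP; rewrite horner_map rp rmorph0.
 apply/polyOverP => i; rewrite coef_map /=; have /IkP[a ->] : p`_i \in Ik by apply/polyOverP.
 by apply/F0P; exists a; rewrite -[LHS]/(h (ikt a)) hE pj.
have eK x : e x \in K1.
 have [G GP] := preim_field e K1; apply/GP; apply: (generated Kf).
 - move=> a; apply/GP; rewrite -[X in X \in _]/(e (iK a)) eiK; apply/kK/k'P/alg_id/F0P; by exists a.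
 - by apply/GP; rewrite -[X in X \in _]/(e y) ey.
 - by apply/GP; rewrite -[X in X \in _]/(e (der y)) dmorph_der ey.
exists phi; split=> //.
 move=> x; have [G GP] := preim_field phi K1; apply/GP.
 have : adjoin (range jkt) (range jK) x by rewrite adjT.
 apply: adjoin_min => _ [b _ <-]; apply/GP; first by apply/kK/pk.
 by rewrite -[X in X \in _]/(phi (jK b)) phiE.
move=> S foS Sk; have [G GP] := preim_field phi k'.
have [|p [pG p0 /rootP rp]] := finite_over_alg (G := G) foS _ (jK y); first by move=> x /Sk h; apply/GP.
case/negP: wk; have hk : relacl k' := alg_closure_relacl k'P.
rewrite -ey -phiE; apply: hk; exists (map_poly phi p); rewrite map_poly_eq0 p0; split=> //.
 by apply/polyOverP => i; rewrite coef_map; apply/GP/polyOverP.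
by apply/rootP; rewrite horner_map rp rmorph0.
Qed.

Lemma embed_riccati (kt L : diffFieldType) (ikt : k ~> kt) (jK : K ~> L) (jkt : kt ~> L) t :
 char_0 k -> riccati_data iK ikt jK jkt t -> exists t' a0 a1 a2,
 [/\ t' \in K1, t' \notin k', [/\ a0 \in k', a1 \in k' & a2 \in k'] & der t' = a2 * t' ^+ 2 + a1 * t' + a0].
Proof.
move=> char0 [fc fo [a0 [a1 [a2 [_ Dt]]]]]; have [phi [pK pk pj pS]] := embed_compositum char0 fc.
exists (phi t), (phi (jkt a0)), (phi (jkt a1)), (phi (jkt a2)); split=> //.
 apply/negP => tk; apply: (pS _ fo) => x; have [G GP] := preim_field phi k' => hx; apply/GP.
 by apply: adjoin_min hx => [_ [b _ <-]|_ ->]; apply/GP => //; apply: pk.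
have := congr1 (phi : {rmorphism L -> M}) Dt; rewrite !rmorphD !rmorphM.
by rewrite -[(_ : {rmorphism _ -> _}) (der t)]/(phi (der t)) dmorph_der => ->.
Qed.

Lemma embed_weierstrass (kt L : diffFieldType) (ikt : k ~> kt) (jK : K ~> L) (jkt : kt ~> L) t :
 char_0 k -> weierstrass_data iK ikt jK jkt t -> exists t' a g2 g3,
 [/\ t' \in K1 /\ der t' \in K1, t' \notin k', [/\ a \in k', g2 \in k' & g3 \in k'], 27%:R * g3 ^+ 2 - g2 ^+ 3 != 0 &
  der t' ^+ 2 = a ^+ 2 * (4%:R * t' ^+ 3 - g2 * t' - g3)].
Proof.
move=> char0 [fc fo [g2 [g3 [a [dg2 dg3 disc Dt]]]]]; have [phi [pK pk pj pS]] := embed_compositum char0 fc.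
have [[acM cM] [F0P k'P] _ _ _] := sol.
have pd : der (phi t) = phi (der t) by rewrite dmorph_der.
have jk b : j b \in k' by apply/k'P/alg_id/F0P; exists b.
exists (phi t), (phi (jkt a)), (j g2), (j g3); split=> //; first by rewrite pd.
- apply/negP => tk; apply: (pS _ fo) => x; have [G GP] := preim_field phi k' => hx; apply/GP.
 apply: adjoin_min hx => [_ [b _ <-]|z]; first by apply/GP; apply: pk.
 case=> ->; apply/GP => //; rewrite -[X in X \in _]/(phi (der t)) -pd.
 have dF0 x' : x' \in F0 -> der x' \in F0 by move=> /F0P[b ->]; apply/F0P; exists (der b); rewrite dmorph_der.
 exact: (alg_closure_stable cM k'P dF0 tk).
- have E : (j : {rmorphism k -> M}) (27%:R * g3 ^+ 2 - g2 ^+ 3) = 27%:R * j g3 ^+ 2 - j g2 ^+ 3.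
  by rewrite rmorphB rmorphM !rmorphXn rmorph_nat.
 by rewrite -E fmorph_eq0.
have := congr1 (phi : {rmorphism L -> M}) Dt; rewrite pd rmorphXn => ->.
by rewrite rmorphM !rmorphB !rmorphM rmorph_nat -!pj.
Qed.
End Produce.

(** When all of k is constant and algebraically closed, kt = k and L = K, so the Riccati equation
    has constant coefficients and is linearized by its roots. *)
Lemma constant_coefficients (k K kt L : diffFieldType) (f : {poly {poly k}}) (iK : k ~> K) (y : K)
  (ikt : k ~> kt) (jK : K ~> L) (jkt : kt ~> L) (t : L) :
 (1 < size f)%N -> constants_alg_closed k -> is_k_of_f f iK y -> (forall c : k, der c = 0) ->
 riccati_data iK ikt jK jkt t ->
 exists t : K, t != 0 /\ (der t = 1 \/ exists2 c : k, c != 0 & der t = iK c * t).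
Proof.
move=> sf Ccl Kf dk [[fo comp adjT] fo2 [a0 [a1 [a2 [nz Dt]]]]].
have [Ik [IkP _]] := img_diff_field ikt; have [FK [FKP _]] := img_diff_field iK.
have ktk b : exists a, b = ikt a.
 have [|p [pI p0 rp]] := finite_over_alg (G := Ik) fo _ b; first by move=> _ [a _ <-]; apply/IkP; exists a.
 have [|a _ ->] := base_const_root (i := ikt) Ccl _ p0 rp; last by exists a.
 by move=> l; have /IkP[a aE] : p`_l \in Ik by [apply/polyOverP]; exists a.
have [JK [JKP _]] := img_diff_field jK.
have LK x : exists x0, x = jK x0.
 apply/JKP; have : adjoin (range jkt) (range jK) x by rewrite adjT.
 apply: adjoin_min => _ [b _ <-]; apply/JKP; last by exists b.
 by have [a ->] := ktk b; exists (iK a); rewrite -comp.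
have [t0 t0E] := LK t; have [c0 c0E] := ktk a0; have [c1 c1E] := ktk a1; have [c2 c2E] := ktk a2.
have jj a : jkt (ikt a) = jK (iK a) := comp a.
have Dt0 : der t0 = iK c2 * t0 ^+ 2 + iK c1 * t0 + iK c0.
 apply: (fmorph_inj jK); rewrite !rmorphD !rmorphM -[LHS]/(jK (der t0)) dmorph_der -t0E Dt c0E c1E c2E !jj t0E.
 by [].
have nt a : t0 != iK a.
 apply/eqP => tE; have [ij ijE] := comp_dmorph iK jK; have [S2 [S2P _]] := img_diff_field ij.
 have aS x : alg S2 x.
  apply: (finite_over_alg fo2) => z; apply: adjoin_min => [_ [b _ <-]|_ ->]; apply/S2P.
   by have [a' ->] := ktk b; exists a'; rewrite ijE -comp.
  by exists a; rewrite ijE -tE -t0E.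
 apply: (generator_transc sf Kf FKP); apply/(img_alg y FKP).
 have /(img_alg (jK y) S2P)[p p0 E] := aS (jK y); exists p => //.
 apply: (fmorph_inj jK); rewrite rmorph0 -horner_map -map_poly_comp -E.
 by congr (_.[_]); apply: eq_map_poly => z /=; rewrite -[RHS]/(ij z) ijE.
have [T hT] := fullF K; have DT := isder_on T (@der_isder K).
have di a : der (iK a) = 0 by rewrite -dmorph_der dk rmorph0.
have i0 a : a != 0 -> iK a != 0 by move=> a0'; rewrite fmorph_eq0.
have tn a : t0 - iK a != 0 by rewrite subr_eq0.
have [c20|c20] := eqVneq c2 0.
 rewrite c20 rmorph0 mul0r add0r in Dt0; have [c10|c10] := eqVneq c1 0.
  rewrite c10 rmorph0 mul0r add0r in Dt0; have c00 : c0 != 0.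
   by apply/eqP => c00; apply: nz; rewrite c0E c1E c2E c00 c10 c20 !rmorph0.
  exists (t0 / iK c0); rewrite mulf_neq0 ?invr_eq0 ?i0 //; last first.
   by have := nt 0; rewrite rmorph0.
  by split=> //; left; rewrite (derQ DT) ?i0 // di Dt0 mulr0 subr0; field; apply: i0.
 exists (t0 - iK (- c0 / c1)); rewrite tn; split=> //; right; exists c1 => //.
 by rewrite (derB DT) // di subr0 Dt0 fmorph_div rmorphN; field; apply: i0.
pose p : {poly k} := c2 *: 'X^2 + c1 *: 'X + c0%:P.
have sp : size p = 3%N.
 have h : (size (c1 *: 'X + c0%:P)%R <= 2)%N.
  rewrite (leq_trans (size_polyD _ _)) // geq_max (leq_trans (size_scale_leq _ _)) ?size_polyX //=.
  by rewrite (leq_trans (size_polyC_leq1 _)).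
 by rewrite /p -addrA size_polyDl size_scale // size_polyXn // ltnS.
have [r _ /rootP rr] : exists2 c, constants c & root p c by apply: Ccl; [move=> l; apply: dk|rewrite sp].
have c0r : c0 = - (c2 * r ^+ 2 + c1 * r).
 move: rr; rewrite /p !hornerE => h; apply/eqP; rewrite -subr_eq0 opprK addrC; apply/eqP; rewrite -[RHS]h; ring.
pose r2 := - c1 / c2 - r.
have ir2 : iK r2 = - iK c1 / iK c2 - iK r by rewrite /r2 rmorphB fmorph_div rmorphN.
have ic0 : iK c0 = - (iK c2 * iK r ^+ 2 + iK c1 * iK r) by rewrite c0r rmorphN rmorphD !rmorphM.
have Dt1 : der t0 = iK c2 * (t0 - iK r) * (t0 - iK r2).
 by rewrite Dt0 ic0 ir2; field; apply: i0.
(* A double root is moved to infinity by -1 / (c2 (t - r)), with derivative 1; two distinct roots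
   are moved to 0 and infinity, which leaves t' = c t. *)
clearbody r2; have [rE|rE] := eqVneq r2 r.
 exists (- (iK c2 * (t0 - iK r))^-1); rewrite oppr_eq0 invr_eq0 mulf_neq0 ?i0 //; split=> //; left.
 have -> : - (iK c2 * (t0 - iK r))^-1 = - 1 / (iK c2 * (t0 - iK r)) by rewrite mulNr div1r.
 rewrite (derQ DT) ?mulf_neq0 ?i0 // derM (derB DT) // !di (derN DT) // (der1 DT) Dt1 rE.
 by field; rewrite tn i0.
exists ((t0 - iK r) / (t0 - iK r2)); rewrite mulf_neq0 ?invr_eq0 //; split=> //; right; exists (c2 * (r - r2)).
 by rewrite mulf_neq0 // subr_eq0 eq_sym.
rewrite (derQ DT) // !(derB DT) // !di Dt1 rmorphM rmorphB.
by field; rewrite tn.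
Qed.

(** * Assembly of the three statements *)

Section ExtendVectorField.
Variables (M : fieldType) (char0 : char_0 M) (aclM : acl M) (k' K1 : sfield M) (ffK : ffield k' K1).

(** Extends v to a derivation of all of M, the form in which [riccati_of_vector_field] takes it. *)
Lemma global_vector_field : has_vector_field k' K1 -> exists v : M -> M, [/\ isder v, stab v K1,
 kills v k', exists2 z, z \in K1 & v z != 0 &
 forall O, place k' O -> stab_in v K1 O].
Proof.
move=> [v [dv vL v0 [z zK vz] vst]]; have [T hT] := fullF M; have [_ kK _] := ffK.
have [|x _|D [dD _ DE]] := der_ext char0 dv (U := T); [by move=> x _; apply: hT|exact: hT|].
exists D; split.
- exact: derOn_full hT dD.
- by move=> x xK; rewrite DE ?vL.
- by move=> x xk; rewrite DE ?v0 // kK.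
- by exists z; rewrite ?DE.
- by move=> O pl x xK xO; rewrite DE //; apply: vst.
Qed.
End ExtendVectorField.

Theorem theorem1p1 (k : diffFieldType) (char0 : [pchar k] =i pred0)
    (Cclosed : constants_alg_closed k)
    (f : {poly {poly k}}) (f_irr : irreducible_elt f) (f_Z : (1 < size f)%N)
    (K : diffFieldType) (iK : {dmorphism k -> K}) (y : K)
    (K_kf : is_k_of_f f iK y)
    (E : diffFieldType) (iE : {dmorphism k -> E})
    (E_isn : iterated_strongly_normal iE) :
  (has_nonalgebraic_solution_in f iE <-> embeds_over iK iE) /\
  (has_nonalgebraic_solution_in f iE ->
   [/\ riccati_type f iK \/ weierstrass_type f iK,
       constants (K := k) = setT -> riccati_type f iK ->
         exists t : K, t != 0 /\
           (der t = 1 \/ exists2 c : k, c != 0 & der t = iK c * t)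
     & strongly_normal iE ->
         (riccati_type f iK -> riccati_type_generating f iK) /\
         (weierstrass_type f iK -> weierstrass_type_generating f iK)]).
Proof.
have nnE := isn_no_new char0 Cclosed E_isn.
have [FE [FEP _]] := img_diff_field iE; have [FK [FKP _]] := img_diff_field iK.
have algE u : ~ algebraicOver iE u <-> ~ alg FE u.
 split=> h h'; apply: h.
  by have /(img_alg u FEP)[p p0 /rootP rp] := h'; exists p.
 by have [p p0 /rootP rp] := h'; apply/(img_alg u FEP); exists p.
split.
 split=> [[_ [u [fu /algE nu]]]|[e eE]].
  by have [e [eE _]] := function_field_embedding char0 f_Z K_kf FKP FEP nu fu; exists e.
 split=> //; exists (e y); split.
  have -> : der (e y) = e (der y) by rewrite dmorph_der.
  rewrite (eval2_map (i := iK) (g := e) (h := iE)); last by move=> a; exact: (esym (eE a)).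
  by rewrite (f_eval K_kf) rmorph0.
 apply/algE => /(img_alg (e y) FEP)[p p0 pe]; apply: (generator_transc f_Z K_kf FKP).
 apply/(img_alg y FKP); exists p => //; apply: (fmorph_inj e); rewrite rmorph0 -horner_map -map_poly_comp -pe.
 by congr (_.[_]); apply: eq_map_poly => z /=; rewrite -[LHS]/(e (iK z)) eE.
move=> hsol; have hasE : has_nonalgebraic_solution f by exists E, iE.
have [_ [u [fu /algE nu]]] := hsol; have [eid eidE] := id_dmorph E.
have [TE TEP] : exists T : sfield E, forall x, x \in T <-> exists a, x = eid a by have [T [TP _]] := img_diff_field eid; exists T.
have ikE a : iE a = eid (iE a) by rewrite eidE.
have auT : alg TE u by apply/alg_id/TEP; exists u; rewrite eidE.
have /no_newP nn := nnE.
split.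
(* The normal form lives on K0 only; an element of K0 outside k' suffices, because K1 is algebraic
   over the field it generates. *)
- have [M [j [w [F0 [k' [K1 [sol [K0 [kK0 K0K ffK0 [z zK zk] res]]]]]]]]] :=
  iterated_solution_field char0 Cclosed f_Z E_isn ikE TEP FEP nn auT nu fu.
 have [_ [F0P k'P] [fw wk wK dwK] _ _] := sol.
 have nw : ~ alg F0 w by move=> /k'P; apply/negP.
 have [e [eiK ey]] := function_field_embedding char0 f_Z K_kf FKP F0P nw fw.
 case: res => [[t [a0 [a1 [a2 [[tK tk tgen] a0k a1k a2k Dt]]]]]|[t [a [g2 [g3 [tK [ak g2k g3k] [dg2 dg3] disc [Dt tgen]]]]]]].
  left; split=> //.
  have [kt [L [ikt [jK [jkt [t' [rd _]]]]]]] := produce_riccati (gen := False) f_Z K_kf sol eiK ey (K0K _ tK) tk a0k a1k a2k Dt (fun h => False_ind _ h).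
  by exists kt, L, ikt, jK, jkt, t'.
 have [dk dK] := solution_stable f_Z sol; right; split=> //; have dtK : der t \in K1 by apply/dK/K0K.
 have tk : t \notin k' by apply: contra zk => tk; apply: (tgen k') zK => //; apply: dk.
 have [kt [L [ikt [jK [jkt [t' [wd _]]]]]]] := produce_weierstrass (gen := False) f_Z K_kf sol eiK ey (K0K _ tK) dtK tk ak g2k g3k dg2 dg3 disc Dt (fun h => False_ind _ h).
 by exists kt, L, ikt, jK, jkt, t'.
- move=> kC [_ [kt [L [ikt [jK [jkt [t rd]]]]]]].
 apply: (constant_coefficients f_Z Cclosed K_kf _ rd) => c.
 by have : constants c by rewrite kC.
(* u lies in E itself, so the step theorem with X = E puts the regular vector field on all of K1. *)
move=> sn; have SP x : x \in FE <-> exists a, x = eid (iE a).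
 by split=> [/FEP[a ->]|[a ->]]; [exists a; rewrite eidE|apply/FEP; exists a; rewrite eidE].
have ikS a : iE a \in FE by apply/FEP; exists a.
have [M [j [w [F0 [k' [K1 [sol _ /(_ _)[]]]]]]]] :=
 strongly_normal_step char0 Cclosed f_Z sn SP TEP ikS nn auT nu fu; first by move=> x; exists x; rewrite eidE.
move=> vf Dst res; have [[acM cM] [F0P k'P] [fw wk wK dwK] [kK ffK Kmin] noC] := sol.
have nw : ~ alg F0 w by move=> /k'P; apply/negP.
have [e [eiK ey]] := function_field_embedding char0 f_Z K_kf FKP F0P nw fw.
have [v [dv vL v0 vnz vst]] := global_vector_field cM ffK vf.
have cst z : z \in K1 -> der z = 0 -> z \in k'.
 by move=> zK dz; have [a _ ->] := noC z zK dz; apply/k'P/alg_id/F0P; exists a.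
have [dk dK] := solution_stable f_Z sol.
split=> -[_ [kt [L [ikt [jK [jkt [t td]]]]]]]; split=> //.
 have [t' [a0 [a1 [a2 [tK tk [a0k a1k a2k] Dt]]]]] := embed_riccati K_kf sol eiK ey char0 td.
 have [x [b0 [b1 [b2 [[xK xk xgen] b0k b1k b2k Dx]]]]] : riccati_in k' K1 der.
  exact: (riccati_of_vector_field cM acM ffK dv vL v0 vst vnz (@der_isder M) dK dk cst Dst tK tk a0k a1k a2k Dt).
 have [kt' [L' [ikt' [jK' [jkt' [x' [rd gen]]]]]]] := produce_riccati (gen := True) f_Z K_kf sol eiK ey xK xk b0k b1k b2k Dx (fun=> xgen).
 by exists kt', L', ikt', jK', jkt', x'; split=> //; apply: gen.
have [t' [a [g2 [g3 [[tK dtK] tk [ak g2k g3k] disc Dt]]]]] := embed_weierstrass K_kf sol eiK ey char0 td.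
have dt0 : der t' != 0 by apply: contraNneq tk => /(cst _ tK).
(* A rational K1 contains no Weierstrass element, so the normal form that generates K1 is of
   Weierstrass kind. *)
case: res => [[x [b0 [b1 [b2 [[xK xk xgen] _ _ _ _]]]]]|].
 by case: (rational_no_weierstrass cM acM ffK xK xk xgen tK tk dtK dt0 ak g2k g3k disc Dt).
move=> [x [b [h2 [h3 [xK [bk h2k h3k] [dh2 dh3] discx [Dx xgen]]]]]].
have xk : x \notin k'.
 apply: contra wk => xk; apply: (xgen k') wK => //; exact: dk.
have [kt' [L' [ikt' [jK' [jkt' [x' [rd gen]]]]]]] := produce_weierstrass (gen := True) f_Z K_kf sol eiK ey xK (dK _ xK) xk bk h2k h3k dh2 dh3 discx Dx (fun=> xgen).
by exists kt', L', ikt', jK', jkt', x'; split=> //; apply: gen.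
Qed.
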